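(* Let $\Gamma\triangleleft \mathrm{PSL}_2(\mathbb{Z})$ be a finite-index normal subgroup and let $G=\mathrm{PSL}_2(\mathbb{Z})/\Gamma$. Let $e$ be the order of the image of $T$ in $G$. Let $\rho\neq 1$ be a non-trivial irreducible complex representation of $G$. Then the multiplicity $d$ of $\rho$ in the canonical representation $\rho_\Gamma$ of $G$ on $S_2(\Gamma)$ is given by $$d = -\frac{5}{12}\dim \rho + \sum_{k=1}^{e-1} N_k(\rho;T)\left(1 - \frac{k}{e}\right) - \frac{\operatorname{Tr}(\rho(S))}{4} + \frac{\zeta^2_3\operatorname{Tr}\big(\rho(R^{-1})\big)}{3(1-\zeta_3^{2})} + \frac{\zeta_3\operatorname{Tr}(\rho(R))}{3(1-\zeta_3)},$$ where $\zeta_3= e^{2\pi i/3}$.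
   Context: $S=\begin{pmatrix}0&-1\\1&0\end{pmatrix}$, $T=\begin{pmatrix}1&1\\0&1\end{pmatrix}$, $R^{-1}=\begin{pmatrix}1&1\\-1&0\end{pmatrix}$, so $R=ST$ in $\mathrm{PSL}_2(\mathbb{Z})$; these elements also denote their images in $G$. $S_2(\Gamma)$ is the finite-dimensional space of weight two holomorphic cusp forms for $\Gamma$ (isomorphic to the space of holomorphic differentials on the compactified modular curve $X(\Gamma)$ via $f\mapsto f\,d\tau$). The canonical representation $\rho_\Gamma$ is the action $$\rho_\Gamma(\gamma)f=f|_2\gamma=f\left(\frac{a\tau+b}{c\tau+d}\right)(c\tau+d)^{-2},\qquad \gamma=\begin{pmatrix}a&b\\c&d\end{pmatrix},$$ which factors through $G$. It is a right action, i.e. a representation of $G^{\mathrm{op}}$; the ''op'' is dropped. Since representations of $G^{\mathrm{op}}$ and of $G$ have the same characters as class functions on $G$, the multiplicity of $\rho$ in $\rho_\Gamma$ is the multiplicity of the character of $\rho$ in the class function $g\mapsto\operatorname{Tr}(\rho_\Gamma(g))$. For $0\le k\le e-1$, $N_k(\rho;T)=\dim\ker\big(\rho(T)-e^{2\pi i k/e}I\big)$. *)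

(* Defs.v *)
(* The complex numbers are R[i] for an arbitrary R : realType. *)
From HB Require Import structures.
From mathcomp Require Import all_boot all_order all_algebra all_fingroup.
From mathcomp Require Import mxrepresentation generic_quotient.
From mathcomp Require Import complex ring lra.
From mathcomp Require Import boolp classical_sets reals topology normedtype derive trigo.

Set Implicit Arguments.
Unset Strict Implicit.
Unset Printing Implicit Defensive.

Import Order.TTheory GRing.Theory Num.Theory numFieldNormedType.Exports.
Local Open Scope ring_scope.

Record normalSubgroup (G : groupType) := NormalSubgroup {
  nsub_pred :> {pred G};
  nsub_closed : group_closed nsub_pred;
  nsub_conj : forall x y, x \in nsub_pred -> (x ^ y)%g \in nsub_pred }.

Section QuotientGroup.
Variables (G : groupType) (N : normalSubgroup G).
Implicit Types x y z : G.
Local Open Scope group_scope.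
Local Open Scope quotient_scope.

Lemma nsub1 : 1 \in N. Proof. by have [] := nsub_closed N. Qed.
Lemma nsubM x y : x \in N -> y \in N -> x * y \in N.
Proof. exact: group_closedM (nsub_closed N) x y. Qed.
Lemma nsubV x : x \in N -> x^-1 \in N.
Proof. exact: group_closedV (nsub_closed N) x. Qed.

(* Left cosets: x ~ y iff x N = y N. *)
Definition coset_rel : rel G := fun x y => x^-1 * y \in N.

Lemma coset_rel_refl : reflexive coset_rel.
Proof. by move=> x; rewrite /coset_rel mulVg nsub1. Qed.
Lemma coset_rel_sym : symmetric coset_rel.
Proof.
by move=> x y; apply/idP/idP => /nsubV; rewrite /coset_rel invgM invgK.
Qed.
Lemma coset_rel_trans : transitive coset_rel.
Proof.
by move=> y x z xy /(nsubM xy); rewrite mulgA -(mulgA x^-1) mulgV mulg1.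
Qed.

Canonical coset_equiv :=
  EquivRel coset_rel coset_rel_refl coset_rel_sym coset_rel_trans.

Definition gquot := {eq_quot coset_rel}.
HB.instance Definition _ := Choice.on gquot.
HB.instance Definition _ := EqQuotient.on gquot.

Lemma gquotP x y : reflect (x = y %[mod gquot]) (coset_rel x y).
Proof. by apply: (iffP idP) => [xy|/eqmodP//]; apply/eqmodP. Qed.

Lemma gquot_reprK (x : G) : coset_rel (repr (\pi_gquot x)) x.
Proof. by apply/gquotP; rewrite reprK. Qed.

Definition gquot_mul (a b : gquot) : gquot := \pi_gquot (repr a * repr b).
Definition gquot_inv (a : gquot) : gquot := \pi_gquot (repr a)^-1.

Lemma coset_relM x x' y y' :
  coset_rel x x' -> coset_rel y y' -> coset_rel (x * y) (x' * y').
Proof.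
rewrite /coset_rel => xx' yy'.
have -> : (x * y)^-1 * (x' * y') = (x^-1 * x') ^ y * (y^-1 * y').
  by rewrite conjgE invgM !mulgA mulgK.
by rewrite nsubM // nsub_conj.
Qed.

Lemma coset_relV x x' : coset_rel x x' -> coset_rel x^-1 x'^-1.
Proof.
rewrite coset_rel_sym /coset_rel => xx'.
suff -> : x^-1^-1 * x'^-1 = (x'^-1 * x) ^ x'^-1 by exact: nsub_conj.
by rewrite conjgE !invgK !mulgA mulgV mul1g.
Qed.

Lemma gquot_mulE x y : gquot_mul (\pi_gquot x) (\pi_gquot y) = \pi_gquot (x * y).
Proof. by apply/gquotP/coset_relM; apply: gquot_reprK. Qed.

Lemma gquot_invE x : gquot_inv (\pi_gquot x) = \pi_gquot x^-1.
Proof. by apply/gquotP/coset_relV; apply: gquot_reprK. Qed.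

Lemma gquot_mulA : associative gquot_mul.
Proof.
elim/quotW=> x; elim/quotW=> y; elim/quotW=> z.
by rewrite (gquot_mulE y z) (gquot_mulE x y) !gquot_mulE mulgA.
Qed.
Lemma gquot_mul1 : left_id (\pi_gquot 1) gquot_mul.
Proof. by elim/quotW=> x; rewrite gquot_mulE mul1g. Qed.
Lemma gquot_mulr1 : right_id (\pi_gquot 1) gquot_mul.
Proof. by elim/quotW=> x; rewrite gquot_mulE mulg1. Qed.
Lemma gquot_mulV : left_inverse (\pi_gquot 1) gquot_inv gquot_mul.
Proof. by elim/quotW=> x; rewrite gquot_invE gquot_mulE mulVg. Qed.
Lemma gquot_mulrV : right_inverse (\pi_gquot 1) gquot_inv gquot_mul.
Proof. by elim/quotW=> x; rewrite gquot_invE gquot_mulE mulgV. Qed.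

HB.instance Definition _ := isGroup.Build gquot
  gquot_mulA gquot_mul1 gquot_mulr1 gquot_mulV gquot_mulrV.

Definition to_gquot (x : G) : gquot := \pi_gquot x.

Lemma to_gquotM : {morph to_gquot : x y / x * y}.
Proof. by move=> x y; rewrite [RHS]gquot_mulE. Qed.

Lemma to_gquotV : {morph to_gquot : x / x^-1}.
Proof. by move=> x; rewrite [RHS]gquot_invE. Qed.

(* Finitely many cosets of N cover G. *)
Definition finite_index :=
  exists s : seq G, forall x, exists2 y, y \in s & coset_rel y x.

(* The quotient G / N again, now as a finGroupType. *)
Section Finite.
Variable fi : finite_index.

Definition fin_gquot of finite_index := gquot.
Local Notation fq := (fin_gquot fi).
HB.instance Definition _ := Group.on fq.

Definition fin_gquot_enum : seq fq := undup (map to_gquot (sval (cid fi))).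

Lemma mem_fquot_enum (a : fq) : a \in fin_gquot_enum.
Proof.
rewrite mem_undup; apply/mapP; have [y ys yx] := svalP (cid fi) (repr a).
by exists y => //; rewrite -[LHS]reprK; apply/esym/gquotP.
Qed.

Lemma fin_gquot_pickleK :
  pcancel (fun a : fq => index a fin_gquot_enum) (onth fin_gquot_enum).
Proof.
by move=> a; rewrite onthE (nth_map a) ?nth_index ?index_mem ?mem_fquot_enum.
Qed.

HB.instance Definition _ := Choice_isCountable.Build fq fin_gquot_pickleK.

Lemma fin_gquot_enumP : finite_axiom fin_gquot_enum.
Proof. by move=> a; rewrite count_uniq_mem ?undup_uniq ?mem_fquot_enum. Qed.

HB.instance Definition _ := isFinite.Build fq fin_gquot_enumP.
End Finite.
End QuotientGroup.

Lemma mx2_entries (K : pzRingType) (A B : 'M[K]_2) :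
  A 0 0 = B 0 0 -> A 0 1 = B 0 1 -> A 1 0 = B 1 0 -> A 1 1 = B 1 1 -> A = B.
Proof.
have ord2 (i : 'I_2) : i = 0 \/ i = 1.
  by case: i => [[|[|//]] ?]; [left | right]; apply/val_inj.
move=> h00 h01 h10 h11; apply/matrixP => i j.
by case: (ord2 i) => ->; case: (ord2 j) => ->.
Qed.

Lemma mulmx2E (K : pzRingType) (A B : 'M[K]_2) i j :
  (A *m B) i j = A i 0 * B 0 j + A i 1 * B 1 j.
Proof.
by rewrite mxE big_ord_recl big_ord1; congr (_ + A i _ * B _ j); apply/val_inj.
Qed.

Lemma det_mx2E (K : comPzRingType) (A : 'M[K]_2) :
  \det A = A 0 0 * A 1 1 - A 0 1 * A 1 0.
Proof.
rewrite (expand_det_row _ 0) big_ord_recl big_ord1 /cofactor !det_mx11 !mxE.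
rewrite /= expr0 mul1r expr1 mulN1r mulrN.
by congr (_ * A _ _ - A _ _ * A _ _); apply/val_inj.
Qed.

Definition mx2 (a b c d : int) : 'M[int]_2 :=
  \matrix_(i, j) if i == 0 then (if j == 0 then a else b)
                 else (if j == 0 then c else d).

Definition SL2Z := {A : 'M[int]_2 | \det A == 1}.

HB.instance Definition _ := SubChoice.on SL2Z.

Definition mkSL2Z (A : 'M[int]_2) (detA : \det A == 1) : SL2Z := exist _ A detA.

Lemma SL2Z_det (A : SL2Z) : \det (val A) = 1. Proof. exact/eqP/(valP A). Qed.

Lemma SL2Z_unit (A : SL2Z) : val A \in unitmx.
Proof. by rewrite unitmxE SL2Z_det unitr1. Qed.

Lemma SL2Z_one_subproof : \det (1%:M : 'M[int]_2) == 1.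
Proof. by rewrite det1. Qed.
Lemma SL2Z_mul_subproof (A B : SL2Z) : \det (val A *m val B) == 1.
Proof. by rewrite det_mulmx !SL2Z_det mulr1. Qed.
Lemma SL2Z_inv_subproof (A : SL2Z) : \det (invmx (val A)) == 1.
Proof. by rewrite det_inv SL2Z_det invr1. Qed.

Definition SL2Z_one : SL2Z := mkSL2Z SL2Z_one_subproof.
Definition SL2Z_mul (A B : SL2Z) : SL2Z := mkSL2Z (SL2Z_mul_subproof A B).
Definition SL2Z_inv (A : SL2Z) : SL2Z := mkSL2Z (SL2Z_inv_subproof A).

Lemma SL2Z_mulA : associative SL2Z_mul.
Proof. by move=> A B D; apply/val_inj; rewrite /= mulmxA. Qed.
Lemma SL2Z_mul1 : left_id SL2Z_one SL2Z_mul.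
Proof. by move=> A; apply/val_inj; rewrite /= mul1mx. Qed.
Lemma SL2Z_mulr1 : right_id SL2Z_one SL2Z_mul.
Proof. by move=> A; apply/val_inj; rewrite /= mulmx1. Qed.
Lemma SL2Z_mulV : left_inverse SL2Z_one SL2Z_inv SL2Z_mul.
Proof. by move=> A; apply/val_inj; rewrite /= mulVmx ?SL2Z_unit. Qed.
Lemma SL2Z_mulrV : right_inverse SL2Z_one SL2Z_inv SL2Z_mul.
Proof. by move=> A; apply/val_inj; rewrite /= mulmxV ?SL2Z_unit. Qed.

HB.instance Definition _ := isGroup.Build SL2Z
  SL2Z_mulA SL2Z_mul1 SL2Z_mulr1 SL2Z_mulV SL2Z_mulrV.

Lemma SL2Z_valM (A B : SL2Z) : val (A * B)%g = val A *m val B.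
Proof. by []. Qed.

Definition pm1 : {pred SL2Z} :=
  [pred A : SL2Z | (val A == 1%:M) || (val A == - 1%:M)].

Lemma pm1_valE (A : SL2Z) : reflect (exists e : bool, val A = (-1) ^+ e *: 1%:M) (A \in pm1).
Proof.
apply: (iffP orP) => [[]/eqP->|[[]]->].
- by exists false; rewrite expr0 scale1r.
- by exists true; rewrite expr1 scaleN1r.
- by right; rewrite expr1 scaleN1r.
- by left; rewrite expr0 scale1r.
Qed.

Lemma pm1_closed : group_closed pm1.
Proof.
split; first by rewrite inE eqxx.
move=> A B /pm1_valE[e hA] /pm1_valE[e' hB]; apply/pm1_valE; exists (e (+) e').
have hB' : val B^-1%g = (-1) ^+ e' *: 1%:M.
  apply: (can_inj (mulKmx (SL2Z_unit B))); rewrite -SL2Z_valM mulgV.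
  by rewrite hB -scalemxAl mul1mx scalerA -expr2 sqrr_sign scale1r.
by rewrite SL2Z_valM hA hB' -scalemxAl mul1mx scalerA signr_addb.
Qed.

Lemma pm1_conj (A B : SL2Z) : A \in pm1 -> (A ^ B)%g \in pm1.
Proof.
move=> /pm1_valE[e hA]; apply/pm1_valE; exists e.
rewrite conjgE !SL2Z_valM hA -scalemxAl mul1mx -scalemxAr -SL2Z_valM.
by rewrite mulVg.
Qed.

(* PSL_2(Z) is SL_2(Z) modulo {1, -1}. *)
Definition PSL2Z := gquot (NormalSubgroup pm1_closed pm1_conj).
HB.instance Definition _ := Group.on PSL2Z.

Definition toPSL (A : SL2Z) : PSL2Z := to_gquot _ A.

Lemma matS_subproof : \det (mx2 0 (-1) 1 0) == 1.
Proof. by rewrite det_mx2E !mxE. Qed.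
Lemma matT_subproof : \det (mx2 1 1 0 1) == 1.
Proof. by rewrite det_mx2E !mxE. Qed.

Definition matS : SL2Z := mkSL2Z matS_subproof.
Definition matT : SL2Z := mkSL2Z matT_subproof.
Definition matR : SL2Z := (matS * matT)%g.

Lemma matR_invE : val (matR^-1)%g = mx2 1 1 (-1) 0.
Proof.
apply: (can_inj (mulKmx (SL2Z_unit matR))); rewrite -SL2Z_valM mulgV.
by apply: mx2_entries; rewrite /= !mulmx2E !mxE /= ?mulmx2E ?mxE.
Qed.

Section UpperHalfPlane.
Variable R : realType.
Local Notation C := R[i].
Local Notation Imc := (@complex.Im R).

Definition UHP := {z : C | 0 < Imc z}.

Implicit Types (A B : SL2Z) (z : UHP) (f : UHP -> C).

(* For A = (a b; c d): autf A z = c z + d and numf A z = a z + b. *)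
Definition autf A (z : C) : C := (val A 1 0)%:~R * z + (val A 1 1)%:~R.
Definition numf A (z : C) : C := (val A 0 0)%:~R * z + (val A 0 1)%:~R.

Lemma SL2Z_detE A :
  val A 0 0 * val A 1 1 - val A 0 1 * val A 1 0 = 1.
Proof. by rewrite -det_mx2E SL2Z_det. Qed.

Lemma Im_int (m : int) : Imc m%:~R = 0.
Proof. by rewrite -(rmorph_int (real_complex R)). Qed.
Lemma Re_int (m : int) : complex.Re (m%:~R : C) = m%:~R.
Proof. by rewrite -(rmorph_int (real_complex R)). Qed.

Lemma autf_neq0 A z : autf A (val z) != 0.
Proof.
apply/eqP; case: z => -[x y] /= y0; rewrite /autf.
rewrite -!(rmorph_int (real_complex R)) /= => -[].
simpc => hre him.
have c0 : val A 1 0 = 0.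
  by apply/eqP; move/eqP: him; rewrite mulf_eq0 (gt_eqF y0) orbF intr_eq0.
have d0 : val A 1 1 = 0.
  by apply/eqP; move/eqP: hre; rewrite c0 mul0r add0r intr_eq0.
by have := SL2Z_detE A; rewrite c0 d0 !mulr0 subr0.
Qed.

Lemma Im_mobius A z : 0 < Imc (numf A (val z) / autf A (val z)).
Proof.
have := autf_neq0 A z.
case: z => -[x y] /= y0; rewrite /autf /numf -!(rmorph_int (real_complex R)) /=.
simpc.
have dR : (val A 0 0)%:~R * (val A 1 1)%:~R - (val A 0 1)%:~R * (val A 1 0)%:~R
    = 1 :> R.
  by rewrite -!rmorphM -rmorphB SL2Z_detE.
set a := _%:~R in dR *; set d := _%:~R in dR *; set b := _%:~R in dR *.
set c := _%:~R in dR *; rewrite eq_complex /= => nz.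
have n0 : 0 < (c * x + d) ^+ 2 + (c * y) ^+ 2.
  rewrite lt_neqAle addr_ge0 ?sqr_ge0// andbT eq_sym.
  by rewrite paddr_eq0 ?sqr_ge0// !sqrf_eq0.
have -> : - ((a * x + b) * (c * y / ((c * x + d) ^+ 2 + (c * y) ^+ 2))) +
    a * y * ((c * x + d) / ((c * x + d) ^+ 2 + (c * y) ^+ 2)) =
    y * (a * d - b * c) / ((c * x + d) ^+ 2 + (c * y) ^+ 2) by ring.
by rewrite dR mulr1 divr_gt0.
Qed.

Definition mobius A z : UHP := Sub (numf A (val z) / autf A (val z)) (Im_mobius A z).

Lemma autfM A B z :
  autf (A * B)%g (val z) = autf A (val (mobius B z)) * autf B (val z).
Proof.
rewrite /autf [val (mobius _ _)]/= SL2Z_valM !mulmx2E !rmorphD !rmorphM/=.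
have := autf_neq0 B z; rewrite /autf /numf => h; field. by [].
Qed.

Lemma mobiusM A B z : mobius (A * B)%g z = mobius A (mobius B z).
Proof.
apply/val_inj; rewrite [LHS]/= autfM [RHS]/=.
have := autf_neq0 B z; have := autf_neq0 A (mobius B z); rewrite /=.
rewrite /numf SL2Z_valM !mulmx2E !rmorphD !rmorphM/=.
rewrite /autf /numf => h h'; field; rewrite h' /=.
move: (mulf_neq0 h h'); congr (_ != _).
by rewrite mulrDl -!mulrA mulVf ?mulr1.
Qed.

(* The weight 2 action f |_2 A. *)
Definition slash f A : UHP -> C :=
  fun z => f (mobius A z) * autf A (val z) ^- 2.

(* Extension by 0 to C, only there to speak of derivatives: UHP is open, so
   derivability at one of its points does not see the values outside. *)
Definition extend f : C^o -> C^o :=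
  fun w => if insub w is Some z then f z else 0.

(* derivable over the field R[i] in direction 1 is complex differentiability. *)
Definition holomorphic f := forall z, derivable (extend f) (val z) 1.

(* f(z) -> 0 as Im z -> +oo, uniformly in Re z. *)
Definition vanishes_at_infty f :=
  forall eps : R, 0 < eps ->
    exists M : R, forall z, M < Imc (val z) -> `|f z| < (eps%:C)%C.

(* Weight two cusp forms. SL_2(Z) is transitive on the cusps, so letting A range
   over SL_2(Z) in the last clause imposes vanishing at every cusp. *)
Definition cusp_form (Gamma : {pred PSL2Z}) f :=
  [/\ holomorphic f,
      forall A, toPSL A \in Gamma -> slash f A = f
    & forall A, vanishes_at_infty (slash f A)].


Lemma slashM f A B : slash (slash f A) B = slash f (A * B)%g.
Proof.
apply/funext => z; rewrite /slash mobiusM autfM exprMn.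
by rewrite [in RHS]invfM mulrA.
Qed.

Lemma slash1 f : slash f 1%g = f.
Proof.
apply/funext => z; rewrite /slash.
have autf1 : autf 1%g (val z) = 1 by rewrite /autf !mxE mul0r add0r.
have -> : mobius 1%g z = z.
  apply/val_inj; rewrite [LHS]/= autf1 divr1.
  by rewrite /numf !mxE mul1r addr0.
by rewrite autf1 expr1n invr1 mulr1.
Qed.

Lemma normc_ge_Im (x : C) : (`|Imc x|%:C <= `|x|)%C.
Proof.
by rewrite normc_def lecR -sqrtr_sqr ler_wsqrtr // lerDr sqr_ge0.
Qed.

Lemma UHP_near z : \forall w \near (val z : C^o), 0 < Imc w.
Proof.
apply/nbhs_ballP; exists ((Imc (val z))%:C)%C => /=.
  by rewrite ltcR; exact: valP z.
move=> w; rewrite -ball_normE /= => zw.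
have := le_lt_trans (normc_ge_Im _) zw; rewrite ltcR raddfB /=.
move=> /(le_lt_trans (ler_norm _)) zw'.
by move: zw'; lra.
Qed.

Lemma extendE f z : extend f (val z) = f z.
Proof. by rewrite /extend valK. Qed.

Lemma holomorphic_slash f A : holomorphic f -> holomorphic (slash f A).
Proof.
move=> hf z; have jz := autf_neq0 A z.
pose m (w : C^o) : C^o := numf A w / autf A w.
pose j (w : C^o) : C^o := autf A w.
apply: (@near_eq_derivable _ _ _
  (fun w : C^o => extend f (m w) * ((j w)^-1 * (j w)^-1) : C^o)).
  near=> w; have w0 : 0 < Imc w by near: w; exact: UHP_near.
  rewrite -[w]/(val (Sub w w0 : UHP)) [in RHS]extendE.
  by rewrite -[m _]/(val (mobius A (Sub w w0))) extendE -invfM -expr2.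
have dj : derivable j (val z) 1.
  apply: derivableD; last exact: derivable_cst.
  by apply: derivableM; [exact: derivable_cst | exact: derivable_id].
have djV : derivable (fun w => (j w)^-1) (val z) 1 by exact: derivableV.
have dn : derivable (numf A : C^o -> C^o) (val z) 1.
  apply: derivableD; last exact: derivable_cst.
  by apply: derivableM; [exact: derivable_cst | exact: derivable_id].
have dm : derivable m (val z) 1 := derivableM dn djV.
have df : derivable (extend f \o m) (val z) 1.
  apply/derivable1_diffP; apply: differentiable_comp.
    exact/derivable1_diffP.
  by apply/derivable1_diffP; exact: (hf (mobius A z)).
exact: (derivableM df (derivableM djV djV)).
Unshelve. all: by end_near.
Qed.


End UpperHalfPlane.

Section CanonicalRepresentation.
Variable R : realType.
Local Notation C := R[i].
Local Notation fun_space := (UHP R -> C).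

Definition lincomb m (b : 'I_m -> fun_space) (v : 'rV[C]_m) : fun_space :=
  fun z => \sum_i v 0 i * b i z.

Definition is_basis (P : set fun_space) m (b : 'I_m -> fun_space) :=
  (forall v, P (lincomb b v)) /\
  (forall f, P f -> exists! v, f = lincomb b v).

(* Some basis of P when P is finite-dimensional, and otherwise the empty family.
   It is applied to spaces of cusp forms, which are finite-dimensional. *)
Definition basis_of (P : set fun_space) : {m : nat & 'I_m -> fun_space} :=
  if pselect (exists mb : {m : nat & 'I_m -> fun_space}, is_basis P (projT2 mb))
  is left h then sval (cid h) else existT _ 0%N (fun=> fun=> 0).

Definition coords m (b : 'I_m -> fun_space) (f : fun_space) : 'rV[C]_m :=
  xget 0 [set v | f = lincomb b v]%classic.

Variables (Gamma : normalSubgroup PSL2Z) (fi : finite_index Gamma).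
Local Notation G := (fin_gquot fi).

(* G is PSL_2(Z) / Gamma; liftG picks a representative in SL_2(Z). *)
Definition toG (A : SL2Z) : G := to_gquot Gamma (toPSL A).
Definition liftG (g : G) : SL2Z := repr (repr g : PSL2Z).

Lemma toGM : {morph toG : A B / (A * B)%g}.
Proof. by move=> A B; rewrite /toG /toPSL !to_gquotM. Qed.

Lemma liftGK : cancel liftG toG.
Proof. by move=> g; rewrite /toG /toPSL /to_gquot !reprK. Qed.

Definition S2 : set fun_space := cusp_form Gamma.

Lemma S2_slash f A : S2 f -> S2 (slash f A).
Proof.
case=> hol inv van; split => [|B BG|B]; first exact: holomorphic_slash.
- rewrite slashM conjgCV -slashM inv// /toPSL.
  have -> : to_gquot (NormalSubgroup pm1_closed pm1_conj) (B ^ A^-1)%g =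
    (toPSL B ^ (toPSL A)^-1)%g.
    by apply: (mulIg (toPSL A)); rewrite -to_gquotM -conjgCV -conjgCV to_gquotM.
  exact: nsub_conj.
- by rewrite slashM; exact: van.
Qed.

Lemma S2_slash_eq f A B : S2 f -> toG A = toG B -> slash f A = slash f B.
Proof.
move=> Sf; rewrite /toG => /gquotP AB.
have [_ inv _] := S2_slash A Sf.
by rewrite -[B](mulVKg A) -slashM inv // /toPSL to_gquotM to_gquotV.
Qed.

Definition dimS2 : nat := projT1 (basis_of S2).
Definition basisS2 : 'I_dimS2 -> fun_space := projT2 (basis_of S2).

(* The matrix of f |-> f |_2 g on S_2(Gamma), for row vectors of coordinates:
   row i holds the coordinates of b_i |_2 g. Row vectors are acted upon from the
   right, so the right action of G gives canonical_mx (g h) =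
   canonical_mx g *m canonical_mx h, and \tr (canonical_mx g) is the trace of the
   operator f |-> f |_2 g. *)
Definition canonical_mx (g : G) : 'M[C]_dimS2 :=
  \matrix_i coords basisS2 (slash (basisS2 i) (liftG g)).

Lemma slash_lincomb m (b : 'I_m -> fun_space) v A :
  slash (lincomb b v) A = lincomb (fun i => slash (b i) A) v.
Proof.
apply/funext => z; rewrite /slash /lincomb mulr_suml.
by apply: eq_bigr => i _; rewrite mulrA.
Qed.

Lemma coordsP m (b : 'I_m -> fun_space) f :
  is_basis S2 b -> S2 f -> lincomb b (coords b f) = f.
Proof.
move=> [_ uniqb] /uniqb[v [fv _]]; rewrite /coords.
by case: xgetP => [w _ /= <-//|/(_ v)/= []].
Qed.

Lemma lincomb_inj m (b : 'I_m -> fun_space) :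
  is_basis S2 b -> injective (lincomb b).
Proof.
move=> [Sb uniqb] v w vw; have [u [_ uu]] := uniqb _ (Sb v).
by rewrite -(uu v) // (uu w).
Qed.

Lemma lincomb_delta m (b : 'I_m -> fun_space) i :
  lincomb b (delta_mx 0 i) = b i.
Proof.
apply/funext => z; rewrite /lincomb (bigD1 i) //= mxE !eqxx mul1r big1 ?addr0//.
by move=> j ji; rewrite mxE (negPf ji) andbF mul0r.
Qed.

Lemma basisS2_mem i : is_basis S2 basisS2 -> S2 (basisS2 i).
Proof. by move=> [Sb _]; rewrite -lincomb_delta. Qed.

Lemma row_canonical_mx i g : is_basis S2 basisS2 ->
  lincomb basisS2 (row i (canonical_mx g)) = slash (basisS2 i) (liftG g).
Proof.
by move=> bb; rewrite rowK coordsP//; apply/S2_slash/basisS2_mem.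
Qed.

Lemma canonical_mxE v g : is_basis S2 basisS2 ->
  lincomb basisS2 (v *m canonical_mx g) = slash (lincomb basisS2 v) (liftG g).
Proof.
move=> bb; rewrite slash_lincomb; apply/funext => z; rewrite /lincomb.
under [RHS]eq_bigr => i _ do rewrite -row_canonical_mx // mulr_sumr.
rewrite exchange_big /=; apply: eq_bigr => j _; rewrite mxE mulr_suml.
by apply: eq_bigr => i _; rewrite !mxE mulrA.
Qed.

Lemma basisS2P : is_basis S2 basisS2 \/ dimS2 = 0%N.
Proof.
rewrite /basisS2 /dimS2 /basis_of.
by case: pselect => [h|_]; [left; exact: svalP (cid h) | right].
Qed.

Lemma canonical_mx_repr : mx_repr [set: G] canonical_mx.
Proof.
have [bb|d0] := basisS2P; last first.
  by split=> [|g h _ _]; apply/matrixP => i; have := ltn_ord i; rewrite {2}d0.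
have SA := basisS2_mem ^~ bb.
split=> [|g h _ _]; apply/row_matrixP => i; apply: (lincomb_inj bb).
  rewrite row_canonical_mx // rowE mulmx1 lincomb_delta -[RHS]slash1.
  by apply: S2_slash_eq => //; rewrite liftGK.
rewrite row_mul canonical_mxE // !row_canonical_mx // slashM.
by apply: S2_slash_eq => //; rewrite toGM !liftGK.
Qed.

Definition canonical_repr : mx_representation C [set: G] dimS2 :=
  MxRepresentation canonical_mx_repr.

End CanonicalRepresentation.

(* The multiplicity in sigma of the irreducible representation rho: socle_mult of
   the isotypic component W of sigma of type rho, if there is one (the same recipe
   as standard_irr_coef in mathcomp.character). *)
Definition irr_mult (F : decFieldType) (gT : finGroupType) (G : {group gT}) n m
    (rho : mx_representation F G n) (sigma : mx_representation F G m) : nat :=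
  if [pick W : DecSocleType sigma | `[< mx_rsim rho (socle_repr W) >]] is Some W
  then socle_mult W else 0%N.

(* exp (i t) *)
Definition cis (R : realType) (t : R) : R[i] := (cos t +i* sin t)%C.

(* Main.v *)
Require Import Defs.
From mathcomp Require Import all_boot all_order all_algebra all_fingroup.
From mathcomp Require Import mxrepresentation generic_quotient complex ring lra zify.
From mathcomp Require Import boolp classical_sets functions reals topology normedtype derive trigo.
From mathcomp Require Import sequences exp realfun measure lebesgue_measure lebesgue_integral ftc.
Set Implicit Arguments.
Unset Strict Implicit.
Unset Printing Implicit Defensive.
Import Order.TTheory GRing.Theory Num.Theory numFieldNormedType.Exports.
Local Open Scope ring_scope.

(* The multiplicity of rho in S_2(Gamma) is the dimension of the space S_2(rho)
   of vector-valued cusp forms F of weight two with F(A z) = J(A, z)^2 rho(A)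
   F(z). Poincare series produce enough such forms of weights 2 + 12 m to choose
   a basis F_1, ..., F_n over the level-one forms, of weights 2 + 12 m_j with
   least sum, and then S_2(rho) is spanned by the F_j with m_j = 0. Locally at
   the elliptic points the matrix Phi of the F_j is diag((z - w)^a) times an
   invertible matrix, where the exponents a (b at the points of order three) are
   prescribed by the eigenvalues of rho(S) and rho(R), and at the cusp it behaves
   like diag(q^lam), where exp (2 pi i lam) are the eigenvalues of rho(T). Hence
   det Phi is a power of E6 times a power of E4 times a nowhere vanishing
   function whose order at the cusp is known, and comparing weights gives sum_j
   (2 + 12 m_j) = 6 sum a + 4 sum b + 12 sum lam. By duality E4^2 E6 Delta Phi^-1
   is holomorphic, its rows being forms of weight 24 - 12 m_i for the dual
   representation; such a form of nonpositive weight is an invariant vector, so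
   m_j <= 1 when rho is irreducible and nontrivial, and the weights count
   S_2(rho). *)

(** * Complex differentiability *)

(** Riemann-Roch for the bundle attached to rho is replaced by the determinant of Phi and by the
    matrix E4^2 E6 Delta Phi^-1. The analysis is done in the coordinate q = e^(2 pi i z): Cauchy's
    formula is proved for functions of period 1, and a punctured disc is the image of the half-plane
    under a + r q, so Taylor expansion and removable singularities are Fourier expansion in
    disguise. The weights 2 + 12 m occur because Delta has weight 12 and no zero. Hence J(A, w)^12 =
    1 when A fixes w, so that adding 12 to the weight changes no local condition, and dividing by
    Delta trades one order of vanishing at the cusp for 12 in the weight. Delta is the exponential
    of a primitive of the weight-two Eisenstein series, which is not absolutely convergent and
    enters as a quasi-period of the Weierstrass zeta function. Poincare series for the trivial
    representation locate the zeros of E4 and E6. The exponents lam lie in (0, 1], the eigenvalue 1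
    of rho(T) having lam = 1, because the forms are cuspidal; this is why N_0 is absent from the
    formula. *)

Section ComplexNorm.
Variable R : realType.
Local Notation C := R[i].
Local Notation Re := (@complex.Re R).
Local Notation Im := (@complex.Im R).
Local Notation ofR := (real_complex R).
Implicit Types (z w : C) (x y : R).

(* The norm of R[i] takes its values in R[i]; nm z is the same number in R. *)
Definition nm z : R := Num.sqrt (Re z ^+ 2 + Im z ^+ 2).

Lemma nmE z : `|z| = ofR (nm z).
Proof. by rewrite normc_def. Qed.

Lemma nm_ge0 z : 0 <= nm z. Proof. exact: sqrtr_ge0. Qed.

Lemma nm0 : nm 0 = 0.
Proof. by rewrite /nm /= !expr0n addr0 sqrtr0. Qed.

Lemma nm1 : nm 1 = 1.
Proof. by apply: (@complexI R); rewrite -nmE normr1. Qed.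

Lemma nmM z w : nm (z * w) = nm z * nm w.
Proof. by apply: (@complexI R); rewrite rmorphM /= -!nmE normrM. Qed.

Lemma nmN z : nm (- z) = nm z.
Proof. by rewrite /nm !raddfN !sqrrN. Qed.

Lemma nmV z : nm z^-1 = (nm z)^-1.
Proof. by apply: (@complexI R); rewrite fmorphV /= -!nmE normfV. Qed.

Lemma nmX z n : nm (z ^+ n) = nm z ^+ n.
Proof. by elim: n => [|n ih]; rewrite ?expr0 ?nm1 // !exprS nmM ih. Qed.

Lemma nmD z w : nm (z + w) <= nm z + nm w.
Proof. by rewrite -lecR rmorphD /= -!nmE ler_normD. Qed.

Lemma nmB z w : nm (z - w) <= nm z + nm w.
Proof. by rewrite -[nm w]nmN nmD. Qed.

Lemma nm_subC z w : nm (z - w) = nm (w - z).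
Proof. by rewrite -nmN opprB. Qed.

Lemma nm_tri u z w : nm (z - w) <= nm (z - u) + nm (u - w).
Proof. by rewrite -[z - w](subrKA u) nmD. Qed.

Lemma nm_eq0 z : (nm z == 0) = (z == 0).
Proof. by rewrite -(inj_eq (@complexI R)) -nmE normr_eq0. Qed.

Lemma nm_gt0 z : (0 < nm z) = (z != 0).
Proof. by rewrite lt_neqAle nm_ge0 andbT eq_sym nm_eq0. Qed.

Lemma nm_real x : nm (ofR x) = `|x|.
Proof. by rewrite /nm /= expr0n addr0 sqrtr_sqr. Qed.

Lemma nm_i : nm 'i%C = 1.
Proof. by rewrite /nm /= expr0n add0r expr1n sqrtr1. Qed.

Lemma sqr_nm z : nm z ^+ 2 = Re z ^+ 2 + Im z ^+ 2.
Proof. by rewrite sqr_sqrtr // addr_ge0 ?sqr_ge0. Qed.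

Lemma nm_Re z : `|Re z| <= nm z.
Proof. by rewrite -sqrtr_sqr ler_wsqrtr // lerDl sqr_ge0. Qed.

Lemma nm_Im z : `|Im z| <= nm z.
Proof. by rewrite -sqrtr_sqr ler_wsqrtr // lerDr sqr_ge0. Qed.

Lemma nm_ReIm z : nm z <= `|Re z| + `|Im z|.
Proof.
rewrite -(ler_pXn2r (ltn0Sn 1)) ?nnegrE ?nm_ge0 ?addr_ge0 //.
rewrite sqr_nm sqrrD !real_normK ?num_real // lerD2r lerDl.
by rewrite mulrn_wge0 // mulr_ge0.
Qed.

Lemma nm_sum I (r : seq I) (P : pred I) (F : I -> C) :
  nm (\sum_(i <- r | P i) F i) <= \sum_(i <- r | P i) nm (F i).
Proof.
elim/big_ind2: _ => [|u a v b ua vb|//]; first by rewrite nm0.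
by apply: (le_trans (nmD _ _)); apply: lerD.
Qed.

Lemma nm_sub_ge z w : nm z - nm w <= nm (z - w).
Proof. by rewrite lerBlDr; apply: le_trans (nmD _ _); rewrite subrK. Qed.

Lemma nm_le0 z : nm z <= 0 -> z = 0.
Proof. by move=> h; apply/eqP; rewrite -nm_eq0 eq_le h nm_ge0. Qed.

(** Identities between limits and integrals are proved through this estimate. No sign is required of
    [K], hence the division by [|K| + 1]. *)
Lemma nm_small0 z (K : R) : (forall e : R, 0 < e -> nm z <= K * e) -> z = 0.
Proof.
move=> h; apply: nm_le0; apply/ler_addgt0Pr => e e0.
have K1 : 0 < `|K| + 1 by rewrite ltr_pwDr.
apply: le_trans (h (e / (`|K| + 1)) _) _; first by rewrite divr_gt0.
rewrite add0r mulrCA ler_piMr // ?(ltW e0) // ler_pdivrMr // mul1r.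
by apply: le_trans (ler_norm _) _; rewrite lerDl.
Qed.

Lemma complex_eqE z w : Re z = Re w -> Im z = Im w -> z = w.
Proof. by case: z w => [a b] [c d] /= -> ->. Qed.

Lemma cReM z w : Re (z * w) = Re z * Re w - Im z * Im w.
Proof. by case: z w => [a b] [c d]. Qed.
Lemma cImM z w : Im (z * w) = Re z * Im w + Im z * Re w.
Proof. by case: z w => [a b] [c d]. Qed.

Definition ccont (f : C -> C) z := forall e : R, 0 < e -> exists2 d : R, 0 < d &
  forall w, nm (w - z) < d -> nm (f w - f z) < e.

Lemma ccont_continuous f z : {for z, continuous (f : C^o -> C^o)} <-> ccont f z.
Proof.
split.
  move=> /cvgrPdist_lt h e e0.
  have /nbhs_ballP[d /= d0 hd] := h (ofR e) ltac:(by rewrite ltcR).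
  have dR : ofR (Re d) = d by rewrite RRe_real // gtr0_real.
  exists (Re d); first by rewrite -ltcR dR.
  move=> w wz; have := hd w; rewrite -ball_normE /= -dR !nmE !ltcR (nm_subC z w) => /(_ wz).
  by rewrite nm_subC.
move=> h; apply/(@cvgrPdist_lt _ C^o _ (nbhs (z : C^o)) _ f (f z)) => e e0.
have eR : ofR (Re e) = e by rewrite RRe_real // gtr0_real.
have [d d0 hd] := h (Re e) ltac:(by rewrite -ltcR eR).
apply/nbhs_ballP; exists (ofR d) => /=; first by rewrite ltcR.
move=> w; rewrite -ball_normE /= -eR !nmE !ltcR (nm_subC z w) => /hd.
by rewrite nm_subC.
Qed.

Lemma ccont_cst c z : ccont (fun=> c) z. Proof. by move=> e e0; exists 1 => // w _; rewrite subrr nm0. Qed.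
Lemma ccont_id z : ccont id z. Proof. by move=> e e0; exists e. Qed.
Lemma ccontD f g z : ccont f z -> ccont g z -> ccont (fun w => f w + g w) z.
Proof.
move=> /ccont_continuous hf /ccont_continuous hg; apply/ccont_continuous.
exact: continuousD hf hg.
Qed.
Lemma ccontM f g z : ccont f z -> ccont g z -> ccont (fun w => f w * g w) z.
Proof.
move=> /ccont_continuous hf /ccont_continuous hg; apply/ccont_continuous.
exact: continuousM hf hg.
Qed.
Lemma ccontN f z : ccont f z -> ccont (fun w => - f w) z.
Proof. by move=> /ccont_continuous hf; apply/ccont_continuous; apply: continuousN hf. Qed.
Lemma ccontB f g z : ccont f z -> ccont g z -> ccont (fun w => f w - g w) z.
Proof.
move=> /ccont_continuous hf /ccont_continuous hg; apply/ccont_continuous.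
exact: continuousB hf hg.
Qed.
Lemma ccontV f z : f z != 0 -> ccont f z -> ccont (fun w => (f w)^-1) z.
Proof. by move=> f0 /ccont_continuous hf; apply/ccont_continuous; apply: continuousV f0 hf. Qed.
Lemma ccont_comp f g z : ccont g z -> ccont f (g z) -> ccont (fun w => f (g w)) z.
Proof.
move=> hg hf e /hf[d /hg[r r0 hr] hd].
by exists r => // w /hr/hd.
Qed.

Lemma ccont_near f g z (d : R) : 0 < d ->
  (forall w, nm (w - z) < d -> f w = g w) -> ccont f z -> ccont g z.
Proof.
move=> d0 fg h; move=> e e0; have [d' d'0 hd] := h e e0.
exists (Num.min d d') => [|w]; first by rewrite lt_min d0.
rewrite lt_min => /andP[wd wd']; rewrite -fg // -fg ?subrr ?nm0 //; exact: hd.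
Qed.

(* Caratheodory's form of complex differentiability: it makes the product and
   chain rules identities between the slope functions. *)
Definition cdiff (f : C -> C) z d := exists phi : C -> C,
  [/\ forall w, f w - f z = phi w * (w - z), ccont phi z & phi z = d].

Lemma cdiffP f z d : cdiff f z d <-> forall e : R, 0 < e -> exists2 r : R, 0 < r &
  forall h, nm h < r -> nm (f (z + h) - f z - d * h) <= e * nm h.
Proof.
split.
  move=> [phi [hphi c phid]] e e0; have [r r0 hr] := c e e0; exists r => // h hh.
  rewrite hphi [z + h - z]addrAC subrr add0r -mulrBl nmM ler_wpM2r ?nm_ge0 //.
  by rewrite -phid ltW // hr // [z + h - z]addrAC subrr add0r.
move=> H; exists (fun w => if w == z then d else (f w - f z) / (w - z)); split.
- move=> w; case: eqP => [->|/eqP wz]; first by rewrite !subrr mulr0.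
  by rewrite divfK // subr_eq0.
- move=> e e0; have [r r0 hr] := H (e / 2) ltac:(by rewrite divr_gt0).
  exists r => // w wr; rewrite eqxx; case: eqP => [_|/eqP wz].
    by rewrite subrr nm0.
  have nz : 0 < nm (w - z) by rewrite nm_gt0 subr_eq0.
  rewrite -(ltr_pM2r nz) -nmM mulrBl divfK ?subr_eq0 //.
  have := hr _ wr; rewrite [z + _]addrC subrK => /le_lt_trans; apply.
  by rewrite ltr_pM2r // ltr_pdivrMr // ltr_pMr // ltr1n.
- by rewrite eqxx.
Qed.

Lemma cdiff_near f g z d (r : R) : 0 < r ->
  (forall w, nm (w - z) < r -> f w = g w) -> cdiff f z d -> cdiff g z d.
Proof.
move=> r0 fg /cdiffP h; apply/cdiffP => e e0; have [s s0 hs] := h e e0.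
exists (Num.min r s) => [|w]; first by rewrite lt_min r0.
rewrite lt_min => /andP[wr ws].
by rewrite -!fg ?hs // ?subrr ?nm0 // [z + w]addrC addrK.
Qed.

Lemma cdiff_ext f g z d : f =1 g -> cdiff f z d -> cdiff g z d.
Proof. by move=> fg; apply: (cdiff_near ltr01) => w _. Qed.

Lemma cdiff_cst c z : cdiff (fun=> c) z 0.
Proof.
by exists (fun=> 0); split => // [w|]; [rewrite subrr mul0r | exact: ccont_cst].
Qed.
Lemma cdiff_id z : cdiff id z 1.
Proof. by exists (fun=> 1); split => // [w|]; [rewrite mul1r | exact: ccont_cst]. Qed.
Lemma cdiffD f g z a b : cdiff f z a -> cdiff g z b ->
  cdiff (fun w => f w + g w) z (a + b).
Proof.
move=> [p [hp cp <-]] [q [hq cq <-]]; exists (fun w => p w + q w); split; last by [].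
- by move=> w; rewrite mulrDl -hp -hq; ring.
- exact: ccontD.
Qed.
Lemma cdiffM f g z a b : cdiff f z a -> cdiff g z b ->
  cdiff (fun w => f w * g w) z (a * g z + f z * b).
Proof.
move=> [p [hp cp <-]] [q [hq cq <-]]; exists (fun w => p w * g z + f w * q w); split; last by [].
- move=> w; rewrite mulrDl -mulrA [g z * _]mulrC mulrA -hp -mulrA -hq; ring.
- apply: ccontD; apply: ccontM => //; first exact: ccont_cst.
  apply: (@ccont_near (fun w => f z + p w * (w - z)) _ _ 1) => //.
    by move=> w _; rewrite -hp addrC subrK.
  apply: ccontD; first exact: ccont_cst.
  by apply: ccontM => //; apply: ccontB; [exact: ccont_id | exact: ccont_cst].
Qed.
Lemma cdiff_cont f z d : cdiff f z d -> ccont f z.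
Proof.
move=> [p [hp cp _]]; apply: (@ccont_near (fun w => f z + p w * (w - z)) _ _ 1) => //.
  by move=> w _; rewrite -hp addrC subrK.
apply: ccontD; first exact: ccont_cst.
by apply: ccontM => //; apply: ccontB; [exact: ccont_id | exact: ccont_cst].
Qed.
Lemma cdiffZ c f z a : cdiff f z a -> cdiff (fun w => c * f w) z (c * a).
Proof. by move=> /(cdiffM (cdiff_cst c z)); rewrite mul0r add0r. Qed.
Lemma cdiffN f z a : cdiff f z a -> cdiff (fun w => - f w) z (- a).
Proof.
move=> h; rewrite -mulN1r; apply: cdiff_ext (cdiffZ (-1) h) => w.
by rewrite mulN1r.
Qed.
Lemma cdiffB f g z a b : cdiff f z a -> cdiff g z b ->
  cdiff (fun w => f w - g w) z (a - b).
Proof. by move=> hf hg; apply: cdiffD => //; apply: cdiffN. Qed.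
Lemma cdiff_comp f g z a b : cdiff g z b -> cdiff f (g z) a ->
  cdiff (fun w => f (g w)) z (a * b).
Proof.
move=> hg; have cg := cdiff_cont hg; move: hg.
move=> [q [hq cq <-]] [p [hp cp <-]]; exists (fun w => p (g w) * q w); split; last by [].
- by move=> w; rewrite hp hq mulrA.
- by apply: ccontM => //; apply: ccont_comp.
Qed.
Lemma cdiff_inv z : z != 0 -> cdiff (fun w => w^-1) z (- z ^- 2).
Proof.
move=> z0.
(* Since 0^-1 = 0, the slope of the inverse is not -1/(z w) at w = 0. The function is replaced there
   by its tangent line at z, outside the disc of radius [nm z] that matters. *)
apply: (@cdiff_near (fun w => if w == 0 then z^-1 - z^-1 ^+ 2 * (w - z) else w^-1)
  _ _ _ (nm z)) => [|w wz|]; first by rewrite nm_gt0.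
  case: eqP wz => // ->; rewrite sub0r nmN ltxx //.
exists (fun w => if w == 0 then - z ^- 2 else - (z^-1 * w^-1)); split.
- move=> w; rewrite (negPf z0); case: eqP => [->|/eqP w0]; first by field.
  by field; rewrite w0.
- apply: (@ccont_near (fun w => - (z^-1 * w^-1)) _ _ (nm z)); first by rewrite nm_gt0.
    by move=> w; case: eqP => // ->; rewrite sub0r nmN ltxx.
  apply: ccontN; apply: ccontM; first exact: ccont_cst.
  by apply: ccontV => //; apply: ccont_id.
- by rewrite (negPf z0) -invfM -expr2.
Qed.
Lemma cdiffV f z a : f z != 0 -> cdiff f z a ->
  cdiff (fun w => (f w)^-1) z (- a / f z ^+ 2).
Proof.
move=> fz hf; have := cdiff_comp hf (cdiff_inv fz).
by rewrite mulNr mulrC mulNr.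
Qed.

Lemma derivable_cdiff f z :
  derivable (f : C^o -> C^o) z 1 <-> exists d, cdiff f z d.
Proof.
split.
  move=> /cvg_ex[d /cvgrPdist_le /= h]; exists d; apply/cdiffP => e e0.
  have /nbhs_ballP[r /= r0 hr] := h (ofR e) ltac:(by rewrite ltcR).
  have rR : ofR (Re r) = r by rewrite RRe_real // gtr0_real.
  exists (Re r) => [|k kr]; first by rewrite -ltcR rR.
  have [->|k0] := eqVneq k 0; first by rewrite addr0 subrr mulr0 subr0 nm0 mulr0.
  have := hr k; rewrite -ball_normE /= -rR !nmE !ltcR lecR sub0r nmN => /(_ kr k0).
  rewrite -[_ *: _]/(k^-1 * (f (k * 1 + z) - f z)) mulr1 [k + z]addrC nm_subC => hh.
  have -> : f (z + k) - f z - d * k = (k^-1 * (f (z + k) - f z) - d) * k by field.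
  by rewrite nmM ler_wpM2r ?nm_ge0.
move=> [d /cdiffP h]; apply/cvg_ex; exists d; apply/(@cvgrPdist_le _ C^o _ (dnbhs (0 : C^o))) => /= e e0.
have eR : ofR (Re e) = e by rewrite RRe_real // gtr0_real.
have [r r0 hr] := h (Re e) ltac:(by rewrite -ltcR eR).
apply/nbhs_ballP; exists (ofR r) => /=; first by rewrite ltcR.
move=> k; rewrite -ball_normE /= -eR !nmE !ltcR lecR sub0r nmN => kr k0.
have kp : 0 < nm k by rewrite nm_gt0.
rewrite -[_ *: _]/(k^-1 * (f (k * 1 + z) - f z)) mulr1 [k + z]addrC nm_subC.
have := hr _ kr; have -> : f (z + k) - f z - d * k = (k^-1 * (f (z + k) - f z) - d) * k by field.
by rewrite nmM ler_pM2r.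
Qed.

Lemma cdiff_unique f z a b : cdiff f z a -> cdiff f z b -> a = b.
Proof.
move=> /cdiffP ha /cdiffP hb; apply/subr0_eq/(@nm_small0 _ 2) => e e0.
have [r r0 hr] := ha e e0; have [s s0 hs] := hb e e0.
pose t := Num.min r s / 2; have t0 : 0 < t by rewrite divr_gt0 // lt_min r0.
have tm : t < Num.min r s by rewrite ltr_pdivrMr // ltr_pMr ?ltr1n // lt_min r0.
have /hr h1 : nm (ofR t) < r.
  by rewrite nm_real gtr0_norm // (lt_le_trans tm) // ge_min lexx.
have /hs h2 : nm (ofR t) < s.
  by rewrite nm_real gtr0_norm // (lt_le_trans tm) // ge_min lexx orbT.
have tp : 0 < nm (ofR t) by rewrite nm_real gtr0_norm.
rewrite -(ler_pM2r tp) -nmM.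
have -> : (a - b) * ofR t = (f (z + ofR t) - f z - b * ofR t) -
   (f (z + ofR t) - f z - a * ofR t) by ring.
by apply: le_trans (nmB _ _) _; rewrite -mulrA mulr_natl mulr2n lerD.
Qed.

Lemma cdiffX f z a n : cdiff f z a ->
  cdiff (fun w => f w ^+ n) z (n%:R * f z ^+ n.-1 * a).
Proof.
move=> hf; elim: n => [|n ih].
  by rewrite mul0r mul0r; exact: cdiff_cst.
have := cdiffM hf ih; set d := (X in cdiff _ _ X); suff -> : d = n.+1%:R * f z ^+ n * a.
  by apply: cdiff_ext => w; rewrite exprS.
rewrite /d; case: n {ih d} => [|n] /=; first by rewrite expr0; ring.
by rewrite -[n.+2%:R]natr1 exprS; ring.
Qed.

End ComplexNorm.

(** * Curve integrals and Goursat's theorem *)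

Section RealPrimitive.
Variable R : realType.
Implicit Types (u v : R -> R) (x : R).
Local Open Scope classical_set_scope.
Local Notation mu := (@lebesgue_measure R).

Lemma continuous_primitive u : continuous u ->
  exists U : R -> R, forall x, is_derive x 1 U (u x).
Proof.
move=> cu.
have itg a b : mu.-integrable `[a, b] (constructive_ereal.EFin \o u).
  apply: continuous_compact_integrable; first exact: segment_compact.
  exact: continuous_subspaceT.
pose H x := if 0 <= x then \int[mu]_(t in `]0, x]) u t
  else - \int[mu]_(t in `]x, 0]) u t.
exists H => x.
(* A base point to the left of both x and 0: near x, [H] is an integral from a fixed point minus a
   constant, whatever the sign of x. *)
pose a := Num.min x 0 - 1; pose F y := \int[mu]_(t in `[a, y]) u t.
have [ax a0] : a < x /\ a < 0.
  by rewrite /a; case: (lerP x 0) => ?; split; lra.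
have HF y : a < y -> H y = F y - F 0.
  move=> ay; rewrite /H; case: leP => y0.
    by rewrite /F (@Rintegral_itvB _ u _ _ 0) ?bnd_simp ?(ltW a0).
  rewrite -opprB; congr (- _).
  by rewrite /F (@Rintegral_itvB _ u _ _ y) ?bnd_simp ?(ltW ay) ?(ltW y0).
have [dF FE] : derivable F x 1 /\ F^`() x = u x.
  apply: (@continuous_FTC1 _ _ (BLeft a) x (x + 1)) => //; last exact: cu.
  by rewrite ltrDl.
apply: (@near_eq_is_derive _ _ _ (fun y => F y - F 0)); last first.
  have h1 : is_derive x 1 F (u x) by apply: DeriveDef; [exact: dF | rewrite -derive1E; exact: FE].
  have := is_deriveB h1 (is_derive_cst (F 0) x 1); rewrite subr0; exact.
near=> y; rewrite HF //; near: y; exact: lt_nbhsr.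
Unshelve. all: by end_near. Qed.

End RealPrimitive.

(** * Integrals of complex functions of a real variable *)

Section Integral.
Variable R : realType.
Local Notation C := R[i].
Local Notation Re := (@complex.Re R).
Local Notation Im := (@complex.Im R).
Local Notation ofR := (real_complex R).
Implicit Types (u v : R -> R) (g : R -> C) (x : R) (z w : C).

Lemma real_diffP u x (d : R) : is_derive x 1 u d <-> forall e : R, 0 < e ->
  exists2 r : R, 0 < r & forall h, `|h| < r -> `|u (x + h) - u x - d * h| <= e * `|h|.
Proof.
split.
  move=> [/cvg_ex[l hl] dE] e e0.
  have ld : l = d by rewrite -dE; apply/esym/cvg_lim.
  move: hl; rewrite {}ld => /cvgrPdist_le /= h.
  have /nbhs_ballP[r /= r0 hr] := h e e0.
  exists r => // k kr.
  have [->|k0] := eqVneq k 0; first by rewrite addr0 subrr mulr0 subr0 normr0 mulr0.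
  have := hr k; rewrite -ball_normE /= sub0r normrN => /(_ kr k0).
  rewrite -[_ *: _]/(k^-1 * (u (k * 1 + x) - u x)) mulr1 [k + x]addrC distrC => hh.
  have -> : u (x + k) - u x - d * k = (k^-1 * (u (x + k) - u x) - d) * k by field.
  by rewrite normrM ler_wpM2r.
move=> h.
have hc : ((fun k : R => k^-1 *: ((u \o shift x) (k *: 1) - u x)) @ (0 : R)^' --> d)%classic.
  apply/(@cvgrPdist_le _ R^o _ (dnbhs (0 : R^o))) => /= e e0.
  have [r r0 hr] := h e e0.
  apply/nbhs_ballP; exists r => //= k; rewrite -ball_normE /= sub0r normrN => kr k0.
  have kp : 0 < `|k| by rewrite normr_gt0.
  rewrite -[_ *: _]/(k^-1 * (u (k * 1 + x) - u x)) mulr1 [k + x]addrC distrC.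
  have := hr _ kr; have -> : u (x + k) - u x - d * k = (k^-1 * (u (x + k) - u x) - d) * k by field.
  by rewrite normrM ler_pM2r.
by apply: DeriveDef; [apply/cvg_ex; exists d | apply/cvg_lim].
Qed.

(** Integrals are differences of a chosen antiderivative rather than Lebesgue integrals, so Chasles'
    relation and reversal of the bounds hold unconditionally. The existence of an antiderivative
    enters in linearity and in estimates. *)
Definition prim u : R -> R := xget (fun=> 0) [set U | forall x, is_derive x 1 U (u x)]%classic.
Definition oint u (a b : R) : R := prim u b - prim u a.

Lemma prim_is_derive u : (exists U : R -> R, forall x, is_derive x 1 U (u x)) ->
  forall x, is_derive x 1 (prim u) (u x).
Proof. by move=> [U hU]; rewrite /prim; case: xgetP => [V _|/(_ U)] //= /(_ hU). Qed.

Lemma oint_FTC u (U : R -> R) a b : (forall x, is_derive x 1 U (u x)) ->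
  oint u a b = U b - U a.
Proof.
move=> hU; have hp := prim_is_derive (ex_intro _ U hU).
have H : (prim u - U) b = (prim u - U) a.
  by apply: is_derive_0_is_cst => x; have := is_deriveB (hp x) (hU x); rewrite subrr.
by move: H; rewrite !fctE /oint => H; lra.
Qed.

Definition rcont g := forall x (e : R), 0 < e -> exists2 d : R, 0 < d &
  forall y, `|y - x| < d -> nm (g y - g x) < e.

Lemma rcont_part (p : C -> R) g : (forall z w, p (z - w) = p z - p w) ->
  (forall z, `|p z| <= nm z) -> rcont g -> continuous (fun x => p (g x)).
Proof.
move=> pB pn cg x; apply/(@cvgrPdist_lt _ R^o _ (nbhs (x : R^o))) => e e0.
have [d d0 hd] := cg x e e0.
apply/nbhs_ballP; exists d => //= y; rewrite -ball_normE /= distrC => /hd h.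
by rewrite -pB (le_lt_trans (pn _)) // nm_subC.
Qed.

Lemma rcont_Re g : rcont g -> continuous (fun x => Re (g x)).
Proof. by apply: rcont_part => [z w|]; [rewrite raddfB | exact: nm_Re]. Qed.
Lemma rcont_Im g : rcont g -> continuous (fun x => Im (g x)).
Proof. by apply: rcont_part => [z w|]; [rewrite raddfB | exact: nm_Im]. Qed.

Lemma rcontD g h : rcont g -> rcont h -> rcont (fun x => g x + h x).
Proof.
move=> cg ch x e e0; have e2 : 0 < e / 2 by rewrite divr_gt0.
have [d d0 hd] := cg x _ e2; have [d' d'0 hd'] := ch x _ e2.
exists (Num.min d d') => [|y]; first by rewrite lt_min d0.
rewrite lt_min => /andP[/hd h1 /hd' h2].
rewrite opprD addrACA (le_lt_trans (nmD _ _)) //; lra.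
Qed.
Lemma rcontZ c g : rcont g -> rcont (fun x => c * g x).
Proof.
move=> cg x e e0; have k0 : 0 < nm c + 1 by rewrite ltr_wpDl ?nm_ge0.
have [d d0 hd] := cg x (e / (nm c + 1)) ltac:(by rewrite divr_gt0).
exists d => // y /hd h; rewrite -mulrBr nmM.
apply: (@le_lt_trans _ _ ((nm c + 1) * nm (g y - g x))).
  by rewrite ler_wpM2r ?nm_ge0 // lerDl.
by rewrite mulrC -ltr_pdivlMr.
Qed.
Lemma rcont_line (F : C -> C) z w : (forall x : R, ccont F (z + ofR x * w)) ->
  rcont (fun x => F (z + ofR x * w)).
Proof.
move=> cF x e e0; have [d d0 hd] := cF x e e0.
have k0 : 0 < nm w + 1 by rewrite ltr_wpDl ?nm_ge0.
exists (d / (nm w + 1)) => [|y yx]; first by rewrite divr_gt0.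
apply: hd; rewrite opprD addrACA subrr add0r -mulrBl nmM -rmorphB nm_real.
apply: (@le_lt_trans _ _ (`|y - x| * (nm w + 1))).
  by rewrite ler_wpM2l // lerDl.
by rewrite -ltr_pdivlMr.
Qed.

Definition cint g (a b : R) : C :=
  (oint (fun x => Re (g x)) a b +i* oint (fun x => Im (g x)) a b)%C.

Lemma cint_chasles g a b c : cint g a b + cint g b c = cint g a c.
Proof. by apply: complex_eqE; rewrite raddfD /= /oint; ring. Qed.

Definition cprim g (G : R -> C) := forall x,
  is_derive x 1 (fun t => Re (G t)) (Re (g x)) /\ is_derive x 1 (fun t => Im (G t)) (Im (g x)).

Lemma cint_FTC g (G : R -> C) a b : cprim g G -> cint g a b = G b - G a.
Proof.
move=> h; apply: complex_eqE; rewrite raddfB /=.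
  by apply: (@oint_FTC _ (fun t => Re (G t))) => x; have [] := h x.
by apply: (@oint_FTC _ (fun t => Im (G t))) => x; have [] := h x.
Qed.

Lemma cint_primitive g : rcont g -> exists G : R -> C, cprim g G.
Proof.
move=> cg; exists (fun x => (prim (fun x => Re (g x)) x +i* prim (fun x => Im (g x)) x)%C).
split.
  exact: (prim_is_derive (continuous_primitive (rcont_Re cg))).
exact: (prim_is_derive (continuous_primitive (rcont_Im cg))).
Qed.

Lemma cprimD g h G H : cprim g G -> cprim h H ->
  cprim (fun x => g x + h x) (fun x => G x + H x).
Proof.
move=> hG hH x; have [g1 g2] := hG x; have [h1 h2] := hH x; split.
  have -> : (fun t => Re (G t + H t)) = (fun t => Re (G t)) + (fun t => Re (H t)).
    by apply/funext => t; rewrite raddfD.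
  by rewrite raddfD; exact: is_deriveD.
have -> : (fun t => Im (G t + H t)) = (fun t => Im (G t)) + (fun t => Im (H t)).
  by apply/funext => t; rewrite raddfD.
by rewrite raddfD; exact: is_deriveD.
Qed.

Lemma cprimZ c g G : cprim g G -> cprim (fun x => c * g x) (fun x => c * G x).
Proof.
move=> hG x; have [g1 g2] := hG x; split.
  have -> : (fun t => Re (c * G t)) =
      (Re c) *: (fun t => Re (G t)) - (Im c) *: (fun t => Im (G t)).
    by apply/funext => t; rewrite cReM.
  by rewrite cReM; apply: is_deriveB; apply: is_deriveZ.
have -> : (fun t => Im (c * G t)) =
    (Re c) *: (fun t => Im (G t)) + (Im c) *: (fun t => Re (G t)).
  by apply/funext => t; rewrite cImM.
by rewrite cImM; apply: is_deriveD; apply: is_deriveZ.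
Qed.

Lemma cintD g h a b : rcont g -> rcont h ->
  cint (fun x => g x + h x) a b = cint g a b + cint h a b.
Proof.
move=> /cint_primitive[G hG] /cint_primitive[H hH].
by rewrite (cint_FTC _ _ hG) (cint_FTC _ _ hH) (cint_FTC _ _ (cprimD hG hH)) opprD addrACA.
Qed.

Lemma cintZ c g a b : rcont g -> cint (fun x => c * g x) a b = c * cint g a b.
Proof.
move=> /cint_primitive[G hG].
by rewrite (cint_FTC _ _ hG) (cint_FTC _ _ (cprimZ c hG)) mulrBr.
Qed.

Lemma oint_bound u (M : R) a b : continuous u -> a <= b ->
  (forall x, a <= x <= b -> `|u x| <= M) -> `|oint u a b| <= M * (b - a).
Proof.
move=> cu ab hM; have hp := prim_is_derive (continuous_primitive cu).
have [|c cab] := @MVT_segment R (prim u) u a b ab (fun x _ => hp x).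
  by apply: derivable_within_continuous => x _; have [] := hp x.
rewrite -/(oint u a b) => ->; rewrite normrM (ger0_norm (x := b - a)) ?subr_ge0 //.
by rewrite ler_wpM2r ?subr_ge0 // hM //; move: cab; rewrite in_itv.
Qed.

(** The factor 2 comes from bounding real and imaginary parts separately. [periodic_max] later
    removes such constants by taking powers. *)
Lemma cint_bound g (M : R) a b : rcont g -> a <= b ->
  (forall x, a <= x <= b -> nm (g x) <= M) -> nm (cint g a b) <= 2 * M * (b - a).
Proof.
move=> cg ab hM; apply: le_trans (nm_ReIm _) _.
have -> : 2 * M * (b - a) = M * (b - a) + M * (b - a) by ring.
apply: lerD; apply: oint_bound => //.
- exact: rcont_Re.
- by move=> x /hM; apply: le_trans; exact: nm_Re.
- exact: rcont_Im.
- by move=> x /hM; apply: le_trans; exact: nm_Im.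
Qed.

Lemma cintB g h a b : rcont g -> rcont h ->
  cint (fun x => g x - h x) a b = cint g a b - cint h a b.
Proof.
move=> cg ch; have -> : (fun x => g x - h x) = (fun x => g x + (-1) * h x).
  by apply/funext => x; rewrite mulN1r.
by rewrite cintD ?cintZ ?mulN1r //; exact: rcontZ.
Qed.

Lemma eq_cint g h a b : rcont g -> rcont h -> a <= b ->
  (forall x, a <= x <= b -> g x = h x) -> cint g a b = cint h a b.
Proof.
move=> cg ch ab gh; apply/subr0_eq; rewrite -cintB //; apply: nm_le0.
have cgh : rcont (fun x => g x - h x).
  have := rcontD cg (rcontZ (-1) ch); congr rcont; apply/funext => x.
  by rewrite mulN1r.
apply: (le_trans (cint_bound (M := 0) cgh ab _)) => [x /gh ->|].
  by rewrite subrr nm0.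
by rewrite mulr0 mul0r.
Qed.

Lemma cdiff_line (F : C -> C) z w d x : cdiff F (z + ofR x * w) d ->
  is_derive x 1 (fun t => Re (F (z + ofR t * w))) (Re (d * w)) /\
  is_derive x 1 (fun t => Im (F (z + ofR t * w))) (Im (d * w)).
Proof.
move=> /cdiffP h.
have H e : 0 < e -> exists2 r : R, 0 < r & forall h, `|h| < r ->
    nm (F (z + ofR (x + h) * w) - F (z + ofR x * w) - d * w * ofR h) <= e * `|h|.
  move=> e0; have k0 : 0 < nm w + 1 by rewrite ltr_wpDl ?nm_ge0.
  have [r r0 hr] := h (e / (nm w + 1)) ltac:(by rewrite divr_gt0).
  exists (r / (nm w + 1)) => [|k kr]; first by rewrite divr_gt0.
  have wk : nm (ofR k * w) <= `|k| * (nm w + 1).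
    by rewrite nmM nm_real ler_wpM2l // lerDl.
  have := hr (ofR k * w); rewrite (le_lt_trans wk) -?ltr_pdivlMr // => /(_ isT) hk.
  rewrite rmorphD mulrDl addrA -mulrA [w * _]mulrC (le_trans hk) //.
  by rewrite (le_trans (ler_wpM2l _ wk)) ?divr_ge0 ?(ltW e0) ?(ltW k0) // mulrCA divfK ?gt_eqF // mulrC.
split; apply/real_diffP => e /H[r r0 hr]; exists r => // k /hr; apply: le_trans.
  apply: le_trans (nm_Re _); rewrite !raddfB /= (cReM (d * w)) /=.
  by rewrite mulr0 subr0.
apply: le_trans (nm_Im _); rewrite !raddfB /= (cImM (d * w)) /=.
by rewrite mulr0 add0r.
Qed.

Lemma cint_line (F f : C -> C) z w a b : (forall s : C, cdiff F s (f s)) ->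
  cint (fun x => f (z + ofR x * w) * w) a b = F (z + ofR b * w) - F (z + ofR a * w).
Proof. by move=> hF; rewrite (@cint_FTC _ (fun x => F (z + ofR x * w))) // => x; apply: cdiff_line. Qed.

Lemma cint_cst c a b : cint (fun=> c) a b = c * ofR (b - a).
Proof.
have h (s : C) : cdiff (fun z : C => c * z) s c.
  by rewrite -[X in cdiff _ _ X]mulr1; apply/cdiffZ/cdiff_id.
have := cint_line 0 1 a b h; rewrite !mulr1 !add0r -mulrBr -rmorphB => <-.
by [].
Qed.

Lemma cint_shift g a b t : rcont g -> cint (fun x => g (x + t)) a b = cint g (a + t) (b + t).
Proof.
move=> /cint_primitive[G hG]; rewrite (cint_FTC _ _ hG).
rewrite (@cint_FTC _ (fun x => G (x + t))) // => x.
have d : is_derive x 1 (fun x => x + t) 1.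
  by rewrite -[X in is_derive _ _ _ X]addr0; apply: is_deriveD.
have [h1 h2] := hG (x + t); split.
  by have := @is_derive1_comp R (fun t => Re (G t)) (fun x => x + t) x _ 1 h1 d; rewrite mulr1.
by have := @is_derive1_comp R (fun t => Im (G t)) (fun x => x + t) x _ 1 h2 d; rewrite mulr1.
Qed.
End Integral.

(** * Goursat's theorem on rectangles *)

Section Goursat.
Variable R : realType.
Local Notation C := R[i].
Local Notation Re := (@complex.Re R).
Local Notation Im := (@complex.Im R).
Local Notation ofR := (real_complex R).
Implicit Types (F G f : C -> C) (a b c d x y : R) (z w p : C).

Definition pt x y : C := (x +i* y)%C.

Lemma pt_hE x y : pt x y = pt 0 y + ofR x * 1.
Proof. by rewrite mulr1; apply: complex_eqE; rewrite raddfD /= ?add0r ?addr0. Qed.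
Lemma pt_vE x y : pt x y = pt x 0 + ofR y * 'i%C.
Proof. by apply: complex_eqE; rewrite raddfD ?cReM ?cImM /=; ring. Qed.
Lemma ptE z : z = pt (Re z) (Im z). Proof. by case: z. Qed.
Lemma nm_pt x y : nm (pt x y) <= `|x| + `|y|. Proof. exact: nm_ReIm. Qed.
Lemma pt_sub x y x' y' : pt x y - pt x' y' = pt (x - x') (y - y').
Proof. by []. Qed.

(** The contour integral around a rectangle, counterclockwise; ['i] is dz/dy on the vertical
    sides. *)
Definition rint F a b c d : C :=
  cint (fun x => F (pt x c)) a b - cint (fun x => F (pt x d)) a b +
  'i%C * (cint (fun y => F (pt b y)) c d - cint (fun y => F (pt a y)) c d).

Lemma rint_splitx F m a b c d : rint F a m c d + rint F m b c d = rint F a b c d.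
Proof.
rewrite /rint -(cint_chasles _ a m b) -(cint_chasles (fun x => F (pt x d)) a m b).
ring.
Qed.
Lemma rint_splity F m a b c d : rint F a b c m + rint F a b m d = rint F a b c d.
Proof.
rewrite /rint -(cint_chasles _ c m d) -(cint_chasles (fun y => F (pt a y)) c m d).
ring.
Qed.

Lemma rcont_h F y : (forall z, ccont F z) -> rcont (fun x => F (pt x y)).
Proof.
move=> cF; have -> : (fun x => F (pt x y)) = (fun x => F (pt 0 y + ofR x * 1)).
  by apply/funext => x; rewrite -pt_hE.
by apply: rcont_line => x; exact: cF.
Qed.
Lemma rcont_v F x : (forall z, ccont F z) -> rcont (fun y => F (pt x y)).
Proof.
move=> cF; have -> : (fun y => F (pt x y)) = (fun y => F (pt x 0 + ofR y * 'i%C)).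
  by apply/funext => y; rewrite -pt_vE.
by apply: rcont_line => y; exact: cF.
Qed.

Lemma rintB F G a b c d : (forall z, ccont F z) -> (forall z, ccont G z) ->
  rint (fun z => F z - G z) a b c d = rint F a b c d - rint G a b c d.
Proof.
move=> cF cG; rewrite /rint !cintB; try exact: rcont_h; try exact: rcont_v.
ring.
Qed.

Lemma cint_pth F f y a b : (forall s : C, cdiff F s (f s)) ->
  cint (fun x => f (pt x y)) a b = F (pt b y) - F (pt a y).
Proof.
move=> h; have := cint_line (pt 0 y) 1 a b h; rewrite -!pt_hE => <-.
by congr cint; apply/funext => x; rewrite mulr1 -pt_hE.
Qed.
Lemma cint_ptv F f x a b : (forall s : C, ccont f s) -> (forall s : C, cdiff F s (f s)) ->
  'i%C * cint (fun y => f (pt x y)) a b = F (pt x b) - F (pt x a).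
Proof.
move=> cf h; rewrite -cintZ; last exact: rcont_v.
have := cint_line (pt x 0) 'i%C a b h; rewrite -!pt_vE => <-.
by congr cint; apply/funext => y; rewrite -pt_vE mulrC.
Qed.

Lemma rint_primitive F f a b c d : (forall s : C, ccont f s) ->
  (forall s : C, cdiff F s (f s)) -> rint f a b c d = 0.
Proof.
move=> cf h; rewrite /rint mulrBr !(cint_pth _ _ _ h) !(cint_ptv _ _ _ cf h).
ring.
Qed.

Lemma rint_bound F M a b c d : (forall z, ccont F z) -> a <= b -> c <= d ->
  (forall x y, a <= x <= b -> c <= y <= d -> nm (F (pt x y)) <= M) ->
  nm (rint F a b c d) <= 4 * M * ((b - a) + (d - c)).
Proof.
move=> cF ab cd hM; rewrite /rint.
have h1 y : c <= y <= d -> nm (cint (fun x => F (pt x y)) a b) <= 2 * M * (b - a).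
  by move=> hy; apply: cint_bound => //; [exact: rcont_h | move=> x hx; apply: hM].
have h2 x : a <= x <= b -> nm (cint (fun y => F (pt x y)) c d) <= 2 * M * (d - c).
  by move=> hx; apply: cint_bound => //; [exact: rcont_v | move=> y hy; apply: hM].
apply: le_trans (nmD _ _) _; rewrite nmM nm_i mul1r.
have h3 := h1 c; have h4 := h1 d; have h5 := h2 a; have h6 := h2 b.
move: h3 h4 h5 h6; rewrite !lexx ab cd => /(_ isT) h3 /(_ isT) h4 /(_ isT) h5 /(_ isT) h6.
have := nmB (cint (fun x => F (pt x c)) a b) (cint (fun x => F (pt x d)) a b).
have := nmB (cint (fun y => F (pt b y)) c d) (cint (fun y => F (pt a y)) c d).
lra.
Qed.

Section Bisection.
Variables (F : C -> C) (e a0 b0 c0 d0 : R).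
Hypotheses (ab0 : a0 <= b0) (cd0 : c0 <= d0).

(** The threshold is exactly additive when a rectangle is cut into four equal ones, so a bad
    rectangle has a bad quarter. [next] tests three quarters; if none is bad, the fourth is
    ([bad_next]). *)
Let bad (r : R * R * R * R) := let: (a, b, c, d) := r in
  e * ((b - a) ^+ 2 + (d - c) ^+ 2) < nm (rint F a b c d).

Let next (r : R * R * R * R) := let: (a, b, c, d) := r in
  let m := (a + b) / 2 in let k := (c + d) / 2 in
  if bad (a, m, c, k) then (a, m, c, k) else
  if bad (m, b, c, k) then (m, b, c, k) else
  if bad (a, m, k, d) then (a, m, k, d) else (m, b, k, d).

Let sq n := iter n next (a0, b0, c0, d0).
Let A n := (sq n).1.1.1. Let B n := (sq n).1.1.2.
Let L n := (sq n).1.2. Let U n := (sq n).2.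

Let sqS n : sq n.+1 = next (A n, B n, L n, U n).
Proof. by rewrite /A /B /L /U /sq iterS; case: (iter _ _ _) => [[[? ?] ?] ?]. Qed.

Let bad_next r : bad r -> bad (next r).
Proof.
case: r => [[[a b] c] d]; rewrite /next; set m := (a + b) / 2; set k := (c + d) / 2.
move=> hb; case: ifP => // h1; case: ifP => // h2; case: ifP => // h3.
apply/negPn/negP => h4; move/negbT: h1; move/negbT: h2; move/negbT: h3.
move: h4 hb; rewrite /bad -!leNgt => h4 hb h3 h2 h1.
have := rint_splity F k a b c d.
rewrite -(rint_splitx F m a b c k) -(rint_splitx F m a b k d) => hE.
have := nmD (rint F a m c k + rint F m b c k) (rint F a m k d + rint F m b k d).
have := nmD (rint F a m c k) (rint F m b c k).
have := nmD (rint F a m k d) (rint F m b k d).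
move: hb; rewrite -hE => hb t1 t2 t3.
suff : e * ((b - a) ^+ 2 + (d - c) ^+ 2) < e * ((b - a) ^+ 2 + (d - c) ^+ 2).
  by rewrite ltxx.
apply: (lt_le_trans hb); apply: (le_trans t3).
apply: (le_trans (lerD t2 t1)); apply: (le_trans (lerD (lerD h1 h2) (lerD h3 h4))).
by rewrite /m /k le_eqVlt; apply/orP; left; apply/eqP; field.
Qed.

Let spec n : [/\ B n - A n = (b0 - a0) / 2 ^+ n, U n - L n = (d0 - c0) / 2 ^+ n,
   A n <= A n.+1 /\ B n.+1 <= B n & L n <= L n.+1 /\ U n.+1 <= U n].
Proof.
have H : B n - A n = (b0 - a0) / 2 ^+ n /\ U n - L n = (d0 - c0) / 2 ^+ n.
  elim: n => [|n [ih1 ih2]]; first by rewrite /A /B /L /U /sq /= expr0 !divr1.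
  rewrite exprS invfM mulrCA -ih1 [X in _ = X]mulrC mulrCA -ih2.
  rewrite /B /A /U /L sqS /next.
  by case: ifP => _ /=; [|case: ifP => _ /=; [|case: ifP => _ /=]]; split; by field.
have hp : 0 <= B n - A n /\ 0 <= U n - L n.
  by rewrite H.1 H.2 !divr_ge0 ?exprn_ge0 ?subr_ge0.
move: H => [h1 h2]; split=> //; rewrite /A /B /L /U sqS /next -/(A n) -/(B n) -/(L n) -/(U n).
  by case: ifP => _ /=; [|case: ifP => _ /=; [|case: ifP => _ /=]]; split; lra.
by case: ifP => _ /=; [|case: ifP => _ /=; [|case: ifP => _ /=]]; split; lra.
Qed.

Let nested (X Y : nat -> R) : (forall n, X n <= X n.+1) -> (forall n, Y n.+1 <= Y n) ->
  (forall n, X n <= Y n) -> exists s, forall n, X n <= s <= Y n.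
Proof.
move=> hX hY hXY.
have mX m n : (m <= n)%N -> X m <= X n.
  by move=> /subnK <-; elim: (n - m)%N => [//|k ih]; rewrite addSn (le_trans ih).
have mY m n : (m <= n)%N -> Y n <= Y m.
  by move=> /subnK <-; elim: (n - m)%N => [//|k ih]; rewrite addSn (le_trans _ ih).
have XY m n : X m <= Y n.
  by case: (leqP m n) => [/mX h|/ltnW/mY]; [apply: le_trans h _ | apply: le_trans].
exists (sup (range X)) => n; apply/andP; split.
  apply: ub_le_sup; last by exists n.
  by exists (Y 0%N) => _ [m _ <-].
by apply: ge_sup; [exists (X 0%N); exists 0%N | move=> _ [m _ <-]].
Qed.

Lemma bisection : 0 < e -> (forall z, ccont F z) ->
  (forall x y, a0 <= x <= b0 -> c0 <= y <= d0 -> exists D, cdiff F (pt x y) D) ->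
  nm (rint F a0 b0 c0 d0) <= e * ((b0 - a0) ^+ 2 + (d0 - c0) ^+ 2).
Proof.
move=> e0 cF dF; rewrite leNgt; apply/negP => hbad.
have badn n : bad (sq n).
  by elim: n => [|n ih]; [exact: hbad | rewrite /sq iterS; exact: bad_next].
have AB n : A n <= B n.
  by rewrite -subr_ge0; have [-> _ _ _] := spec n; rewrite divr_ge0 ?exprn_ge0 ?subr_ge0.
have LU n : L n <= U n.
  by rewrite -subr_ge0; have [_ -> _ _] := spec n; rewrite divr_ge0 ?exprn_ge0 ?subr_ge0.
have [s hs] : exists s, forall n, A n <= s <= B n.
  by apply: nested => // n; have [_ _ [? ?] _] := spec n.
have [t ht] : exists t, forall n, L n <= t <= U n.
  by apply: nested => // n; have [_ _ _ [? ?]] := spec n.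
have [D /cdiffP hD] := dF s t (hs 0%N) (ht 0%N).
(* With V the half-perimeter, [rint_bound] gives 4 (e/8 V) V = e V^2 / 2, and V^2 / 2 is at most the
   sum of the two squared sides. *)
have [r r0 hr] := hD (e / 8) ltac:(by rewrite divr_gt0).
pose W := (b0 - a0) + (d0 - c0).
have W0 : 0 <= W by rewrite addr_ge0 ?subr_ge0.
have [n hn] : exists n : nat, W / 2 ^+ n < r.
  have [n hn] : exists n : nat, W / r < n%:R.
    by exists (Num.trunc (W / r)).+1; exact: truncnS_gt.
  exists n; rewrite ltr_pdivrMr ?exprn_gt0 // -ltr_pdivrMl // mulrC.
  by apply: lt_trans hn _; rewrite -natrX ltr_nat ltn_expl.
have [w1 w2 _ _] := spec n.
(* The affine approximation at the limit point has a quadratic primitive, so its contour integral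
   vanishes and only the remainder has to be bounded. *)
pose p := pt s t; pose af z := F p + D * (z - p).
have caf z : ccont af z.
  apply: ccontD; first exact: ccont_cst.
  by apply: ccontM; [exact: ccont_cst | apply: ccontB; [exact: ccont_id | exact: ccont_cst]].
have raf : rint af (A n) (B n) (L n) (U n) = 0.
  apply: (@rint_primitive (fun z => F p * z + D / 2 * (z - p) ^+ 2)) => // z.
  have h1 := cdiffZ (F p) (cdiff_id z).
  have h2 := cdiffZ (D / 2) (cdiffX 2 (cdiffB (cdiff_id z) (cdiff_cst p z))).
  have := cdiffD h1 h2; rewrite /= expr1 subr0 !mulr1 mulrA divfK //.
  by rewrite pnatr_eq0.
have := badn n; rewrite /bad.
case hq : (sq n) => [[[a b] c] d].
have [Aa Bb Lc Ud] : [/\ A n = a, B n = b, L n = c & U n = d] by rewrite /A /B /L /U hq.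
move: w1 w2 raf (AB n) (LU n) (hs n) (ht n).
rewrite Aa Bb Lc Ud => w1 w2 raf ab cd sab tcd.
have -> : rint F a b c d = rint (fun z => F z - af z) a b c d.
  by rewrite rintB // raf subr0.
apply/negP; rewrite -leNgt.
have V0 : 0 <= (b - a) + (d - c) by rewrite addr_ge0 ?subr_ge0.
apply: le_trans (@rint_bound _ (e / 8 * ((b - a) + (d - c))) _ _ _ _ _ ab cd _) _.
- by move=> z; apply: ccontB.
- move=> x y hx hy; have np : nm (pt x y - p) <= (b - a) + (d - c).
    apply: le_trans (nm_pt _ _) _; apply: lerD; rewrite ler_norml; lra.
  have := hr (pt x y - p); rewrite [p + _]addrC subrK /af opprD addrA => h.
  apply: le_trans (h _) _; last by rewrite ler_wpM2l // divr_ge0 // ltW.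
  by apply: le_lt_trans np _; rewrite w1 w2 -mulrDl.
rewrite (_ : 4 * (e / 8 * (b - a + (d - c))) * (b - a + (d - c)) =
   e * (((b - a) + (d - c)) ^+ 2 / 2)); last by field.
rewrite ler_wpM2l ?(ltW e0) // ler_pdivrMr //.
have := sqr_ge0 ((b - a) - (d - c)); nra.
Qed.
End Bisection.

Theorem Goursat F a b c d : a <= b -> c <= d -> (forall z, ccont F z) ->
  (forall x y, a <= x <= b -> c <= y <= d -> exists D, cdiff F (pt x y) D) ->
  rint F a b c d = 0.
Proof.
move=> ab cd cF dF; apply: (@nm_small0 _ _ ((b - a) ^+ 2 + (d - c) ^+ 2)) => e e0.
by rewrite mulrC; apply: bisection.
Qed.

(** Cutting around a small square centred at [p] leaves four rectangles without [p]; on the square F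
    is bounded, so it contributes little. Cauchy's formula needs this for a difference quotient,
    known only to be continuous at its base point. *)
Theorem Goursat_except F p a b c d : a < Re p < b -> c < Im p < d ->
  (forall z, ccont F z) ->
  (forall x y, a <= x <= b -> c <= y <= d -> pt x y <> p -> exists D, cdiff F (pt x y) D) ->
  rint F a b c d = 0.
Proof.
case: p => px py /= /andP[ax xb] /andP[cy yd] cF dF.
have [r r0 hr] := cF (pt px py) 1 ltr01.
pose M := nm (F (pt px py)) + 1.
(* The central square has half-side t <= e, and [rint_bound] gives 4 M (2t + 2t). *)
apply: (@nm_small0 _ _ (4 * M * 4)) => e e0.
pose t := Num.min e (Num.min (r / 3) (Num.min (Num.min (px - a) (b - px)) (Num.min (py - c) (d - py)))).
have t0 : 0 < t by rewrite /t !lt_min e0 divr_gt0 // !subr_gt0 ax xb cy yd.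
have : t <= t by []. rewrite {2}/t !le_min => /and3P[te tr /andP[/andP[ta tb] /andP[tc td]]].
have D x y : a <= x <= b -> c <= y <= d -> t <= `|x - px| \/ t <= `|y - py| ->
    exists D, cdiff F (pt x y) D.
  move=> hx hy h; apply: dF => // -[xE yE]; move: h; rewrite xE yE !subrr normr0; lra.
rewrite -(rint_splitx F (px - t)) -(rint_splitx F (px + t) (px - t)).
rewrite -(rint_splity F (py - t) (px - t)) -(rint_splity F (py + t) (px - t) _ (py - t)).
rewrite (@Goursat F a (px - t)) ?(@Goursat F (px + t) b) ?(@Goursat F (px - t) (px + t) c)
  ?(@Goursat F (px - t) (px + t) (py + t)) ?add0r ?addr0 //; try lra.
- apply: le_trans (@rint_bound _ M _ _ _ _ cF _ _ _) _; try lra.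
    move=> x y hx hy; rewrite /M -lerBlDl; apply: le_trans (nm_sub_ge _ _) _.
    apply/ltW/hr; rewrite pt_sub; apply: le_lt_trans (nm_pt _ _) _.
    have : `|x - px| <= t by rewrite ler_norml; lra.
    have : `|y - py| <= t by rewrite ler_norml; lra.
    move: tr r0; rewrite ler_pdivlMr //; lra.
  have M0 : 0 < M by rewrite ltr_wpDl ?nm_ge0.
  rewrite -!mulrA !ler_pM2l //; lra.
- by move=> x y hx hy; apply: D; [lra|lra|right; rewrite ger0_norm; lra].
- by move=> x y hx hy; apply: D; [lra|lra|right; rewrite ler0_norm; lra].
- by move=> x y hx hy; apply: D; [lra|lra|left; rewrite ger0_norm; lra].
- by move=> x y hx hy; apply: D; [lra|lra|left; rewrite ler0_norm; lra].
Qed.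

End Goursat.

(** * Periodic holomorphic functions, regularity *)

Section Exponential.
Variable R : realType.
Local Notation C := R[i].
Local Notation Re := (@complex.Re R).
Local Notation Im := (@complex.Im R).
Local Notation ofR := (real_complex R).
Implicit Types (z w q t : C) (x y : R).

Lemma cisD x y : cis (x + y) = cis x * cis y :> C.
Proof.
by apply: complex_eqE; rewrite ?cReM ?cImM /cis /= ?cosD ?sinD //; ring.
Qed.
Lemma cis0 : cis 0 = 1 :> C. Proof. by rewrite /cis cos0 sin0. Qed.
Lemma nm_cis x : nm (cis x : C) = 1.
Proof. by rewrite /nm /cis /= cos2Dsin2 sqrtr1. Qed.

Definition cexp z : C := ofR (expR (Re z)) * cis (Im z).

Lemma cexpD z w : cexp (z + w) = cexp z * cexp w.
Proof. rewrite /cexp !raddfD /= expRD rmorphM cisD /=; ring. Qed.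
Lemma cexp0 : cexp 0 = 1. Proof. by rewrite /cexp /= expR0 cis0 mulr1. Qed.
Lemma nm_cexp z : nm (cexp z) = expR (Re z).
Proof. by rewrite /cexp nmM nm_cis mulr1 nm_real gtr0_norm ?expR_gt0. Qed.
Lemma cexp_neq0 z : cexp z != 0.
Proof. by rewrite -nm_gt0 nm_cexp expR_gt0. Qed.

Lemma cdiff_cexp0 : cdiff cexp 0 1.
Proof.
apply/cdiffP => e e0.
have [n [n0 ne n1]] : exists n : R, [/\ 0 < n, n <= e / 8 & n <= 1].
  by exists (Num.min (e / 8) 1); rewrite lt_min divr_gt0 //= !ge_min !lexx orbT.
have /real_diffP/(_ n n0)[r1 r10 h1] := is_derive_expR (0 : R).
have /real_diffP/(_ n n0)[r2 r20 h2] := is_derive_cos (0 : R).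
have /real_diffP/(_ n n0)[r3 r30 h3] := is_derive_sin (0 : R).
exists (Num.min n (Num.min r1 (Num.min r2 r3))) => [|h].
  by rewrite !lt_min n0 r10 r20 r30.
rewrite !lt_min => /and4P[hn hr1 hr2 hr3].
have hx := nm_Re h; have hy := nm_Im h.
move: (h1 (Re h)) (h2 (Im h)) (h3 (Im h)).
rewrite !add0r expR0 cos0 sin0 oppr0 mul0r !subr0 !addr0 !mul1r.
move=> /(_ (le_lt_trans hx hr1)) H1 /(_ (le_lt_trans hy hr2)) H2 /(_ (le_lt_trans hy hr3)) H3.
rewrite cexp0.
move: h hn hr1 hr2 hr3 hx hy H1 H2 H3 => [x y] /= hn _ _ _ hx hy H1 H2 H3.
set k := nm _ in hn hx hy *.
have k0 : 0 <= k by exact: nm_ge0.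
apply: le_trans (nm_ReIm _) _.
rewrite !raddfB /cexp /= !mul0r !subr0 !addr0.
have -> : expR x * cos y - 1 - x = (expR x - 1 - x) * cos y + (1 + x) * (cos y - 1) by ring.
have -> : expR x * sin y - y = (expR x - 1 - x) * sin y + (1 + x) * (sin y - y) + x * y by ring.
have nk : n * k <= e / 8 * k by rewrite ler_wpM2r.
have H1' : `|expR x - 1 - x| <= n * k by apply: le_trans H1 _; rewrite ler_wpM2l // ltW.
have H2' : `|cos y - 1| <= n * k by apply: le_trans H2 _; rewrite ler_wpM2l // ltW.
have H3' : `|sin y - y| <= n * k by apply: le_trans H3 _; rewrite ler_wpM2l // ltW.
have cy : `|cos y| <= 1 by rewrite ler_norml cos_geN1 cos_le1.
have sy : `|sin y| <= 1 by rewrite ler_norml sin_geN1 sin_le1.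
have x1 : `|1 + x| <= 2.
  apply: le_trans (ler_normD _ _) _; rewrite normr1.
  by have := le_trans hx (ltW hn); move: n1; lra.
have xy : `|x * y| <= n * k.
  by rewrite normrM; apply: ler_pM => //; apply: le_trans hx (ltW hn).
have t1 : `|(expR x - 1 - x) * cos y| <= n * k.
  by rewrite normrM -[n * k]mulr1; apply: ler_pM.
have t2 : `|(expR x - 1 - x) * sin y| <= n * k.
  by rewrite normrM -[n * k]mulr1; apply: ler_pM.
have t3 : `|(1 + x) * (cos y - 1)| <= 2 * (n * k) by rewrite normrM; apply: ler_pM.
have t4 : `|(1 + x) * (sin y - y)| <= 2 * (n * k) by rewrite normrM; apply: ler_pM.
have ek : 0 <= e * k by rewrite mulr_ge0 // ltW.
have := ler_normD ((expR x - 1 - x) * cos y) ((1 + x) * (cos y - 1)).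
have := ler_normD ((expR x - 1 - x) * sin y + (1 + x) * (sin y - y)) (x * y).
have := ler_normD ((expR x - 1 - x) * sin y) ((1 + x) * (sin y - y)).
lra.
Qed.

Lemma cdiff_cexp z : cdiff cexp z (cexp z).
Proof.
have h : cdiff (fun w => w - z) z 1.
  by rewrite -[X in cdiff _ _ X]subr0; apply: cdiffB; [exact: cdiff_id | exact: cdiff_cst].
have := cdiffZ (cexp z) (cdiff_comp (f := cexp) (a := 1) h _); rewrite !mulr1 subrr.
move=> /(_ cdiff_cexp0); apply: cdiff_ext => w.
by rewrite -cexpD addrC subrK.
Qed.

Definition c2pi : C := (0 +i* (2 * pi))%C.
(* ee t is the local parameter q at the cusp. *)
Definition ee t := cexp (c2pi * t).

Lemma pi2_gt0 : 0 < 2 * pi :> R. Proof. by rewrite mulr_gt0 ?pi_gt0. Qed.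
Lemma c2pi_neq0 : c2pi != 0.
Proof. by rewrite -nm_gt0 (lt_le_trans pi2_gt0) // (le_trans (ler_norm _) (nm_Im c2pi)). Qed.
Lemma eeD z w : ee (z + w) = ee z * ee w.
Proof. by rewrite /ee mulrDr cexpD. Qed.
Lemma ee0 : ee 0 = 1. Proof. by rewrite /ee mulr0 cexp0. Qed.
Lemma ee_neq0 z : ee z != 0. Proof. exact: cexp_neq0. Qed.
Lemma eeN z : ee (- z) = (ee z)^-1.
Proof. by apply: (mulIf (ee_neq0 z)); rewrite -eeD addNr ee0 mulVf ?ee_neq0. Qed.
Lemma ee_real x : ee (ofR x) = cis (2 * pi * x).
Proof. by rewrite /ee /cexp cReM cImM /= mul0r !mulr0 subr0 expR0 mul1r add0r. Qed.
Lemma ee1 : ee 1 = 1.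
Proof.
have -> : (1 : C) = ofR 1 by [].
rewrite ee_real mulr1 mulr_natl mulr2n cisD /cis cospi sinpi.
by apply: complex_eqE; rewrite ?cReM ?cImM /=; ring.
Qed.
Lemma eeD1 z : ee (z + 1) = ee z. Proof. by rewrite eeD ee1 mulr1. Qed.
Lemma nm_ee z : nm (ee z) = expR (- (2 * pi * Im z)).
Proof. by rewrite /ee nm_cexp cReM /= mul0r sub0r. Qed.
Lemma cdiff_ee z : cdiff ee z (c2pi * ee z).
Proof.
have h : cdiff (fun w => c2pi * w) z c2pi.
  by rewrite -[X in cdiff _ _ X]mulr1; apply/cdiffZ/cdiff_id.
by rewrite mulrC; exact: (cdiff_comp h (cdiff_cexp _)).
Qed.
Lemma eeX z n : ee z ^+ n = ee (z *+ n).
Proof. by elim: n => [|n ih]; rewrite ?mulr0n ?ee0 // exprS ih mulrS eeD. Qed.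

(** |ee w| = 1 makes w real, and then 1 = cos (2 pi x) = 1 - 2 sin^2 (pi x), while sin (pi |x|) > 0
    for 0 < |x| < 1. *)
Lemma ee_eq1 w : ee w = 1 -> `|Re w| < 1 -> w = 0.
Proof.
move=> h hx; have hy : Im w = 0.
  have : nm (ee w) = 1 by rewrite h nm1.
  rewrite nm_ee -[RHS]expR0 => /expR_inj/eqP; rewrite oppr_eq0 mulf_eq0 => /orP[/eqP p0|/eqP//].
  by have := pi2_gt0; rewrite p0 ltxx.
have wE : w = ofR (Re w) by apply: complex_eqE; rewrite ?hy.
move: h; rewrite wE ee_real /= => -[h _]; congr ofR; apply/eqP/negPn/negP => x0.
have : cos (2 * pi * `|Re w|) = 1.
  by have [h0|h0] := leP 0 (Re w); [rewrite ger0_norm | rewrite ltr0_norm // mulrN cosN].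
have -> : 2 * pi * `|Re w| = pi * `|Re w| + pi * `|Re w| by ring.
have s0 : 0 < sin (pi * `|Re w|).
  by apply: sin_gt0_pi; rewrite mulr_gt0 ?pi_gt0 ?normr_gt0 //= gtr_pMr ?pi_gt0.
rewrite cosD -!expr2 cos2sin2 => hh; have := exprn_gt0 2 s0.
by move: hh; lra.
Qed.

Lemma ee_surj q : q != 0 -> exists t, ee t = q.
Proof.
move=> q0; have nq : 0 < nm q by rewrite nm_gt0.
pose u := q / ofR (nm q).
have nz : ofR (nm q) != 0 by rewrite -nm_gt0 nm_real normr_gt0 gt_eqF.
have nu : nm u = 1 by rewrite /u nmM nmV nm_real gtr0_norm // divff // gt_eqF.
have [a ha] : exists a : R, cis a = u.
  have := sqr_nm u; rewrite nu expr1n => hu.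
  have hRe : -1 <= Re u <= 1 by rewrite -ler_norml -nu nm_Re.
  have ck : cos (acos (Re u)) = Re u by apply: acosK.
  have sk : sin (acos (Re u)) = `|Im u|.
    rewrite sin_acos // -sqrtr_sqr; congr Num.sqrt; move: hu; lra.
  have [h|h] := leP 0 (Im u).
    by exists (acos (Re u)); apply: complex_eqE => //=; rewrite sk ger0_norm.
  exists (- acos (Re u)); apply: complex_eqE => /=; first by rewrite cosN.
  by rewrite sinN sk ltr0_norm // opprK.
exists ((ofR (ln (nm q)) + (0 +i* a)%C) / c2pi).
rewrite /ee mulrC divfK ?c2pi_neq0 // /cexp !raddfD /= addr0 add0r lnK ?posrE //.
by rewrite ha /u mulrC divfK.
Qed.
End Exponential.

(** * Cauchy's formula and Fourier expansion for period one *)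

Section PeriodicCauchy.
Variable R : realType.
Local Notation C := R[i].
Local Notation Re := (@complex.Re R).
Local Notation Im := (@complex.Im R).
Local Notation ofR := (real_complex R).
Implicit Types (F G f : C -> C) (a b c d x y : R) (z w p t q : C).

(** [Goursat] wants a function continuous on the whole plane; composing with the projection onto a
    rectangle extends a function that is continuous on the rectangle only. *)
Definition clamp a b x : R := Num.max a (Num.min x b).

Lemma clamp_in a b x : a <= b -> a <= clamp a b x <= b.
Proof. by move=> ab; rewrite /clamp le_max lexx ge_max ab ge_min lexx orbT. Qed.
Lemma clamp_id a b x : a <= x <= b -> clamp a b x = x.
Proof. by move=> /andP[ax xb]; rewrite /clamp (min_idPl xb) (max_idPr ax). Qed.
Lemma clamp_lip a b x y : `|clamp a b x - clamp a b y| <= `|x - y|.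
Proof.
have hmax u v : `|Num.max a u - Num.max a v| <= `|u - v|.
  have h1 := ler_norm (u - v); have h2 := ler_norm (- (u - v)); rewrite normrN in h2.
  by rewrite !maxEle; case: (leP a u) => ?; case: (leP a v) => ?; rewrite ler_norml; lra.
apply: le_trans (hmax _ _) _.
have h1 := ler_norm (x - y); have h2 := ler_norm (- (x - y)); rewrite normrN in h2.
by rewrite !minEle; case: (leP x b) => ?; case: (leP y b) => ?; rewrite ler_norml; lra.
Qed.

Definition clp a b c d z := pt (clamp a b (Re z)) (clamp c d (Im z)).

Lemma ccont_clp F a b c d : a <= b -> c <= d ->
  (forall x y, a <= x <= b -> c <= y <= d -> ccont F (pt x y)) ->
  forall z, ccont (fun w => F (clp a b c d w)) z.
Proof.
move=> ab cd cF z e e0.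
have [r r0 hr] := cF _ _ (clamp_in (Re z) ab) (clamp_in (Im z) cd) e e0.
exists (r / 2) => [|w wz]; first by rewrite divr_gt0.
apply: hr; rewrite pt_sub; apply: le_lt_trans (nm_pt _ _) _.
have h1 := clamp_lip a b (Re w) (Re z); have h2 := clamp_lip c d (Im w) (Im z).
have := nm_Re (w - z); have := nm_Im (w - z); rewrite !raddfB /=.
move: wz; rewrite ltr_pdivlMr // => wz h3 h4.
have := le_trans h1 h4; have := le_trans h2 h3; lra.
Qed.

(** The margin [s] makes the clamped function agree with F near each point of the rectangle, so
    derivatives there are unchanged. *)
Lemma Goursat_clamp F p a b c d s : 0 < s -> a < Re p < b -> c < Im p < d ->
  (forall x y, a - s <= x <= b + s -> c - s <= y <= d + s -> ccont F (pt x y)) ->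
  (forall x y, a - s <= x <= b + s -> c - s <= y <= d + s -> pt x y <> p ->
     exists D, cdiff F (pt x y) D) ->
  rint (fun z => F (clp (a - s) (b + s) (c - s) (d + s) z)) a b c d = 0.
Proof.
move=> s0 hp hp' cF dF; apply: (Goursat_except hp hp').
  by apply: ccont_clp => //; [move: hp | move: hp'] => /andP[]; lra.
move=> x y hx hy xyp; have [||D hD] := dF x y _ _ xyp; [lra|lra|].
exists D; apply: (cdiff_near s0) hD => w hw; congr F; rewrite [LHS]ptE.
have := nm_Re (w - pt x y); have := nm_Im (w - pt x y); rewrite !raddfB /= => h1 h2.
have : `|Re w - x| < s by apply: le_lt_trans h2 hw.
have : `|Im w - y| < s by apply: le_lt_trans h1 hw.
rewrite !ltr_norml => h3 h4.
rewrite /clp (@clamp_id _ _ (Re w)); last lra.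
by rewrite (@clamp_id _ _ (Im w)) //; lra.
Qed.

Lemma cint_period (g : R -> C) x : rcont g -> (forall y, g (y + 1) = g y) ->
  cint g x (x + 1) = cint g 0 1.
Proof.
move=> cg pg; rewrite -(cint_chasles g x 0) -(cint_chasles g 0 1 (x + 1)).
have -> : cint g 1 (x + 1) = cint g 0 x.
  rewrite -[X in cint g X _]add0r -cint_shift //.
  by congr cint; apply/funext => y; exact: pg.
by rewrite addrCA cint_chasles /cint /oint !subrr addr0.
Qed.

Definition holoH f := forall z, 0 < Im z -> exists D : C, cdiff f z D.

Lemma rcontM (g1 g2 : R -> C) : rcont g1 -> rcont g2 -> rcont (fun x => g1 x * g2 x).
Proof.
move=> c1 c2 x e e0.
have K0 : 0 < nm (g1 x) + nm (g2 x) + 1 by rewrite ltr_wpDl // addr_ge0 ?nm_ge0.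
pose k := Num.min 1 (e / (nm (g1 x) + nm (g2 x) + 1)).
have k0 : 0 < k by rewrite lt_min ltr01 divr_gt0.
have k1 : k <= 1 by rewrite ge_min lexx.
have ke : k * (nm (g1 x) + nm (g2 x) + 1) <= e by rewrite -ler_pdivlMr // ge_min lexx orbT.
have [d1 d10 h1] := c1 x k k0; have [d2 d20 h2] := c2 x k k0.
exists (Num.min d1 d2) => [|y]; first by rewrite lt_min d10.
rewrite lt_min => /andP[/h1 hy1 /h2 hy2].
have -> : g1 y * g2 y - g1 x * g2 x =
  (g1 y - g1 x) * g2 x + g1 x * (g2 y - g2 x) + (g1 y - g1 x) * (g2 y - g2 x) by ring.
apply: le_lt_trans (nmD _ _) _; apply: (@lt_le_trans _ _ (k * nm (g2 x) + nm (g1 x) * k + k)).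
  apply: ler_ltD; last first.
    rewrite nmM -[k]mulr1; apply: (@le_lt_trans _ _ (k * nm (g2 y - g2 x))).
      by rewrite ler_wpM2r ?nm_ge0 // ltW.
    by rewrite ltr_pM2l // (lt_le_trans hy2).
  apply: le_trans (nmD _ _) _; rewrite !nmM; apply: lerD.
    by rewrite ler_wpM2r ?nm_ge0 // ltW.
  by rewrite ler_wpM2l ?nm_ge0 // ltW.
by apply: le_trans ke; rewrite le_eqVlt; apply/orP; left; apply/eqP; ring.
Qed.

Lemma nm_ee_small (e : R) : 0 < e -> exists Y : R, forall z, Y < Im z -> nm (ee z) < e.
Proof.
move=> e0; exists (- (ln e / (2 * pi))) => z hz; rewrite nm_ee -[e]lnK ?posrE //.
have p0 := pi2_gt0 R; rewrite ltr_expR; move: hz; set q := ln e / _ => hz.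
have -> : ln e = q * (2 * pi) by rewrite /q divfK // gt_eqF.
have : 0 < (2 * pi) * (Im z + q) by rewrite mulr_gt0 //; lra.
lra.
Qed.

(* With q = ee z these are Cauchy's formula and the Taylor expansion at q = 0 of
   a function holomorphic in a punctured disc with f(q) = o(1/q). *)
Section Formula.
Variable f : C -> C.
Hypothesis fper : forall z, f (z + 1) = f z.
Hypothesis fhol : holoH f.
Hypothesis fgrow : forall e : R, 0 < e -> exists Y : R, forall z, Y < Im z -> nm (f z * ee z) <= e.

(** Since dq = 2 pi i q dz, [kernel t z] dz is dq / (2 pi i (q - q_t)), the Cauchy kernel in the
    coordinate q = [ee z]. *)
Let kernel t z := (1 - ee (t - z))^-1.

Let ee_ne1 t z : Im z <> Im t -> 1 - ee (t - z) != 0.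
Proof.
move=> h; rewrite subr_eq0 eq_sym; apply/eqP => h1; apply: h.
have := nm_ee (t - z); rewrite h1 nm1 -[LHS]expR0 => /expR_inj/eqP.
rewrite eq_sym oppr_eq0 mulf_eq0 => /orP[/eqP p0|].
  by have := pi2_gt0 R; rewrite p0 ltxx.
by rewrite raddfB subr_eq0 => /eqP.
Qed.

Let cdiff_eesub t z : cdiff (fun w => ee (t - w)) z (- (c2pi R * ee (t - z))).
Proof.
have h : cdiff (fun w => t - w) z (-1).
  by rewrite -[X in cdiff _ _ X]add0r; apply: cdiffB; [exact: cdiff_cst | exact: cdiff_id].
by have := cdiff_comp h (cdiff_ee _); rewrite mulrN1.
Qed.

Let ker_rcont t y : Im t <> y -> rcont (fun x => kernel t (pt x y)).
Proof.
move=> h; have -> : (fun x => kernel t (pt x y)) = (fun x => kernel t (pt 0 y + ofR x * 1)).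
  by apply/funext => x; rewrite -pt_hE.
apply: rcont_line => x; rewrite -pt_hE; apply: ccontV; first by apply: ee_ne1 => /= hh; apply: h.
apply: ccontB; [exact: ccont_cst | exact: cdiff_cont (cdiff_eesub _ _)].
Qed.

Let f_cont z : 0 < Im z -> ccont f z.
Proof. by move=> /fhol[d /cdiff_cont]. Qed.

Let f_rcont y : 0 < y -> rcont (fun x => f (pt x y)).
Proof.
move=> h; have -> : (fun x => f (pt x y)) = (fun x => f (pt 0 y + ofR x * 1)).
  by apply/funext => x; rewrite -pt_hE.
by apply: rcont_line => x; rewrite -pt_hE; apply: f_cont.
Qed.

(** Goursat on a rectangle of width one centred at [Re t]: the vertical sides cancel by periodicity,
    so the horizontal integrals below and above [t] agree. Subtracting [f t] makes the integrand
    continuous at [t]. *)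
Let slope_int t h H : 0 < h -> h < Im t -> Im t < H ->
  let phi y x := (f (pt x y) - f t) * kernel t (pt x y) in
  cint (phi h) (Re t - 1 / 2) (Re t - 1 / 2 + 1) = cint (phi H) (Re t - 1 / 2) (Re t - 1 / 2 + 1).
Proof.
move=> h0 ht tH phi.
have [D [psi [psiE psic _]]] := fhol (lt_trans h0 ht).
have := cdiffB (cdiff_cst 1 t) (cdiff_eesub t t).
rewrite subrr ee0 mulr1 sub0r opprK => -[ka [kaE kac kat]].
(* Both f w - f t and 1 - ee (t - w) are w - t times a slope function; the quotient of the slopes is
   continuous at t, since the second one is 2 pi i there. *)
pose g w := psi w / ka w.
have gE w : w <> t -> g w = (f w - f t) * kernel t w.
  move=> /eqP wt; rewrite psiE /kernel; have := kaE w; rewrite subrr ee0 subrr subr0 => ->.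
  rewrite invfM; have w0 : w - t != 0 by rewrite subr_eq0.
  by rewrite /g -mulrA; congr (_ * _); rewrite mulrA mulrAC divff // mul1r.
(* The bound h / 2 keeps the enlarged rectangle in the half-plane; 1 / 4 keeps it at horizontal
   distance less than 1 from t, so t is the only zero of the denominator. *)
set a := Re t - 1 / 2; pose s := Num.min (h / 2) (1 / 4).
have s0 : 0 < s by rewrite lt_min !divr_gt0.
have [sh s4] : s <= h / 2 /\ s <= 1 / 4 by rewrite /s !ge_min !lexx orbT.
have ker0 x y : a - s <= x <= a + 1 + s -> pt x y <> t -> 1 - ee (t - pt x y) != 0.
  move=> hx ne; rewrite subr_eq0 eq_sym; apply/eqP => /ee_eq1 e1; apply: ne.
  apply/esym/subr0_eq/e1; rewrite raddfB /= ltr_norml; move: hx; rewrite /a; lra.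
have dg x y : a - s <= x <= a + 1 + s -> h - s <= y <= H + s -> pt x y <> t ->
    exists E, cdiff g (pt x y) E.
  move=> hx hy ne.
  have [E hE] : exists E, cdiff f (pt x y) E by apply: fhol => /=; lra.
  have k0 := ker0 x y hx ne.
  have h1 := cdiffB hE (cdiff_cst (f t) (pt x y)).
  have h2 := cdiffV (f := fun w => 1 - ee (t - w)) k0 (cdiffB (cdiff_cst 1 _) (cdiff_eesub t (pt x y))).
  eexists; apply: (@cdiff_near _ _ _ _ _ (nm (t - pt x y)) _ _ (cdiffM h1 h2)) => [|w hw].
    by rewrite nm_gt0 subr_eq0 eq_sym; apply/eqP.
  by rewrite gE // => wt; move: hw; rewrite wt ltxx.
have cg x y : a - s <= x <= a + 1 + s -> h - s <= y <= H + s -> ccont g (pt x y).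
  move=> hx hy; have [xyt|/eqP ne] := eqVneq (pt x y) t.
    rewrite xyt; apply: ccontM => //; apply: ccontV => //; first by rewrite kat c2pi_neq0.
  by have [E /cdiff_cont] := dg x y hx hy ne.
have ta : a < Re t < a + 1 by rewrite /a; lra.
have th : h < Im t < H by rewrite ht.
have := Goursat_clamp s0 ta th cg dg.
set g' := (fun z : C => g _).
have cg' : forall z, ccont g' z by apply: ccont_clp => //; lra.
have g'E x y : a - s <= x <= a + 1 + s -> h - s <= y <= H + s -> g' (pt x y) = g (pt x y).
  by move=> hx hy; rewrite /g' /clp /= !clamp_id.
rewrite /rint.
have -> : cint (fun y => g' (pt (a + 1) y)) h H = cint (fun y => g' (pt a y)) h H.
  apply: eq_cint; try exact: rcont_v; first lra.
  move=> y hy; rewrite (g'E (a + 1)) ?(g'E a); [|lra|lra|lra|lra].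
  have ne1 : pt (a + 1) y <> t by move=> tE; move: ta; rewrite -tE /= ltxx andbF.
  have ne2 : pt a y <> t by move=> tE; move: ta; rewrite -tE /= ltxx.
  rewrite !gE //.
  have -> : pt (a + 1) y = pt a y + 1 by apply: complex_eqE; rewrite raddfD /= ?addr0.
  by rewrite fper /kernel opprD addrA -[in RHS](subrK 1 (t - pt a y)) eeD1.
rewrite subrr mulr0 addr0 => /subr0_eq.
have phiE y : h - s <= y <= H + s -> Im t <> y -> cint (fun x => g' (pt x y)) a (a + 1) = cint (phi y) a (a + 1).
  move=> hy ty; apply: eq_cint.
  - exact: rcont_h.
  - apply: rcontM; last exact: ker_rcont.
    have y0 : 0 < y by lra.
    exact: (rcontD (f_rcont y0) (rcont_h (F := fun=> - f t) y (fun z => ccont_cst _ z))).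
  - lra.
  - move=> x hx; rewrite g'E; [|lra|exact: hy].
    by rewrite gE // => xt; apply: ty; rewrite -xt.
have tnh : Im t <> h by move=> e1; move: ht; rewrite e1 ltxx.
have tnH : Im t <> H by move=> e1; move: tH; rewrite e1 ltxx.
rewrite (phiE h _ tnh) ?(phiE H _ tnH) //; lra.
Qed.

(** |q_t / q_z| on the line Im z = h, the ratio of the geometric series below. *)
Let rho t h : R := expR (- (2 * pi * (Im t - h))).

Let nm_eesub t x h : nm (ee (t - pt x h)) = rho t h.
Proof. by rewrite nm_ee raddfB. Qed.

Let rho_lt1 t h : h < Im t -> 0 < rho t h < 1.
Proof.
by move=> ht; rewrite expR_gt0 -expR0 ltr_expR oppr_lt0 mulr_gt0 ?pi2_gt0 ?subr_gt0.
Qed.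

Let ker_bound t x h : h < Im t -> nm (kernel t (pt x h)) <= (1 - rho t h)^-1.
Proof.
move=> /rho_lt1/andP[r0 r1]; rewrite nmV lef_pV2 ?posrE ?subr_gt0 //.
  by rewrite -(nm_eesub t x) -nm1 nm_sub_ge.
have := nm_sub_ge 1 (ee (t - pt x h)); rewrite nm1 nm_eesub; apply: lt_le_trans.
by rewrite subr_gt0.
Qed.

Let ee_rcont t y n : rcont (fun x => ee (t - pt x y) ^+ n).
Proof.
apply: (rcont_h (F := fun z => ee (t - z) ^+ n)) => z.
exact: cdiff_cont (cdiffX n (cdiff_eesub t z)).
Qed.

Let int_pow t y n : cint (fun x => ee (t - pt x y) ^+ n.+1) 0 1 = 0.
Proof.
pose F z := - (n.+1%:R * c2pi R)^-1 * ee (t - z) ^+ n.+1.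
have c0 : n.+1%:R * c2pi R != 0 by rewrite mulf_neq0 ?c2pi_neq0 ?pnatr_eq0.
have hF (z : C) : cdiff F z (ee (t - z) ^+ n.+1).
  have := cdiffZ (- (n.+1%:R * c2pi R)^-1) (cdiffX n.+1 (cdiff_eesub t z)).
  rewrite /= exprS; congr cdiff; field.
  by rewrite c2pi_neq0 addrC natr1 pnatr_eq0.
rewrite (cint_pth _ _ _ hF) /F; have -> : pt 1 y = pt 0 y + 1.
  by apply: complex_eqE; rewrite raddfD /= ?add0r ?addr0.
by rewrite opprD addrA -[in X in _ - X](subrK 1 (t - pt 0 y)) eeD1 subrr.
Qed.

Let kerE t x h n : h < Im t -> ee (t - pt x h) ^+ n * kernel t (pt x h) =
  ee (t - pt x h) ^+ n + ee (t - pt x h) ^+ n.+1 * kernel t (pt x h).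
Proof.
move=> ht; rewrite /kernel exprS; have : 1 - ee (t - pt x h) != 0.
  by apply: ee_ne1 => /= h1; move: ht; rewrite h1 ltxx.
by move=> k0; field.
Qed.

Let ker_rcont' t h : h < Im t -> rcont (fun x => kernel t (pt x h)).
Proof. by move=> ht; apply: ker_rcont => h1; move: ht; rewrite h1 ltxx. Qed.

(** Unfolding [kerE] expands the kernel as a geometric series in ee (t - z). The constant term
    integrates to 1, the positive powers to 0 because they have a periodic primitive, and the
    remainder is O(rho^n). *)
Let int_ker t h : h < Im t -> cint (fun x => kernel t (pt x h)) 0 1 = 1.
Proof.
move=> ht; have /andP[r0 r1] := rho_lt1 ht; have ck := ker_rcont' ht.
have H n : cint (fun x => kernel t (pt x h)) 0 1 =
    1 + cint (fun x => ee (t - pt x h) ^+ n.+1 * kernel t (pt x h)) 0 1.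
  elim: n => [|n ih].
    have -> : (fun x => kernel t (pt x h)) = (fun x => ee (t - pt x h) ^+ 0 + ee (t - pt x h) ^+ 1 * kernel t (pt x h)).
      by apply/funext => x; rewrite -kerE // expr0 mul1r.
    rewrite cintD; [|exact: ee_rcont|by apply: rcontM; [exact: ee_rcont|]].
    by have := cint_cst (1 : C) 0 1; rewrite subr0 mulr1 => ->.
  rewrite ih; congr (1 + _).
  have -> : (fun x => ee (t - pt x h) ^+ n.+1 * kernel t (pt x h)) =
    (fun x => ee (t - pt x h) ^+ n.+1 + ee (t - pt x h) ^+ n.+2 * kernel t (pt x h)).
    by apply/funext => x; rewrite -kerE.
  rewrite cintD; [|exact: ee_rcont|by apply: rcontM; [exact: ee_rcont|]].
  by rewrite int_pow add0r.
apply/subr0_eq/(@nm_small0 _ _ (2 * (1 - rho t h)^-1)) => e e0.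
have [n hn] : exists n, rho t h ^+ n.+1 <= e.
  have [n hn] : exists n : nat, (e * (1 - rho t h))^-1 < n%:R.
    by exists (Num.trunc (e * (1 - rho t h))^-1).+1; exact: truncnS_gt.
  exists n; have e1 : 0 < e * (1 - rho t h) by rewrite mulr_gt0 // subr_gt0.
  have k0 : 0 < (rho t h)^-1 - 1 by rewrite subr_gt0 invf_gt1.
  (* Bernoulli's inequality for 1 / rho, the source of rho^n -> 0. *)
  have B m : 1 + m%:R * (1 - rho t h) <= (rho t h)^-1 ^+ m.
    elim: m => [|m ih]; first by rewrite mul0r addr0 expr0.
    rewrite exprS; apply: le_trans (ler_wpM2l _ ih); last by rewrite invr_ge0 ltW.
    have hr : 2 - rho t h <= (rho t h)^-1.
      rewrite -(ler_pM2l r0) divff ?gt_eqF //; have := sqr_ge0 (1 - rho t h); nra.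
    have p0 : 0 <= 1 + m%:R * (1 - rho t h) by rewrite addr_ge0 // mulr_ge0 // subr_ge0 ltW.
    apply: le_trans (ler_wpM2r p0 hr); rewrite -natr1.
    have : 0 <= m%:R * (1 - rho t h) ^+ 2 by rewrite mulr_ge0 ?sqr_ge0.
    nra.
  rewrite -[e]invrK -[_ ^+ _]invrK lef_pV2 ?posrE ?invr_gt0 ?exprn_gt0 // -exprVn.
  apply: le_trans (B _); apply: (@le_trans _ _ (n.+1%:R * (1 - rho t h))); last by rewrite lerDr.
  rewrite -ler_pdivrMr ?subr_gt0 // -invfM; apply: (le_trans (ltW hn)).
  by rewrite ler_nat.
rewrite (H n) addrC addKr mulrC mulrA.
apply: le_trans (@cint_bound _ _ (e * (1 - rho t h)^-1) 0 1 _ _ _) _ => //.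
- by apply: rcontM; [exact: ee_rcont|].
- move=> x _; rewrite nmM nmX nm_eesub; apply: ler_pM => //.
  + by rewrite exprn_ge0 // ltW.
  + exact: nm_ge0.
  + exact: ker_bound.
- by rewrite subr0 mulr1 mulrCA mulrA.
Qed.

(** The difference of the two sides is the integral of (f - f t) times the kernel, which [slope_int]
    moves to an arbitrarily high line. There |kernel| <= 2 |q_z| / |q_t|, and f q tends to 0 by
    [fgrow]. *)
Lemma periodic_Cauchy t (h : R) : 0 < h -> h < Im t ->
  f t = cint (fun x => f (pt x h) * kernel t (pt x h)) 0 1.
Proof.
move=> h0 ht; set a := Re t - 1 / 2.
have per y (g : C -> C) : (forall z, g (z + 1) = g z) -> forall x, g (pt (x + 1) y) = g (pt x y).
  move=> gp x; have -> : pt (x + 1) y = pt x y + 1.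
    by apply: complex_eqE; rewrite raddfD /= ?addr0.
  exact: gp.
have kper z : kernel t (z + 1) = kernel t z.
  by rewrite /kernel opprD addrA -[in RHS](subrK 1 (t - z)) eeD1.
have cfk : rcont (fun x => f (pt x h) * kernel t (pt x h)).
  by apply: rcontM; [exact: f_rcont | exact: ker_rcont'].
have cck : rcont (fun x => f t * kernel t (pt x h)).
  exact/rcontZ/ker_rcont'.
rewrite -(@cint_period _ a) //; last first.
  by move=> y; apply: (per h (fun z => f z * kernel t z)) => z; rewrite fper kper.
rewrite -[LHS]mulr1 -(int_ker ht) -(@cint_period _ a) //; last first.
- by move=> y; apply: (per h (fun z => kernel t z)) => z; rewrite kper.
- exact: ker_rcont'.
rewrite -cintZ; last exact: ker_rcont'.
apply/esym/subr0_eq; rewrite -cintB //.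
have -> : (fun x => f (pt x h) * kernel t (pt x h) - f t * kernel t (pt x h)) =
  (fun x => (f (pt x h) - f t) * kernel t (pt x h)).
  by apply/funext => x; rewrite mulrBl.
have nt0 : 0 < nm (ee t) by rewrite nm_gt0 ee_neq0.
apply: (@nm_small0 _ _ (4 * (1 + nm (f t)) / nm (ee t))) => e e0.
have [Y1 hY1] := fgrow e0.
have [Y2 hY2] := nm_ee_small e0.
have [Y3 hY3] := @nm_ee_small (nm (ee t) / 2) ltac:(by rewrite divr_gt0).
pose H := Num.max (Im t) (Num.max Y1 (Num.max Y2 Y3)) + 1.
have : Num.max (Im t) (Num.max Y1 (Num.max Y2 Y3)) < H by rewrite ltrDl.
rewrite !gt_max => /and4P[tH /= H1 H2 H3].
rewrite (slope_int h0 ht tH).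
have tnH : Im t <> H by move=> h1; move: tH; rewrite -h1 ltxx.
have H0 : 0 < H by rewrite (lt_trans h0) // (lt_trans ht).
apply: le_trans (@cint_bound _ _ (2 * (1 + nm (f t)) / nm (ee t) * e) _ _ _ _ _) _.
- apply: rcontM; last exact: ker_rcont.
  exact: (rcontD (f_rcont H0) (rcont_h (F := fun=> - f t) H (fun z => ccont_cst _ z))).
- by rewrite lerDl.
- move=> x _; set z := pt x H; have nz0 : 0 < nm (ee z) by rewrite nm_gt0 ee_neq0.
  have k1 : nm (kernel t z) <= 2 * nm (ee z) / nm (ee t).
    rewrite nmV -[X in _ <= X]invrK lef_pV2 ?posrE ?invr_gt0 ?divr_gt0 ?mulr_gt0 //; last first.
      by rewrite nm_gt0; apply: ee_ne1 => h1; apply: tnH; rewrite -h1.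
    rewrite nm_subC; apply: le_trans (nm_sub_ge _ _); rewrite nm1 eeD eeN nmM nmV invf_div.
    have z3 := hY3 z H3; move: z3; rewrite ltr_pdivlMr // => z3.
    rewrite lerBrDr -(ler_pM2r nz0) mulrDl divfK ?gt_eqF // mul1r.
    have -> : nm (ee t) / (2 * nm (ee z)) * nm (ee z) = nm (ee t) / 2 by field; rewrite gt_eqF.
    lra.
  rewrite nmM; apply: le_trans (ler_wpM2l (nm_ge0 _) k1) _.
  have f1 := nmB (f z) (f t).
  have f2 := hY1 z H1; rewrite nmM in f2; have f3 := hY2 z H2.
  have -> : nm (f z - f t) * (2 * nm (ee z) / nm (ee t)) = (2 / nm (ee t)) * (nm (f z - f t) * nm (ee z)).
    by field; rewrite gt_eqF.
  have -> : 2 * (1 + nm (f t)) / nm (ee t) * e = (2 / nm (ee t)) * ((1 + nm (f t)) * e).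
    by field; rewrite gt_eqF.
  rewrite ler_pM2l ?divr_gt0 //.
  apply: le_trans (ler_wpM2r (nm_ge0 _) f1) _; rewrite !mulrDl mul1r lerD //.
  by rewrite ler_wpM2l ?nm_ge0 // ltW.
- by rewrite [X in X - _]addrC addrK mulr1 le_eqVlt; apply/orP; left; apply/eqP; field; rewrite gt_eqF.
Qed.

(** The coefficients are the integrals of f(z) q_z^-j over a period. Subtracting n terms multiplies
    the integrand of Cauchy's formula by (q_t / q_z)^n, of modulus rho^n. *)
Theorem fourier (h M : R) : 0 < h -> (forall x, nm (f (pt x h)) <= M) ->
  exists a : nat -> C, forall n t, h < Im t ->
    nm (f t - \sum_(j < n) a j * ee t ^+ j) <= 2 * M * (rho t h ^+ n / (1 - rho t h)).
Proof.
move=> h0 hM; exists (fun j => cint (fun x => f (pt x h) * ee (0 - pt x h) ^+ j) 0 1) => n t ht.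
have /andP[r0 r1] := rho_lt1 ht.
have cf := f_rcont h0; have ck := ker_rcont' ht.
have -> : f t - \sum_(j < n) cint (fun x => f (pt x h) * ee (0 - pt x h) ^+ j) 0 1 * ee t ^+ j =
    cint (fun x => f (pt x h) * (ee (t - pt x h) ^+ n * kernel t (pt x h))) 0 1.
  elim: n => [|n ih].
    rewrite big_ord0 subr0 {1}(periodic_Cauchy h0 ht); congr cint.
    by apply/funext => x; rewrite expr0 mul1r.
  rewrite big_ord_recr /= opprD addrA ih.
  have -> : (fun x => f (pt x h) * (ee (t - pt x h) ^+ n * kernel t (pt x h))) =
     (fun x => ee t ^+ n * (f (pt x h) * ee (0 - pt x h) ^+ n) +
        f (pt x h) * (ee (t - pt x h) ^+ n.+1 * kernel t (pt x h))).
    apply/funext => x; rewrite kerE // mulrDr; congr (_ + _).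
    by rewrite mulrCA -exprMn -eeD add0r.
  have c1 : rcont (fun x => f (pt x h) * ee (0 - pt x h) ^+ n) by apply: rcontM.
  rewrite cintD ?cintZ //; first by rewrite mulrC addrC addKr.
    exact: rcontZ.
  by apply: rcontM => //; apply: rcontM.
have M0 : 0 <= M by apply: le_trans (hM 0); exact: nm_ge0.
apply: le_trans (@cint_bound _ _ (M * (rho t h ^+ n / (1 - rho t h))) 0 1 _ _ _) _ => //.
- by apply: rcontM => //; apply: rcontM.
- move=> x _; rewrite !nmM nmX nm_eesub; apply: ler_pM => //; first exact: nm_ge0.
    by rewrite mulr_ge0 ?nm_ge0 // exprn_ge0 // ltW.
  by rewrite ler_wpM2l ?exprn_ge0 ?(ltW r0) // ker_bound.
- by rewrite subr0 mulr1 mulrA.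
Qed.

End Formula.
End PeriodicCauchy.

(** * Maximum principle and removable singularities *)

Section Consequences.
Variable R : realType.
Local Notation C := R[i].
Local Notation Re := (@complex.Re R).
Local Notation Im := (@complex.Im R).
Local Notation ofR := (real_complex R).
Implicit Types (f g : C -> C) (x y : R) (z w p t q a D : C).

Lemma rcont_bounded (g : R -> C) : rcont g -> exists M, forall x, 0 <= x <= 1 -> nm (g x) <= M.
Proof.
move=> cg; have c1 : {within `[0 : R, 1], continuous (fun x => nm (g x))}%classic.
  apply: continuous_subspaceT => x; apply/(@cvgrPdist_lt _ R^o _ (nbhs (x : R^o))) => e e0.
  have [d d0 hd] := cg x e e0.
  apply/nbhs_ballP; exists d => //= y; rewrite -ball_normE /= distrC => /hd h.
  have h1 := nm_sub_ge (g x) (g y); have h2 := nm_sub_ge (g y) (g x).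
  by rewrite nm_subC in h1; rewrite ltr_norml; apply/andP; split; lra.
have [c _ hc] := EVT_max (@ler01 R) c1.
by exists (nm (g c)) => x hx; apply: hc; rewrite in_itv.
Qed.

(* f = o(1/q) at the cusp, the hypothesis of the removable singularity theorem in q. *)
Definition smallq f := forall e : R, 0 < e -> exists Y : R, forall z, Y < Im z -> nm (f z * ee z) <= e.

Lemma periodicZ f : (forall z, f (z + 1) = f z) -> forall (m : int) z, f (z + m%:~R) = f z.
Proof.
move=> fp; have H (n : nat) z : f (z + n%:R) = f z.
  by elim: n => [|n ih]; rewrite ?addr0 // -natr1 addrA fp.
case=> n z; first exact: H.
by rewrite NegzE rmorphN /= -{2}(subrK (n.+1%:~R) z) H.
Qed.

Lemma periodic_reduce f y : (forall z, f (z + 1) = f z) -> forall M,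
  (forall x, 0 <= x <= 1 -> nm (f (pt x y)) <= M) -> forall x, nm (f (pt x y)) <= M.
Proof.
move=> fp M hM x; rewrite -(periodicZ fp (- Num.floor x)).
have -> : pt x y + (- Num.floor x)%:~R = pt (x - (Num.floor x)%:~R) y.
  by apply: complex_eqE; rewrite raddfD /= ?Re_int ?Im_int ?addr0 // rmorphN.
apply: hM; have /andP[h1 h2] := floor_itv x; rewrite intrD in h2; lra.
Qed.

Lemma holo_rcont f y : holoH f -> 0 < y -> rcont (fun x => f (pt x y)).
Proof.
move=> hf h; have -> : (fun x => f (pt x y)) = (fun x => f (pt 0 y + ofR x * 1)).
  by apply/funext => x; rewrite -pt_hE.
apply: rcont_line => x; rewrite -pt_hE.
by have [D /cdiff_cont] : exists D, cdiff f (pt x y) D by apply: hf.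
Qed.

Lemma periodic_bounded f y : (forall z, f (z + 1) = f z) -> holoH f -> 0 < y ->
  exists M, forall x, nm (f (pt x y)) <= M.
Proof.
move=> fp hf y0; have [M hM] := rcont_bounded (holo_rcont hf y0).
by exists M; exact: periodic_reduce.
Qed.

(** The power trick, which discards constants independent of n: if x / y were 1 + u with u > 0,
    Bernoulli's inequality would make its powers exceed K. *)
Lemma le_of_pow (x y K : R) : 0 <= x -> 0 <= y -> (forall n : nat, x ^+ n <= K * y ^+ n) -> x <= y.
Proof.
move=> x0 y0 h; rewrite leNgt; apply/negP => yx.
have [y00|yp] := eqVneq y 0.
  by have := h 1%N; rewrite y00 expr1 expr0n mulr0; move: yx; rewrite y00; lra.
have {yp}yp : 0 < y by rewrite lt_neqAle eq_sym yp.
pose u := x / y - 1; have u0 : 0 < u by rewrite subr_gt0 ltr_pdivlMr // mul1r.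
have B m : 1 + m%:R * u <= (x / y) ^+ m.
  elim: m => [|m ih]; first by rewrite mul0r addr0 expr0.
  rewrite exprS; apply: le_trans (ler_wpM2l _ ih); last by rewrite divr_ge0.
  have -> : x / y = 1 + u by rewrite /u addrC subrK.
  rewrite -natr1; have : 0 <= m%:R * u ^+ 2 by rewrite mulr_ge0 ?sqr_ge0.
  nra.
have hK n : 1 + n%:R * u <= K.
  apply: le_trans (B n) _; rewrite expr_div_n ler_pdivrMr ?exprn_gt0 //.
have := hK (Num.trunc (K / u)).+1; have := truncnS_gt (K / u).
by rewrite ltr_pdivrMr // => h1 h2; lra.
Qed.

Lemma rho_E z h : expR (- (2 * pi * (Im z - h))) = nm (ee z) * expR (2 * pi * h) :> R.
Proof. by rewrite nm_ee -expRD; congr expR; ring. Qed.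

(** [fourier] without terms gives the bound up to a factor 2 / (1 - r). Applied to all powers of f
    it becomes sharp by [le_of_pow]; the powers satisfy [smallq] because f is by then known to be
    bounded near the cusp. *)
Theorem periodic_max f (h M : R) : (forall z, f (z + 1) = f z) -> holoH f -> smallq f -> 0 < h ->
  (forall x, nm (f (pt x h)) <= M) -> forall t, h < Im t -> nm (f t) <= M.
Proof.
move=> fp hf sf h0 hM t ht.
have M0 : 0 <= M by apply: le_trans (hM 0); exact: nm_ge0.
pose r y : R := expR (- (2 * pi * (y - h))).
have rlt y : h < y -> 0 < r y < 1.
  by move=> hy; rewrite expR_gt0 -expR0 ltr_expR oppr_lt0 mulr_gt0 ?pi2_gt0 ?subr_gt0.
have F0 g B : (forall z, g (z + 1) = g z) -> holoH g -> smallq g ->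
    (forall x, nm (g (pt x h)) <= B) -> forall z, h < Im z -> nm (g z) <= 2 * B / (1 - r (Im z)).
  move=> gp hg sg hB z hz; have [a /(_ 0%N z hz)] := fourier gp hg sg h0 hB.
  by rewrite big_ord0 subr0 expr0 mul1r.
have B1 := F0 f M fp hf sf hM.
pose K : R := 2 / (1 - r (h + 1)).
have [r0 r1] : 0 < r (h + 1) /\ r (h + 1) < 1 by apply/andP/rlt; rewrite ltrDl.
have K0 : 0 <= K by rewrite divr_ge0 // subr_ge0 ltW.
have KM0 : 0 <= K * M by rewrite mulr_ge0.
have fb z : h + 1 < Im z -> nm (f z) <= K * M.
  move=> hz; have hz' : h < Im z by apply: lt_trans hz; rewrite ltrDl.
  apply: le_trans (B1 z hz') _; rewrite mulrAC ler_wpM2r // /K ler_pM2l //.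
  have /andP[_ rz1] := rlt _ hz'.
  rewrite lef_pV2 ?posrE ?subr_gt0 // lerD2l lerN2 ler_expR lerN2 ler_pM2l ?pi2_gt0 //; lra.
apply: (@le_of_pow _ _ (2 / (1 - r (Im t)))) => //; first exact: nm_ge0.
move=> n; rewrite -nmX mulrAC; apply: (F0 (fun z => f z ^+ n)) => //.
- by move=> z; rewrite fp.
- by move=> z /hf[D hD]; eexists; apply: cdiffX hD.
- move=> e e0; have k0 : 0 < (K * M) ^+ n + 1 by rewrite ltr_wpDl // exprn_ge0.
  have [Y hY] := @nm_ee_small _ (e / ((K * M) ^+ n + 1)) ltac:(by rewrite divr_gt0).
  exists (Num.max (h + 1) Y) => z; rewrite gt_max => /andP[hz /hY hz'].
  rewrite nmM nmX; apply: (@le_trans _ _ (((K * M) ^+ n + 1) * nm (ee z))).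
    rewrite ler_wpM2r ?nm_ge0 //; apply: (@le_trans _ _ ((K * M) ^+ n)); last by rewrite lerDl.
    by apply: lerXn2r; rewrite ?nnegrE ?nm_ge0 //; exact: fb.
  by rewrite mulrC -ler_pdivlMr // ltW.
- by move=> x; rewrite nmX; apply: lerXn2r; rewrite ?nnegrE ?nm_ge0.
Qed.

(** Schwarz's lemma in the coordinate q: the maximum principle for f / q, for which [smallq] says
    just that f tends to 0. *)
Theorem periodic_max0 f (h M : R) : (forall z, f (z + 1) = f z) -> holoH f ->
  (forall e : R, 0 < e -> exists Y, forall z, Y < Im z -> nm (f z) <= e) -> 0 < h ->
  (forall x, nm (f (pt x h)) <= M) ->
  forall t, h < Im t -> nm (f t) <= M * expR (- (2 * pi * (Im t - h))).
Proof.
move=> fp hf sf h0 hM t ht; rewrite rho_E.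
have ne z : 0 < nm (ee z) by rewrite nm_gt0 ee_neq0.
rewrite mulrCA [X in _ <= X]mulrC -ler_pdivrMr // -nmV -nmM.
apply: (@periodic_max (fun z => f z / ee z)) ht => //.
- by move=> z; rewrite fp eeD1.
- move=> z /hf[D hD]; eexists; apply: (cdiffM hD).
  by apply: cdiffV; [exact: ee_neq0 | exact: cdiff_ee].
- by move=> e /sf[Y hY]; exists Y => z /hY; rewrite divfK ?ee_neq0.
- by move=> x; rewrite nmM nmV nm_ee /= -expRN opprK ler_pM2r ?expR_gt0.
Qed.

Theorem periodic_limit f : (forall z, f (z + 1) = f z) -> holoH f -> smallq f ->
  exists c : C, exists2 K : R, 0 <= K & forall z, 1 < Im z -> nm (f z - c) <= K * nm (ee z).
Proof.
move=> fp hf sf; have h0 : 0 < (1 / 2 : R) by lra.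
have [M hM] := periodic_bounded fp hf h0.
have M0 : 0 <= M by apply: le_trans (hM 0); exact: nm_ge0.
have [a ha] := fourier fp hf sf h0 hM.
pose r : R := expR (- (2 * pi * (1 - 1 / 2))).
have r1 : r < 1 by rewrite -[X in _ < X]expR0 ltr_expR oppr_lt0 mulr_gt0 ?pi2_gt0 //; lra.
exists (a 0%N), (2 * M * expR (2 * pi * (1 / 2)) / (1 - r)) => [|z hz].
  by rewrite divr_ge0 ?subr_ge0 ?(ltW r1) // !mulr_ge0 // expR_ge0.
have hz' : 1 / 2 < Im z by lra.
have := ha 1%N z hz'; rewrite big_ord1 expr0 mulr1 expr1 => h; apply: le_trans h _.
rewrite rho_E.
have -> : 2 * M * expR (2 * pi * (1 / 2)) / (1 - r) * nm (ee z) =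
  2 * M * (nm (ee z) * expR (2 * pi * (1 / 2)) / (1 - r)) by ring.
apply: ler_wpM2l; first by rewrite mulr_ge0.
apply: ler_wpM2l; first by rewrite mulr_ge0 ?nm_ge0 ?expR_ge0.
rewrite -rho_E lef_pV2 ?posrE ?subr_gt0 //; last first.
  by rewrite -[X in _ < X]expR0 ltr_expR oppr_lt0 mulr_gt0 ?pi2_gt0 //; lra.
rewrite lerD2l lerN2 ler_expR lerN2 ler_pM2l ?pi2_gt0 //; lra.
Qed.

(** The map t -> a + r0 ee t sends the half-plane onto the punctured disc and makes f periodic, so
    this is [fourier] in the coordinate z - a. The circle of radius r is the line at height [h]. *)
Theorem punctured_Taylor f a (r0 r M : R) : 0 < r -> r < r0 ->
  (forall z, 0 < nm (z - a) < r0 -> exists D, cdiff f z D) ->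
  (forall e : R, 0 < e -> exists2 d : R, 0 < d & forall z, 0 < nm (z - a) < d -> nm ((z - a) * f z) <= e) ->
  (forall z, nm (z - a) = r -> nm (f z) <= M) ->
  exists c : nat -> C, forall n z, 0 < nm (z - a) < r ->
    nm (f z - \sum_(j < n) c j * (z - a) ^+ j) <=
      2 * M * ((nm (z - a) / r) ^+ n / (1 - nm (z - a) / r)).
Proof.
move=> r_gt0 rr0 hf sf hM; have r0_gt0 : 0 < r0 by apply: lt_trans rr0.
have nr0 : ofR r0 != 0 by rewrite -nm_gt0 nm_real normr_gt0 gt_eqF.
pose m t := a + ofR r0 * ee t; pose F t := f (m t).
have mE t : m t - a = ofR r0 * ee t by rewrite /m addrC addKr.
have nmm t : nm (m t - a) = r0 * nm (ee t) by rewrite mE nmM nm_real gtr0_norm.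
have eelt t : 0 < Im t -> 0 < nm (m t - a) < r0.
  move=> t0; rewrite nmm mulr_gt0 ?nm_gt0 ?ee_neq0 //= gtr_pMr //.
  by rewrite nm_ee -[X in _ < X]expR0 ltr_expR oppr_lt0 mulr_gt0 ?pi2_gt0.
have Fp z : F (z + 1) = F z by rewrite /F /m eeD1.
have hF : holoH F.
  move=> t t0; have [D hD] := hf _ (eelt t t0).
  by eexists; apply: (cdiff_comp _ hD); apply: cdiffD (cdiff_cst _ _) (cdiffZ _ (cdiff_ee _)).
have sF : smallq F.
  move=> e e0; have [d d0 hd] := sf (e * r0) ltac:(by rewrite mulr_gt0).
  have [Y hY] := @nm_ee_small _ (d / r0) ltac:(by rewrite divr_gt0).
  exists Y => z /hY; rewrite ltr_pdivlMr // mulrC => hz.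
  have := hd (m z); rewrite nmm hz mulr_gt0 ?nm_gt0 ?ee_neq0 // => /(_ isT).
  rewrite mE !nmM nm_real gtr0_norm // => h1; rewrite -(ler_pM2l r0_gt0) [_ * e]mulrC.
  by apply: le_trans h1; rewrite -mulrA [nm (F z) * _]mulrC.
pose h := ln (r0 / r) / (2 * pi).
have p0 := pi2_gt0 R.
have hE : expR (2 * pi * h) = r0 / r by rewrite /h mulrC divfK ?gt_eqF // lnK // posrE divr_gt0.
have h0 : 0 < h.
  rewrite -(pmulr_rgt0 _ p0) -(ltr_expR 0) expR0 hE ltr_pdivlMr // mul1r //.
have FM x : nm (F (pt x h)) <= M.
  by apply: hM; rewrite nmm nm_ee /= expRN hE invf_div mulrCA divff ?mulr1 // gt_eqF.
have [c hc] := fourier Fp hF sF h0 FM.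
exists (fun j => c j / ofR r0 ^+ j) => n z /andP[z0 zr].
have [t ht] := @ee_surj _ ((z - a) / ofR r0) ltac:(by rewrite mulf_neq0 ?invr_eq0 // -nm_gt0).
have mt : m t = z by rewrite /m ht mulrC divfK // addrC subrK.
have rhoE : expR (- (2 * pi * (Im t - h))) = nm (z - a) / r.
  rewrite rho_E hE ht nmM nmV nm_real gtr0_norm //; field; rewrite !gt_eqF //.
have tH : h < Im t.
  have : nm (z - a) / r < 1 by rewrite ltr_pdivrMr // mul1r.
  by rewrite -rhoE -[X in _ < X]expR0 ltr_expR oppr_lt0 pmulr_rgt0 // subr_gt0.
have := hc n t tH; rewrite rhoE /F mt.
suff -> : \sum_(j < n) c j * ee t ^+ j = \sum_(j < n) c j / ofR r0 ^+ j * (z - a) ^+ j by [].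
by apply: eq_bigr => j _; rewrite ht expr_div_n mulrAC mulrA.
Qed.

Lemma circle_bounded f a (r : R) : 0 < r -> (forall z, nm (z - a) = r -> ccont f z) ->
  exists M, forall z, nm (z - a) = r -> nm (f z) <= M.
Proof.
move=> r0 cf; pose m (x : R) := a + ofR r * ee (ofR x).
have mr x : nm (m x - a) = r.
  by rewrite /m addrC addKr nmM nm_real gtr0_norm // ee_real nm_cis mulr1.
have [M hM] : exists M, forall x, 0 <= x <= 1 -> nm (f (m x)) <= M.
  apply: rcont_bounded.
  have -> : (fun x => f (m x)) = (fun x => f (a + ofR r * ee (0 + ofR x * 1))).
    by apply/funext => x; rewrite add0r mulr1.
  apply: (@rcont_line _ (fun z => f (a + ofR r * ee z))) => x; rewrite add0r mulr1.
  apply: (@ccont_comp _ f (fun z => a + ofR r * ee z)); last by apply: cf; exact: mr.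
  by apply: cdiff_cont; apply: cdiffD (cdiff_cst _ _) (cdiffZ _ (cdiff_ee _)).
exists M => z zr.
have nr : ofR r != 0 by rewrite -nm_gt0 nm_real normr_gt0 gt_eqF.
have [t ht] := @ee_surj _ ((z - a) / ofR r) ltac:(by rewrite mulf_neq0 ?invr_eq0 // -nm_gt0 zr).
have t0 : Im t = 0.
  have : nm (ee t) = 1 by rewrite ht nmM zr nmV nm_real gtr0_norm // divff // gt_eqF.
  rewrite nm_ee -[RHS]expR0 => /expR_inj/eqP; rewrite oppr_eq0 mulf_eq0 => /orP[/eqP p0|/eqP//].
  by have := pi2_gt0 R; rewrite p0 ltxx.
have tE : t = ofR (Re t) by apply: complex_eqE; rewrite ?t0.
have zE : z = m (Re t) by rewrite /m -tE ht mulrC divfK // addrC subrK.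
have gp (z' : C) : f (a + ofR r * ee (z' + 1)) = f (a + ofR r * ee z') by rewrite eeD1.
rewrite zE; apply: (@periodic_reduce (fun z => f (a + ofR r * ee z)) 0 gp) => x hx.
exact: hM.
Qed.

(** The Taylor estimate of order two already shows that the extension by [c 0] has derivative
    [c 1]. *)
Theorem removable f a (r0 : R) : 0 < r0 ->
  (forall z, 0 < nm (z - a) < r0 -> exists D, cdiff f z D) ->
  (forall e : R, 0 < e -> exists2 d : R, 0 < d & forall z, 0 < nm (z - a) < d -> nm ((z - a) * f z) <= e) ->
  exists c D, cdiff (fun z => if z == a then c else f z) a D.
Proof.
move=> r0_gt0 hf sf; pose r := r0 / 2.
have [r_gt0 rr0] : 0 < r /\ r < r0 by rewrite /r; lra.
have [M hM] : exists M, forall z, nm (z - a) = r -> nm (f z) <= M.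
  apply: circle_bounded => // z zr.
  by have [D /cdiff_cont] : exists D, cdiff f z D by apply: hf; rewrite zr r_gt0.
have M0 : 0 <= M by apply: le_trans (hM (a + ofR r) _); rewrite ?nm_ge0 // addrC addKr nm_real gtr0_norm.
have [c hc] := punctured_Taylor r_gt0 rr0 hf sf hM.
exists (c 0%N), (c 1%N); apply/cdiffP => e e0.
pose K := 4 * M / r ^+ 2 + 1.
have K0 : 0 < K by apply: ltr_wpDl => //; apply: divr_ge0; [lra | exact: sqr_ge0].
exists (Num.min (r / 2) (e / K)) => [|h].
  by rewrite lt_min !divr_gt0.
rewrite lt_min => /andP[hr he].
rewrite eqxx; have [->|h0] := eqVneq h 0; first by rewrite addr0 eqxx mulr0 subr0 subrr nm0 mulr0.
have -> : (a + h == a) = false by apply/negbTE; rewrite -subr_eq0 addrC addKr.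
have hp : 0 < nm h by rewrite nm_gt0.
have := hc 2%N (a + h); rewrite [a + h - a]addrC addKr hp (lt_trans hr) /=; last lra.
move=> /(_ isT); rewrite big_ord_recr big_ord1 /= expr0 mulr1 expr1 opprD addrA => H.
apply: (le_trans H); have h2 : nm h / r <= 1 / 2 by rewrite ler_pdivrMr //; lra.
apply: (@le_trans _ _ (K * nm h * nm h)); last first.
  by rewrite ler_wpM2r ?nm_ge0 // mulrC -ler_pdivlMr // ltW.
apply: (@le_trans _ _ (2 * M * ((nm h / r) ^+ 2 * 2))).
  apply: ler_wpM2l; first by rewrite mulr_ge0.
  apply: ler_wpM2l; first exact: sqr_ge0.
  rewrite -[X in _ <= X]invrK lef_pV2 ?posrE ?invr_gt0 //; lra.
have -> : 2 * M * ((nm h / r) ^+ 2 * 2) = 4 * M / r ^+ 2 * nm h * nm h by field; rewrite gt_eqF.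
by rewrite /K; apply: ler_wpM2r (ltW hp) _ _ _; apply: ler_wpM2r (ltW hp) _ _ _; rewrite lerDl.
Qed.

End Consequences.

(** * Derivatives, quotients and primitives of holomorphic functions *)

Section Regularity.
Variable R : realType.
Local Notation C := R[i].
Local Notation Re := (@complex.Re R).
Local Notation Im := (@complex.Im R).
Local Notation ofR := (real_complex R).
Implicit Types (f g E G : C -> C) (x y r : R) (z w p t q a D : C).

Definition dv f z : C := xget 0 [set D | cdiff f z D]%classic.

Lemma dvP f z : (exists D, cdiff f z D) -> cdiff f z (dv f z).
Proof. by move=> [D hD]; rewrite /dv; case: xgetP => [E _|/(_ D)]. Qed.
Lemma dvE f z D : cdiff f z D -> dv f z = D.
Proof. by move=> h; apply: cdiff_unique (dvP (ex_intro _ D h)) h. Qed.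

Lemma ccont_bounded f a : ccont f a -> exists2 r, 0 < r & forall z, nm (z - a) < r -> nm (f z) <= nm (f a) + 1.
Proof.
move=> /(_ 1 ltr01)[r r0 hr]; exists r => // z /hr h.
by have := nm_sub_ge (f z) (f a); lra.
Qed.

Lemma ccont_neq0 f a : ccont f a -> f a != 0 -> exists2 r, 0 < r & forall z, nm (z - a) < r -> f z != 0.
Proof.
move=> cf fa; have f0 : 0 < nm (f a) by rewrite nm_gt0.
have [r r0 hr] := cf _ f0; exists r => // z /hr h; apply/eqP => fz; move: h.
by rewrite fz sub0r nmN ltxx.
Qed.

(** The constants are explicit because termwise differentiation of series ([csum_cdiff]) needs them
    uniform. They come from Taylor on the disc of radius r / 2, where |z - a| <= r / 4 makes the
    geometric factor at most 2. *)
Lemma Taylor1 f a r (M : R) : 0 < r -> (forall z, nm (z - a) < r -> exists D, cdiff f z D) ->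
  (forall z, nm (z - a) < r -> nm (f z) <= M) ->
  [/\ nm (dv f a) <= 12 * M / r &
     forall z, nm (z - a) <= r / 4 -> nm (f z - f a - dv f a * (z - a)) <= 16 * M / r ^+ 2 * nm (z - a) ^+ 2].
Proof.
move=> r0 hf hM.
have ra : nm (a - a) < r by rewrite subrr nm0.
have M0 : 0 <= M by apply: le_trans (hM a ra); exact: nm_ge0.
have cf : ccont f a by have [D /cdiff_cont] := hf a ra.
have r2 : 0 < r / 2 by rewrite divr_gt0.
have [c hc] : exists c : nat -> C, forall n z, 0 < nm (z - a) < r / 2 ->
    nm (f z - \sum_(j < n) c j * (z - a) ^+ j) <=
      2 * M * ((nm (z - a) / (r / 2)) ^+ n / (1 - nm (z - a) / (r / 2))).
  apply: (@punctured_Taylor R f a r) => //; first lra.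
  - by move=> z /andP[_]; exact: hf.
  - move=> e e0; have [d d0 hd] := ccont_bounded cf.
    have k0 : 0 < nm (f a) + 1 by rewrite ltr_wpDl ?nm_ge0.
    exists (Num.min d (e / (nm (f a) + 1))) => [|z]; first by rewrite lt_min d0 divr_gt0.
    rewrite lt_min => /and3P[_ /hd h1 h2]; rewrite nmM.
    apply: (@le_trans _ _ (nm (z - a) * (nm (f a) + 1))); first by rewrite ler_wpM2l ?nm_ge0.
    by rewrite -ler_pdivlMr // ltW.
  - by move=> z zr; apply: hM; rewrite zr; lra.
have B n z : 0 < nm (z - a) -> nm (z - a) <= r / 4 ->
    nm (f z - \sum_(j < n) c j * (z - a) ^+ j) <= 4 * M * (nm (z - a) / (r / 2)) ^+ n.
  move=> z0 zr; apply: (le_trans (hc n z _)); first by apply/andP; split => //; lra.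
  have u2 : nm (z - a) / (r / 2) <= 1 / 2 by rewrite ler_pdivrMr //; lra.
  have u0 : 0 <= nm (z - a) / (r / 2) by rewrite divr_ge0 ?nm_ge0 // ltW.
  set u := _ / (r / 2) in u2 u0 *.
  have -> : 4 * M * u ^+ n = 2 * M * (u ^+ n * 2) by ring.
  apply: ler_wpM2l; first by rewrite mulr_ge0.
  apply: ler_wpM2l; first exact: exprn_ge0.
  rewrite -[X in _ <= X]invrK lef_pV2 ?posrE ?invr_gt0 //; lra.
have c0 : c 0%N = f a.
  apply/subr0_eq/(@nm_small0 _ _ 2) => e e0; have [d d0 hd] := cf e e0.
  pose k := Num.min (d / 2) (Num.min (r / 4) (e / (8 * M / r + 1))).
  have K0 : 0 < 8 * M / r + 1 by apply: ltr_wpDl => //; apply: divr_ge0; lra.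
  have k0 : 0 < k by rewrite !lt_min !divr_gt0.
  have : k <= k by []. rewrite {2}/k !le_min => /and3P[kd kr ke].
  have nk : nm (a + ofR k - a) = k by rewrite addrC addKr nm_real gtr0_norm.
  have h1 := hd (a + ofR k); rewrite nk in h1.
  have h2 := B 1%N (a + ofR k); rewrite nk big_ord1 expr0 mulr1 expr1 in h2.
  have h3 : 4 * M * (k / (r / 2)) <= e.
    have -> : 4 * M * (k / (r / 2)) = (8 * M / r) * k by field; rewrite gt_eqF.
    move: ke; rewrite ler_pdivlMr // => ke; apply: le_trans ke.
    by rewrite mulrC ler_wpM2l ?(ltW k0) // lerDl.
  have h4 := nm_tri (f (a + ofR k)) (c 0%N) (f a).
  have h5 := h1 ltac:(lra); have h6 := h2 k0 kr.
  rewrite nm_subC in h6; lra.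
have hT z : nm (z - a) <= r / 4 -> nm (f z - f a - c 1%N * (z - a)) <= 16 * M / r ^+ 2 * nm (z - a) ^+ 2.
  move=> zr; have [->|za] := eqVneq z a; first by rewrite !subrr mulr0 subr0 nm0 expr0n mulr0.
  have := B 2%N z; rewrite nm_gt0 subr_eq0 za => /(_ isT zr).
  rewrite big_ord_recr big_ord1 /= expr0 mulr1 expr1 opprD addrA c0.
  congr (_ <= _); field; rewrite gt_eqF //.
have dE : dv f a = c 1%N.
  apply: dvE; apply/cdiffP => e e0; pose K := 16 * M / r ^+ 2 + 1.
  have K0 : 0 < K by apply: ltr_wpDl => //; apply: divr_ge0; [lra | exact: sqr_ge0].
  exists (Num.min (r / 4) (e / K)) => [|h]; first by rewrite lt_min !divr_gt0.
  rewrite lt_min => /andP[h1 h2].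
  have := hT (a + h); rewrite [a + h - a]addrC addKr => /(_ (ltW h1)) h3; apply: le_trans h3 _.
  rewrite expr2 mulrA ler_wpM2r ?nm_ge0 //; move: h2; rewrite ltr_pdivlMr // => /ltW; apply: le_trans.
  by rewrite mulrC ler_wpM2l ?nm_ge0 // lerDl.
split; last by rewrite dE.
(* Evaluating the second-order estimate at distance r / 4 gives |f'(a)| r / 4 <= 2 M + M. *)
have nk : nm (a + ofR (r / 4) - a) = r / 4.
  by rewrite addrC addKr nm_real gtr0_norm // divr_gt0.
have h1 := hT (a + ofR (r / 4)); rewrite nk lexx in h1; move: {h1}(h1 isT) => h1.
have h2 := hM (a + ofR (r / 4)); rewrite nk in h2; move: {h2}(h2 ltac:(lra)) => h2.
have h3 := hM a ra.
have h4 := nm_sub_ge (c 1%N * (a + ofR (r / 4) - a)) (f (a + ofR (r / 4)) - f a).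
have h5 := nmB (f (a + ofR (r / 4))) (f a).
rewrite (nm_subC (c 1%N * _)) nmM nk in h4.
have h6 : 16 * M / r ^+ 2 * (r / 4) ^+ 2 = M by field; rewrite gt_eqF.
by rewrite dE ler_pdivlMr //; lra.
Qed.

Definition slope f a z : C := if z == a then dv f a else (f z - f a) / (z - a).

Lemma slopeE f a z : (exists D, cdiff f a D) -> f z = f a + (z - a) * slope f a z.
Proof.
move=> _; rewrite /slope; case: eqP => [->|/eqP za]; first by rewrite subrr mul0r addr0.
by rewrite mulrC divfK ?subr_eq0 // addrC subrK.
Qed.

(** Times z - a, the quotient is f z - f a, which tends to 0, so the singularity is removable. The
    value filled in must be [dv f a] because the filled quotient is a slope function of f at a. *)
Lemma slope_cdiff f a r : 0 < r -> (forall z, nm (z - a) < r -> exists D, cdiff f z D) ->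
  forall z, nm (z - a) < r -> exists D, cdiff (slope f a) z D.
Proof.
move=> r0 hf z zr; have ra : nm (a - a) < r by rewrite subrr nm0.
have da := dvP (hf a ra).
have hq w : w != a -> nm (w - a) < r -> exists D, cdiff (fun z => (f z - f a) / (z - a)) w D.
  move=> wa /hf[D hD]; eexists; apply: cdiffM.
    by apply: cdiffB hD (cdiff_cst _ _).
  by apply: cdiffV; [rewrite subr_eq0 | apply: cdiffB (cdiff_id _) (cdiff_cst _ _)].
have [->|za] := eqVneq z a; last first.
  have [D hD] := hq z za zr; exists D; apply: (@cdiff_near _ _ _ _ _ (nm (z - a))) hD.
    by rewrite nm_gt0 subr_eq0.
  by move=> w wz; rewrite /slope; case: eqP => // wa; move: wz; rewrite wa nm_subC ltxx.
have [c [D hD]] : exists c D, cdiff (fun z => if z == a then c else (f z - f a) / (z - a)) a D.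
  apply: (removable r0) => [w /andP[w0 wr]|e e0].
    by apply: hq => //; rewrite -subr_eq0 -nm_gt0.
  have [d d0 hd] := cdiff_cont da e0; exists d => // w /andP[w0 /hd wd].
  by rewrite mulrC divfK -?nm_gt0 // ltW.
have cE : c = dv f a.
  apply/esym/dvE; exists (fun z => if z == a then c else (f z - f a) / (z - a)).
  split; last by rewrite eqxx.
  - move=> w; case: eqP => [->|/eqP wa]; first by rewrite !subrr mulr0.
    by rewrite divfK // subr_eq0.
  - exact: cdiff_cont hD.
by exists D; rewrite /slope -cE.
Qed.

Lemma dv_slope f a r z : 0 < r -> (forall z, nm (z - a) < r -> exists D, cdiff f z D) ->
  nm (z - a) < r -> dv f z = slope f a z + (z - a) * dv (slope f a) z.
Proof.
move=> r0 hf zr; apply: dvE; have ds := dvP (slope_cdiff r0 hf zr).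
have h1 := cdiffM (cdiffB (cdiff_id z) (cdiff_cst a z)) ds.
rewrite subr0 mul1r in h1.
have := cdiffD (cdiff_cst (f a) z) h1; rewrite add0r; apply: cdiff_ext => w.
by rewrite -slopeE //; apply: hf; rewrite subrr nm0.
Qed.

Lemma dv_cont f a r : 0 < r -> (forall z, nm (z - a) < r -> exists D, cdiff f z D) -> ccont (dv f) a.
Proof.
move=> r0 hf e e0; have ra : nm (a - a) < r by rewrite subrr nm0.
have hs := slope_cdiff r0 hf; set g := slope f a in hs *.
have cg : ccont g a by have [D /cdiff_cont] := hs a ra.
have [s s0 gs] := ccont_bounded cg; set M := nm (g a) + 1 in gs.
have M0 : 0 <= M by rewrite addr_ge0 ?nm_ge0.
pose t := Num.min r s / 2; have t0 : 0 < t by rewrite divr_gt0 // lt_min r0.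
have [tr ts] : t + t <= r /\ t + t <= s.
  by rewrite /t -splitr !ge_min !lexx orbT.
have gb z : nm (z - a) < t -> nm (dv g z) <= 12 * M / t.
  move=> zt; have tri w : nm (w - z) < t -> nm (w - a) < t + t.
    by move=> wz; apply: le_lt_trans (nm_tri z _ _) _; apply: ltrD.
  have [] // := @Taylor1 g z t M t0.
    by move=> w /tri wa; apply: hs; apply: lt_le_trans tr.
  by move=> w /tri wa; apply: gs; apply: lt_le_trans ts.
have [d d0 hd] := cg (e / 2) ltac:(by rewrite divr_gt0).
pose K := 12 * M / t + 1.
have K0 : 0 < K by apply: ltr_wpDl => //; apply: divr_ge0; lra.
exists (Num.min (Num.min t d) (e / 2 / K)) => [|z].
  by rewrite !lt_min t0 d0 !divr_gt0.
rewrite !lt_min => /andP[/andP[zt /hd zd] zK].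
rewrite (dv_slope r0 hf ra) subrr mul0r addr0 (dv_slope (z := z) r0 hf); last by lra.
rewrite addrAC; apply: le_lt_trans (nmD _ _) _; rewrite -/g nmM.
have h1 := gb z zt; rewrite ltr_pdivlMr // in zK.
have h2 : nm (z - a) * nm (dv g z) <= nm (z - a) * K.
  by rewrite ler_wpM2l ?nm_ge0 //; apply: le_trans h1 _; rewrite lerDl.
lra.
Qed.

(** f' = g + (z - a) g' with g the slope at a. The second summand is differentiable at a as soon as
    g' is continuous there, which is [dv_cont] for g. *)
Lemma dv_cdiff f a r : 0 < r -> (forall z, nm (z - a) < r -> exists D, cdiff f z D) ->
  exists D, cdiff (dv f) a D.
Proof.
move=> r0 hf; have ra : nm (a - a) < r by rewrite subrr nm0.
have hs := slope_cdiff r0 hf; have [D hD] := hs a ra.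
have h2 : cdiff (fun z => (z - a) * dv (slope f a) z) a (dv (slope f a) a).
  exists (dv (slope f a)); split => //.
    by move=> w; rewrite subrr mul0r subr0 mulrC.
  exact: dv_cont r0 hs.
eexists; apply: (@cdiff_near _ _ _ _ _ r r0 _ (cdiffD hD h2)) => w wr.
by rewrite -(dv_slope r0 hf wr).
Qed.

Lemma disc_H a z : nm (z - a) < Im a -> 0 < Im z.
Proof. by move=> h; have := nm_Im (z - a); rewrite raddfB /= ler_norml => /andP[]; lra. Qed.

Lemma holoH_disc f a : holoH f -> forall z, nm (z - a) < Im a -> exists D, cdiff f z D.
Proof. by move=> hf z /disc_H; exact: hf. Qed.

Lemma holoH_dv f : holoH f -> holoH (dv f).
Proof. by move=> hf a a0; exact: (dv_cdiff a0 (holoH_disc hf)). Qed.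

Lemma holoH_slope f a : holoH f -> 0 < Im a -> holoH (slope f a).
Proof.
move=> hf a0 z z0; have [->|za] := eqVneq z a.
  by apply: (slope_cdiff a0 (holoH_disc hf)); rewrite subrr nm0.
have [D hD] := hf z z0; eexists.
apply: (@cdiff_near _ (fun z => (f z - f a) / (z - a)) _ _ _ (nm (z - a))); first by rewrite nm_gt0 subr_eq0.
  by move=> w wz; rewrite /slope; case: eqP => // wa; move: wz; rewrite wa nm_subC ltxx.
apply: cdiffM; first by apply: cdiffB hD (cdiff_cst _ _).
by apply: cdiffV; [rewrite subr_eq0 | apply: cdiffB (cdiff_id _) (cdiff_cst _ _)].
Qed.

Lemma holoHD f g : holoH f -> holoH g -> holoH (fun z => f z + g z).
Proof. by move=> hf hg z z0; have [D hD] := hf z z0; have [E hE] := hg z z0; eexists; exact: cdiffD hD hE. Qed.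
Lemma holoHB f g : holoH f -> holoH g -> holoH (fun z => f z - g z).
Proof. by move=> hf hg z z0; have [D hD] := hf z z0; have [E hE] := hg z z0; eexists; exact: cdiffB hD hE. Qed.
Lemma holoHM f g : holoH f -> holoH g -> holoH (fun z => f z * g z).
Proof. by move=> hf hg z z0; have [D hD] := hf z z0; have [E hE] := hg z z0; eexists; exact: cdiffM hD hE. Qed.
Lemma holoHZ (c : C) f : holoH f -> holoH (fun z => c * f z).
Proof. by move=> hf z z0; have [D hD] := hf z z0; eexists; exact: cdiffZ hD. Qed.
Lemma holoH_cst (c : C) : holoH (fun=> c). Proof. by move=> z _; exists 0; exact: cdiff_cst. Qed.
Lemma holoHX f n : holoH f -> holoH (fun z => f z ^+ n).
Proof. by move=> hf z z0; have [D hD] := hf z z0; eexists; exact: cdiffX hD. Qed.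
Lemma holoHV f : holoH f -> (forall z, 0 < Im z -> f z != 0) -> holoH (fun z => (f z)^-1).
Proof. by move=> hf f0 z z0; have [D hD] := hf z z0; eexists; apply: cdiffV hD; exact: f0. Qed.
Lemma holoH_sum I (s : seq I) (P : pred I) (F : I -> C -> C) : (forall i, P i -> holoH (F i)) ->
  holoH (fun z => \sum_(i <- s | P i) F i z).
Proof.
move=> hF; elim: s => [|i s ih].
  have -> : (fun z => \sum_(i <- [::] | P i) F i z) = fun=> 0 by apply/funext => z; rewrite big_nil.
  exact: holoH_cst.
have -> : (fun z => \sum_(i <- i :: s | P i) F i z) =
   fun z => (if P i then F i z else 0) + \sum_(i <- s | P i) F i z.
  by apply/funext => z; rewrite big_cons; case: (P i) => //; rewrite add0r.
apply: (@holoHD (fun z => if P i then F i z else 0)) ih.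
by case: (boolP (P i)) => [/hF//|_]; exact: holoH_cst.
Qed.
Lemma holoH_prod I (s : seq I) (P : pred I) (F : I -> C -> C) : (forall i, P i -> holoH (F i)) ->
  holoH (fun z => \prod_(i <- s | P i) F i z).
Proof.
move=> hF; elim: s => [|i s ih].
  have -> : (fun z => \prod_(i <- [::] | P i) F i z) = fun=> 1 by apply/funext => z; rewrite big_nil.
  exact: holoH_cst.
have -> : (fun z => \prod_(i <- i :: s | P i) F i z) =
   fun z => (if P i then F i z else 1) * \prod_(i <- s | P i) F i z.
  by apply/funext => z; rewrite big_cons; case: (P i) => //; rewrite mul1r.
apply: (@holoHM (fun z => if P i then F i z else 1)) ih.
by case: (boolP (P i)) => [/hF//|_]; exact: holoH_cst.
Qed.
Lemma holoH_eq f g : (forall z, 0 < Im z -> f z = g z) -> holoH f -> holoH g.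
Proof.
move=> fg hf z z0; have [D hD] := hf z z0; exists D; apply: (cdiff_near z0) hD => w /disc_H.
exact: fg.
Qed.

(** Near a zero of E the quotient is that of the two slopes, and the slope of E is nonzero there
    because the zero is simple. *)
Theorem holoH_quotient f E : holoH f -> holoH E ->
  (forall z, 0 < Im z -> E z = 0 -> f z = 0 /\ dv E z != 0) ->
  exists2 g, holoH g & forall z, 0 < Im z -> f z = E z * g z.
Proof.
move=> hf hE hz; exists (fun z => if E z == 0 then dv f z / dv E z else f z / E z); last first.
  move=> z z0; case: eqP => [e0|/eqP e0]; last by rewrite mulrC divfK.
  by have [-> _] := hz z z0 e0; rewrite e0 mul0r.
move=> a a0; have ra : nm (a - a) < Im a by rewrite subrr nm0.
have [e0|e0] := eqVneq (E a) 0; last first.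
  have [r r0 hr] : exists2 r, 0 < r & forall z, nm (z - a) < r -> E z != 0.
    by apply: ccont_neq0 => //; have [D /cdiff_cont] := hE a a0.
  have [D hD] := hf a a0; have [D' hD'] := hE a a0; eexists.
  by apply: (@cdiff_near _ _ _ _ _ r r0 _ (cdiffM hD (cdiffV e0 hD'))) => w /hr/negPf ->.
have [f0 dE0] := hz a a0 e0.
have [D1 h1] := slope_cdiff a0 (holoH_disc hf) ra.
have [D2 h2] := slope_cdiff a0 (holoH_disc hE) ra.
have sE0 : slope E a a != 0 by rewrite /slope eqxx.
have [r r0 hr] := ccont_neq0 (cdiff_cont h2) sE0.
eexists; apply: (@cdiff_near _ _ _ _ _ r r0 _ (cdiffM h1 (cdiffV sE0 h2))) => w wr.
have [->|wa] := eqVneq w a; first by rewrite e0 /slope eqxx eqxx.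
have dEa : exists D, cdiff E a D by apply: hE.
have dfa : exists D, cdiff f a D by apply: hf.
have wa0 : w - a != 0 by rewrite subr_eq0.
have Ew : E w = (w - a) * slope E a w by rewrite {1}(slopeE w dEa) e0 add0r.
have fw : f w = (w - a) * slope f a w by rewrite {1}(slopeE w dfa) f0 add0r.
have Ew0 : E w != 0 by rewrite Ew mulf_neq0 // hr.
by rewrite (negPf Ew0) fw Ew -mulf_div divff // mul1r.
Qed.

Lemma cint_swap (g : R -> C) x y : cint g y x = - cint g x y.
Proof. by apply/eqP; rewrite -addr_eq0 cint_chasles /cint /oint !subrr. Qed.

Lemma rint_swapx (F : C -> C) (a b c d : R) : rint F b a c d = - rint F a b c d.
Proof.
by rewrite /rint (cint_swap (fun x => F (pt x c)) a) (cint_swap (fun x => F (pt x d)) a); ring.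
Qed.
Lemma rint_swapy (F : C -> C) (a b c d : R) : rint F a b d c = - rint F a b c d.
Proof.
by rewrite /rint (cint_swap (fun y => F (pt b y)) c) (cint_swap (fun y => F (pt a y)) c); ring.
Qed.

Lemma cint_bound' (g : R -> C) (M : R) x y : rcont g ->
  (forall s, `|s - x| <= `|y - x| -> nm (g s) <= M) -> nm (cint g x y) <= 2 * M * `|y - x|.
Proof.
move=> cg hM; have [xy|yx] := leP x y.
  rewrite ger0_norm ?subr_ge0 //; apply: cint_bound => // s hs; apply: hM.
  by rewrite !ger0_norm ?subr_ge0 //; lra.
rewrite cint_swap nmN distrC gtr0_norm ?subr_gt0 //; apply: cint_bound => //; first exact: ltW.
by move=> s hs; apply: hM; rewrite distrC [`|y - x|]distrC !ger0_norm ?subr_ge0 //; lra.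
Qed.

(** The integral from i along an L-shaped path, horizontal and then vertical. By Goursat the
    horizontal leg may be slid to the height of z when z varies. *)
Definition Lint (F : C -> C) z : C := cint (fun x => F (pt x 1)) 0 (Re z) + 'i%C * cint (fun y => F (pt (Re z) y)) 1 (Im z).

Lemma Lint_cdiff (F : C -> C) (h : R) z : h < 1 -> h < Im z -> (forall w, ccont F w) ->
  (forall w, h < Im w -> exists D, cdiff F w D) -> cdiff (Lint F) z (F z).
Proof.
move=> h1 hz cF dF; apply/cdiffP => e e0.
have [d d0 hd] := cF z (e / 4) ltac:(by rewrite divr_gt0).
exists (Num.min (d / 2) (Im z - h)) => [|k].
  by rewrite lt_min divr_gt0 // subr_gt0.
rewrite lt_min => /andP[kd kh].
move: k kd kh => [u v] kd kh; move: z hz hd kh => [x y] /= hz hd kh.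
have nu := nm_Re (u +i* v)%C; have nv := nm_Im (u +i* v)%C; rewrite /= in nu nv.
have G0 (a b c c' : R) : h < c -> h < c' -> rint F a b c c' = 0.
  move=> hc hc'; have G1 (a' b' s t : R) : a' <= b' -> s <= t -> h < s -> rint F a' b' s t = 0.
    by move=> ab st hs; apply: Goursat => // X Y _ /andP[hY _]; apply: dF => /=; apply: lt_le_trans hY.
  have [ab|/ltW ab] := leP a b; have [cc|/ltW cc] := leP c c'.
  - exact: G1.
  - by rewrite rint_swapy G1 ?oppr0.
  - by rewrite rint_swapx G1 ?oppr0.
  - by rewrite rint_swapx rint_swapy G1 ?oppr0.
have yv : h < y + v.
  by move: nv; rewrite ler_norml => /andP[hv _]; move: kh; lra.
have := G0 x (x + u) 1 y h1 hz; rewrite /rint => hG.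
have -> : Lint F ((x +i* y)%C + (u +i* v)%C) - Lint F (x +i* y)%C - F (x +i* y)%C * (u +i* v)%C =
  (cint (fun s => F (pt s y) - F (pt x y)) x (x + u)) +
  'i%C * cint (fun s => F (pt (x + u) s) - F (pt x y)) y (y + v).
  have cst (a b : R) : cint (fun=> F (pt x y)) a b = F (pt x y) * ofR (b - a) by exact: cint_cst.
  rewrite !cintB; try exact: rcont_h; try exact: rcont_v; try (by apply: (rcont_h (F := fun=> F (pt x y)) 0 (fun w => ccont_cst _ w))).
  rewrite !cst /Lint /= -(cint_chasles _ 0 x (x + u)) -(cint_chasles (fun y => F (pt (x + u) y)) 1 y (y + v)).
  have -> : (u +i* v)%C = ofR u + 'i%C * ofR v by apply: complex_eqE; rewrite raddfD ?cReM ?cImM /=; ring.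
  rewrite ![_ + _ - x]addrC ![_ + _ - y]addrC !addKr -/(pt x y).
  move: hG; set A := cint (fun x => F (pt x 1)) x (x + u) => hG.
  have -> : A = cint (fun x0 : R => F (pt x0 y)) x (x + u) - 'i%C * (cint (fun y0 : R => F (pt (x + u) y0)) 1 y - cint (fun y0 : R => F (pt x y0)) 1 y).
    by apply/eqP; rewrite -subr_eq0 -hG; apply/eqP; ring.
  ring.
have b1 : nm (cint (fun s => F (pt s y) - F (pt x y)) x (x + u)) <= 2 * (e / 4) * `|u|.
  have -> : `|u| = `|x + u - x| by congr `|_|; rewrite addrC addKr.
  apply: cint_bound'.
    exact: (rcontD (rcont_h y cF) (rcont_h (F := fun=> - F (pt x y)) 0 (fun w => ccont_cst _ w))).
  move=> s hs; apply/ltW/hd; rewrite pt_sub subrr; apply: le_lt_trans (nm_pt _ _) _.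
  rewrite normr0 addr0; apply: le_lt_trans hs _; rewrite [x + u]addrC addrK; lra.
have b2 : nm (cint (fun s => F (pt (x + u) s) - F (pt x y)) y (y + v)) <= 2 * (e / 4) * `|v|.
  have -> : `|v| = `|y + v - y| by congr `|_|; rewrite addrC addKr.
  apply: cint_bound'.
    exact: (rcontD (rcont_v (x + u) cF) (rcont_h (F := fun=> - F (pt x y)) 0 (fun w => ccont_cst _ w))).
  move=> s hs; apply/ltW/hd; rewrite pt_sub; apply: le_lt_trans (nm_pt _ _) _.
  rewrite [x + u]addrC addrK; rewrite [y + v]addrC addrK in hs; lra.
apply: le_trans (nmD _ _) _; rewrite nmM nm_i mul1r.
have k0 := nm_ge0 (u +i* v)%C.
have e4 : 0 <= 2 * (e / 4) by lra.
have b3 := ler_wpM2l e4 nu; have b4 := ler_wpM2l e4 nv; lra.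
Qed.

Theorem primitive f : holoH f -> exists G, forall z, 0 < Im z -> cdiff G z (f z).
Proof.
(* Freezing the imaginary part below height h makes f continuous on the whole plane and leaves it
   unchanged above h. The integral does not depend on h as long as h <= min (1, Im z), the path
   staying above h. *)
move=> hf; pose Fh (h : R) z := f (pt (Re z) (Num.max (Im z) h)).
pose m (y : R) := Num.min y 1.
have Fhc h : 0 < h -> forall z, ccont (Fh h) z.
  move=> h0 z; have [D /cdiff_cont cf] : exists D, cdiff f (pt (Re z) (Num.max (Im z) h)) D.
    by apply: hf; rewrite /= lt_max h0 orbT.
  move=> e e0; have [d d0 hd] := cf e e0; exists (d / 2) => [|w wz]; first by rewrite divr_gt0.
  apply: hd; rewrite pt_sub; apply: le_lt_trans (nm_pt _ _) _.
  have h1 := nm_Re (w - z); have h2 := nm_Im (w - z); rewrite !raddfB /= in h1 h2.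
  have h3 : `|Num.max (Im w) h - Num.max (Im z) h| <= `|Im w - Im z|.
    have h4 := ler_norm (Im w - Im z); have h5 := ler_norm (- (Im w - Im z)); rewrite normrN in h5.
    by rewrite !maxEle; case: (leP (Im w) h) => ?; case: (leP (Im z) h) => ?; rewrite ler_norml; lra.
  lra.
have Fhd h : 0 < h -> forall w, h < Im w -> exists D, cdiff (Fh h) w D.
  move=> h0 w hw; have w0 : 0 < Im w by apply: lt_trans hw.
  have [D hD] := hf w w0; exists D; apply: (@cdiff_near _ _ _ _ _ (Im w - h)) hD; first by rewrite subr_gt0.
  move=> z zw; rewrite /Fh [in LHS](ptE z); congr f; congr pt; apply/esym/max_idPl.
  have := nm_Im (z - w); rewrite raddfB ler_norml /= => /andP[h1 _]; lra.
have Lh h k z : 0 < h -> h <= 1 -> h <= Im z -> 0 < k -> k <= 1 -> k <= Im z -> Lint (Fh h) z = Lint (Fh k) z.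
  have H h' k' y0 y1 x : 0 < h' -> 0 < k' -> y0 <= y1 -> h' <= y0 -> k' <= y0 ->
      cint (fun y => Fh h' (pt x y)) y0 y1 = cint (fun y => Fh k' (pt x y)) y0 y1.
    move=> h0 k0 y01 hy ky; apply: eq_cint => //; try by apply: rcont_v; apply: Fhc.
    by move=> y hyy; rewrite /Fh /= !(max_idPl _) //; lra.
  move=> h0 h1 hz k0 k1 kz; rewrite /Lint; congr (_ + _ * _).
    by congr cint; apply/funext => x; rewrite /Fh /= !(max_idPl _).
  have [z1|/ltW z1] := leP 1 (Im z); first exact: H.
  by rewrite cint_swap [in RHS]cint_swap; congr (- _); apply: H.
exists (fun z => Lint (Fh (m (Im z) / 2)) z) => z z0.
have mE y : 0 < y -> [/\ 0 < m y, m y <= 1 & m y <= y].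
  by move=> y0; rewrite /m lt_min y0 ltr01 !ge_min !lexx orbT.
have [m0 m1 mz] := mE _ z0.
pose h := m (Im z) / 4.
have fE : f z = Fh h z.
  by rewrite /Fh (max_idPl _) -?ptE //; rewrite /h; lra.
rewrite fE; apply: (@cdiff_near _ (Lint (Fh h)) _ _ _ (Im z / 2)); first by rewrite divr_gt0.
  move=> w wz; have := nm_Im (w - z); rewrite raddfB ler_norml /= => /andP[hw _].
  have w2 : Im z / 2 < Im w by lra.
  have [mw0 mw1 mw] : [/\ 0 < m (Im w), m (Im w) <= 1 & m (Im w) <= Im w] by apply: mE; lra.
  by apply: Lh; rewrite /h; lra.
by apply: (@Lint_cdiff _ h) => //; [| |apply: Fhc|apply: Fhd]; rewrite /h; lra.
Qed.

End Regularity.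

(** * Unconditional sums *)

Section Summation.
Variable R : realType.
Local Notation C := R[i].
Local Notation Re := (@complex.Re R).
Local Notation Im := (@complex.Im R).
Local Notation ofR := (real_complex R).

Lemma uniq_sub_split (V : nmodType) (I : eqType) (A B : seq I) (F : I -> V) :
  uniq A -> uniq B -> {subset A <= B} ->
  \sum_(i <- B) F i = \sum_(i <- A) F i + \sum_(i <- B | i \notin A) F i.
Proof.
move=> uA uB AB; rewrite (bigID (mem A)) /=; congr (_ + _).
rewrite -big_filter; apply: perm_big; apply: uniq_perm => //; first exact: filter_uniq.
by move=> i; rewrite mem_filter; case: (boolP (i \in A)) => //= /AB.
Qed.

Definition bsum (I : eqType) (b : I -> R) (K : R) :=
  (forall i, 0 <= b i) /\ forall B : seq I, uniq B -> \sum_(i <- B) b i <= K.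

Section OneIndex.
Variable I : choiceType.
Implicit Types (f g : I -> C) (b : I -> R) (A B : seq I) (s t : C).

(** Convergence over finite subsets, with no order of summation: sums over lattices and over SL2(Z)
    may be reindexed by any bijection. *)
Definition hasSum f s := forall e : R, 0 < e -> exists A, forall B, uniq B ->
  {subset A <= B} -> nm (\sum_(i <- B) f i - s) <= e.

Lemma hasSum_unique f s t : hasSum f s -> hasSum f t -> s = t.
Proof.
move=> hs ht; apply/subr0_eq/(@nm_small0 _ _ 2) => e e0.
have [A hA] := hs e e0; have [B hB] := ht e e0.
have u := undup_uniq (A ++ B).
have h1 := hA _ u ltac:(by move=> i iA; rewrite mem_undup mem_cat iA).
have h2 := hB _ u ltac:(by move=> i iB; rewrite mem_undup mem_cat iB orbT).
set v := \sum_(i <- undup (A ++ B)) f i in h1 h2.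
have := nm_tri v s t; rewrite (nm_subC s v); lra.
Qed.

Lemma hasSumD f g s t : hasSum f s -> hasSum g t -> hasSum (fun i => f i + g i) (s + t).
Proof.
move=> hs ht e e0; have e2 : 0 < e / 2 by rewrite divr_gt0.
have [A hA] := hs _ e2; have [B hB] := ht _ e2; exists (A ++ B) => D uD sD.
have h1 := hA _ uD ltac:(by move=> i iA; apply: sD; rewrite mem_cat iA).
have h2 := hB _ uD ltac:(by move=> i iB; apply: sD; rewrite mem_cat iB orbT).
rewrite big_split /= opprD addrACA; apply: le_trans (nmD _ _) _; lra.
Qed.

Lemma hasSumZ c f s : hasSum f s -> hasSum (fun i => c * f i) (c * s).
Proof.
move=> hs e e0; have k0 : 0 < nm c + 1 by rewrite ltr_wpDl ?nm_ge0.
have [A hA] := hs (e / (nm c + 1)) ltac:(by rewrite divr_gt0); exists A => B uB AB.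
rewrite -mulr_sumr -mulrBr nmM; have h := hA B uB AB.
apply: (@le_trans _ _ ((nm c + 1) * nm (\sum_(i <- B) f i - s))).
  by rewrite ler_wpM2r ?nm_ge0 // lerDl.
by rewrite mulrC -ler_pdivlMr.
Qed.

Lemma hasSumB f g s t : hasSum f s -> hasSum g t -> hasSum (fun i => f i - g i) (s - t).
Proof.
move=> hs ht; have := hasSumD hs (hasSumZ (-1) ht); rewrite mulN1r.
by congr hasSum; apply/funext => i; rewrite mulN1r.
Qed.

Lemma hasSum_bound f s (K : R) : (forall B, uniq B -> nm (\sum_(i <- B) f i) <= K) ->
  hasSum f s -> nm s <= K.
Proof.
move=> hK hs; apply/ler_addgt0Pr => e e0; have [A hA] := hs e e0.
have h1 := hA _ (undup_uniq A) ltac:(by move=> i; rewrite mem_undup).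
have h2 := hK _ (undup_uniq A).
have := nm_sub_ge s (\sum_(i <- undup A) f i); rewrite nm_subC; lra.
Qed.

Lemma hasSum_nonneg b K : bsum b K -> exists2 S : R, hasSum (fun i => ofR (b i)) (ofR S) & S <= K.
Proof.
move=> [b0 bK]; pose E := [set x | exists2 B, uniq B & x = \sum_(i <- B) b i]%classic.
have E0 : (E !=set0)%classic by exists 0; exists [::] => //; rewrite big_nil.
have Eub : has_sup E by split => //; exists K => _ [B uB ->]; exact: bK.
exists (sup E); last by apply: ge_sup => // _ [B uB ->]; exact: bK.
move=> e e0; have [_ [A uA ->] hA] := sup_adherent e0 Eub; exists A => B uB AB.
rewrite -rmorph_sum -rmorphB nm_real ler_norml.
have h1 : \sum_(i <- B) b i <= sup E by apply: ub_le_sup; [case: Eub | exists B].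
have h2 : \sum_(i <- A) b i <= \sum_(i <- B) b i.
  by rewrite (uniq_sub_split b uA uB AB) lerDl sumr_ge0.
by move: hA h1 h2; set S := sup E; lra.
Qed.

Lemma bsum_ge0 b K : bsum b K -> 0 <= K.
Proof. by move=> [_ /(_ [::] isT)]; rewrite big_nil. Qed.

Lemma sum_dom f b K : bsum b K -> (forall i, nm (f i) <= b i) ->
  forall B, uniq B -> nm (\sum_(i <- B) f i) <= K.
Proof.
move=> [_ bK] fb B uB; apply: le_trans (nm_sum _ _ _) _; apply: le_trans (bK B uB).
by apply: ler_sum => i _; exact: fb.
Qed.

Lemma hasSum_dom f b K : bsum b K -> (forall i, nm (f i) <= b i) -> exists s, hasSum f s.
Proof.
move=> hb fb; have [b0 bK] := hb.
have [S hS _] := hasSum_nonneg hb.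
have nn (u : I -> R) : (forall i, `|u i| <= b i) -> exists S', hasSum (fun i => ofR (u i)) S'.
  (* u + b is nonnegative and at most 2 b, so the sum of u is a difference of two nonnegative
     sums. *)
  move=> hu; have hb2 : bsum (fun i => u i + b i) (K + K).
    split=> [i|B uB].
      by have := hu i; rewrite ler_norml => /andP[h _]; lra.
    rewrite big_split /=; apply: lerD; last exact: bK.
    apply: le_trans (bK B uB); apply: ler_sum => i _.
    exact: le_trans (ler_norm _) (hu i).
  have [S2 hS2 _] := hasSum_nonneg hb2; exists (ofR S2 - ofR S).
  have := hasSumB hS2 hS; congr hasSum; apply/funext => i.
  by rewrite rmorphD addrK.
have [s1 h1] := nn (fun i => Re (f i)) (fun i => le_trans (nm_Re _) (fb i)).
have [s2 h2] := nn (fun i => Im (f i)) (fun i => le_trans (nm_Im _) (fb i)).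
exists (s1 + 'i%C * s2); have := hasSumD h1 (hasSumZ 'i%C h2); congr hasSum.
by apply/funext => i; apply: complex_eqE; rewrite raddfD ?cReM ?cImM /=; ring.
Qed.

Definition csum f : C := xget 0 [set s | hasSum f s]%classic.

Lemma csumE f s : hasSum f s -> csum f = s.
Proof. by move=> h; rewrite /csum; case: xgetP => [t _ /= ht|/(_ s)//]; exact: hasSum_unique ht h. Qed.

Lemma csumP f b K : bsum b K -> (forall i, nm (f i) <= b i) -> hasSum f (csum f).
Proof. by move=> hb fb; have [s hs] := hasSum_dom hb fb; rewrite (csumE hs). Qed.

Lemma csum_bound f b K : bsum b K -> (forall i, nm (f i) <= b i) -> nm (csum f) <= K.
Proof. by move=> hb fb; apply: hasSum_bound (csumP hb fb); exact: sum_dom hb fb. Qed.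

Lemma bsumZ c b K : 0 <= c -> bsum b K -> bsum (fun i => c * b i) (c * K).
Proof.
move=> c0 [b0 bK]; split=> [i|B uB]; first by rewrite mulr_ge0.
by rewrite -mulr_sumr ler_wpM2l // bK.
Qed.

Lemma bsum_tail b K (e : R) : bsum b K -> 0 < e -> exists2 A, uniq A &
  bsum (fun i => if i \in A then 0 else b i) e.
Proof.
move=> hb e0; have [S hS _] := hasSum_nonneg hb; have [b0 bK] := hb.
have [A hA] := hS (e / 2) ltac:(by rewrite divr_gt0).
exists (undup A); first exact: undup_uniq.
split=> [i|B uB]; first by case: ifP.
pose D := undup (A ++ B).
have uD : uniq D := undup_uniq _.
have AD : {subset undup A <= D} by move=> i; rewrite !mem_undup mem_cat => ->.
have h1 := hA D uD ltac:(by move=> i iA; apply: AD; rewrite mem_undup).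
have h2 := hA (undup A) (undup_uniq _) ltac:(by move=> i; rewrite mem_undup).
rewrite -rmorph_sum -rmorphB nm_real ler_norml in h1.
rewrite -rmorph_sum -rmorphB nm_real ler_norml in h2.
have h3 := uniq_sub_split b (undup_uniq A) uD AD.
have h4 : \sum_(i <- B) (if i \in undup A then 0 else b i) <= \sum_(i <- D | i \notin undup A) b i.
  have -> : \sum_(i <- D | i \notin undup A) b i = \sum_(i <- D) (if i \in undup A then 0 else b i).
    by rewrite big_mkcond; apply: eq_bigr => i _; case: (i \in undup A).
  have BD : {subset B <= D} by move=> i; rewrite mem_undup mem_cat => ->; rewrite orbT.
  rewrite (uniq_sub_split _ uB uD BD) lerDl sumr_ge0 // => i _; by case: ifP.
lra.
Qed.

Lemma csum_split f b K A : bsum b K -> (forall i, nm (f i) <= b i) -> uniq A ->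
  csum f = \sum_(i <- A) f i + csum (fun i => if i \in A then 0 else f i).
Proof.
move=> hb fb uA; set h := (fun i => if i \in A then 0 else f i).
have hh : hasSum h (csum h).
  by apply: (csumP hb) => i; rewrite /h; case: ifP => // _; rewrite nm0; case: hb.
apply: csumE => e e0; have [D hD] := hh e e0; exists (A ++ D) => B uB sB.
have AB : {subset A <= B} by move=> i iA; apply: sB; rewrite mem_cat iA.
have := hD B uB ltac:(by move=> i iD; apply: sB; rewrite mem_cat iD orbT).
rewrite (uniq_sub_split f uA uB AB) opprD addrACA subrr add0r.
suff -> : \sum_(i <- B) h i = \sum_(i <- B | i \notin A) f i by [].
by rewrite [RHS]big_mkcond; apply: eq_bigr => i _; rewrite /h; case: (i \in A).
Qed.

(** Dominated convergence. [Q Y z] is to be read: z is beyond Y. It is used for Im z tending to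
    infinity and, with [T] = nat, for exponents tending to infinity. *)
Lemma dominated_limit (T : Type) (Q : R -> T -> Prop) (F : I -> T -> C) (l : I -> C) b K :
  bsum b K -> (forall Y Y' z, Y <= Y' -> Q Y' z -> Q Y z) ->
  (forall i z, Q 0 z -> nm (F i z) <= b i) -> (forall i, nm (l i) <= b i) ->
  (forall i (e : R), 0 < e -> exists Y, forall z, Q Y z -> nm (F i z - l i) <= e) ->
  forall e : R, 0 < e -> exists Y, forall z, Q Y z -> nm (csum (F ^~ z) - csum l) <= e.
Proof.
move=> hb Qm Fb lb Fl e e0.
have [A uA hA] := bsum_tail hb (e := e / 3) ltac:(by rewrite divr_gt0).
have [Y [Y0 hY]] : exists Y, 0 <= Y /\ forall z, Q Y z -> \sum_(i <- A) nm (F i z - l i) <= e / 3.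
  have : 0 < e / 3 by rewrite divr_gt0.
  move: (e / 3) => e' {hA uA}; elim: A e' => [|i A ih] e' e'0.
    by exists 0; split => // z _; rewrite big_nil ltW.
  have e2 : 0 < e' / 2 by rewrite divr_gt0.
  have [Y [Y0 hY]] := ih _ e2; have [Y' hY'] := Fl i _ e2.
  exists (Num.max Y Y'); split=> [|z Qz]; first by rewrite le_max Y0.
  have h1 := hY z (Qm Y (Num.max Y Y') z ltac:(by rewrite le_max lexx) Qz).
  have h2 := hY' z (Qm Y' (Num.max Y Y') z ltac:(by rewrite le_max lexx orbT) Qz).
  rewrite big_cons; lra.
exists Y => z Qz; have Fz i : nm (F i z) <= b i by apply: Fb; apply: Qm Qz.
rewrite (csum_split (f := F ^~ z) hb Fz uA) (csum_split hb lb uA).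
have t1 : nm (csum (fun i => if i \in A then 0 else F i z)) <= e / 3.
  by apply: (csum_bound hA) => i; case: ifP => //; rewrite nm0.
have t2 : nm (csum (fun i => if i \in A then 0 else l i)) <= e / 3.
  by apply: (csum_bound hA) => i; case: ifP => //; rewrite nm0.
have t3 : nm (\sum_(i <- A) F i z - \sum_(i <- A) l i) <= e / 3.
  by rewrite -sumrB; apply: le_trans (nm_sum _ _ _) (hY z Qz).
rewrite opprD addrACA; apply: le_trans (nmD _ _) _.
have := nmB (csum (fun i => if i \in A then 0 else F i z)) (csum (fun i => if i \in A then 0 else l i)).
lra.
Qed.

(** Cauchy's estimates bound the second-order Taylor remainders by a common multiple of [b i], so
    they can be summed. *)
Lemma csum_cdiff (F : I -> C -> C) b K (a : C) (r : R) : bsum b K -> 0 < r ->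
  (forall i z, nm (z - a) < r -> exists D, cdiff (F i) z D) ->
  (forall i z, nm (z - a) < r -> nm (F i z) <= b i) ->
  exists D, cdiff (fun z => csum (F ^~ z)) a D.
Proof.
move=> hb r0 hF Fb.
have [hD hT] : (forall i, nm (dv (F i) a) <= 12 / r * b i) /\
    forall i z, nm (z - a) <= r / 4 ->
      nm (F i z - F i a - dv (F i) a * (z - a)) <= 16 / r ^+ 2 * nm (z - a) ^+ 2 * b i.
  split=> [i|i z zr]; have [h1 h2] := Taylor1 r0 (hF i) (Fb i).
    by rewrite mulrAC.
  apply: le_trans (h2 z zr) _; rewrite le_eqVlt; apply/orP; left; apply/eqP; ring.
have K0 := bsum_ge0 hb.
have bD : bsum (fun i => 12 / r * b i) (12 / r * K).
  by apply: bsumZ => //; rewrite divr_ge0 // ltW.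
have sD := csumP bD hD; set D := csum _ in sD.
exists D; apply/cdiffP => e e0.
pose L := 16 * K / r ^+ 2 + 1.
have L0 : 0 < L by apply: ltr_wpDl => //; apply: divr_ge0; [rewrite mulr_ge0 | exact: sqr_ge0].
exists (Num.min (r / 4) (e / L)) => [|h]; first by rewrite lt_min !divr_gt0.
rewrite lt_min => /andP[hr he].
have sF z : nm (z - a) < r -> hasSum (F ^~ z) (csum (F ^~ z)).
  by move=> zr; apply: (csumP hb) => i; exact: Fb.
have ahr : nm (a + h - a) < r by rewrite [a + h]addrC addrK; lra.
have sh := sF _ ahr; have sa := sF a ltac:(by rewrite subrr nm0).
have := hasSumB (hasSumB sh sa) (hasSumZ h sD).
set f := (fun i => _ - _) => hf.
have hbd : bsum (fun i => 16 / r ^+ 2 * nm h ^+ 2 * b i) (16 / r ^+ 2 * nm h ^+ 2 * K).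
  by apply: bsumZ => //; rewrite mulr_ge0 ?divr_ge0 ?sqr_ge0.
have fb i : nm (f i) <= 16 / r ^+ 2 * nm h ^+ 2 * b i.
  have := hT i (a + h); rewrite [a + h - a]addrC addKr /f => /(_ (ltW hr)).
  by rewrite [h * _]mulrC.
have := hasSum_bound (sum_dom hbd fb) hf; rewrite [h * D]mulrC => h1; apply: le_trans h1 _.
have -> : 16 / r ^+ 2 * nm h ^+ 2 * K = 16 * K / r ^+ 2 * nm h * nm h by ring.
rewrite ler_wpM2r ?nm_ge0 //; move: he; rewrite ltr_pdivlMr // => /ltW; apply: le_trans.
by rewrite mulrC ler_wpM2l ?nm_ge0 // lerDl.
Qed.
End OneIndex.

Lemma hasSum_reindex (I J : choiceType) (h : I -> J) (k : J -> I) (f : J -> C) s :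
  cancel h k -> cancel k h -> hasSum f s -> hasSum (fun i => f (h i)) s.
Proof.
move=> hk kh hs e e0; have [A hA] := hs e e0; exists (map k A) => B uB AB.
have := hA (map h B); rewrite map_inj_uniq //; last exact: can_inj hk.
rewrite big_map; apply=> // j jA; rewrite -(kh j) map_f // AB // map_f //.
Qed.

(** Summability need not be known: a divergent family has [csum] equal to 0, on both sides. *)
Lemma csum_reindex (I J : choiceType) (h : I -> J) (k : J -> I) (f : J -> C) :
  cancel h k -> cancel k h -> csum (fun i => f (h i)) = csum f.
Proof.
move=> hk kh; have [[s hs]|hN] := pselect (exists s, hasSum f s).
  by rewrite (csumE hs); apply: csumE; exact: hasSum_reindex hs.
rewrite /csum; case: xgetP => [s _ hs|_]; case: xgetP => [t _ ht|_] //.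
- by case: hN; exists t.
- case: hN; exists s; have := hasSum_reindex kh hk hs.
  by congr hasSum; apply/funext => j; rewrite kh.
- by case: hN; exists t.
Qed.

Lemma bsum_inj (I J : eqType) (h : I -> J) (b : J -> R) K : injective h -> bsum b K ->
  bsum (fun i => b (h i)) K.
Proof.
move=> ih [b0 bK]; split=> // B uB; have := bK (map h B).
by rewrite map_inj_uniq // big_map; apply.
Qed.

Lemma bsum_prod (I J : eqType) (b : I -> R) (d : J -> R) K L : bsum b K -> bsum d L ->
  bsum (fun p : I * J => b p.1 * d p.2) (K * L).
Proof.
move=> [b0 bK] [d0 dL]; split=> [p|B uB]; first by rewrite mulr_ge0.
pose X := undup (map fst B); pose Y := undup (map snd B).
pose D := [seq (x, y) | x <- X, y <- Y].
have uD : uniq D by apply: allpairs_uniq; rewrite ?undup_uniq // => -[? ?] [? ?].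
have BD : {subset B <= D}.
  move=> [x y] xyB; apply/allpairsP; exists (x, y) => /=.
  by rewrite !mem_undup (map_f fst xyB) (map_f snd xyB).
apply: (@le_trans _ _ (\sum_(p <- D) b p.1 * d p.2)).
  by rewrite (uniq_sub_split _ uB uD BD) lerDl sumr_ge0 // => p _; rewrite mulr_ge0.
rewrite /D big_allpairs_dep /=.
under eq_bigr => x _ do rewrite -mulr_sumr.
rewrite -mulr_suml; apply: ler_pM; rewrite ?sumr_ge0 //; [apply: bK | apply: dL]; exact: undup_uniq.
Qed.

(* (1 + |n|)^(-3/2), a summable weight: products of these dominate the sums over
   lattices and over SL2(Z). *)
Definition wt (n : int) : R := ((1 + `|n|%:~R) * Num.sqrt (1 + `|n|%:~R))^-1.

Lemma wtN n : wt (- n) = wt n. Proof. by rewrite /wt normrN. Qed.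

Lemma wt_nat_sum N : \sum_(i < N) wt i%:Z <= 3.
Proof.
(* A telescoping bound: with a and c the square roots of m+1 and m+2, c^-3 <= 2/a - 2/c because (c -
   a)(c + a) = 1. *)
have H m : \sum_(i < m.+1) wt i%:Z <= 3 - 2 / Num.sqrt m.+1%:R.
  elim: m => [|m ih].
    rewrite big_ord1; have -> : wt 0 = 1 by rewrite /wt normr0 addr0 sqrtr1 mulr1 invr1.
    rewrite sqrtr1; lra.
  rewrite big_ord_recr /=; apply: le_trans (lerD ih (lexx _)) _.
  have E0 : 1 + `|m.+1%:Z|%:~R = m.+2%:R :> R.
    by rewrite ger0_norm // -[m.+2%:R]natr1 addrC.
  rewrite /wt E0.
  set a := Num.sqrt m.+1%:R; set c := Num.sqrt m.+2%:R.
  have a0 : 0 < a by rewrite sqrtr_gt0 ltr0n.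
  have c0 : 0 < c by rewrite sqrtr_gt0 ltr0n.
  have c2 : c ^+ 2 = m.+2%:R by rewrite sqr_sqrtr ?ler0n.
  have a2 : a ^+ 2 = m.+1%:R by rewrite sqr_sqrtr ?ler0n.
  have ac : a <= c by rewrite ler_wsqrtr // ler_nat.
  rewrite -c2 -lerBrDl.
  have E : c ^+ 2 - a ^+ 2 = 1 by rewrite c2 a2 -natrB // subSnn.
  have -> : 3 - 2 / c - (3 - 2 / a) = 2 * (c - a) / (a * c) by field; rewrite !gt_eqF.
  rewrite -(ler_pM2r (x := a * c * (c ^+ 2 * c))); last by rewrite !mulr_gt0.
  have -> : (c ^+ 2 * c)^-1 * (a * c * (c ^+ 2 * c)) = a * c by field; rewrite gt_eqF.
  have -> : 2 * (c - a) / (a * c) * (a * c * (c ^+ 2 * c)) = 2 * (c - a) * c ^+ 2 * c by field; rewrite !gt_eqF.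
  have h1 : (c - a) * (c + a) = 1 by rewrite -E; ring.
  have h2 : 1 <= 2 * (c - a) * c.
    have : 0 <= (c - a) * (c - a) by rewrite mulr_ge0 // subr_ge0.
    by move: h1; lra.
  apply: (@le_trans _ _ (c * c)); first by rewrite ler_wpM2r // ltW.
  have h3 : 0 <= (2 * (c - a) * c - 1) * (c * c).
    by rewrite mulr_ge0 ?subr_ge0 // mulr_ge0 // ltW.
  move: h3; lra.
case: N => [|N]; first by rewrite big_ord0.
by apply: le_trans (H N) _; rewrite gerBl divr_ge0 ?sqrtr_ge0.
Qed.

Lemma wt_ge0 n : 0 <= wt n.
Proof. by rewrite invr_ge0 mulr_ge0 ?sqrtr_ge0 // addr_ge0 // ler0z. Qed.

Lemma bsum_wt : bsum wt 6.
Proof.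
have HN (B : seq nat) : uniq B -> \sum_(i <- B) wt i%:Z <= 3.
  move=> uB; pose N := (\max_(i <- B) i).+1.
  have sB : {subset B <= iota 0 N}.
    by move=> i iB; rewrite mem_iota add0n ltnS; apply: (@leq_bigmax_seq _ B xpredT id i).
  apply: le_trans (wt_nat_sum N); rewrite -(big_mkord xpredT (fun i => wt i%:Z)) /index_iota subn0.
  rewrite (uniq_sub_split _ uB (iota_uniq _ _) sB) lerDl sumr_ge0 // => i _; exact: wt_ge0.
split=> [|B uB]; first exact: wt_ge0.
rewrite (bigID (fun n : int => 0 <= n)) /=.
have -> : (6 : R) = 3 + 3 by lra.
apply: lerD.
  rewrite -big_filter; set B1 := seq.filter _ B.
  have -> : \sum_(i <- B1) wt i = \sum_(i <- map absz B1) wt i%:Z.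
    rewrite big_map; apply: eq_big_seq => n; rewrite mem_filter => /andP[n0 _].
    by rewrite gez0_abs.
  apply: HN; rewrite map_inj_in_uniq ?filter_uniq // => x y.
  by rewrite !mem_filter => /andP[x0 _] /andP[y0 _] h; rewrite -(gez0_abs x0) -(gez0_abs y0) h.
rewrite -big_filter; set B1 := seq.filter _ B.
have -> : \sum_(i <- B1) wt i = \sum_(i <- map absz B1) wt i%:Z.
  rewrite big_map; apply: eq_big_seq => n; rewrite mem_filter => /andP[n0 _].
  by rewrite ltz0_abs ?wtN // ltNge.
apply: HN; rewrite map_inj_in_uniq ?filter_uniq // => x y.
rewrite !mem_filter => /andP[x0 _] /andP[y0 _] h; apply: oppr_inj.
by rewrite -(ltz0_abs (m := x)) ?ltNge // -(ltz0_abs (m := y)) ?ltNge // h.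
Qed.

End Summation.

(** * The modular group *)

Section Mobius.
Variable R : realType.
Local Notation C := R[i].
Local Notation Re := (@complex.Re R).
Local Notation Im := (@complex.Im R).
Local Notation ofR := (real_complex R).
Implicit Types (A B : SL2Z) (z w t : C).

Local Notation J := (@autf R).

Lemma cReD z w : Re (z + w) = Re z + Re w. Proof. by case: z w => [? ?] [? ?]. Qed.
Lemma cImD z w : Im (z + w) = Im z + Im w. Proof. by case: z w => [? ?] [? ?]. Qed.

Definition mob A z : C := numf A z / J A z.

Definition ea A : int := val A 0 0.
Definition eb A : int := val A 0 1.
Definition ec A : int := val A 1 0.
Definition ed A : int := val A 1 1.

Lemma edet A : ea A * ed A - eb A * ec A = 1. Proof. exact: SL2Z_detE. Qed.
Lemma JE A z : J A z = (ec A)%:~R * z + (ed A)%:~R. Proof. by []. Qed.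
Lemma numfE A z : numf A z = (ea A)%:~R * z + (eb A)%:~R. Proof. by []. Qed.

Lemma SL2Z_eq A B : ea A = ea B -> eb A = eb B -> ec A = ec B -> ed A = ed B -> A = B.
Proof. by move=> h1 h2 h3 h4; apply: val_inj; apply: mx2_entries. Qed.

Lemma J_neq0 A z : 0 < Im z -> J A z != 0.
Proof. by move=> z0; exact: (autf_neq0 A (Sub z z0 : UHP R)). Qed.
Lemma mob_gt0 A z : 0 < Im z -> 0 < Im (mob A z).
Proof. by move=> z0; exact: (Im_mobius A (Sub z z0 : UHP R)). Qed.
Lemma mobM A B z : 0 < Im z -> mob (A * B)%g z = mob A (mob B z).
Proof. by move=> z0; have /(congr1 val) := mobiusM A B (Sub z z0 : UHP R). Qed.
Lemma JM A B z : 0 < Im z -> J (A * B)%g z = J A (mob B z) * J B z.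
Proof. by move=> z0; have := autfM A B (Sub z z0 : UHP R). Qed.

Lemma edetC A : (ea A)%:~R * (ed A)%:~R - (eb A)%:~R * (ec A)%:~R = 1 :> C.
Proof. by rewrite -!rmorphM -rmorphB edet. Qed.
Lemma edetR A : (ea A)%:~R * (ed A)%:~R - (eb A)%:~R * (ec A)%:~R = 1 :> R.
Proof. by rewrite -!rmorphM -rmorphB edet. Qed.

Lemma mobB A z w : 0 < Im z -> 0 < Im w -> mob A z - mob A w = (z - w) / (J A z * J A w).
Proof.
move=> z0 w0; have hz := J_neq0 A z0; have hw := J_neq0 A w0; have d := edetC A.
rewrite /mob; apply: (mulIf (mulf_neq0 hz hw)); rewrite divfK ?mulf_neq0 // mulrBl.
have -> : numf A z / J A z * (J A z * J A w) = numf A z * J A w by field.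
have -> : numf A w / J A w * (J A z * J A w) = numf A w * J A z by field.
rewrite !numfE !JE; have -> : z - w = ((ea A)%:~R * (ed A)%:~R - (eb A)%:~R * (ec A)%:~R) * (z - w) by rewrite d mul1r.
ring.
Qed.

Lemma Re_J A z : Re (J A z) = (ec A)%:~R * Re z + (ed A)%:~R.
Proof. by rewrite JE cReD cReM /= !Re_int Im_int; ring. Qed.
Lemma Im_J A z : Im (J A z) = (ec A)%:~R * Im z.
Proof. by rewrite JE cImD cImM /= !Re_int !Im_int; ring. Qed.

Lemma nmJ2 A z : nm (J A z) ^+ 2 = ((ec A)%:~R * Re z + (ed A)%:~R) ^+ 2 + ((ec A)%:~R * Im z) ^+ 2.
Proof. by rewrite sqr_nm Re_J Im_J. Qed.

Lemma Im_mob A z : 0 < Im z -> Im (mob A z) = Im z / nm (J A z) ^+ 2.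
Proof.
move=> z0; have hz := J_neq0 A z0.
have n0 : nm (J A z) != 0 by rewrite nm_eq0.
have : Im (mob A z) * nm (J A z) ^+ 2 = Im z.
  have : mob A z * J A z = numf A z by rewrite /mob divfK.
  move: (mob A z) => w E; have E1 := congr1 Re E; have E2 := congr1 Im E.
  rewrite cReM Re_J Im_J numfE cReD cReM !Re_int !Im_int in E1; rewrite cImM Re_J Im_J numfE cImD cImM Re_int !Im_int in E2.
  rewrite nmJ2; have d := edetR A.
  move: E1 E2 d; set a := (ea A)%:~R; set b := (eb A)%:~R; set c := (ec A)%:~R; set e := (ed A)%:~R.
  set X := Re w; set Y := Im w; move=> E1 E2 d.
  have -> : Y * ((c * Re z + e) ^+ 2 + (c * Im z) ^+ 2) =
    (X * (c * Im z) + Y * (c * Re z + e)) * (c * Re z + e) -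
    (X * (c * Re z + e) - Y * (c * Im z)) * (c * Im z) by ring.
  have hz1 : Im z = (a * e - b * c) * Im z by rewrite d mul1r.
  by rewrite E1 E2 [RHS]hz1; ring.
by move=> <-; rewrite mulfK // expf_neq0.
Qed.

Lemma matT_subproof' (m : int) : \det (mx2 1 m 0 1) == 1.
Proof. by rewrite det_mx2E !mxE /= mulr1 mulr0 subr0. Qed.
Definition mT (m : int) : SL2Z := mkSL2Z (matT_subproof' m).

Lemma mT1 : mT 1 = matT. Proof. exact: val_inj. Qed.
Lemma J_mT m z : J (mT m) z = 1. Proof. by rewrite /autf !mxE /= mul0r add0r. Qed.
Lemma mob_mT m z : mob (mT m) z = z + m%:~R.
Proof. by rewrite /mob J_mT divr1 /numf !mxE /= mul1r. Qed.
Lemma J_T z : J matT z = 1. Proof. by rewrite -mT1 J_mT. Qed.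
Lemma mob_T z : mob matT z = z + 1. Proof. by rewrite -mT1 mob_mT. Qed.
Lemma J_S z : J matS z = z. Proof. by rewrite /autf !mxE /= mul1r addr0. Qed.
Lemma mob_S z : mob matS z = - z^-1.
Proof. by rewrite /mob J_S /numf !mxE /= mul0r add0r mulN1r. Qed.
Lemma mob1 z : mob 1%g z = z.
Proof. by rewrite /mob /autf /numf !mxE /= mul0r !mul1r add0r divr1 addr0. Qed.
Lemma J1 z : J 1%g z = 1.
Proof. by rewrite /autf !mxE /= mul0r add0r. Qed.

Lemma mobK A z : 0 < Im z -> mob A^-1%g (mob A z) = z.
Proof. by move=> z0; rewrite -mobM // mulVg mob1. Qed.
Lemma mobVK A z : 0 < Im z -> mob A (mob A^-1%g z) = z.
Proof. by move=> z0; rewrite -mobM // mulgV mob1. Qed.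
Lemma JV A z : 0 < Im z -> J A^-1%g (mob A z) = (J A z)^-1.
Proof.
move=> z0; apply: (mulIf (J_neq0 A z0)); rewrite -JM // mulVg J1 mulVf //.
exact: J_neq0.
Qed.

Lemma cdiff_J A z : cdiff (J A) z (ec A)%:~R.
Proof.
have := cdiffD (cdiffZ (ec A)%:~R (cdiff_id z)) (cdiff_cst (ed A)%:~R z).
by rewrite mulr1 addr0.
Qed.
Lemma cdiff_mob A z : 0 < Im z -> cdiff (mob A) z (J A z ^- 2).
Proof.
move=> z0; have hz := J_neq0 A z0.
have hn : cdiff (numf A) z (ea A)%:~R.
  have := cdiffD (cdiffZ (ea A)%:~R (cdiff_id z)) (cdiff_cst (eb A)%:~R z).
  by rewrite mulr1 addr0.
have := cdiffM hn (cdiffV hz (cdiff_J A z)); congr cdiff.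
apply: (mulIf (expf_neq0 2 hz)); rewrite mulVf ?expf_neq0 //; apply: (eq_trans _ (edetC A)).
rewrite mulrDl; have -> : (ea A)%:~R * (J A z)^-1 * J A z ^+ 2 = (ea A)%:~R * J A z by field.
have -> : numf A z * (- (ec A)%:~R / J A z ^+ 2) * J A z ^+ 2 = - numf A z * (ec A)%:~R by field.
by rewrite numfE JE; ring.
Qed.

Lemma floor_half (x : R) : exists m : int, -1 / 2 <= x + m%:~R <= 1 / 2.
Proof.
exists (- Num.floor (x + 1 / 2)); rewrite rmorphN.
have /andP[h1 h2] := floor_itv (x + 1 / 2); rewrite intrD in h2; lra.
Qed.

(** As 4/5 < sqrt 3 / 2, a point that nearly attains the supremum of Im over the orbit is high
    enough: translated to |Re| <= 1/2 and inverted by S, a lower one would exceed the supremum. *)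
Lemma fundamental z : 0 < Im z -> exists A, 4 / 5 < Im (mob A z).
Proof.
move=> z0; pose E := [set y | exists A, y = Im (mob A z)]%classic.
have E0 : (E !=set0)%classic by exists (Im (mob 1%g z)); exists 1%g.
have Eub : has_sup E.
  split=> //; exists (Num.max (Im z) (Im z)^-1) => _ [A ->]; rewrite Im_mob //.
  have n0 : 0 < nm (J A z) ^+ 2 by rewrite exprn_gt0 // nm_gt0 J_neq0.
  rewrite ler_pdivrMr // nmJ2.
  have [c0|c0] := eqVneq (ec A) 0.
    have d1 : (ed A)%:~R ^+ 2 >= 1 :> R.
      have := edet A; rewrite c0 mulr0 subr0 => h.
      have : ed A ^+ 2 >= 1 by nia.
      by rewrite -(ler_int R) rmorphXn.
    rewrite c0 !mul0r expr0n addr0 add0r; apply: le_trans (_ : Im z * 1 <= _); first by rewrite mulr1.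
    by apply: ler_pM => //; [lra | rewrite le_max lexx].
  have c1 : (ec A)%:~R ^+ 2 >= 1 :> R.
    have : ec A ^+ 2 >= 1 by move: c0; nia.
    by rewrite -(ler_int R) rmorphXn.
  have : (Im z)^-1 <= Num.max (Im z) (Im z)^-1 by rewrite le_max lexx orbT.
  set M := Num.max _ _ => hM.
  have iz : (Im z)^-1 * Im z ^+ 2 = Im z by rewrite expr2 mulrA mulVf ?mul1r // gt_eqF.
  apply: (@le_trans _ _ ((Im z)^-1 * ((ec A)%:~R * Im z) ^+ 2)).
    rewrite exprMn mulrCA iz; rewrite -[X in X <= _]mul1r; exact: ler_wpM2r (ltW z0) _ _ c1.
  apply: ler_pM => //; first by rewrite invr_ge0 ltW.
    exact: sqr_ge0.
  by rewrite lerDr sqr_ge0.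
pose s := sup E; have s0 : 0 < s.
  apply: lt_le_trans (mob_gt0 1%g z0) _; apply: ub_le_sup; [by case: Eub | by exists 1%g].
(* With error s / 20, the inequality Im w <= s |w|^2 gives 19/20 < 1/4 + (Im w)^2, and 19/20 - 1/4 =
   7/10 > (4/5)^2. *)
have [_ [A ->] hA] := @sup_adherent _ E (s / 20) ltac:(by rewrite divr_gt0) Eub.
rewrite -/s in hA.
have [m hm] := floor_half (Re (mob A z)).
pose w := mob (mT m * A)%g z.
have wE : w = mob A z + m%:~R by rewrite /w mobM // mob_mT.
have w0 : 0 < Im w by exact: mob_gt0.
have Iw : Im w = Im (mob A z) by rewrite wE raddfD /= Im_int addr0.
have Rw : Re w = Re (mob A z) + m%:~R by rewrite wE raddfD /= Re_int.
have hs : Im (mob matS w) <= s.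
  rewrite /w -mobM //; apply: ub_le_sup; [by case: Eub | by exists (matS * (mT m * A))%g].
exists (mT m * A)%g; rewrite -/w.
have n0 : 0 < nm w ^+ 2 by rewrite exprn_gt0 // nm_gt0; apply: contraTneq w0 => ->; rewrite ltxx.
rewrite Im_mob // J_S ler_pdivrMr // sqr_nm Rw in hs.
have x2 : (Re (mob A z) + m%:~R) ^+ 2 <= 1 / 4.
  move: hm; set u := _ + _ => hm; have : 0 <= (1 / 2 - u) * (u + 1 / 2) by rewrite mulr_ge0 //; lra.
  lra.
have h1 : s - s / 20 < s * (1 / 4 + Im w ^+ 2).
  apply: lt_le_trans (_ : Im w <= _); first by rewrite Iw.
  by apply: le_trans hs _; rewrite ler_wpM2l ?(ltW s0) // lerD2r.
have h2 : 19 / 20 < 1 / 4 + Im w ^+ 2.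
  rewrite -(ltr_pM2l s0); lra.
rewrite ltNge; apply/negP => h3.
have : Im w ^+ 2 <= (4 / 5) ^+ 2 by apply: lerXn2r => //; rewrite nnegrE ?ltW //; lra.
lra.
Qed.

Definition zeta : C := pt (- 1 / 2) (Num.sqrt 3 / 2).

Lemma sqrt3_gt0 : 0 < Num.sqrt 3 :> R. Proof. by rewrite sqrtr_gt0 ltr0n. Qed.
Lemma zeta_gt0 : 0 < Im zeta.
Proof. by rewrite /= divr_gt0 // sqrt3_gt0. Qed.
Lemma i_gt0 : 0 < Im ('i%C : C). Proof. exact: ltr01. Qed.

Lemma zeta2 : zeta ^+ 2 + zeta + 1 = 0.
Proof.
have h : Num.sqrt 3 ^+ 2 = 3 :> R by rewrite sqr_sqrtr // ler0n.
by apply: complex_eqE; rewrite !raddfD expr2 /= ?cReM ?cImM /=; move: h; lra.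
Qed.

Lemma fixed_quadratic A z : 0 < Im z -> mob A z = z ->
  2 * (ec A)%:~R * Re z = (ea A)%:~R - (ed A)%:~R /\
  4 * (ec A)%:~R ^+ 2 * Im z ^+ 2 = 4 - ((ea A)%:~R + (ed A)%:~R) ^+ 2.
Proof.
move=> z0 hz; have E : z * J A z = numf A z by rewrite -{1}hz /mob divfK // J_neq0.
have E1 := congr1 Re E; have E2 := congr1 Im E; have d := edetR A.
rewrite cReM Re_J Im_J numfE cReD cReM !Re_int !Im_int in E1; rewrite cImM Re_J Im_J numfE cImD cImM Re_int !Im_int in E2.
move: E1 E2 d z0; set a := (ea A)%:~R; set b := (eb A)%:~R; set c := (ec A)%:~R; set e := (ed A)%:~R.
move: (Re z) (Im z) => x y E1 E2 d y0.
have h1 : 2 * c * x = a - e.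
  apply: (mulIf (lt0r_neq0 y0)); move: E2; lra.
split=> //; have : 4 * c * (x * (c * x + e) - y * (c * y)) = 4 * c * (a * x - 0 * y + b) by rewrite E1; ring.
have h2 : (2 * c * x) ^+ 2 = (a - e) ^+ 2 by rewrite h1.
have h3 : 2 * c * x * (e - a) = (a - e) * (e - a) by rewrite h1.
move: h2 h3 d; lra.
Qed.

Lemma fixed_c0 A z : 0 < Im z -> mob A z = z -> ec A = 0 -> A \in pm1.
Proof.
move=> z0 hz c0; have [h1 _] := fixed_quadratic z0 hz.
have ad : ea A = ed A.
  by apply/eqP; rewrite -subr_eq0 -(intr_eq0 R) rmorphB -h1 c0 mulr0 mul0r.
have b0 : eb A = 0.
  have E : z * J A z = numf A z by rewrite -{1}hz /mob divfK // J_neq0.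
  move/eqP: E; rewrite JE numfE c0 mul0r add0r ad mulrC -subr_eq0 opprD addNKr oppr_eq0 intr_eq0.
  by move/eqP.
have := edet A; rewrite c0 b0 mulr0 subr0 ad => hd.
have d1 : ed A = 1 \/ ed A = -1 by nia.
by rewrite inE; apply/orP; case: d1 => d1; [left|right]; apply/eqP/mx2_entries;
  rewrite ?mxE /= -/(ea A) -/(eb A) -/(ec A) -/(ed A) ?ad ?b0 ?c0 ?d1 ?oppr0.
Qed.

(** Conjugated to a fixed point of height y > 4/5, the element satisfies 4 c^2 y^2 = 4 - t^2 with t
    its trace. Hence c^2 = 1 and |t| <= 1, so y is 1 or sqrt 3 / 2, and an integral translation
    reaches i or zeta. *)
Lemma elliptic A z : 0 < Im z -> mob A z = z -> A \notin pm1 ->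
  exists B, mob B z = 'i%C \/ mob B z = zeta.
Proof.
move=> z0 hz hA; have [B hB] := fundamental z0; set w := mob B z in hB.
have w0 : 0 < Im w by exact: mob_gt0.
pose D := (B * A * B^-1)%g.
have hw : mob D w = w by rewrite /D !mobM ?mob_gt0 // mobK // hz.
have cD : ec D <> 0.
  move=> /(fixed_c0 w0 hw) DA; move/negP: hA; apply.
  have -> : A = (D ^ B)%g by rewrite conjgE /D !mulgA mulVg mul1g mulgKV.
  exact: pm1_conj.
have [h1 h2] := fixed_quadratic w0 hw; have dD := edet D.
have y2 : 16 / 25 < Im w ^+ 2.
  have : 0 < (Im w - 4 / 5) * (Im w + 4 / 5) by rewrite mulr_gt0 //; lra.
  lra.
have c2 : ec D ^+ 2 = 1.
  have : ec D ^+ 2 < 2.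
    rewrite -(ltr_int R) rmorphXn /=.
    have : 0 <= ((ea D)%:~R + (ed D)%:~R) ^+ 2 :> R by exact: sqr_ge0.
    have : 0 <= (ec D)%:~R ^+ 2 :> R by exact: sqr_ge0.
    nra.
  by move: cD; nia.
have c2R : (ec D)%:~R ^+ 2 = 1 :> R by rewrite -rmorphXn c2.
rewrite c2R mulr1 in h2.
have t2 : (ea D + ed D) ^+ 2 < 2.
  by rewrite -(ltr_int R) rmorphXn /= rmorphD; move: h2 y2; lra.
have ht : ea D + ed D = 0 \/ (ea D + ed D = 1 \/ ea D + ed D = -1) by nia.
have x1 : 2 * Re w = (ec D)%:~R * ((ea D)%:~R - (ed D)%:~R).
  rewrite -h1; have -> : (ec D)%:~R * (2 * (ec D)%:~R * Re w) = (ec D)%:~R ^+ 2 * (2 * Re w) by ring.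
  by rewrite c2R mul1r.
case: ht => ht.
  have htR : (ea D)%:~R + (ed D)%:~R = 0 :> R by rewrite -rmorphD ht.
  have y1 : Im w = 1.
    apply/eqP; rewrite -(eqrXn2 (n := 2)) ?ltW // expr1n; apply/eqP.
    by move: h2; rewrite htR expr0n /=; lra.
  exists (mT (- (ec D * ea D)) * B)%g; left; rewrite mobM // mob_mT -/w.
  apply: complex_eqE; rewrite raddfD /= ?Re_int ?Im_int ?addr0 // rmorphN rmorphM /=.
  by move: x1 htR; nra.
have ht2 : ((ea D)%:~R + (ed D)%:~R) ^+ 2 = 1 :> R.
  by rewrite -rmorphD; case: ht => ->; rewrite ?rmorphN ?sqrrN expr1n.
have y1 : Im w = Num.sqrt 3 / 2.
  apply/eqP; rewrite -(eqrXn2 (n := 2)) ?ltW ?divr_gt0 ?sqrt3_gt0 // expr_div_n sqr_sqrtr ?ler0n //.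
  by apply/eqP; move: h2; rewrite ht2; lra.
(* The trace is odd, hence so is a - d: 2 Re w is an odd integer, and a translation brings Re w to
   -1/2. *)
have [m hm] : exists m : int, ec D * (ea D - ed D) = 2 * m - 1.
  have c1 : ec D = 1 \/ ec D = -1 by move: c2; nia.
  case: c1 => ->; case: ht => ht.
  - by exists (ea D); lia.
  - by exists (ea D + 1); lia.
  - by exists (1 - ea D); lia.
  - by exists (- ea D); lia.
exists (mT (- m) * B)%g; right; rewrite mobM // mob_mT -/w.
apply: complex_eqE; rewrite raddfD /= ?Re_int ?Im_int ?addr0 // rmorphN.
have := congr1 (fun k : int => k%:~R : R) hm; rewrite rmorphM !rmorphB rmorphM /=.
by move: x1; lra.
Qed.

Lemma stab_i A : mob A 'i%C = 'i%C -> A \in pm1 \/ (matS * A)%g \in pm1.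
Proof.
move=> h; have [h1 h2] := fixed_quadratic i_gt0 h; rewrite /= mulr0 in h1.
have ad : ea A = ed A by apply/eqP; rewrite -subr_eq0 -(intr_eq0 R) rmorphB -h1.
have h3 : ec A ^+ 2 = 1 - ea A ^+ 2.
  apply/eqP; rewrite -(eqr_int R) rmorphB !rmorphXn /=; apply/eqP.
  by move: h2; rewrite /= ad expr1n; lra.
have [c0|a0] : ec A = 0 \/ ea A = 0 by nia.
  by left; exact: fixed_c0 i_gt0 h c0.
right; have S0 : mob (matS * A)%g ('i%C : C) = 'i%C.
  by rewrite mobM ?i_gt0 // h mob_S; apply: complex_eqE; rewrite /=; field.
apply: (fixed_c0 i_gt0 S0); rewrite /ec SL2Z_valM mulmx2E -/(ea A) a0 mulr0 add0r -/(ec A).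
by rewrite !mxE /= mul0r.
Qed.

Lemma mob_R_zeta : mob matR zeta = zeta.
Proof.
have z0 := zeta_gt0; rewrite /matR mobM // mob_T mob_S.
have z1 : zeta + 1 != 0.
  by apply/eqP => /(congr1 Im); rewrite raddfD /= addr0 => h; move: z0; rewrite /= h ltxx.
apply: (mulIf z1); rewrite mulNr mulVf //.
by apply/eqP; rewrite -subr_eq0; apply/eqP; move: zeta2 => h; rewrite -[RHS]oppr0 -h; ring.
Qed.

Lemma stab_zeta A : mob A zeta = zeta ->
  [\/ A \in pm1, (matR * A)%g \in pm1 | (matR * (matR * A))%g \in pm1].
Proof.
move=> h; have z0 := zeta_gt0; have [h1 h2] := fixed_quadratic z0 h; have d := edet A.
have ad : ed A = ea A + ec A.
  apply/eqP; rewrite -(eqr_int R) rmorphD; apply/eqP; move: h1; rewrite /=; lra.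
have h3 : 3 * ec A ^+ 2 = 4 - (ea A + ed A) ^+ 2.
  apply/eqP; rewrite -(eqr_int R) rmorphB rmorphM !rmorphXn rmorphD /=; apply/eqP.
  move: h2; rewrite /= expr_div_n sqr_sqrtr ?ler0n //; lra.
have hR : mob (matR * A)%g zeta = zeta by rewrite mobM // h mob_R_zeta.
have hRR : mob (matR * (matR * A))%g zeta = zeta by rewrite mobM // hR mob_R_zeta.
have vR : val matR = mx2 0 (-1) 1 1.
  by apply: mx2_entries; rewrite /matR SL2Z_valM mulmx2E !mxE.
have cR B : ec (matR * B)%g = ea B + ec B.
  by rewrite /ec SL2Z_valM mulmx2E vR !mxE /= !mul1r.
have aR B : ea (matR * B)%g = - ec B.
  by rewrite /ea SL2Z_valM mulmx2E vR !mxE /= mul0r add0r mulN1r.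
have : ec A = 0 \/ (ea A + ec A = 0 \/ ea A = 0) by nia.
case=> [c0|[c0|a0]].
- by apply: Or31; exact: fixed_c0 z0 h c0.
- by apply: Or32; apply: (fixed_c0 z0 hR); rewrite cR.
- by apply: Or33; apply: (fixed_c0 z0 hRR); rewrite !cR aR a0 add0r addNr.
Qed.

End Mobius.

(** Euclid's algorithm on the first column (a, c): S T^(-q) turns it into (-c, a - q c), with q the
    quotient of a by c. When c = 0 there remains a translation up to sign, and S^2 = -1. *)
Lemma SL2Z_ind (P : SL2Z -> Prop) : P matS -> P matT ->
  (forall A B, P A -> P B -> P (A * B)%g) -> (forall A, P A -> P A^-1%g) -> forall A, P A.
Proof.
move=> PS PT PM PV.
have P1 : P 1%g by rewrite -(mulgV matS); apply: PM => //; apply: PV.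
have PTn m : P (mT m).
  have Tn (n : nat) : P (mT n%:Z).
    elim: n => [|n ih].
      have -> : mT 0 = 1%g by apply: val_inj; apply: mx2_entries; rewrite !mxE.
      exact: P1.
    have -> : mT n.+1 = (mT n * matT)%g.
      by apply: val_inj; apply: mx2_entries; rewrite /= mulmx2E !mxE /=; lia.
    exact: PM.
  case: m => n; first exact: Tn.
  have -> : mT (Negz n) = (mT n.+1)^-1%g; last exact/PV/Tn.
  apply: (mulIg (mT n.+1)); rewrite mulVg.
  by apply: val_inj; apply: mx2_entries; rewrite /= mulmx2E !mxE /=; lia.
have eST B m : ec (matS * (mT m * B))%g = ea B + m * ec B /\ ea (matS * (mT m * B))%g = - ec B.
  rewrite /ec /ea !SL2Z_valM !mulmx2E !mxE /=; split; lia.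
move=> A; have [n hn] : exists n : nat, (absz (ec A) < n)%N by exists (absz (ec A)).+1.
elim: n A hn => // n ih A hn.
have [c0|c0] := eqVneq (ec A) 0.
  have d := edet A; rewrite c0 mulr0 subr0 in d.
  have [ad|ad] : ea A = 1 /\ ed A = 1 \/ ea A = -1 /\ ed A = -1.
    have [h|[h|[h|[h|h]]]] : ea A <= -2 \/ (ea A = -1 \/ (ea A = 0 \/ (ea A = 1 \/ 2 <= ea A))) by lia.
    - by have [e1|e1] : ed A <= -1 \/ 0 <= ed A; [lia|nia|nia].
    - by right; rewrite h in d *; lia.
    - by rewrite h mul0r in d.
    - by left; rewrite h in d *; lia.
    - by have [e1|e1] : ed A <= 0 \/ 1 <= ed A; [lia|nia|nia].
    have -> : A = mT (eb A); last exact: PTn.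
    by apply: SL2Z_eq; rewrite ?c0 ?ad.1 ?ad.2 /ea /eb /ec /ed !mxE.
  have -> : A = (matS * matS * mT (- eb A))%g; last by apply/PM => //; apply/PM.
  by apply: SL2Z_eq; rewrite ?c0 ?ad.1 ?ad.2 /ea /eb /ec /ed !SL2Z_valM !mulmx2E !mxE /=; lia.
pose q := (ea A %/ ec A)%Z.
have hq : ea A = q * ec A + (ea A %% ec A)%Z by exact: divz_eq.
have hr : (0 <= (ea A %% ec A)%Z) && ((ea A %% ec A)%Z < `|ec A|).
  by rewrite modz_ge0 // ltz_mod.
have [e1 e2] := eST A (- q).
have hB : P (matS * (mT (- q) * A))%g.
  apply: ih; rewrite e1; move: hr hn; rewrite {2}hq; set r := (ea A %% ec A)%Z; lia.
have -> : A = ((mT (- q))^-1 * (matS^-1 * (matS * (mT (- q) * A))))%g by rewrite !mulKg.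
by apply/PM; [apply/PV/PTn | apply/PM => //; apply/PV].
Qed.

(** * Vanishing of invariant functions that decay at the cusp *)

Section Siegel.
Variable R : realType.
Local Notation C := R[i].
Local Notation Re := (@complex.Re R).
Local Notation Im := (@complex.Im R).
Local Notation ofR := (real_complex R).
Local Notation J := (@autf R).
Implicit Types (f g : C -> C) (A B : SL2Z) (z w t : C).

(* Contraction argument: the invariant function |u| Im^k is bounded by its values
   in the fundamental domain, which the decay at infinity compares with those on
   the line Im = h just below it. *)
Lemma siegel_gen (I : Type) (u : I -> C -> C) (k : int) (phi : R -> R) (th : R) (h := 79 / 100 : R) :
  (forall i A z, 0 < Im z -> exists i',
     nm (u i (mob A z)) * Im (mob A z) ^ k = nm (u i' z) * Im z ^ k) ->
  (forall i (M : R), (forall x, nm (u i (pt x h)) <= M) -> forall z, h < Im z ->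
     nm (u i z) <= M * phi (Im z)) ->
  (exists M : R, forall i x, nm (u i (pt x h)) <= M) ->
  0 < th < 1 -> (forall y, 4 / 5 < y -> phi y * (y / h) ^ k <= th) ->
  forall i z, 0 < Im z -> u i z = 0.
Proof.
move=> hinv hdec [M hM] /andP[th0 th1] hk.
have h0 : 0 < h by rewrite /h; lra.
have step (B : R) : 0 <= B -> (forall i x, nm (u i (pt x h)) * h ^ k <= B) ->
    forall i z, 0 < Im z -> nm (u i z) * Im z ^ k <= B * th.
  move=> B0 hB i z z0; have [A hA] := fundamental z0.
  have hkp : 0 < h ^ k by rewrite exprz_gt0.
  have hA' : h < Im (mob A z) by apply: lt_trans hA; rewrite /h; lra.
  have [i' <-] : exists i', nm (u i' (mob A z)) * Im (mob A z) ^ k = nm (u i z) * Im z ^ k.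
    have [i' hi'] := hinv i A^-1%g (mob A z) (mob_gt0 A z0).
    by exists i'; rewrite -hi' mobK.
  set y := Im (mob A z) in hA hA' *.
  have y0 : 0 < y by apply: lt_trans hA'.
  have bl x : nm (u i' (pt x h)) <= B / h ^ k by rewrite ler_pdivlMr.
  apply: le_trans (ler_wpM2r _ (hdec i' _ bl _ hA')) _; first by rewrite exprz_ge0 // ltW.
  have yh : y ^ k = (y / h) ^ k * h ^ k by rewrite -expfzMl divfK // gt_eqF.
  rewrite -/y yh.
  have -> : B / h ^ k * phi y * ((y / h) ^ k * h ^ k) =
     B * (phi y * (y / h) ^ k) by field; rewrite gt_eqF.
  by apply: ler_wpM2l => //; apply: hk.
have [B B0 hB] : exists2 B, 0 <= B & forall n i z, 0 < Im z -> nm (u i z) * Im z ^ k <= B * th ^+ n.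
  pose B := Num.max 0 (M * h ^ k).
  have B0 : 0 <= B by rewrite le_max lexx.
  have BM i x : nm (u i (pt x h)) * h ^ k <= B.
    by rewrite le_max ler_wpM2r ?orbT // exprz_ge0 // ltW.
  exists (B * th); first by rewrite mulr_ge0 // ltW.
  elim=> [|n ih] i z z0; first by rewrite expr0 mulr1; exact: step.
  rewrite exprSr mulrA; apply: step => //; first by rewrite !mulr_ge0 ?exprn_ge0 // ltW.
  by move=> i' x; apply: (ih i' (pt x h)).
move=> i z z0; apply: nm_le0.
suff : nm (u i z) * Im z ^ k <= 0 by rewrite pmulr_lle0 // exprz_gt0.
have v0 : 0 <= nm (u i z) * Im z ^ k by rewrite mulr_ge0 ?nm_ge0 // exprz_ge0 // ltW.
rewrite leNgt; apply/negP => v1; move: th1; apply/negP; rewrite -leNgt.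
apply: (@le_of_pow R _ _ (B / (nm (u i z) * Im z ^ k))) => //; first exact: ltW.
move=> n; rewrite expr1n mulrAC ler_pdivlMr // mul1r; exact: hB.
Qed.

(** The decay e^(-d (y - h)) beats the growth (y/h)^k <= e^(c (y - h)). As y - h > 4/5 - 79/100 =
    1/100, the contraction factor is e^(-(d - c)/100). *)
Lemma siegel (I : Type) (u : I -> C -> C) (k : int) (c d : R) (h := 79 / 100 : R) :
  (forall i A z, 0 < Im z -> exists i',
     nm (u i (mob A z)) * Im (mob A z) ^ k = nm (u i' z) * Im z ^ k) ->
  (forall i (M : R), (forall x, nm (u i (pt x h)) <= M) -> forall z, h < Im z ->
     nm (u i z) <= M * expR (- (d * (Im z - h)))) ->
  (exists M : R, forall i x, nm (u i (pt x h)) <= M) ->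
  (forall y, h <= y -> (y / h) ^ k <= expR (c * (y - h))) -> c < d ->
  forall i z, 0 < Im z -> u i z = 0.
Proof.
move=> hinv hdec hM hk cd.
apply: (@siegel_gen I u k (fun y => expR (- (d * (y - h)))) (expR (- ((d - c) / 100)))) => //.
  by rewrite expR_gt0 /= -[X in _ < X]expR0 ltr_expR oppr_lt0; lra.
move=> y hy; have yh : h <= y by rewrite /h; lra.
apply: (@le_trans _ _ (expR (- (d * (y - h))) * expR (c * (y - h)))).
  by apply: ler_wpM2l; [exact: expR_ge0 | exact: hk].
rewrite -expRD ler_expR; have -> : - (d * (y - h)) + c * (y - h) = - ((d - c) * (y - h)) by ring.
rewrite lerN2 ler_pM2l ?subr_gt0 //; rewrite /h; lra.
Qed.

Lemma cdiff_lip (F : C -> C) (M : R) z w : 0 <= M ->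
  (forall s : R, 0 <= s <= 1 -> exists2 D, cdiff F (z + ofR s * w) D & nm D <= M) ->
  nm (F (z + w) - F z) <= 2 * M * nm w.
Proof.
move=> M0 hF; pose d s : C := dv F (z + ofR s * w).
have hd (s : R) : 0 <= s <= 1 -> cdiff F (z + ofR s * w) (d s) /\ nm (d s) <= M.
  by move=> hs; have [D hD DM] := hF s hs; rewrite /d (dvE hD).
have key (p : C -> R) : (forall x, `|p x| <= nm x) -> (forall x y, p (x - y) = p x - p y) ->
    (forall s : R, 0 <= s <= 1 -> is_derive s 1 (fun t : R => p (F (z + ofR t * w))) (p (d s * w))) ->
    `|p (F (z + w) - F z)| <= M * nm w.
  move=> pn pB pd.
  have [||c c01] := @MVT_segment R (fun t : R => p (F (z + ofR t * w))) (fun s => p (d s * w)) 0 1 ler01.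
  - by move=> s; rewrite in_itv /= => /andP[s0 s1]; apply: pd; rewrite !ltW.
  - by apply: derivable_within_continuous => s; rewrite in_itv /= => /pd[].
  rewrite rmorph1 rmorph0 mul1r mul0r addr0 subr0 mulr1 -pB => ->.
  apply: le_trans (pn _) _; rewrite nmM ler_wpM2r ?nm_ge0 //.
  by apply: (hd c _).2; rewrite in_itv /= in c01.
have h1 := key Re (@nm_Re R) (fun x y => raddfB _ x y) (fun s hs => (cdiff_line (hd s hs).1).1).
have h2 := key Im (@nm_Im R) (fun x y => raddfB _ x y) (fun s hs => (cdiff_line (hd s hs).1).2).
by apply: le_trans (nm_ReIm _) _; lra.
Qed.

Lemma segment_gt (z w : C) (y s : R) : y < Im z -> y < Im (z + w) -> 0 <= s <= 1 ->
  y < Im (z + ofR s * w).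
Proof.
rewrite !cImD cImM /= mul0r addr0 => h1 h2 /andP[s0 s1].
have [->|sp] := eqVneq s 0; first by rewrite mul0r addr0.
have {s0 sp}s0 : 0 < s by rewrite lt_neqAle eq_sym sp.
have : 0 <= (1 - s) * (Im z - y) by rewrite mulr_ge0 ?subr_ge0 // ltW.
have : 0 < s * (Im z + Im w - y) by rewrite mulr_gt0 // subr_gt0.
lra.
Qed.

Lemma cdiff_cst_H (F : C -> C) : (forall z, 0 < Im z -> cdiff F z 0) ->
  forall z w, 0 < Im z -> 0 < Im w -> F z = F w.
Proof.
move=> hF z w z0 w0; apply/esym/subr0_eq/nm_le0.
have E : z + (w - z) = w by rewrite addrC subrK.
have := @cdiff_lip F 0 z (w - z) (lexx _); rewrite E mulr0 mul0r; apply=> s hs.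
exists 0; last by rewrite nm0.
by apply: hF; apply: segment_gt hs; rewrite ?E.
Qed.

(** The theorems on periodic functions ask for f (z + 1) = f z on all of C, while forms are periodic
    on the half-plane; extension by 0 bridges the two. *)
Definition Hext f z : C := if 0 < Im z then f z else 0.

Lemma HextE f z : 0 < Im z -> Hext f z = f z. Proof. by rewrite /Hext => ->. Qed.
Lemma holoH_Hext f : holoH f -> holoH (Hext f).
Proof. by apply: holoH_eq => z z0; rewrite HextE. Qed.

Definition perH f := forall z, 0 < Im z -> f (z + 1) = f z.

Lemma perH_Hext f : perH f -> forall z, Hext f (z + 1) = Hext f z.
Proof. by move=> fp z; rewrite /Hext cImD addr0; case: ifP => // /fp. Qed.

Lemma smallq_Hext f : smallq f -> smallq (Hext f).
Proof.
move=> sf e /sf[Y hY]; exists (Num.max Y 0) => z; rewrite gt_max => /andP[h1 h2].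
by rewrite HextE // hY.
Qed.

Lemma perH_int f : perH f -> forall (m : int) z, 0 < Im z -> f (z + m%:~R) = f z.
Proof.
move=> fp m z z0; rewrite -(HextE f z0) -(periodicZ (perH_Hext fp) m) HextE //.
by rewrite cImD Im_int addr0.
Qed.

Lemma perH_strip f (P : C -> Prop) (Y : R) : perH f -> 0 <= Y ->
  (forall z, Y < Im z -> -1 / 2 <= Re z <= 1 / 2 -> P (f z)) -> forall z, Y < Im z -> P (f z).
Proof.
move=> fp Y0 h z zY; have z0 : 0 < Im z by apply: le_lt_trans zY.
have [m hm] := floor_half (Re z); rewrite -(perH_int fp m z0).
by apply: h; rewrite ?cImD ?cReD ?Im_int ?Re_int ?addr0.
Qed.

Lemma perH_limit f : perH f -> holoH f -> smallq f -> exists c : C,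
  exists2 K : R, 0 <= K & forall z, 1 < Im z -> nm (f z - c) <= K * nm (ee z).
Proof.
move=> fp hf sf.
have [c [K K0 h]] := periodic_limit (perH_Hext fp) (holoH_Hext hf) (smallq_Hext sf).
exists c, K => // z z1; rewrite -(HextE f) ?h //; exact: lt_trans z1.
Qed.

Lemma perH_bounded f (y : R) : perH f -> holoH f -> 0 < y -> exists M, forall x, nm (f (pt x y)) <= M.
Proof.
move=> fp hf y0; have [M hM] := periodic_bounded (perH_Hext fp) (holoH_Hext hf) y0.
by exists M => x; rewrite -(HextE f).
Qed.

Lemma perH_max f (h M : R) : perH f -> holoH f -> smallq f -> 0 < h ->
  (forall x, nm (f (pt x h)) <= M) -> forall z, h < Im z -> nm (f z) <= M.
Proof.
move=> fp hf sf h0 hM z hz; have z0 : 0 < Im z by apply: lt_trans hz.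
rewrite -(HextE f z0); apply: periodic_max hz => //; [exact: perH_Hext | exact: holoH_Hext | exact: smallq_Hext | ].
by move=> x; rewrite HextE.
Qed.

Section Width.
Variables (n : nat) (f : C -> C).
Hypotheses (n0 : (0 < n)%N) (hf : holoH f).
Hypothesis fp : forall z, 0 < Im z -> f (z + n%:R) = f z.

Let F z := f (n%:R * z).
Let nR : 0 < n%:R :> R. Proof. by rewrite ltr0n. Qed.
Let imn z : Im (n%:R * z) = n%:R * Im z.
Proof. by rewrite -[n%:R]/(n%:~R) cImM Re_int Im_int mul0r addr0. Qed.
Let Fp : perH F.
Proof. by move=> z z0; rewrite /F mulrDr mulr1 fp // imn mulr_gt0. Qed.
Let hF : holoH F.
Proof.
move=> z z0; have [D hD] := hf (z := n%:R * z) ltac:(by rewrite imn mulr_gt0).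
by eexists; apply: cdiff_comp (cdiffZ _ (cdiff_id _)) hD.
Qed.
Let ptn (x y : R) : (n%:R : C) * pt x y = pt (n%:R * x) (n%:R * y).
Proof. by apply: complex_eqE; rewrite -[n%:R]/(n%:~R) ?cImM ?cReM Re_int Im_int mul0r ?addr0 ?subr0. Qed.

Lemma width_bounded (y : R) : 0 < y -> exists M, forall x, nm (f (pt x y)) <= M.
Proof.
move=> y0; have [M hM] := perH_bounded Fp hF (y := y / n%:R) ltac:(by rewrite divr_gt0).
exists M => x; have := hM (x / n%:R); rewrite /F ptn.
by rewrite ![n%:R * _]mulrC !divfK ?gt_eqF.
Qed.

Lemma width_max0 (h M : R) : 0 < h ->
  (forall e : R, 0 < e -> exists Y : R, forall z, Y < Im z -> nm (f z) <= e) ->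
  (forall x, nm (f (pt x h)) <= M) ->
  forall z, h < Im z -> nm (f z) <= M * expR (- (2 * pi / n%:R * (Im z - h))).
Proof.
move=> h0 sf hM z hz.
have nC : (n%:R : C) != 0 by rewrite pnatr_eq0 -lt0n.
have zE : z = n%:R * (z / n%:R) by rewrite mulrC divfK.
have iz : Im (z / n%:R) = Im z / n%:R.
  by rewrite [in RHS]zE imn [n%:R * _]mulrC mulfK // gt_eqF.
have := @periodic_max0 R (Hext F) (h / n%:R) M (perH_Hext Fp) (holoH_Hext hF) _ _ _ (z / n%:R).
have z0 : 0 < Im z by apply: lt_trans hz.
rewrite HextE ?iz ?divr_gt0 // /F -zE ltr_pM2r ?invr_gt0 // hz -mulrBl [2 * pi * _]mulrC.
have -> : (Im z - h) / n%:R * (2 * pi) = 2 * pi / n%:R * (Im z - h) by ring.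
apply=> //.
- move=> e /sf[Y hY]; exists (Num.max 0 (Y / n%:R)) => w; rewrite gt_max => /andP[w0 wY].
  rewrite HextE //; apply: hY; rewrite imn mulrC -ltr_pdivrMr //.
- move=> x; rewrite HextE ?divr_gt0 //= /F ptn.
  by rewrite [n%:R * (h / _)]mulrC divfK ?gt_eqF.
Qed.
End Width.

Lemma smallq_bounded f (M Y : R) : (forall z, Y < Im z -> nm (f z) <= M) -> smallq f.
Proof.
move=> fM e e0; have M1 : 0 < `|M| + 1 by rewrite ltr_wpDl.
have [Y' hY'] := @nm_ee_small R (e / (`|M| + 1)) ltac:(by rewrite divr_gt0).
exists (Num.max Y Y') => z; rewrite gt_max => /andP[/fM h1 /hY' h2].
rewrite nmM; apply: (@le_trans _ _ ((`|M| + 1) * nm (ee z))).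
  by apply: ler_wpM2r; [exact: nm_ge0 | apply: le_trans h1 _; apply: le_trans (ler_norm _) _; rewrite lerDl].
by rewrite mulrC -ler_pdivlMr // ltW.
Qed.

Definition vanish f := forall e : R, 0 < e -> exists Y : R, forall z, Y < Im z -> nm (f z) <= e.

Lemma vanish_ee f c (K : R) : (forall z, 1 < Im z -> nm (f z - c) <= K * nm (ee z)) ->
  vanish (fun z => f z - c).
Proof.
move=> h e e0; have K1 : 0 < `|K| + 1 by rewrite ltr_wpDl.
have [Y hY] := @nm_ee_small R (e / (`|K| + 1)) ltac:(by rewrite divr_gt0).
exists (Num.max 1 Y) => z; rewrite gt_max => /andP[/h h1 /hY h2].
apply: le_trans h1 _; apply: (@le_trans _ _ ((`|K| + 1) * nm (ee z))).
  by apply: ler_wpM2r; [exact: nm_ge0 | apply: le_trans (ler_norm _) _; rewrite lerDl].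
by rewrite mulrC -ler_pdivlMr // ltW.
Qed.

Definition mob_invariant f := forall A z, 0 < Im z -> f (mob A z) = f z.

Lemma mob_invariant_perH f : mob_invariant f -> perH f.
Proof. by move=> fi z z0; rewrite -mob_T fi. Qed.

Lemma weight0_zero f : mob_invariant f -> holoH f -> vanish f -> forall z, 0 < Im z -> f z = 0.
Proof.
move=> fi hf vf; have fp := mob_invariant_perH fi.
apply: (@siegel unit (fun=> f) 0 0 (2 * pi) _ _ _ _ (pi2_gt0 R) tt).
- by move=> _ A z z0; exists tt; rewrite fi // !expr0z.
- move=> _ M hM z hz; have := @width_max0 1 f isT hf _ _ M _ vf hM z hz.
  by rewrite divr1; apply=> //; lra.
- have [|M hM] := perH_bounded fp hf (y := 79 / 100); first by lra.
  by exists M.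
- by move=> y _; rewrite expr0z mul0r expR0.
Qed.

Lemma weight0_const f : mob_invariant f -> holoH f -> smallq f -> exists c, forall z, 0 < Im z -> f z = c.
Proof.
move=> fi hf sf; have [c [K _ hK]] := perH_limit (mob_invariant_perH fi) hf sf.
exists c => z z0; apply/subr0_eq.
apply: (@weight0_zero (fun z => f z - c)) => //.
- by move=> A w w0; rewrite fi.
- by apply: holoHB => //; exact: holoH_cst.
- exact: vanish_ee hK.
Qed.
End Siegel.

(** * Level-one modular forms *)

Section Eta.
Variable R : realType.
Local Notation C := R[i].
Local Notation Re := (@complex.Re R).
Local Notation Im := (@complex.Im R).
Local Notation ofR := (real_complex R).
Local Notation J := (@autf R).
Implicit Types (A B : SL2Z) (z w u t : C) (p q a b : int * int).

Definition lat t p : C := p.1%:~R * t + p.2%:~R.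

Lemma latD t p q : lat t (p + q) = lat t p + lat t q.
Proof. by rewrite /lat /= !rmorphD /=; ring. Qed.
Lemma latN t p : lat t (- p) = - lat t p.
Proof. by rewrite /lat /= !rmorphN /=; ring. Qed.
Lemma latB t p q : lat t (p - q) = lat t p - lat t q.
Proof. by rewrite latD latN. Qed.
Lemma lat0 t : lat t 0 = 0. Proof. by rewrite /lat mul0r addr0. Qed.

Definition sz p : R := 1 + `|p.1|%:~R + `|p.2|%:~R.

Lemma sz_ge1 p : 1 <= sz p.
Proof. by rewrite /sz -addrA lerDl addr_ge0 // ler0z. Qed.
Lemma sz_gt0 p : 0 < sz p. Proof. by apply: lt_le_trans (sz_ge1 p). Qed.

Lemma sz_sub a p : sz p <= sz a * sz (a - p).
Proof.
rewrite /sz -[1]/(1%:~R : R) -!intrD -intrM ler_int /=.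
have : `|p.1| <= `|a.1| + `|a.1 - p.1| by lia.
have : `|p.2| <= `|a.2| + `|a.2 - p.2| by lia.
move: `|a.1 - p.1| `|a.2 - p.2| (normr_ge0 (a.1 - p.1)) (normr_ge0 (a.2 - p.2)).
move: `|p.1| `|p.2| `|a.1| `|a.2| (normr_ge0 a.1) (normr_ge0 a.2) => x y z w ? ? k l ? ? ? ?; nia.
Qed.

(** By the inequality of means, sqrt ((1+x)(1+y)) <= 1 + x + y, so the cube splits into one-variable
    weights of exponent 3/2. *)
Lemma sz_wt p : (sz p)^-1 ^+ 3 <= wt R p.1 * wt R p.2.
Proof.
have key (x y : R) : 0 <= x -> 0 <= y -> (1 + x + y)^-1 ^+ 3 <=
    ((1 + x) * Num.sqrt (1 + x))^-1 * ((1 + y) * Num.sqrt (1 + y))^-1.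
  move=> x0 y0; rewrite -invfM exprVn.
  have sx : Num.sqrt (1 + x) ^+ 2 = 1 + x by rewrite sqr_sqrtr // addr_ge0.
  have sy : Num.sqrt (1 + y) ^+ 2 = 1 + y by rewrite sqr_sqrtr // addr_ge0.
  have px : 0 < Num.sqrt (1 + x) by rewrite sqrtr_gt0 ltr_wpDr.
  have py : 0 < Num.sqrt (1 + y) by rewrite sqrtr_gt0 ltr_wpDr.
  rewrite lef_pV2 ?posrE; first last.
  - by apply: mulr_gt0; apply: mulr_gt0 => //; lra.
  - by apply: exprn_gt0; lra.
  have h : Num.sqrt (1 + x) * Num.sqrt (1 + y) <= 1 + x + y.
    by have := sqr_ge0 (Num.sqrt (1 + x) - Num.sqrt (1 + y)); rewrite -/(GRing.exp _ 2) sqrrB sx sy; lra.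
  have -> : (1 + x) * Num.sqrt (1 + x) * ((1 + y) * Num.sqrt (1 + y)) =
     (1 + x) * ((1 + y) * (Num.sqrt (1 + x) * Num.sqrt (1 + y))) by ring.
  rewrite !exprS expr0 mulr1; apply: ler_pM; [lra| | lra|].
    by apply: mulr_ge0; [lra | apply: mulr_ge0; apply: ltW].
  by apply: ler_pM; [lra | apply: mulr_ge0; apply: ltW | lra | ].
by apply: key; rewrite ler0z.
Qed.

Lemma lat_ge (X Y : R) : 0 < Y -> 0 <= X -> exists2 d : R, 0 < d &
  forall t p, `|Re t| <= X -> Y <= Im t -> p != 0 -> d * sz p <= nm (lat t p).
Proof.
move=> Y0 X0; exists (Y / (2 * (Y + X + 1))); first by rewrite divr_gt0 //; lra.
move=> t p hX hY p0.
have h1 : `|p.1%:~R| * Im t <= nm (lat t p).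
  apply: le_trans (nm_Im _); rewrite cImD cImM Re_int !Im_int mul0r !addr0 normrM.
  by rewrite (ger0_norm (le_trans (ltW Y0) hY)).
have h2 : `|p.2%:~R| - `|p.1%:~R| * `|Re t| <= nm (lat t p).
  apply: le_trans (nm_Re _); rewrite cReD cReM !Re_int Im_int mul0r subr0.
  by rewrite lerBlDr -normrM; apply: le_trans (ler_normB _ (p.1%:~R * Re t)); rewrite addrAC subrr add0r.
have h3 : sz p <= 2 * (`|p.1%:~R| + `|p.2%:~R|).
  rewrite -!intr_norm /sz -[2]/(2%:~R : R) -[1]/(1%:~R : R) -!intrD -intrM ler_int.
  move: p0; rewrite -[p == 0]/((p.1 == 0) && (p.2 == 0)); lia.
have h0 : 0 <= `|p.1%:~R| :> R by [].
set N := nm _ in h1 h2 *; set x : R := `|_| in h0 h1 h2 h3; set y : R := `|_| in h2 h3.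
have e1 : x * Y <= N by apply: le_trans h1; exact: ler_wpM2l.
have e2 : y - x * X <= N by apply: le_trans h2; rewrite lerD2l lerN2 ler_wpM2l.
rewrite mulrAC ler_pdivrMr; last lra.
have : Y * sz p <= Y * (2 * (x + y)) by rewrite ler_wpM2l // ltW.
have : 0 <= Y * (N - (y - x * X)) by rewrite mulr_ge0 ?subr_ge0 // ltW.
have : 0 <= (X + 1) * (N - x * Y) by rewrite mulr_ge0 ?subr_ge0 //; lra.
nra.
Qed.

Lemma lat_neq0 t p : 0 < Im t -> p != 0 -> lat t p != 0.
Proof.
move=> t0 p0; have [d d0 h] := lat_ge t0 (normr_ge0 (Re t)).
by rewrite -nm_gt0; apply: lt_le_trans (h t p _ _ p0) => //; rewrite mulr_gt0 // sz_gt0.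
Qed.

(** The term of index u in the Weierstrass zeta function at w. As 0^-1 = 0, u = 0 gives the term 1/w
    and u = w loses its pole. *)
Definition zterm w u := (w - u)^-1 + u^-1 + w / u ^+ 2.

Lemma ztermE w u : u != 0 -> w - u != 0 -> zterm w u = w ^+ 2 * (u ^+ 2 * (w - u))^-1.
Proof. by move=> u0 wu; rewrite /zterm; field; rewrite u0 wu. Qed.
Lemma zterm0 u : zterm 0 u = 0.
Proof. by rewrite /zterm sub0r invrN mul0r addNr addr0. Qed.
Lemma zterm0r w : zterm w 0 = w^-1.
Proof. by rewrite /zterm subr0 expr0n invr0 mulr0 !addr0. Qed.
Lemma ttww w : zterm w w = w^-1 + w^-1.
Proof.
rewrite /zterm subrr invr0 add0r; have [->|w0] := eqVneq w 0; first by rewrite mul0r invr0.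
by congr (_ + _); field.
Qed.
Lemma ztermZ (c w u : C) : c != 0 -> zterm (w / c) (u / c) = c * zterm w u.
Proof.
move=> c0; have cV : c^-1 * c = 1 by rewrite mulVf.
have E (x : C) : (x / c)^-1 = c * x^-1 by rewrite invfM invrK mulrC.
rewrite /zterm -mulrBl !E !mulrDr; congr (_ + _ + _).
by rewrite -exprVn E exprMn exprVn -[RHS]mul1r -cV; move: (u ^+ 2)^-1 c^-1 => a b; ring.
Qed.
Lemma zterm_add w w' u : zterm (w + w') u = zterm w u + zterm w' (u - w) + w' * ((u ^+ 2)^-1 - ((u - w) ^+ 2)^-1).
Proof.
rewrite /zterm -[w - u]opprB invrN (_ : w' - (u - w) = w + w' - u); first by ring.
by ring.
Qed.

Definition zterm_const (d Z : R) a : R := Z ^+ 2 * sz a / d ^+ 3 + 2 * sz a ^+ 3 / d.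

(** Away from u = 0 and u = w the term is w^2 / (u^2 (w - u)), of size |u|^-3, where [sz_sub]
    compares w - u with u. The cases a = 0, p = 0 and p = a are bounded separately. *)
Lemma zterm_bound (d Z : R) t a p : 0 < d -> (forall p, p != 0 -> d * sz p <= nm (lat t p)) ->
  nm (lat t a) <= Z -> nm (zterm (lat t a) (lat t p)) <= zterm_const d Z a * (wt R p.1 * wt R p.2).
Proof.
move=> d0 hd aZ; have sa := sz_ge1 a; have sp := sz_gt0 p; have sa0 := sz_gt0 a.
have dV q : q != 0 -> nm (lat t q)^-1 <= (d * sz q)^-1.
  move=> q0; have dq : 0 < d * sz q by rewrite mulr_gt0 // sz_gt0.
  by rewrite nmV lef_pV2 ?hd // posrE //; apply: lt_le_trans (hd _ q0).
have Z0 : 0 <= Z by apply: le_trans (nm_ge0 _) aZ.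
have t1 : 0 <= Z ^+ 2 * sz a / d ^+ 3.
  by rewrite mulr_ge0 ?invr_ge0 ?mulr_ge0 ?sqr_ge0 ?exprn_ge0 // ltW.
have t2 : 0 <= 2 * sz a ^+ 3 / d.
  by apply: divr_ge0; [apply: mulr_ge0 => //; apply: exprn_ge0 | ]; apply: ltW.
have K0 : 0 <= zterm_const d Z a by apply: addr_ge0.
apply: (@le_trans _ _ (zterm_const d Z a * (sz p)^-1 ^+ 3)); last exact: ler_wpM2l (sz_wt p).
have [a0|a0] := eqVneq a 0.
  rewrite {1}a0 lat0 zterm0 nm0; apply: mulr_ge0 => //.
  by rewrite exprn_ge0 // invr_ge0 ltW.
have saV : (d * sz a)^-1 <= d^-1.
  by rewrite lef_pV2 ?posrE ?mulr_gt0 // ler_peMr // ltW.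
have sa3 : 1 <= sz a ^+ 3 by rewrite exprn_ege1.
have dV0 : 0 < d^-1 by rewrite invr_gt0.
have [p0|p0] := eqVneq p 0.
  rewrite p0 lat0 zterm0r /sz /= addr0 addr0 invr1 expr1n mulr1.
  apply: le_trans (dV _ a0) _; apply: le_trans saV _.
  rewrite /zterm_const; apply: ler_wpDl => //; rewrite ler_peMl //; first exact: ltW.
  lra.
have [->|pa] := eqVneq p a.
  rewrite ttww; apply: le_trans (nmD _ _) _; rewrite /zterm_const mulrDl.
  apply: ler_wpDl; first by rewrite mulr_ge0 // exprn_ge0 // invr_ge0 ltW.
  have -> : 2 * sz a ^+ 3 / d * (sz a)^-1 ^+ 3 = d^-1 + d^-1 by field; rewrite !gt_eqF.
  by apply: lerD; apply: le_trans (dV _ a0) _.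
have ap : a - p != 0 by rewrite subr_eq0 eq_sym.
have lp : lat t p != 0 by rewrite -nm_gt0; apply: lt_le_trans (hd _ p0); rewrite mulr_gt0.
have la : lat t a - lat t p != 0.
  by rewrite -latB -nm_gt0; apply: lt_le_trans (hd _ ap); rewrite mulr_gt0 // sz_gt0.
rewrite (ztermE lp la) /zterm_const mulrDl; apply: ler_wpDr.
  by rewrite mulr_ge0 // exprn_ge0 // invr_ge0 ltW.
rewrite -latB nmM nmX invfM nmM -exprVn nmX.
have h1 := dV _ p0; have h2 := dV _ ap; have h3 := sz_sub a p.
have h4 : (d * sz (a - p))^-1 <= sz a / (d * sz p).
  rewrite -[X in _ <= X]invrK lef_pV2 ?posrE ?mulr_gt0 ?sz_gt0 ?invr_gt0 ?mulr_gt0 //; last first.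
    by rewrite invr_gt0 mulr_gt0.
  by rewrite invfM invrK mulrCA ler_wpM2l ?(ltW d0) // mulrC ler_pdivrMr // mulrC.
have -> : Z ^+ 2 * sz a / d ^+ 3 * (sz p)^-1 ^+ 3 =
   Z ^+ 2 * ((d * sz p)^-1 ^+ 2 * (sz a / (d * sz p))) by field; rewrite !gt_eqF.
apply: ler_pM; rewrite ?exprn_ge0 ?mulr_ge0 ?nm_ge0 ?exprn_ge0 ?nm_ge0 //.
  by rewrite lerXn2r ?nnegrE ?nm_ge0.
apply: ler_pM; rewrite ?exprn_ge0 ?nm_ge0 //.
  by rewrite lerXn2r ?nnegrE ?nm_ge0 // invr_ge0 mulr_ge0 // ltW.
exact: le_trans h2 h4.
Qed.

(* The Weierstrass zeta function of Z t + Z regularized at the lattice point a: since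
   0^-1 = 0, both polar terms drop out. It is additive in a: these are the quasi-periods. *)
Definition eta t a : C := csum (fun p => zterm (lat t a) (lat t p)).

Lemma bsum_wt2 (K : R) : 0 <= K -> bsum (fun p : int * int => K * (wt R p.1 * wt R p.2)) (K * (6 * 6)).
Proof. by move=> K0; apply: bsumZ => //; apply: bsum_prod; exact: bsum_wt. Qed.

Lemma zterm_const_ge0 (d Z : R) a : 0 < d -> 0 <= zterm_const d Z a.
Proof.
move=> d0; have s0 := sz_gt0 a; rewrite /zterm_const; apply: addr_ge0; apply: divr_ge0.
- by apply: mulr_ge0; [exact: sqr_ge0 | exact: ltW].
- by apply: exprn_ge0; exact: ltW.
- by apply: mulr_ge0 => //; apply: exprn_ge0; exact: ltW.
- exact: ltW.
Qed.

Lemma eta_hasSum t a : 0 < Im t -> hasSum (fun p => zterm (lat t a) (lat t p)) (eta t a).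
Proof.
move=> t0; have [d d0 h] := lat_ge t0 (normr_ge0 (Re t)).
apply: csumP (bsum_wt2 (zterm_const_ge0 (nm (lat t a)) a d0)) _ => p.
by apply: zterm_bound => // q q0; apply: h.
Qed.

Lemma eta_bound (X Y : R) : 0 < Y -> 0 <= X -> exists2 d : R, 0 < d &
  forall t a Z, `|Re t| <= X -> Y <= Im t -> nm (lat t a) <= Z -> nm (eta t a) <= 36 * zterm_const d Z a.
Proof.
move=> Y0 X0; have [d d0 h] := lat_ge Y0 X0; exists d => // t a Z hX hY hZ.
have -> : 36 * zterm_const d Z a = zterm_const d Z a * (6 * 6) by ring.
apply: csum_bound (bsum_wt2 (zterm_const_ge0 Z a d0)) _ => p.
by apply: zterm_bound => // q q0; apply: h.
Qed.

(** The reflection p -> a - p turns each term into its opposite, so a sum, if there is one, equals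
    its own opposite; if there is none, [csum] is 0 by default. *)
Lemma eta_shift t a : 0 < Im t ->
  csum (fun p => (lat t p ^+ 2)^-1 - (lat t (p - a) ^+ 2)^-1) = 0.
Proof.
move=> t0; set f := (fun p => _); set s := csum f.
have e : csum (fun p => f (a - p)) = s.
  by apply: (@csum_reindex _ _ _ (fun p => a - p) (fun p => a - p)) => p; rewrite opprB addrCA subrr addr0.
have [[v hv]|hN] := pselect (exists v, hasSum f v).
  have hN : hasSum (fun p => f (a - p)) (- v).
    have := hasSumZ (-1) hv; rewrite mulN1r; congr hasSum; apply/funext => p.
    by rewrite /f mulN1r opprB addrAC subrr add0r latN sqrrN !latB -[lat t a - _]opprB sqrrN.
  have h : v = - v by rewrite -(csumE hN) e /s (csumE hv).
  rewrite /s (csumE hv); apply/eqP.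
  have : v *+ 2 == 0 by rewrite mulr2n {2}h subrr.
  by rewrite mulrn_eq0.
by rewrite /s /csum; case: xgetP => // v _ /= hv; case: hN; exists v.
Qed.

(** After a translation of the lattice by a, [zterm_add] gives additivity up to [lat t b] times the
    sum of [eta_shift], which converges here because the three other sums do. *)
Lemma etaD t a b : 0 < Im t -> eta t (a + b) = eta t a + eta t b.
Proof.
move=> t0; have [b0|b0] := eqVneq b 0.
  rewrite b0 addr0 [eta t 0](_ : _ = 0) ?addr0 //; apply: csumE => e e0; exists [::] => B _ _.
  by rewrite big1 ?subrr ?nm0 ?ltW // => p _; rewrite lat0 zterm0.
have hab := eta_hasSum (a + b) t0; have ha := eta_hasSum a t0; have hb := eta_hasSum b t0.
have hb' : hasSum (fun p => zterm (lat t b) (lat t p - lat t a)) (eta t b).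
  rewrite (_ : (fun p => _) = (fun p => zterm (lat t b) (lat t (p - a)))); last first.
    by apply/funext => p; rewrite latB.
  by apply: (@hasSum_reindex R _ _ (fun p => p - a) (fun p => p + a) _ _ _ _ hb) => p; rewrite ?subrK ?addrK.
have := hasSumB (hasSumB hab ha) hb'; set v := _ - _ => hv.
have w0 := lat_neq0 t0 b0.
have : hasSum (fun p => (lat t p ^+ 2)^-1 - (lat t (p - a) ^+ 2)^-1) ((lat t b)^-1 * v).
  have := hasSumZ (lat t b)^-1 hv; congr hasSum; apply/funext => p.
  have E (x y c d : C) : c != 0 -> c^-1 * (x + y + c * d - x - y) = d by move=> c0; field.
  by rewrite latD zterm_add latB E.
move/csumE; rewrite eta_shift // => /eqP; rewrite eq_sym mulf_eq0 invr_eq0 (negPf w0) /=.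
by rewrite /v -addrA -opprD subr_eq0 => /eqP.
Qed.

Lemma etaE t a : 0 < Im t -> eta t a = a.1%:~R * eta t (1, 0) + a.2%:~R * eta t (0, 1).
Proof.
move=> t0; pose f a := eta t a.
have f0 : f 0 = 0 by have := etaD 0 0 t0; rewrite addr0 -/(f 0) => h; apply/(addrI (f 0)); rewrite -h addr0.
have fN b : f (- b) = - f b.
  by apply/eqP; rewrite -addr_eq0 -etaD // addNr; apply/eqP.
have fMn b (n : nat) : f (b *+ n) = n%:R * f b.
  by elim: n => [|n ih]; rewrite ?mulr0n ?mul0r // mulrS /f etaD // -/(f _) -/(f _) ih -natr1; ring.
have fMz b (m : int) : f (b *~ m) = m%:~R * f b.
  by case: m => n; rewrite ?NegzE ?mulrNz -?pmulrn ?fN fMn ?rmorphN //= mulNr.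
have aE : a = (1, 0) *~ a.1 + (0, 1) *~ a.2.
  have E (x y : int) (m : int) : (x, y) *~ m = (x * m, y * m).
    have En (n : nat) : (x, y) *+ n = (x * n%:Z, y * n%:Z).
      elim: n => [|n ih]; first by rewrite !mulr0.
      by rewrite mulrS ih; congr (_, _) => /=; lia.
    case: m => n; first exact: En.
    by rewrite NegzE mulrNz -pmulrn En; congr (_, _) => /=; lia.
  by rewrite !E; case: a => m n; congr (_, _) => /=; lia.
by rewrite {1}aE etaD // -!/(f _) !fMz.
Qed.

Definition pact p A : int * int := (p.1 * ea A + p.2 * ec A, p.1 * eb A + p.2 * ed A).

Lemma lat_mob A t p : 0 < Im t -> lat (mob A t) p = lat t (pact p A) / J A t.
Proof.
move=> t0; have j0 := J_neq0 A t0; apply: (mulIf j0); rewrite divfK //.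
rewrite /lat mulrDl -mulrA /mob divfK // /pact /= numfE JE !(rmorphD, rmorphM) /=; ring.
Qed.

Lemma pactK A p : pact (pact p A) A^-1%g = p.
Proof.
have E B : ea (A * B)%g = ea A * ea B + eb A * ec B /\ eb (A * B)%g = ea A * eb B + eb A * ed B.
  by rewrite /ea /eb SL2Z_valM !mulmx2E.
have E' B : ec (A * B)%g = ec A * ea B + ed A * ec B /\ ed (A * B)%g = ec A * eb B + ed A * ed B.
  by rewrite /ec /ed SL2Z_valM !mulmx2E.
have [e1 e2] := E A^-1%g; have [e3 e4] := E' A^-1%g; rewrite mulgV in e1 e2 e3 e4.
have key (x y z w x' y' z' w' m n : int) : 1 = x * x' + y * z' -> 0 = x * y' + y * w' ->
    0 = z * x' + w * z' -> 1 = z * y' + w * w' ->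
    ((m * x + n * z) * x' + (m * y + n * w) * z', (m * x + n * z) * y' + (m * y + n * w) * w') = (m, n).
  move=> h1 h2 h3 h4; congr (_, _).
    transitivity (m * (x * x' + y * z') + n * (z * x' + w * z')); first by ring.
    by rewrite -h1 -h3; ring.
  transitivity (m * (x * y' + y * w') + n * (z * y' + w * w')); first by ring.
  by rewrite -h2 -h4; ring.
by rewrite [RHS]surjective_pairing; apply: key; rewrite -?e1 -?e2 -?e3 -?e4 /ea /eb /ec /ed !mxE.
Qed.

(** The lattice of mob A t is that of t divided by J(A, t), and zeta is homogeneous of degree -1
    ([ztermZ]). *)
Lemma eta_mob A t a : 0 < Im t -> eta (mob A t) a = J A t * eta t (pact a A).
Proof.
move=> t0; have j0 := J_neq0 A t0; apply: csumE.
have -> : (fun p => zterm (lat (mob A t) a) (lat (mob A t) p)) =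
    (fun p => J A t * zterm (lat t (pact a A)) (lat t (pact p A))).
  by apply/funext => p; rewrite !lat_mob // ztermZ.
apply: hasSumZ; apply: (@hasSum_reindex _ _ _ (pact ^~ A) (pact ^~ A^-1%g)) (eta_hasSum _ t0).
  by move=> p; rewrite pactK.
by move=> p; rewrite -{2}[A]invgK pactK.
Qed.

Lemma lat_holo p : holoH (lat ^~ p).
Proof.
move=> z z0; eexists; apply: cdiffD; last exact: cdiff_cst.
exact: cdiffZ (cdiff_id _).
Qed.

Lemma latV_holo p : holoH (fun t => (lat t p)^-1).
Proof.
have [->|p0] := eqVneq p 0.
  by apply: (@holoH_eq _ (fun=> 0)); [move=> z _; rewrite lat0 invr0 | exact: holoH_cst].
by apply: holoHV; [exact: lat_holo | move=> z z0; exact: lat_neq0].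
Qed.

Lemma eta_holo a : holoH (eta ^~ a).
Proof.
move=> z z0; pose Y := Im z / 2; have Y0 : 0 < Y by rewrite divr_gt0.
have [d d0 h] := @lat_ge (`|Re z| + Y) Y Y0 ltac:(by rewrite addr_ge0 // ltW).
pose Z := (`|a.1|%:~R * (nm z + Y) + `|a.2|%:~R : R).
have reg w : nm (w - z) < Y -> [/\ 0 < Im w, `|Re w| <= `|Re z| + Y, Y <= Im w & nm (lat w a) <= Z].
  move=> hw; have hI := nm_Im (w - z); have hR := nm_Re (w - z).
  have wI : Y <= Im w.
    by move: hI; rewrite raddfB /= ler_norml /Y => /andP[+ _]; rewrite /Y in hw; lra.
  split=> //; first exact: lt_le_trans wI.
    have : `|Re w| <= `|Re z| + `|Re (w - z)|.
      by apply: le_trans (ler_normD _ _); rewrite raddfB /= addrC subrK.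
    lra.
  rewrite /lat; apply: le_trans (nmD _ _) _; rewrite nmM /Z.
  rewrite -!(rmorph_int (real_complex R)) !nm_real !intr_norm lerD2r ler_wpM2l //.
  have := nmD z (w - z); rewrite addrC subrK; lra.
apply: csum_cdiff (bsum_wt2 (zterm_const_ge0 Z a d0)) Y0 _ _.
- move=> p w /reg[w0 _ _ _]; move: w w0; rewrite -/(holoH _) /zterm.
  apply: holoHD; first apply: holoHD.
  + apply: (@holoH_eq _ (fun t => (lat t (a - p))^-1)) (latV_holo _) => w w0.
    by rewrite latB.
  + exact: latV_holo.
  + apply: holoHM; first exact: lat_holo.
    apply: (@holoH_eq _ (fun t => (lat t p)^-1 ^+ 2)); first by move=> w _; rewrite exprVn.
    by apply: holoHX; exact: latV_holo.
- by move=> p w /reg[w0 h1 h2 h3]; apply: zterm_bound => // q q0; apply: h.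
Qed.
End Eta.

(** * The weight-two Eisenstein series and Legendre's relation *)

Section Level1.
Variable R : realType.
Local Notation C := R[i].
Local Notation Re := (@complex.Re R).
Local Notation Im := (@complex.Im R).
Local Notation ofR := (real_complex R).
Local Notation J := (@autf R).
Implicit Types (A B : SL2Z) (z w u t : C) (p q a b : int * int) (f : C -> C).

(** The quasi-period along 1 is, up to normalization, the weight-two Eisenstein series; [g2_mob] is
    its quasi-modularity. *)
Definition g2 t : C := eta t (0, 1).
(* Legendre's relation: kap is constant. *)
Definition kap t : C := t * eta t (0, 1) - eta t (1, 0).

Lemma g2_mob A t : 0 < Im t ->
  g2 (mob A t) = J A t ^+ 2 * g2 t - (ec A)%:~R * J A t * kap t.
Proof.
move=> t0; rewrite /g2 eta_mob // etaE // /pact /kap /= !(mul0r, mul1r, add0r) JE; ring.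
Qed.

Lemma kap_mob A t : 0 < Im t -> kap (mob A t) = kap t.
Proof.
move=> t0; have j0 := J_neq0 A t0.
rewrite {1}/kap -/(g2 _) g2_mob // eta_mob // (etaE (pact (1, 0) A)) // /pact /= !(mul0r, mul1r, addr0).
have E (N j g c k x : C) : j != 0 -> N / j * (j ^+ 2 * g - c * j * k) - x = N * (j * g - c * k) - x.
  by move=> ?; congr (_ - _); field.
rewrite /mob E // -[RHS]mul1r -[X in _ = X * _](edetC R A) numfE JE /kap /g2.
by move: (eta t (1, 0)) (eta t (0, 1)) (_%:~R) (_%:~R) (_%:~R) (_%:~R) => x y ca cb cc cd; ring.
Qed.

Lemma g2_perH : perH g2.
Proof. by move=> z z0; rewrite -mob_T g2_mob // J_T /ec !mxE /= !mul0r subr0 expr1n mul1r. Qed.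

Lemma g2_holo : holoH g2. Proof. exact: eta_holo. Qed.

Lemma kap_holo : holoH kap.
Proof.
apply: holoHB; last exact: eta_holo.
apply: holoHM; last exact: eta_holo.
by move=> z _; exists 1; exact: cdiff_id.
Qed.

Lemma strip_smallq f (K : R) : perH f -> 0 <= K ->
  (forall z, 1 < Im z -> -1 / 2 <= Re z <= 1 / 2 -> nm (f z) <= K * Im z ^+ 3) -> smallq f.
Proof.
move=> fp K0 hK e e0; have p0 := pi_gt0 R.
(* e^(-2 pi y) is the fourth power of e^(-pi y / 2), and x e^-x <= 1 at x = pi y / 2. The fourth
   power of y leaves one to spare over the growth y^3. *)
pose c := (pi / 2) ^+ 4 : R; have c0 : 0 < c by rewrite exprn_gt0 // divr_gt0.
exists (Num.max 1 (K / (c * e))).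
apply: (@perH_strip R (fun z => f z * ee z) (fun v => nm v <= e)) => [|| z].
- by move=> z z0; rewrite fp // eeD ee1 mulr1.
- by rewrite le_max ler01.
rewrite gt_max => /andP[z1 zY] zx; have z0 : 0 < Im z by apply: lt_trans z1.
have h : c * Im z ^+ 4 * nm (ee z) <= 1.
  rewrite /c -exprMn nm_ee.
  have -> : - (2 * pi * Im z) = - (pi / 2 * Im z) * 4%:R :> R by field.
  rewrite expRM_natr -exprMn exprn_ile1 //.
    by rewrite !mulr_ge0 ?expR_ge0 ?invr_ge0 // ltW.
  rewrite expRN ler_pdivrMr ?expR_gt0 // mul1r.
  by apply: le_trans (expR_ge1Dx _); rewrite lerDr.
rewrite nmM; apply: le_trans (ler_wpM2r (nm_ge0 _) (hK _ z1 zx)) _.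
have cy : 0 < c * Im z by rewrite mulr_gt0.
rewrite -(ler_pM2l cy); have -> : c * Im z * (K * Im z ^+ 3 * nm (ee z)) =
   K * (c * Im z ^+ 4 * nm (ee z)) by ring.
apply: (@le_trans _ _ K); first by rewrite -[X in _ <= X]mulr1 ler_wpM2l.
have ce : 0 < c * e by apply: mulr_gt0.
by move: (ltW zY); rewrite ler_pdivrMr // mulrCA mulrA.
Qed.

Lemma lat01 t : lat t (0, 1) = 1. Proof. by rewrite /lat /= mul0r add0r. Qed.
Lemma lat10 t : lat t (1, 0) = t. Proof. by rewrite /lat /= mul1r addr0. Qed.

Lemma g2_bounded : exists K : R, forall z, 1 < Im z -> nm (g2 z) <= K.
Proof.
have [d d0 h] := @eta_bound R 1 1 ltr01 ler01.
exists (36 * zterm_const d 1 (0, 1)); apply: (@perH_strip R g2 (fun v => nm v <= _) 1 g2_perH ler01) => z z1 /andP[x1 x2].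
by apply: h; [rewrite ler_norml; apply/andP; split; lra | exact: ltW | rewrite lat01 nm1].
Qed.

Lemma kap_smallq : smallq kap.
Proof.
have [d d0 h] := @eta_bound R 1 1 ltr01 ler01; have [K hK] := g2_bounded.
pose s := sz R (1, 0); have s0 : 0 < s := sz_gt0 _ _.
have h1 : 0 <= s / d ^+ 3 by rewrite divr_ge0 ?exprn_ge0 // ltW.
have h2 : 0 <= 2 * s ^+ 3 / d by rewrite divr_ge0 ?mulr_ge0 ?exprn_ge0 // ltW.
apply: (@strip_smallq _ (2 * `|K| + 36 * (4 * (s / d ^+ 3) + 2 * s ^+ 3 / d))).
- exact: mob_invariant_perH (@kap_mob).
- by move: h1 h2 (normr_ge0 K); lra.
move=> z z1 /andP[x1 x2]; have y1 : 1 <= Im z := ltW z1.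
have nz : nm z <= 2 * Im z.
  apply: le_trans (nm_ReIm _) _; rewrite [`|Im z|]ger0_norm; last lra.
  have : `|Re z| <= 1 by rewrite ler_norml; apply/andP; split; lra.
  lra.
have e1 : nm (eta z (1, 0)) <= 36 * zterm_const d (2 * Im z) (1, 0).
  by apply: h => //; [rewrite ler_norml; apply/andP; split; lra | rewrite lat10].
have e2 : nm (g2 z) <= `|K| by apply: le_trans (hK z z1) (ler_norm _).
rewrite /kap; apply: le_trans (nmB _ _) _; rewrite nmM -/(g2 z).
have y3 : Im z <= Im z ^+ 3 by rewrite exprS ler_peMr ?exprn_ege1 //; lra.
have y2 : Im z ^+ 2 <= Im z ^+ 3 by apply: ler_weXn2l.
have y4 : 1 <= Im z ^+ 3 by rewrite exprn_ege1.
rewrite mulrDl; apply: lerD.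
  apply: (@le_trans _ _ (2 * Im z * `|K|)); first by apply: ler_pM => //; exact: nm_ge0.
  by rewrite mulrAC ler_wpM2l // mulr_ge0.
apply: le_trans e1 _; rewrite /zterm_const -/s -[X in _ <= X]mulrA ler_wpM2l // [X in _ <= X]mulrDl.
apply: lerD; last by rewrite ler_peMr.
have -> : (2 * Im z) ^+ 2 * s / d ^+ 3 = 4 * (s / d ^+ 3) * Im z ^+ 2 by ring.
by rewrite ler_wpM2l // mulr_ge0.
Qed.

(** The limit is the sum over the row p.1 = 0, the other terms tending to 0. It is nonzero by
    symmetry: twice the sum, paired by n -> 1 - n, has nonnegative terms, one of which is 3. *)
Lemma g2_limit : exists2 c : C, c != 0 & exists2 K : R, 0 <= K &
  forall z, 1 < Im z -> nm (g2 z - c) <= K * nm (ee z).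
Proof.
have [K0 hK0] := g2_bounded.
have [c [K K1 hK]] := perH_limit g2_perH g2_holo (smallq_bounded hK0).
exists c; last by exists K.
pose l p : C := if p.1 == 0 then zterm 1 p.2%:~R else 0.
have [d d0 h] := @lat_ge R 1 1 ltr01 ler01.
pose Q (Y : R) (z : C) := [/\ 1 <= Im z, `|Re z| <= 1 & Y <= Im z].
have hb := bsum_wt2 (zterm_const_ge0 1 (0, 1) d0).
have Fb p z : Q 0 z -> nm (zterm (lat z (0, 1)) (lat z p)) <= zterm_const d 1 (0, 1) * (wt R p.1 * wt R p.2).
  by move=> [q1 q2 _]; apply: zterm_bound => //; [move=> q q0; exact: h | rewrite lat01 nm1].
have lE p z : p.1 == 0 -> l p = zterm (lat z (0, 1)) (lat z p).
  by move=> /[dup] p0 /eqP p1; rewrite /l p0 lat01 /lat p1 mul0r add0r.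
have Q0 : Q 0 'i%C by split; rewrite /= ?normr0.
have lb p : nm (l p) <= zterm_const d 1 (0, 1) * (wt R p.1 * wt R p.2).
  have [p0|p0] := boolP (p.1 == 0); first by rewrite (lE p 'i%C) //; exact: Fb.
  rewrite /l (negPf p0) nm0; exact: hb.1 p.
have clim : c = csum l.
  apply/subr0_eq/(@nm_small0 _ _ 2) => e e0.
  have [||Y hY] := @dominated_limit R _ C Q (fun p z => zterm (lat z (0, 1)) (lat z p)) l _ _ hb _ Fb lb _ e e0.
  - by move=> Y Y' z YY [q1 q2 q3]; split=> //; exact: le_trans q3.
  - move=> p e' e'0; have [p0|p0] := boolP (p.1 == 0).
      by exists 0 => z _; rewrite -lE // subrr nm0 ltW.
    exists (e'^-1) => z [q1 q2 q3]; rewrite /l (negPf p0) subr0 lat01.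
    have z0 : 0 < Im z by apply: lt_le_trans q1.
    have big u : u = lat z p \/ u = 1 - lat z p -> Im z <= nm u.
      have a1 : 1 <= `|p.1|%:~R :> R by rewrite -[1]/(1%:~R) ler_int; lia.
      have : Im z <= `|p.1%:~R * Im z|.
        by rewrite normrM -intr_norm [`|Im z|]ger0_norm ?ler_peMl // ltW.
      move=> hh [] ->; apply: le_trans (nm_Im _); rewrite /lat.
        by rewrite cImD cImM Re_int !Im_int mul0r !addr0.
      by rewrite raddfB /= cImD cImM Re_int !Im_int mul0r !addr0 sub0r normrN.
    have u1 := big _ (or_introl erefl); have u2 := big _ (or_intror erefl).
    have p1 : lat z p != 0 by rewrite -nm_gt0; apply: lt_le_trans u1.
    have p2 : 1 - lat z p != 0 by rewrite -nm_gt0; apply: lt_le_trans u2.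
    rewrite ztermE // expr1n mul1r nmV nmM nmX.
    apply: (@le_trans _ _ (Im z)^-1); last by rewrite -[e']invrK lef_pV2 ?posrE ?invr_gt0.
    rewrite lef_pV2 ?posrE // ?mulr_gt0 ?exprn_gt0 ?nm_gt0 //.
    have hn : 1 <= nm (lat z p) ^+ 2 by rewrite exprn_ege1 //; exact: le_trans u1.
    by apply: le_trans u2 _; rewrite ler_peMl ?nm_ge0.
  have [Y2 hY2] := vanish_ee hK e0.
  pose z := pt 0 (Num.max 2 (Num.max Y Y2 + 1)).
  have z2 : 2 <= Im z by rewrite le_max lexx.
  have zY : Num.max Y Y2 + 1 <= Im z by rewrite le_max lexx orbT.
  have := le_max Y Y Y2; have := le_max Y2 Y Y2; rewrite !lexx orbT /= => m1 m2.
  have := hY z ltac:(by split; [lra | rewrite normr0 | lra]).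
  have := hY2 z ltac:(by lra).
  have := nm_tri (g2 z) c (csum l); rewrite [nm (c - g2 z)]nm_subC.
  move: (nm (g2 z - c)) => x; rewrite /g2 /eta; move: (nm (_ - csum l)) (nm (c - _)) => y w; lra.
have hl : hasSum l c by rewrite clim; exact: csumP hb lb.
(* 1 / (n^2 (1 - n)) + 1 / ((1 - n)^2 n) is the square of 1 / (n (1 - n)); for n = 0 and n = 1 the
   pair gives 1 + 2. *)
pose hh p : int * int := (p.1, 1 - p.2).
have hhK : cancel hh hh by case=> m n; rewrite /hh /=; congr (_, _); lia.
have hs := hasSumD hl (hasSum_reindex hhK hhK hl).
have pos p : exists2 r : R, 0 <= r & l p + l (hh p) = ofR r /\ (p = 0 -> r = 3).
  case: p => m n; rewrite /l /hh /=; have [->|m0] := eqVneq m 0; last first.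
    by exists 0; rewrite ?addr0 // rmorph0; split=> // -[] /eqP; rewrite (negPf m0).
  have [->|n0] := eqVneq n 0.
    exists 3; rewrite // subr0 zterm0r ttww invr1; split=> //.
    by rewrite rmorph_nat; ring.
  have [->|n1] := eqVneq n 1.
    exists 3; rewrite // subrr zterm0r ttww invr1; split=> //.
    by rewrite rmorph_nat; ring.
  have a0 : (n%:~R : C) != 0 by rewrite intr_eq0.
  have a1 : 1 - (n%:~R : C) != 0 by rewrite subr_eq0 eq_sym -[1]/(1%:~R) eqr_int.
  exists (((n%:~R)^-1 * (1 - n%:~R)^-1) ^+ 2); first exact: sqr_ge0.
  split; last by case=> /eqP; rewrite (negPf n0).
  have nE : ofR n%:~R = n%:~R :> C by rewrite rmorph_int.
  rewrite rmorphXn rmorphM !fmorphV rmorphB rmorph1 /= nE rmorphB /= !ztermE //.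
    by field; rewrite a0 a1.
  by rewrite opprB addrCA subrr addr0.
apply/eqP => c0; have [A hA] := hs 1 ltr01; rewrite c0 in hA.
have := hA (undup (0 :: A)) (undup_uniq _) ltac:(by move=> p pA; rewrite mem_undup in_cons pA orbT).
apply/negP; rewrite -ltNge addr0 subr0; apply: lt_le_trans (nm_Re _).
apply: lt_le_trans (ler_norm _).
rewrite (bigD1_seq 0) ?undup_uniq ?mem_undup ?mem_head //= cReD.
have [r _ [-> ->]] := pos 0; rewrite //=.
suff : 0 <= Re (\sum_(i <- undup (0 :: A) | i != 0) (l i + l (hh i))) by move=> ?; lra.
elim/big_ind: _ => [//|x y hx hy|p _]; first by rewrite cReD addr_ge0.
by have [s s0 [-> _]] := pos p.
Qed.

Definition bounded_inf f := exists M Y : R, forall z, Y < Im z -> nm (f z) <= M.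
Definition wform (k : int) f := forall A z, 0 < Im z -> f (mob A z) = J A z ^ k * f z.

Lemma wformM k l f g : wform k f -> wform l g -> wform (k + l) (fun z => f z * g z).
Proof. by move=> hf hg A z z0; rewrite hf // hg // expfzDr ?J_neq0 // mulrACA. Qed.
Lemma wformV k f : wform k f -> wform (- k) (fun z => (f z)^-1).
Proof. by move=> hf A z z0; rewrite hf // invfM -invr_expz. Qed.
Lemma wformX k f n : wform k f -> wform (k * n%:Z) (fun z => f z ^+ n).
Proof. by move=> hf A z z0; rewrite hf // exprMn -exprz_exp. Qed.
Lemma wformZ k f c : wform k f -> wform k (fun z => c * f z).
Proof. by move=> hf A z z0; rewrite hf // mulrCA. Qed.
Lemma wformB k f g : wform k f -> wform k g -> wform k (fun z => f z - g z).
Proof. by move=> hf hg A z z0; rewrite hf // hg // mulrBr. Qed.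
Lemma wform_perH k f : wform k f -> perH f.
Proof. by move=> hf z z0; rewrite -mob_T hf // J_T exp1rz mul1r. Qed.

Lemma nm_weight k A z c : 0 < Im z ->
  nm (J A z ^ k * c) ^+ 2 * Im (mob A z) ^ k = nm c ^+ 2 * Im z ^ k.
Proof.
move=> z0; rewrite Im_mob // nmM exprMn expfzMl.
have j0 : nm (J A z) != 0 by rewrite nm_eq0 J_neq0.
have -> : nm (J A z ^ k) = nm (J A z) ^ k.
  by case: k => n; rewrite ?NegzE -?invr_expz ?nmV nmX.
have := expfz_neq0 k j0; rewrite exprz_inv -invr_expz expr2 expfzMl -expr2.
by move: (nm (J A z) ^ k) => x x0; field.
Qed.

Lemma wform_nm k f A z : wform k f -> 0 < Im z ->
  nm (f (mob A z)) ^+ 2 * Im (mob A z) ^ k = nm (f z) ^+ 2 * Im z ^ k.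
Proof. by move=> hf z0; rewrite hf // nm_weight. Qed.

(** The invariant |f|^2 Im^k avoids half-integral powers, so [siegel_gen] is applied to f^2. The
    contraction comes from the weight: (y/h)^k <= h/y <= 79/80 for k < 0. *)
Lemma wform_neg0 k f : wform k f -> holoH f -> bounded_inf f -> k < 0 ->
  forall z, 0 < Im z -> f z = 0.
Proof.
move=> wf hf [M [Y hM]] k0 z z0; pose u z := f z ^+ 2.
have up : perH u by move=> w w0; rewrite /u (wform_perH wf).
have hu : holoH u by exact: holoHX.
have us : smallq u.
  apply: (@smallq_bounded _ _ (M ^+ 2) Y) => w /hM h; rewrite nmX.
  by rewrite lerXn2r ?nnegrE ?nm_ge0 //; apply: le_trans h; exact: nm_ge0.
suff : u z = 0 by move/eqP; rewrite expf_eq0 => /eqP.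
refine (@siegel_gen R unit (fun=> u) k (fun=> 1) (79 / 80) _ _ _ _ _ tt z z0).
- by move=> _ A w w0; exists tt; rewrite !nmX wform_nm.
- by move=> _ M' hM' w hw; rewrite mulr1; apply: perH_max hw => //; lra.
- have [|M' hM'] := perH_bounded up hu (y := 79 / 100); first by lra.
  by exists M'.
- by apply/andP; split; lra.
move=> y y0; rewrite mul1r; case: k k0 {wf} => // n _.
rewrite NegzE -invr_expz -exprVn invf_div.
have hy : (0 : R) <= 79 / 100 / y <= 79 / 80.
  by apply/andP; split; [rewrite divr_ge0 //; lra | rewrite ler_pdivrMr; lra].
rewrite exprS; have /andP[y1 y2] := hy.
by apply: le_trans y2; rewrite ler_piMr // exprn_ile1 //; lra.
Qed.
End Level1.

(** * Limits at the cusp and the discriminant *)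

Section Discriminant.
Variable R : realType.
Local Notation C := R[i].
Local Notation Re := (@complex.Re R).
Local Notation Im := (@complex.Im R).
Local Notation ofR := (real_complex R).
Local Notation J := (@autf R).
Implicit Types (A B : SL2Z) (z w u t c : C) (f g F : C -> C).

Definition tends f c := vanish (fun z => f z - c).

Lemma tends_comp F f c : tends f c -> ccont F c -> tends (fun z => F (f z)) (F c).
Proof.
move=> hf hF e e0; have [d d0 hd] := hF e e0.
have [Y hY] := hf (d / 2) ltac:(by rewrite divr_gt0); exists Y => z /hY h.
by apply/ltW/hd; apply: le_lt_trans h _; lra.
Qed.

Lemma tends_bounded f c : tends f c -> bounded_inf f.
Proof.
move=> hf; have [Y hY] := hf 1 ltr01; exists (nm c + 1), Y => z /hY h.
by have := nmD (f z - c) c; rewrite subrK; lra.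
Qed.

Lemma vanishM f g : vanish f -> bounded_inf g -> vanish (fun z => f z * g z).
Proof.
move=> hf [M [Y hM]] e e0; have M0 : 0 < `|M| + 1 by rewrite ltr_wpDl.
have [Y' hY'] := hf (e / (`|M| + 1)) ltac:(by rewrite divr_gt0).
exists (Num.max Y Y') => z; rewrite gt_max => /andP[/hM h1 /hY' h2].
rewrite nmM; apply: (@le_trans _ _ (e / (`|M| + 1) * (`|M| + 1))); last by rewrite divfK // gt_eqF.
apply: ler_pM => //; try exact: nm_ge0.
by apply: le_trans h1 _; apply: le_trans (ler_norm _) _; rewrite lerDl.
Qed.

Lemma vanishD f g : vanish f -> vanish g -> vanish (fun z => f z + g z).
Proof.
move=> hf hg e e0; have e2 : 0 < e / 2 by rewrite divr_gt0.
have [Y hY] := hf _ e2; have [Y' hY'] := hg _ e2.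
exists (Num.max Y Y') => z; rewrite gt_max => /andP[/hY h1 /hY' h2].
by apply: le_trans (nmD _ _) _; lra.
Qed.

Lemma eq_vanish f g : (forall z, 0 < Im z -> f z = g z) -> vanish f -> vanish g.
Proof.
move=> fg hf e /hf[Y hY]; exists (Num.max Y 0) => z; rewrite gt_max => /andP[/hY h z0].
by rewrite -fg.
Qed.

Lemma bounded_inf_cst c : bounded_inf (fun=> c).
Proof. by exists (nm c), 0. Qed.

Lemma vanishZ c f : vanish f -> vanish (fun z => c * f z).
Proof. by move=> hf; have := vanishM hf (bounded_inf_cst c); apply: eq_vanish => z _; rewrite mulrC. Qed.

Lemma tends_cst c : tends (fun=> c) c.
Proof. by move=> e e0; exists 0 => z _; rewrite subrr nm0 ltW. Qed.

Lemma eq_tends f g c : (forall z, 0 < Im z -> f z = g z) -> tends f c -> tends g c.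
Proof. by move=> fg; apply: eq_vanish => z z0; rewrite fg. Qed.

Lemma tendsD f g a b : tends f a -> tends g b -> tends (fun z => f z + g z) (a + b).
Proof. by move=> hf hg; apply: eq_vanish (vanishD hf hg) => z _; ring. Qed.

Lemma tendsM f g a b : tends f a -> tends g b -> tends (fun z => f z * g z) (a * b).
Proof.
move=> hf hg; apply: eq_vanish (vanishD (vanishM hf (tends_bounded hg)) (vanishZ a hg)) => z _.
by ring.
Qed.

Lemma tendsZ f a c : tends f a -> tends (fun z => c * f z) (c * a).
Proof. by move=> hf; apply: tendsM => //; exact: tends_cst. Qed.

Lemma tendsB f g a b : tends f a -> tends g b -> tends (fun z => f z - g z) (a - b).
Proof. by move=> hf hg; have := tendsD hf (tendsZ (-1) hg); rewrite mulN1r; apply: eq_tends => z _; rewrite mulN1r. Qed.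

Lemma tendsX f a n : tends f a -> tends (fun z => f z ^+ n) (a ^+ n).
Proof.
move=> hf; elim: n => [|n ih]; first exact: tends_cst.
rewrite exprS; have := tendsM hf ih; apply: eq_tends => z _; by rewrite exprS.
Qed.

Lemma boundedM f g : bounded_inf f -> bounded_inf g -> bounded_inf (fun z => f z * g z).
Proof.
move=> [M [Y hM]] [N [X hN]]; exists (M * N), (Num.max Y X) => z; rewrite gt_max => /andP[/hM h1 /hN h2].
by rewrite nmM; apply: ler_pM => //; exact: nm_ge0.
Qed.

Lemma ee_bounded (n : nat) : bounded_inf (fun z : C => ee z ^+ n).
Proof.
exists 1, 0 => z z0; rewrite nmX exprn_ile1 ?nm_ge0 // nm_ee -[X in _ <= X]expR0 ler_expR oppr_le0.
by rewrite mulr_ge0 ?(ltW z0) // ltW // pi2_gt0.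
Qed.

Lemma dv_vanish f : holoH f -> vanish f -> vanish (dv f).
Proof.
move=> hf vf e e0; have [Y hY] := vf (e / 12) ltac:(by rewrite divr_gt0).
exists (Num.max 1 (Y + 1)) => z; rewrite gt_max => /andP[z1 zY].
have near w : nm (w - z) < 1 -> 0 < Im w /\ Y < Im w.
  move=> h; have := nm_Im (w - z); rewrite raddfB /= ler_norml => /andP[h' _].
  by split; lra.
have [||h _] := @Taylor1 R f z 1 (e / 12) ltr01.
- by move=> w /near[w0 _]; exact: hf.
- by move=> w /near[_ wY]; exact: hY.
by apply: le_trans h _; lra.
Qed.

Lemma i_neq0 : ('i%C : C) != 0.
Proof. by rewrite -nm_gt0 nm_i. Qed.

Lemma mob_S_i : mob matS ('i%C : C) = 'i%C.
Proof.
rewrite mob_S; apply: (mulfI i_neq0); rewrite mulrN divff ?i_neq0 //.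
by rewrite -expr2 sqr_i.
Qed.

Lemma mob_matR z : 0 < Im z -> mob matR z = mob matS (z + 1).
Proof. by move=> z0; rewrite mobM // mob_T. Qed.

Lemma zeta1X : (zeta R + 1) ^+ 2 = zeta R.
Proof.
by have h := zeta2 R; apply/eqP; rewrite -subr_eq0; apply/eqP; rewrite -[RHS]h; ring.
Qed.

Lemma zeta_X3 : zeta R ^+ 3 = 1.
Proof.
have h := zeta2 R; apply/eqP; rewrite -subr_eq0; apply/eqP.
by transitivity ((zeta R - 1) * (zeta R ^+ 2 + zeta R + 1)); [ring | rewrite h mulr0].
Qed.

Lemma J_R_zeta : J matR (zeta R) = zeta R + 1.
Proof. by rewrite JM ?zeta_gt0 // J_S mob_T ?zeta_gt0 // J_T mulr1. Qed.

(** G (z + 1) - G z has derivative 0, and high up G z - c z has arbitrarily small derivative, so the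
    constant is c. *)
Lemma primitive_shift g G c : perH g -> tends g c -> (forall z, 0 < Im z -> cdiff G z (g z)) ->
  forall z, 0 < Im z -> G (z + 1) - G z = c.
Proof.
move=> gp gc hG; pose H z := G (z + 1) - G z.
have hH z : 0 < Im z -> cdiff H z 0.
  move=> z0; have z1 : 0 < Im (z + 1) by rewrite cImD addr0.
  have := cdiffB (cdiff_comp (cdiffD (cdiff_id z) (cdiff_cst 1 z)) (hG _ z1)) (hG _ z0).
  by rewrite addr0 mulr1 gp // subrr.
move=> z z0; rewrite -/(H z); apply/subr0_eq/(@nm_small0 _ _ 2) => e e0.
have [Y hY] := gc e e0; pose w := pt 0 (Num.max 1 (Y + 1)).
have w1 : 1 <= Im w by rewrite le_max lexx.
have wY : Y < Im w by rewrite lt_max; apply/orP; right; lra.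
rewrite (cdiff_cst_H hH z0 (w := w)); last by apply: lt_le_trans w1.
have -> : H w - c = (fun z => G z - c * z) (w + 1) - (fun z => G z - c * z) w by rewrite /H /=; ring.
have -> : 2 * e = 2 * e * nm (1 : C) by rewrite nm1 mulr1.
apply: (@cdiff_lip R (fun z => G z - c * z)); first exact: ltW.
move=> s s01; have wI : Im (w + ofR s * 1) = Im w by rewrite mulr1 cImD addr0.
exists (g (w + ofR s * 1) - c * 1); last by rewrite [c * 1]mulr1; apply: hY; rewrite wI.
apply: cdiffB; last exact: cdiffZ (cdiff_id _).
by apply: hG; rewrite wI; apply: lt_le_trans w1.
Qed.

(** If kap were 0, g2 dz would be invariant. A primitive would then be invariant under S and R,
    since each has a fixed point, hence under T, against the nonzero constant term of g2. *)
Lemma kap_const : exists2 k0 : C, k0 != 0 & forall z, 0 < Im z -> kap z = k0.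
Proof.
have [k0 hk] := weight0_const (@kap_mob R) (@kap_holo R) (@kap_smallq R).
exists k0 => //; apply/eqP => k00.
have [c c0 [K K0 hK]] := g2_limit R; have [G hG] := primitive (@g2_holo R).
have inv A w : 0 < Im w -> mob A w = w -> forall z, 0 < Im z -> G (mob A z) = G z.
  move=> w0 fix_w z z0; apply/subr0_eq; pose H z := G (mob A z) - G z.
  have hH u : 0 < Im u -> cdiff H u 0.
    move=> u0; have j0 := J_neq0 A u0.
    have := cdiffB (cdiff_comp (cdiff_mob A u0) (hG _ (mob_gt0 A u0))) (hG _ u0).
    by rewrite g2_mob // hk // k00 mulr0 subr0 mulrAC divff ?expf_neq0 // mul1r subrr.
  by rewrite -/(H z) (cdiff_cst_H hH z0 w0) /H fix_w subrr.
have := primitive_shift (@g2_perH R) (vanish_ee hK) hG (@i_gt0 R).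
have i1 : 0 < Im ('i%C + 1) by rewrite cImD addr0 i_gt0.
rewrite -(inv matS _ (@i_gt0 R) mob_S_i _ i1) -mob_matR ?i_gt0 //.
rewrite (inv matR _ (zeta_gt0 R) (mob_R_zeta R)) ?i_gt0 // subrr => e.
by rewrite -e eqxx in c0.
Qed.

Lemma ee_int (m : int) : ee (m%:~R : C) = 1.
Proof.
rewrite -[m%:~R]add0r -[RHS](@ee0 R); apply: (@periodicZ R (@ee R)) => z.
by rewrite eeD ee1 mulr1.
Qed.

(** [D] is the exponential of a multiple of a primitive of g2, hence without zeros, and of weight 12
    up to a character. The character is trivial on S and R, which fix points where J^12 = 1. The
    order 1 at the cusp is forced by vanishing theorems from both sides. *)
Lemma quasi_exists : exists E2 D : C -> C,
  [/\ [/\ holoH E2, perH E2 & tends E2 1],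
      forall A z, 0 < Im z -> E2 (mob A z) = J A z ^+ 2 * E2 z + 12 / c2pi R * (ec A)%:~R * J A z,
      forall z, 0 < Im z -> D z != 0,
      wform 12 D /\ forall z, 0 < Im z -> cdiff D z (c2pi R * E2 z * D z) &
      exists2 c, c != 0 & tends (fun z => D z / ee z) c].
Proof.
have [k0 k00 hk] := kap_const; have [c c0 [K K0 hK]] := g2_limit R.
have [G hG] := primitive (@g2_holo R); have p0 := c2pi_neq0 R.
have Gs := primitive_shift (@g2_perH R) (vanish_ee hK) hG.
(* With this constant the defect of g2 contributes 12 c / J(A, z) to the logarithmic derivative,
   which is that of J(A, z)^12. *)
pose lam := - 12 / k0; pose D z := cexp (lam * G z).
have lam0 : lam != 0 by rewrite mulf_neq0 ?invr_eq0 ?oppr_eq0 ?pnatr_eq0.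
have D0 z : D z != 0 by exact: cexp_neq0.
have dD z : 0 < Im z -> cdiff D z (lam * g2 z * D z).
  by move=> z0; have := cdiff_comp (cdiffZ lam (hG z z0)) (cdiff_cexp _); rewrite mulrC.
have char A w : 0 < Im w -> mob A w = w -> J A w ^+ 12 = 1 ->
    forall z, 0 < Im z -> D (mob A z) = J A z ^+ 12 * D z.
  move=> w0 fixw jw z z0.
  pose L z := lam * G (mob A z) - lam * G z; pose q z := cexp (L z) * (J A z)^-1 ^+ 12.
  have hq u : 0 < Im u -> cdiff q u 0.
    move=> u0; have j0 := J_neq0 A u0.
    have dL : cdiff L u (12 * (ec A)%:~R / J A u).
      have := cdiffB (cdiffZ lam (cdiff_comp (cdiff_mob A u0) (hG _ (mob_gt0 A u0)))) (cdiffZ lam (hG _ u0)).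
      rewrite g2_mob // hk // (_ : _ - _ = 12 * (ec A)%:~R / J A u) //.
      by rewrite /lam; field; rewrite k00 j0.
    have := cdiffM (cdiff_comp dL (cdiff_cexp _)) (cdiffX 12 (cdiffV j0 (cdiff_J A u))).
    rewrite [X in cdiff _ _ X](_ : _ = 0) //=; set x := cexp _; set j := J A u in j0 *.
    by field.
  have := cdiff_cst_H hq z0 w0; rewrite /q /L fixw subrr cexp0 [in RHS]exprVn jw invr1 mulr1.
  move=> /(canRL (mulfK (expf_neq0 12 (invr_neq0 (J_neq0 A z0))))).
  rewrite exprVn invrK mul1r => h; rewrite /D -h -cexpD; congr cexp; ring.
have DS : forall z, 0 < Im z -> D (mob matS z) = J matS z ^+ 12 * D z.
  apply: (char _ _ (@i_gt0 R) mob_S_i); rewrite J_S.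
  by rewrite -[12%N]/(2 * 6)%N exprM sqr_i -signr_odd.
have DR : forall z, 0 < Im z -> D (mob matR z) = J matR z ^+ 12 * D z.
  apply: (char _ _ (zeta_gt0 R) (mob_R_zeta R)); rewrite J_R_zeta.
  by rewrite -[12%N]/(2 * 6)%N exprM zeta1X -[6%N]/(3 * 2)%N exprM zeta_X3 expr1n.
have DT z : 0 < Im z -> D (z + 1) = D z.
  move=> z0; have z1 : 0 < Im (z + 1) by rewrite cImD addr0.
  have := DR z z0; rewrite mob_matR // DS // J_S JM // mob_T // J_S J_T mulr1.
  apply: mulfI; rewrite expf_neq0 //; apply/eqP => e; by rewrite e ltxx in z1.
have wD : wform 12 D.
  move=> A z z0; rewrite -exprnP; move: A z z0.
  apply: SL2Z_ind => [z z0|z z0|A B hA hB z z0|A hA z z0]; first exact: DS.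
  - by rewrite mob_T DT // J_T expr1n mul1r.
  - by rewrite mobM // hA ?mob_gt0 // hB // JM // exprMn mulrA.
  - have j0 := J_neq0 A^-1%g z0; have z0' := mob_gt0 A^-1%g z0.
    have := hA _ z0'; rewrite mobVK // => ->; rewrite mulrA -exprMn.
    have := JM A A^-1%g z0; rewrite mulgV J1 => e.
    by rewrite [J _ _ * _]mulrC -e expr1n mul1r.
(* Invariance under T gives e^(lam c) = 1; m is the order of D at the cusp. *)
have [m hm] : exists m : int, lam * c = c2pi R * m%:~R.
  pose t := lam * c / c2pi R; have et : ee t = 1.
    rewrite /ee /t [c2pi R * _]mulrC divfK //.
    apply: (mulIf (D0 'i%C)); rewrite mul1r -{2}(DT _ (@i_gt0 R)) /D -cexpD.
    by rewrite -mulrDr -(Gs _ (@i_gt0 R)) subrK.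
  exists (Num.floor (Re t)); suff <- : t = (Num.floor (Re t))%:~R by rewrite [RHS]mulrC divfK.
  apply/subr0_eq/ee_eq1; first by rewrite eeD et eeN ee_int invr1 mul1r.
  rewrite raddfB /= Re_int.
  have := Num.Theory.floor_itv (Re t); rewrite intrD => /andP[h1 h2].
  by rewrite ltr_norml; apply/andP; split; lra.
pose G1 z := G z - c * z.
have dG1 z : 0 < Im z -> cdiff G1 z (g2 z - c).
  by move=> z0; have := cdiffB (hG z z0) (cdiffZ c (cdiff_id z)); rewrite mulr1.
have hG1 : holoH G1 by move=> z /dG1; exists (g2 z - c).
have G1p : perH G1.
  by move=> z z0; have := Gs z z0; rewrite /G1 => /(canRL (subrK _)) ->; ring.
have sG1 : smallq G1.
  pose w0 := pt 0 2 : C.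
  apply: (@strip_smallq R _ (nm (G1 w0) + 8 * K)) => //.
    by rewrite addr_ge0 ?nm_ge0 ?mulr_ge0.
  move=> z z1 /andP[x1 x2].
  have lip : nm (G1 (w0 + (z - w0)) - G1 w0) <= 2 * K * nm (z - w0).
    apply: cdiff_lip => // s s01.
    have h1 : 1 < Im (w0 + ofR s * (z - w0)).
      by apply: segment_gt => //; [rewrite /= ; lra | rewrite addrC subrK].
    exists (g2 (w0 + ofR s * (z - w0)) - c); first by apply: dG1; apply: lt_trans h1.
    apply: le_trans (hK _ h1) _; rewrite ler_piMr // nm_ee -[X in _ <= X]expR0 ler_expR oppr_le0.
    by rewrite mulr_ge0 ?(ltW (pi2_gt0 R)) //; lra.
  rewrite [w0 + _]addrC subrK in lip.
  have nz : nm (z - w0) <= 4 * Im z.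
    apply: le_trans (nm_ReIm _) _; rewrite !raddfB /= subr0.
    have : `|Re z| <= 1 by rewrite ler_norml; apply/andP; split; lra.
    have : `|Im z - 2| <= Im z + 2 by rewrite ler_norml; apply/andP; split; lra.
    lra.
  have y3 : Im z <= Im z ^+ 3 by rewrite exprS ler_peMr ?exprn_ege1 //; lra.
  have y4 : 1 <= Im z ^+ 3 by rewrite exprn_ege1 // ltW.
  have := nmD (G1 z - G1 w0) (G1 w0); rewrite subrK => h.
  apply: le_trans h _; apply: le_trans (lerD lip (lexx _)) _.
  have : 2 * K * nm (z - w0) <= 2 * K * (4 * Im z) by rewrite ler_wpM2l // mulr_ge0.
  have : K * Im z <= K * Im z ^+ 3 by rewrite ler_wpM2l.
  have : nm (G1 w0) <= nm (G1 w0) * Im z ^+ 3 by rewrite ler_peMr // nm_ge0.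
  move: (Im z ^+ 3) (nm (G1 w0)) (nm (z - w0)) => x y v; nra.
have [c1 [K1 _ hK1]] := perH_limit G1p hG1 sG1.
pose f z := cexp (lam * G1 z).
have f0 z : f z != 0 by exact: cexp_neq0.
have hf : tends f (cexp (lam * c1)).
  apply: (@tends_comp (fun x => cexp (lam * x)) _ _ (vanish_ee hK1)).
  by apply: cdiff_cont; apply: cdiff_comp (cdiffZ lam (cdiff_id c1)) (cdiff_cexp _).
have hfV : tends (fun z => (f z)^-1) (cexp (lam * c1))^-1.
  by apply: (tends_comp (F := fun x => x^-1) hf); apply: cdiff_cont (cdiff_inv (cexp_neq0 _)).
have Df z : D z = ee (m%:~R * z) * f z.
  rewrite /D /f /ee -cexpD; congr cexp; rewrite mulrA -hm /G1; ring.
have eeM (n : nat) z : ee (n%:R * z) = ee z ^+ n by rewrite eeX mulr_natl.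
(* Otherwise 1 / D would be bounded at the cusp and of weight -12, hence zero. *)
have m1 : 0 < m.
  rewrite ltNge; apply/negP => m0.
  have : (D 'i%C)^-1 = 0.
    refine (@wform_neg0 R _ _ (wformV wD) _ _ _ _ (@i_gt0 R)) => //.
      by apply: holoHV => [z z0|z _]; [exists (lam * g2 z * D z); exact: dD | exact: D0].
    have [n mn] : exists n : nat, m = - n%:Z by exists `|m|%N; lia.
    have [M [Y hM]] := boundedM (ee_bounded n) (tends_bounded hfV).
    exists M, Y => z /hM; have -> // : (D z)^-1 = ee z ^+ n / f z.
    by rewrite Df invfM mn rmorphN mulNr eeN invrK -(eeM n).
  by move/eqP; rewrite invr_eq0 (negPf (D0 _)).
have m2 : m = 1.
  suff : ~ 2 <= m by lia.
  move=> m2.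
  have [n mn] : exists n : nat, m = n.+2%:Z by exists `|m - 2|%N; lia.
  have : D 'i%C ^+ 2 = 0; last by move/eqP; rewrite expf_eq0 (negPf (D0 _)) andbF.
  (* If m >= 2, D^2 is O(q^4), a decay rate 8 pi >= 16, above the rate 12 / (79/100) of the growth
     (y/h)^12; [siegel] would then make D vanish. *)
  pose u z := D z ^+ 2; pose v z := u z * ee (- (4 * z)).
  have pu : perH u by move=> z z0; rewrite /u DT.
  have hu : holoH u by apply: holoHX => z z0; exists (lam * g2 z * D z); exact: dD.
  have pv : perH v.
    move=> z z0; rewrite /v pu // mulrDr opprD eeD mulr1 -[- 4]/((-4)%:~R) ee_int mulr1 //.
  have hv : holoH v.
    apply: holoHM => // z _; eexists; apply: cdiff_comp (cdiff_ee _).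
    exact: cdiffN (cdiffZ 4 (cdiff_id z)).
  have sv : smallq v.
    have [M [Y hM]] := boundedM (ee_bounded (n * 2)) (tends_bounded (tendsX 2 hf)).
    apply: (@smallq_bounded R v M Y) => z /hM; congr (nm _ <= _); rewrite /v /u.
    have -> : D z = ee z ^+ n * ee z ^+ 2 * f z.
      by rewrite Df mn -exprD addn2; congr (_ * _); exact: (eeM n.+2).
    by rewrite eeN (eeM 4) exprM; move: (ee z) (ee_neq0 z) => q q0; field.
  have nv z : nm (u z) = nm (v z) * expR (- (2 * pi * 4 * Im z)).
    have E : nm (ee (- (4 * z))) * expR (- (2 * pi * 4 * Im z)) = 1.
      rewrite nm_ee -expRD -[RHS]expR0; congr expR; rewrite raddfN /= cImM /=; ring.
    by rewrite /v nmM -[RHS]mulrA E mulr1.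
  refine (@siegel R unit (fun=> u) 12 (12 / (79 / 100)) (2 * pi * 4) _ _ _ _ _ tt _ (@i_gt0 R)).
  - by move=> _ A z z0; exists tt; rewrite !nmX wform_nm.
  - move=> _ M hM z hz; rewrite nv.
    have h0 : 0 < 79 / 100 :> R by lra.
    have : nm (v z) <= M * expR (2 * pi * 4 * (79 / 100)).
      apply: (perH_max pv hv sv h0) hz => x; rewrite -ler_pdivrMr ?expR_gt0 // -expRN.
      by have := hM x; rewrite nv.
    move=> /(ler_wpM2r (expR_ge0 (- (2 * pi * 4 * Im z)))); rewrite -[_ * expR _ * expR _]mulrA -expRD.
    by congr (_ <= _ * expR _); ring.
  - have [|M hM] := perH_bounded pu hu (y := 79 / 100); first by lra.
    by exists M.
  - move=> y hy; rewrite -exprnP.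
    have -> : 12 / (79 / 100) * (y - 79 / 100) = (y / (79 / 100) - 1) * 12%:R :> R by field.
    rewrite expRM_natr; apply: lerXn2r; rewrite ?nnegrE ?expR_ge0 ?divr_ge0 //; try lra.
    by apply: le_trans (expR_ge1Dx _); lra.
  - by have := pi_ge2 R; lra.
rewrite m2 mulr1 in hm.
exists (fun z => lam / c2pi R * g2 z), D; split.
- split; first by apply: holoHZ; exact: g2_holo.
    by move=> z z0; rewrite g2_perH.
  have := tendsZ (lam / c2pi R) (vanish_ee hK : tends (@g2 R) c).
  by rewrite [lam / _ * c]mulrAC hm divff.
- move=> A z z0; rewrite g2_mob // hk // /lam; field; by rewrite k00 p0.
- by move=> z _; exact: D0.
- split=> // z z0; have -> : c2pi R * (lam / c2pi R * g2 z) = lam * g2 z by field.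
  exact: dD.
- exists (cexp (lam * c1)); first exact: cexp_neq0.
  by apply: eq_tends hf => z z0; rewrite Df m2 mul1r mulrAC divff ?ee_neq0 ?mul1r.
Qed.
End Discriminant.

(** * Serre's derivative and the forms E4 and E6 *)

Section Eisenstein.
Variable R : realType.
Local Notation C := R[i].
Local Notation Re := (@complex.Re R).
Local Notation Im := (@complex.Im R).
Local Notation ofR := (real_complex R).
Local Notation J := (@autf R).
Implicit Types (A B : SL2Z) (z w u t c : C) (f g F : C -> C).

(* The quasi-modular form of weight two with value 1 at the cusp; Delta is the
   exponential of a primitive of it. *)
Definition E2 : C -> C := sval (cid (quasi_exists R)).
Definition Delta : C -> C := sval (cid (svalP (cid (quasi_exists R)))).

Lemma E2_Delta : [/\ [/\ holoH E2, perH E2 & tends E2 1],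
      forall A z, 0 < Im z -> E2 (mob A z) = J A z ^+ 2 * E2 z + 12 / c2pi R * (ec A)%:~R * J A z,
      forall z, 0 < Im z -> Delta z != 0,
      wform 12 Delta /\ forall z, 0 < Im z -> cdiff Delta z (c2pi R * E2 z * Delta z) &
      exists2 c, c != 0 & tends (fun z => Delta z / ee z) c].
Proof. exact: svalP (cid (svalP (cid (quasi_exists R)))). Qed.

Lemma E2_holo : holoH E2. Proof. by have [[]] := E2_Delta. Qed.
Lemma E2_tends : tends E2 1. Proof. by have [[]] := E2_Delta. Qed.
Lemma Delta_neq0 z : 0 < Im z -> Delta z != 0. Proof. by have [_ _ h _ _] := E2_Delta; exact: h. Qed.
Lemma Delta_wform : wform 12 Delta. Proof. by have [_ _ _ []] := E2_Delta. Qed.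
Lemma Delta_holo : holoH Delta.
Proof. by have [_ _ _ [_ h] _] := E2_Delta => z /h; exists (c2pi R * E2 z * Delta z). Qed.
Lemma Delta_tends : exists2 c, c != 0 & tends (fun z => Delta z / ee z) c.
Proof. by have [] := E2_Delta. Qed.
Lemma Delta_bounded : exists2 c, c != 0 & tends (fun z => ee z / Delta z) c.
Proof.
have [c c0 h] := Delta_tends; exists c^-1; first by rewrite invr_eq0.
have := tends_comp (F := fun x => x^-1) h (cdiff_cont (cdiff_inv c0)).
by apply: eq_tends => z _; rewrite invfM invrK mulrC.
Qed.

Lemma vanish_ee1 : vanish (@ee R).
Proof.
move=> e e0; have [Y hY] := nm_ee_small e0.
by exists Y => z /hY /ltW.
Qed.

Lemma Delta_vanish : vanish Delta.
Proof.
have [c _ h] := Delta_tends.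
apply: eq_vanish (vanishM vanish_ee1 (tends_bounded h)) => z _.
by rewrite mulrC divfK ?ee_neq0.
Qed.

Lemma vanish_div_Delta f : perH f -> holoH f -> vanish f -> bounded_inf (fun z => f z / Delta z).
Proof.
move=> fp hf vf.
have [Y hY] := vf 1 ltr01.
have [c [K K0 hK]] := perH_limit fp hf (smallq_bounded hY).
have c0 : c = 0.
  apply: (@nm_small0 R _ 2) => e e0.
  have [Y1 h1] := vf e e0; have [Y2 h2] := vanish_ee hK e0.
  pose z := pt 0 (Num.max Y1 Y2 + 1).
  have := h1 z; have := h2 z; rewrite /=.
  have l1 : Y1 < Num.max Y1 Y2 + 1 by apply: le_lt_trans (_ : Num.max Y1 Y2 < _); rewrite ?le_max ?lexx ?ltrDl.
  have l2 : Y2 < Num.max Y1 Y2 + 1 by apply: le_lt_trans (_ : Num.max Y1 Y2 < _); rewrite ?le_max ?lexx ?orbT ?ltrDl.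
  move=> /(_ l2) a /(_ l1) b; have := nmB (f z) (f z - c); rewrite opprB addrC subrK; lra.
have [d d0 hd] := Delta_bounded.
have hb : bounded_inf (fun z => f z / ee z).
  exists K, 1 => z /hK; rewrite c0 subr0 nmM nmV => h.
  by rewrite ler_pdivrMr // nm_gt0 ee_neq0.
have [M [Y' hM]] := boundedM hb (tends_bounded hd); exists M, Y' => z /hM.
by rewrite mulrA divfK ?ee_neq0.
Qed.

(** Dividing by Delta leaves a bounded form of negative weight. *)
Lemma wform_vanish0 k f : wform k f -> holoH f -> vanish f -> k < 12 -> forall z, 0 < Im z -> f z = 0.
Proof.
move=> wf hf vf k12 z z0; have D0 := Delta_neq0 z0.
have E : f z = f z * (Delta z)^-1 * Delta z by rewrite divfK.
rewrite E (wform_neg0 (wformM wf (wformV Delta_wform)) _ _ _ z0) ?mul0r //.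
- by apply: holoHM => //; apply: holoHV; [exact: Delta_holo | exact: Delta_neq0].
- exact: vanish_div_Delta (wform_perH wf) hf vf.
- lia.
Qed.

(** This is -12 times Serre's derivative: the defect of E2 cancels that of f' ([dv_mob]). The
    scaling gives the limit k at the cusp when f has limit 1. *)
Definition serre (k : nat) f z : C := k%:R * E2 z * f z - 12 / c2pi R * dv f z.

Lemma dv_mob (k : nat) f A z : wform k%:Z f -> holoH f -> 0 < Im z ->
  dv f (mob A z) = J A z ^+ k.+2 * dv f z + k%:R * (ec A)%:~R * J A z ^+ k.+1 * f z.
Proof.
move=> wf hf z0; have j0 := J_neq0 A z0.
have h1 := cdiff_comp (cdiff_mob A z0) (dvP (hf _ (mob_gt0 A z0))).
have h2 := cdiffM (cdiffX k (cdiff_J A z)) (dvP (hf z z0)).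
have h3 : cdiff (fun w => f (mob A w)) z (k%:R * J A z ^+ k.-1 * (ec A)%:~R * f z + J A z ^+ k * dv f z).
  apply: (@cdiff_near R (fun w => J A w ^+ k * f w) _ z _ (Im z)) => // w hw.
  by rewrite wf // (@disc_H R z).
have := cdiff_unique h1 h3; move/(canRL (divfK (expf_neq0 2 j0))) => ->.
have -> : k%:R * J A z ^+ k.-1 * (ec A)%:~R * f z = k%:R * J A z ^+ k / J A z * (ec A)%:~R * f z.
  by case: k {wf h2 h3} => [|k]; [rewrite !mul0r | rewrite exprSr mulrA mulfK].
by rewrite !exprS; field.
Qed.

Lemma serre_wform (k : nat) f : wform k%:Z f -> holoH f -> wform k.+2%:Z (serre k f).
Proof.
move=> wf hf A z z0; have [_ hg _ _ _] := E2_Delta; have j0 := J_neq0 A z0.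
rewrite /serre (dv_mob A wf hf z0) hg // wf // -!exprnP !exprS; ring.
Qed.

Lemma serre_holo k f : holoH f -> holoH (serre k f).
Proof.
move=> hf; apply: holoHB; last by apply: holoHZ; exact: holoH_dv.
by apply: holoHM => //; apply: holoHM; [exact: holoH_cst | exact: E2_holo].
Qed.

Lemma dv_tends f c : holoH f -> tends f c -> tends (dv f) 0.
Proof.
move=> hf tf; have hc : holoH (fun z => f z - c) by apply: holoHB => //; exact: holoH_cst.
apply: eq_vanish (dv_vanish hc tf) => z z0; rewrite subr0.
apply: dvE; rewrite -[X in cdiff _ _ X]subr0; apply: cdiffB (dvP (hf z z0)) (cdiff_cst _ _).
Qed.

Lemma serre_tends k f : holoH f -> tends f 1 -> tends (serre k f) k%:R.
Proof.
move=> hf tf; have -> : k%:R = k%:R * 1 * 1 - 12 / c2pi R * 0 :> C by rewrite !mulr1 mulr0 subr0.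
apply: tendsB; last by apply: tendsZ; exact: dv_tends tf.
by apply: tendsM => //; apply: tendsZ; exact: E2_tends.
Qed.

(** Ramanujan's differential equations for E2 and E4 serve as definitions of E4 and E6, so weights
    and constant terms follow from those of E2. *)
Definition E4 z : C := E2 z ^+ 2 - 12 / c2pi R * dv E2 z.
Definition E6 z : C := 4^-1 * serre 4 E4 z.

Lemma E4_holo : holoH E4.
Proof.
apply: holoHB; first by apply: holoHX; exact: E2_holo.
by apply: holoHZ; apply: holoH_dv; exact: E2_holo.
Qed.
Lemma E6_holo : holoH E6. Proof. by apply: holoHZ; apply: serre_holo; exact: E4_holo. Qed.

Lemma E4_wform : wform 4%:Z E4.
Proof.
move=> A z z0; have [_ hg _ _ _] := E2_Delta; have j0 := J_neq0 A z0; have p0 := c2pi_neq0 R.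
have h1 := cdiff_comp (cdiff_mob A z0) (dvP (E2_holo (mob_gt0 A z0))).
have h2 := cdiffD (cdiffM (cdiffX 2 (cdiff_J A z)) (dvP (E2_holo z0)))
  (cdiffZ (12 / c2pi R * (ec A)%:~R) (cdiff_J A z)).
have h3 := @cdiff_near R _ (fun w => E2 (mob A w)) z _ (Im z) z0 _ h2.
have := cdiff_unique h1 (h3 _) => {h3}; rewrite /E4 hg // -exprnP.
move=> h4; have -> : dv E2 (mob A z) = dv E2 (mob A z) / J A z ^+ 2 * J A z ^+ 2 by rewrite divfK ?expf_neq0.
by rewrite h4 => [|w hw]; [field | rewrite hg // (@disc_H R z)].
Qed.

Lemma E6_wform : wform 6%:Z E6.
Proof. by apply: wformZ; apply: (@serre_wform 4); [exact: E4_wform | exact: E4_holo]. Qed.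

Lemma E4_tends : tends E4 1.
Proof.
have -> : 1 = 1 ^+ 2 - 12 / c2pi R * 0 :> C by rewrite mulr0 subr0 expr1n.
apply: tendsB; first by apply: tendsX; exact: E2_tends.
by apply: tendsZ; apply: dv_tends E2_tends; exact: E2_holo.
Qed.

Lemma E6_tends : tends E6 1.
Proof.
have -> : 1 = 4^-1 * 4%:R :> C by rewrite mulVf ?pnatr_eq0.
by apply: tendsZ; apply: serre_tends E4_tends; exact: E4_holo.
Qed.

(** Ramanujan's third equation: the difference is a form of weight 8 vanishing at the cusp. It gives
    the simplicity of the zero of E6 at i. *)
Lemma serre_E6 z : 0 < Im z -> serre 6 E6 z = 6 * E4 z ^+ 2.
Proof.
move=> z0; apply/subr0_eq; pose f z := serre 6 E6 z - 6 * E4 z ^+ 2.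
apply: (@wform_vanish0 8%:Z f) => //.
- apply: wformB; first by apply: (@serre_wform 6); [exact: E6_wform | exact: E6_holo].
  by apply: wformZ; apply: (wformX 2 E4_wform).
- apply: holoHB; first by apply: serre_holo; exact: E6_holo.
  by apply: holoHZ; apply: holoHX; exact: E4_holo.
- have := tendsB (serre_tends 6 E6_holo E6_tends) (tendsZ 6 (tendsX 2 E4_tends)).
  by rewrite expr1n mulr1 subrr; apply: eq_vanish => w _; rewrite subr0.
Qed.

(** R fixes zeta, and J(R, zeta)^4 = zeta^2 is not 1. *)
Lemma E4_zeta : E4 (zeta R) = 0.
Proof.
have := E4_wform matR (zeta_gt0 R); rewrite mob_R_zeta J_R_zeta -exprnP.
rewrite -[4%N]/(2 * 2)%N exprM zeta1X => h; apply/eqP; move/eqP: h.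
rewrite -subr_eq0 -{1}[E4 _]mul1r -mulrBl mulf_eq0 => /orP[|//].
rewrite subr_eq0 eq_sym => /eqP z2; exfalso.
have := zeta2 R; rewrite z2 => /eqP; rewrite -addrA addrCA -[1 + 1]/(2%:R) eq_complex /=.
by case/andP => /eqP h _; move: h; lra.
Qed.

Lemma E6_i : E6 'i%C = 0.
Proof.
have := E6_wform matS (@i_gt0 R); rewrite mob_S_i J_S -exprnP -[6%N]/(2 * 3)%N exprM sqr_i.
rewrite -signr_odd expr1 mulN1r => h; apply/eqP.
have : E6 'i%C *+ 2 == 0 by rewrite mulr2n {1}h addNr.
by rewrite mulrn_eq0.
Qed.

(** At a zero of E4 the definition of E6 leaves only a multiple of the derivative of E4. *)
Lemma dv_E4_zeta : E6 (zeta R) != 0 -> dv E4 (zeta R) != 0.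
Proof.
apply: contra => /eqP h.
by rewrite /E6 /serre h E4_zeta !mulr0 subrr mulr0.
Qed.

Lemma dv_E6_i : E4 'i%C != 0 -> dv E6 'i%C != 0.
Proof.
apply: contra => /eqP h; have := serre_E6 (@i_gt0 R).
rewrite /serre h E6_i !mulr0 subrr => /esym/eqP; rewrite mulf_eq0 pnatr_eq0 /= expf_eq0.
by [].
Qed.
End Eisenstein.

(** * Poincare series *)

Section Poincare.
Variable R : realType.
Local Notation C := R[i].
Local Notation Re := (@complex.Re R).
Local Notation Im := (@complex.Im R).
Local Notation ofR := (real_complex R).
Local Notation J := (@autf R).
Implicit Types (A B : SL2Z) (z w u t c : C).

(* num w A t = (A t - conj w) J(A, t); its negative powers are the terms of the
   Poincare series, which for large weight concentrates on the stabilizer of w. *)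
Definition num w A t : C := numf A t - pt (Re w) (- Im w) * J A t.

Lemma num_mob w A B t : 0 < Im t -> num w A (mob B t) = num w (A * B)%g t / J B t.
Proof.
move=> t0; have j0 := J_neq0 B t0; have t1 := mob_gt0 B t0; have j1 := J_neq0 A t1.
have numfM u : 0 < Im u -> numf (A * B)%g u = numf A (mob B u) * J B u.
  move=> u0; have h := mobM A B u0; rewrite {1}/mob {1}[mob A _]/mob JM // in h.
  have ja := J_neq0 A (mob_gt0 B u0); have jb := J_neq0 B u0.
  move/(canRL (divfK (mulf_neq0 ja jb))): h => ->; by field.
by rewrite /num numfM // JM //; field.
Qed.

Lemma num_lower w A t : 0 < Im w -> 0 < Im t -> Im w * nm (J A t) <= nm (num w A t).
Proof.
move=> w0 t0; have j0 := J_neq0 A t0.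
have -> : num w A t = (mob A t - pt (Re w) (- Im w)) * J A t by rewrite /num /mob; field.
rewrite nmM ler_wpM2r ?nm_ge0 //; apply: le_trans (nm_Im _); apply: le_trans (ler_norm _).
by rewrite raddfB /= opprK lerDr ltW // mob_gt0.
Qed.

Lemma num_lower2 w A t : 0 < Im w -> 0 < Im t ->
  Im w * nm (numf A t) <= (Im w + nm w) * nm (num w A t).
Proof.
move=> w0 t0; have h := num_lower A w0 t0.
have nw : nm (pt (Re w) (- Im w)) = nm w by rewrite /nm /= sqrrN.
have -> : numf A t = num w A t + pt (Re w) (- Im w) * J A t by rewrite /num subrK.
have h1 := nmD (num w A t) (pt (Re w) (- Im w) * J A t); rewrite nmM nw in h1.
have : Im w * nm (num w A t + pt (Re w) (- Im w) * J A t) <=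
   Im w * (nm (num w A t) + nm w * nm (J A t)) by rewrite ler_wpM2l // ltW.
have : nm w * (Im w * nm (J A t)) <= nm w * nm (num w A t) by rewrite ler_wpM2l ?nm_ge0.
lra.
Qed.

Definition bw A : R := (wt R (ea A) * wt R (eb A)) * (wt R (ec A) * wt R (ed A)).

Lemma bsum_bw (K : R) : 0 <= K -> bsum (fun A => K * bw A) (K * (6 * 6 * (6 * 6))).
Proof.
move=> K0; apply: bsumZ => //.
have h := bsum_prod (bsum_prod (bsum_wt R) (bsum_wt R)) (bsum_prod (bsum_wt R) (bsum_wt R)).
apply: (@bsum_inj R _ _ (fun A => ((ea A, eb A), (ec A, ed A))) _ _ _ h).
by move=> A B [] ? ? ? ?; apply: SL2Z_eq.
Qed.

Lemma num_bound w (X Y : R) : 0 < Im w -> 0 < Y -> 0 <= X -> exists2 x : R, 0 < x &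
  forall A t, `|Re t| <= X -> Y <= Im t -> num w A t != 0 /\
    forall k, (6 <= k)%N -> nm ((num w A t)^-1 ^+ k) <= x ^+ k * bw A.
Proof.
move=> w0 Y0 X0; have [d d0 hd] := lat_ge Y0 X0.
pose v := Im w; pose d' := v * d / (v + nm w + 1).
have vn : 0 < v + nm w + 1 by rewrite ltr_wpDl ?ltr01 // addr_ge0 ?nm_ge0 // ltW.
have vd : 0 < v * d by apply: mulr_gt0.
have d'0 : 0 < d' by apply: divr_gt0.
exists d'^-1; first by rewrite invr_gt0.
move=> A t hX hY; have t0 : 0 < Im t by apply: lt_le_trans hY.
have p1 : (ea A, eb A) != 0.
  by apply/eqP => -[a b]; have := edet A; rewrite a b !mul0r subr0.
have p2 : (ec A, ed A) != 0.
  by apply/eqP => -[a b]; have := edet A; rewrite a b !mulr0 subr0.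
have s1 := sz_gt0 R (ea A, eb A); have s2 := sz_gt0 R (ec A, ed A).
have g1 := sz_ge1 R (ea A, eb A).
have N1 : nm (num w A t) >= d' * sz R (ea A, eb A).
  have h := num_lower2 A w0 t0; have h1 := hd t _ hX hY p1; rewrite -/v in h.
  have h2 : v * (d * sz R (ea A, eb A)) <= v * nm (numf A t) by rewrite ler_wpM2l ?numfE ?(ltW w0).
  rewrite /d' mulrAC ler_pdivrMr // -mulrA; apply: le_trans h2 _; apply: le_trans h _.
  by rewrite mulrC ler_wpM2l ?nm_ge0 // lerDl.
have N2 : nm (num w A t) >= d' * sz R (ec A, ed A).
  have h := num_lower A w0 t0; have h1 := hd t _ hX hY p2; rewrite -/v in h.
  have h2 : v * (d * sz R (ec A, ed A)) <= v * nm (J A t) by rewrite ler_wpM2l ?JE ?(ltW w0).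
  rewrite /d' mulrAC ler_pdivrMr // -mulrA; apply: le_trans h2 _; apply: le_trans h _.
  by rewrite ler_peMr ?nm_ge0 // lerDr addr_ge0 ?nm_ge0 // ltW.
have n0 : num w A t != 0 by rewrite -nm_gt0; apply: lt_le_trans N1; apply: mulr_gt0.
split=> // k k6; rewrite nmX nmV.
set m := nm _ in N1 N2 *; have m0 : 0 < m by rewrite nm_gt0.
have e1 : m^-1 <= d'^-1 * (sz R (ea A, eb A))^-1 by rewrite -invfM lef_pV2 ?posrE // mulr_gt0.
have e2 : m^-1 <= d'^-1 * (sz R (ec A, ed A))^-1 by rewrite -invfM lef_pV2 ?posrE // mulr_gt0.
have e0 : m^-1 <= d'^-1.
  by apply: le_trans e1 _; rewrite ler_piMr ?invr_ge0 ?(ltW d'0) // invf_le1.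
have mV : 0 <= m^-1 by rewrite invr_ge0 ltW.
(* Two cubes of 1/|num| are spent on the rows (a, b) and (c, d) of A, each by [sz_wt]; this is where
   the weight 6 comes from. *)
rewrite -(subnKC k6) !exprD -[6%N]/(3 + 3)%N !exprD /bw.
have E1 : m^-1 ^+ 3 <= d'^-1 ^+ 3 * (wt R (ea A) * wt R (eb A)).
  apply: (@le_trans _ _ ((d'^-1 * (sz R (ea A, eb A))^-1) ^+ 3)).
    by rewrite lerXn2r ?nnegrE // mulr_ge0 ?invr_ge0 // ltW.
  rewrite exprMn ler_wpM2l ?exprn_ge0 ?invr_ge0 ?(ltW d'0) //.
  exact: (sz_wt R (ea A, eb A)).
have E2 : m^-1 ^+ 3 <= d'^-1 ^+ 3 * (wt R (ec A) * wt R (ed A)).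
  apply: (@le_trans _ _ ((d'^-1 * (sz R (ec A, ed A))^-1) ^+ 3)).
    by rewrite lerXn2r ?nnegrE // mulr_ge0 ?invr_ge0 // ltW.
  rewrite exprMn ler_wpM2l ?exprn_ge0 ?invr_ge0 ?(ltW d'0) //.
  exact: (sz_wt R (ec A, ed A)).
have E3 : m^-1 ^+ (k - 6) <= d'^-1 ^+ (k - 6) by rewrite lerXn2r ?nnegrE // invr_ge0 ltW.
have -> : d'^-1 ^+ 3 * d'^-1 ^+ 3 * d'^-1 ^+ (k - 6) *
    (wt R (ea A) * wt R (eb A) * (wt R (ec A) * wt R (ed A))) =
   (d'^-1 ^+ 3 * (wt R (ea A) * wt R (eb A))) * (d'^-1 ^+ 3 * (wt R (ec A) * wt R (ed A))) * d'^-1 ^+ (k - 6).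
  by ring.
by apply: ler_pM; rewrite ?mulr_ge0 ?exprn_ge0 //; apply: ler_pM; rewrite ?exprn_ge0.
Qed.

Lemma hasSum_sum (I : choiceType) (K : Type) (r : seq K) (f : K -> I -> C) (s : K -> C) :
  (forall k, hasSum (f k) (s k)) -> hasSum (fun i => \sum_(k <- r) f k i) (\sum_(k <- r) s k).
Proof.
move=> h; elim: r => [|k r ih].
  rewrite big_nil (_ : (fun=> _) = fun=> 0); last by apply/funext => i; rewrite big_nil.
  by move=> e e0; exists [::] => B _ _; rewrite big1 // subrr nm0 ltW.
rewrite big_cons (_ : (fun i => _) = fun i => f k i + \sum_(l <- r) f l i); last first.
  by apply/funext => i; rewrite big_cons.
exact: hasSumD.
Qed.

Lemma pow_small (x e : R) : 0 <= x -> x < 1 -> 0 < e -> exists N, forall p, (N <= p)%N -> x ^+ p <= e.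
Proof.
move=> x0 x1 e0; have [N hN] : exists N, x ^+ N <= e.
  have [//|h] := pselect (exists N, x ^+ N <= e).
  suff : 1 <= x by rewrite leNgt x1.
  apply: (@le_of_pow R 1 x e^-1) => // p; rewrite expr1n mulrC ler_pdivlMr // mul1r.
  by rewrite leNgt; apply/negP => hp; apply: h; exists p; exact: ltW.
by exists N => p Np; apply: le_trans hN; apply: ler_wiXn2l => //; exact: ltW.
Qed.

(** Diagonal dominance: compare norms at the largest coordinate of a vector in the kernel. *)
Lemma near_scalar_unit n (s : C) (N : 'M[C]_n) (e : R) :
  (forall i j, nm (N i j - (i == j)%:R * s) <= e) -> n%:R * e < nm s -> N \in unitmx.
Proof.
move=> hN es; rewrite unitmxE unitfE; apply/det0P => -[v v0 vN].
have [i0 _] : exists i0 : 'I_n, v 0 i0 != 0.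
  apply/existsP; rewrite -negb_forall; apply: contra v0 => /forallP h.
  by apply/eqP/rowP => i; rewrite mxE; apply/eqP.
have [i _ hi] := @arg_maxP _ _ _ i0 xpredT (fun i => nm (v 0 i)) isT.
have vi : 0 < nm (v 0 i).
  have [j vj] : exists j, v 0 j != 0.
    apply/existsP; rewrite -negb_forall; apply: contra v0 => /forallP h.
    by apply/eqP/rowP => j; rewrite mxE; apply/eqP.
  by apply: lt_le_trans (hi j isT); rewrite nm_gt0.
have : nm s * nm (v 0 i) <= n%:R * e * nm (v 0 i).
  have := congr1 (fun M : 'rV_n => M 0 i) vN; rewrite !mxE => h.
  have -> : nm s * nm (v 0 i) = nm (\sum_j v 0 j * (N j i - (j == i)%:R * s)).
    under eq_bigr => j _ do rewrite mulrBr; rewrite sumrB h sub0r nmN (bigD1 i) //= eqxx mul1r.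
    rewrite big1 ?addr0 ?nmM 1?mulrC // => j /negPf ->; by rewrite mul0r mulr0.
  apply: le_trans (nm_sum _ _ _) _.
  apply: (@le_trans _ _ (\sum_(j < n) nm (v 0 i) * e)).
    by apply: ler_sum => j _; rewrite nmM; apply: ler_pM; rewrite ?nm_ge0 ?hN //; exact: hi.
  by rewrite sumr_const card_ord -mulr_natl; lra.
by rewrite ler_pM2r // leNgt es.
Qed.

Variables (n : nat) (rho : SL2Z -> 'M[C]_n).
Hypothesis rhoM : forall A B, rho (A * B)%g = rho A *m rho B.
Hypothesis rho1 : rho 1%g = 1%:M.
Variable M : R.
Hypothesis rho_bound : forall A i j, nm (rho A i j) <= M.
Variable e : nat.
Hypotheses (e0 : (0 < e)%N) (rho_e : rho (mT e%:Z) = 1%:M).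

Definition vform (k : int) (F : C -> 'cV[C]_n) :=
  (forall i, holoH (fun z => F z i 0)) /\
  forall A z, 0 < Im z -> F (mob A z) = J A z ^ k *: (rho A *m F z).
Definition cuspv (F : C -> 'cV[C]_n) := forall i, vanish (fun z => F z i 0).

(** The factor [rho A^-1] makes the substitution A -> A B in the sum produce [rho B] on the left, so
    the columns of the matrix of sums are vector-valued forms. *)
Definition pcterm k w i j A t : C := (num w A t)^-1 ^+ k * rho A^-1%g i j.
Definition pc k w i j t : C := csum (fun A => pcterm k w i j A t).

Lemma pcterm_bound w (X Y : R) : 0 < Im w -> 0 < Y -> 0 <= X -> exists2 x : R, 0 < x &
  forall k i j A t, (6 <= k)%N -> `|Re t| <= X -> Y <= Im t -> num w A t != 0 /\
    nm (pcterm k w i j A t) <= x ^+ k * `|M| * bw A.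
Proof.
move=> w0 Y0 X0; have [x x0 h] := num_bound w0 Y0 X0; exists x => // k i j A t k6 hX hY.
have [n0 hn] := h A t hX hY; split=> //; rewrite /pcterm nmM mulrAC.
apply: ler_pM; rewrite ?nm_ge0 ?hn //.
by apply: le_trans (ler_norm M); exact: rho_bound.
Qed.

Lemma pcK_ge0 k (x : R) : 0 < x -> 0 <= x ^+ k * `|M|.
Proof. by move=> x0; rewrite mulr_ge0 // exprn_ge0 // ltW. Qed.

Lemma pc_hasSum k w i j t : (6 <= k)%N -> 0 < Im w -> 0 < Im t ->
  hasSum (fun A => pcterm k w i j A t) (pc k w i j t).
Proof.
move=> k6 w0 t0; have [x x0 h] := pcterm_bound w0 t0 (normr_ge0 (Re t)).
apply: csumP (bsum_bw (pcK_ge0 k x0)) _ => A.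
by apply: (h k i j A t k6 _ _).2.
Qed.

Lemma num_holo w A : holoH (num w A).
Proof.
move=> z z0; eexists; rewrite /num; apply: cdiffB; last exact: cdiffZ (cdiff_J A z).
apply: (@cdiff_ext R (fun u => lat u (ea A, eb A))); first by move=> u; rewrite numfE.
exact: (cdiffD (cdiffZ _ (cdiff_id z)) (cdiff_cst _ z)).
Qed.

Lemma pc_holo k w i j : (6 <= k)%N -> 0 < Im w -> holoH (pc k w i j).
Proof.
move=> k6 w0 z z0; pose Y := Im z / 2; have Y0 : 0 < Y by rewrite divr_gt0.
have [x x0 h] := @pcterm_bound w (`|Re z| + Y) Y w0 Y0 ltac:(by rewrite addr_ge0 // ltW).
have reg t : nm (t - z) < Y -> `|Re t| <= `|Re z| + Y /\ Y <= Im t.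
  move=> ht; have hI := nm_Im (t - z); have hR := nm_Re (t - z); split.
    have : `|Re t| <= `|Re z| + `|Re (t - z)|.
      by apply: le_trans (ler_normD _ _); rewrite raddfB /= addrC subrK.
    lra.
  by move: hI; rewrite raddfB /= ler_norml /Y => /andP[+ _]; rewrite /Y in ht; lra.
apply: (csum_cdiff (bsum_bw (pcK_ge0 k x0)) Y0) => A t /reg[h1 h2].
  have [n0 _] := h k i j A t k6 h1 h2; have t0 : 0 < Im t := lt_le_trans Y0 h2.
  have [D hD] := num_holo w A t0.
  eexists; exact: cdiffM (cdiffX k (cdiffV n0 hD)) (cdiff_cst _ t).
exact: (h k i j A t k6 h1 h2).2.
Qed.

Lemma pc_mob k w i j B t : (6 <= k)%N -> 0 < Im w -> 0 < Im t ->
  pc k w i j (mob B t) = J B t ^+ k * \sum_l rho B i l * pc k w l j t.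
Proof.
move=> k6 w0 t0; apply: csumE.
pose g A := J B t ^+ k * \sum_l rho B i l * pcterm k w l j A t.
have hg : hasSum g (J B t ^+ k * \sum_l rho B i l * pc k w l j t).
  by apply/hasSumZ/hasSum_sum => l; apply/hasSumZ/pc_hasSum.
have := @hasSum_reindex R _ _ (fun A => (A * B)%g) (fun A => (A * B^-1)%g) g _ _ _ hg.
rewrite (_ : (fun A => g _) = (fun A => pcterm k w i j A (mob B t))).
  by apply=> A; rewrite ?mulgK ?mulgKV.
apply/funext => A; rewrite /g /pcterm num_mob // invfM invrK exprMn.
have -> : rho A^-1%g i j = \sum_l rho B i l * rho (A * B)^-1%g l j.
  by rewrite -{1}(mulVKg B A^-1%g) -invgM rhoM mxE.
by rewrite !mulr_sumr; apply: eq_bigr => l _; ring.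
Qed.

Lemma pc_bounded k w i j : (6 <= k)%N -> 0 < Im w -> bounded_inf (pc k w i j).
Proof.
move=> k6 w0; have eR : 1 <= e%:R :> R by rewrite ler1n.
have [x x0 h] := @pcterm_bound w e%:R 1 w0 ltr01 (ler0n _ _).
pose K := x ^+ k * `|M| * (6 * 6 * (6 * 6)).
pose F z := pc k w i j (e%:R * z).
have imE z : Im (e%:R * z) = e%:R * Im z.
  by rewrite -[e%:R]/(e%:~R) cImM Re_int Im_int mul0r addr0.
have reE z : Re (e%:R * z) = e%:R * Re z.
  by rewrite -[e%:R]/(e%:~R) cReM Re_int Im_int mul0r subr0.
have Fp : perH F.
  move=> z z0; rewrite /F mulrDr mulr1 -[X in _ + X]/((e%:Z)%:~R) -mob_mT pc_mob //; last first.
    by rewrite imE mulr_gt0 //; lra.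
  rewrite J_mT expr1n mul1r rho_e (bigD1 i) //= mxE eqxx mul1r big1 ?addr0 // => l /negPf li.
  by rewrite mxE eq_sym li mul0r.
have hF z : 1 < Im z -> nm (F z) <= K.
  apply: (@perH_strip R F (fun v => nm v <= K) 1 Fp ler01) => {}z z1 /andP[x1 x2].
  apply: csum_bound (bsum_bw (pcK_ge0 k x0)) _ => A.
  apply: (h k i j A _ k6 _ _).2; rewrite ?reE ?imE.
    rewrite normrM ger0_norm; last by lra.
    by rewrite ler_piMr; [|lra|rewrite ler_norml; apply/andP; split; lra].
  by apply: le_trans (ltW z1) _; rewrite ler_peMl // ltW //; lra.
exists K, e%:R => z z1; have eC : (e%:R : C) != 0 by rewrite pnatr_eq0 -lt0n.
have zE : z = e%:R * (z / e%:R) by rewrite mulrC divfK.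
have := hF (z / e%:R); rewrite /F -zE; apply.
have ep : 0 < e%:R :> R by lra.
by rewrite -(ltr_pM2l ep) mulr1 -imE -zE.
Qed.

Section Limit.
Variable w : C.
Hypothesis w0 : 0 < Im w.
Let b2 : C := pt 0 (2 * Im w).
Let b20 : b2 != 0.
Proof. by apply/eqP => /(congr1 Im) /= /eqP; rewrite mulf_eq0 pnatr_eq0 /= gt_eqF. Qed.
Let b2E : w - pt (Re w) (- Im w) = b2.
Proof. by apply: complex_eqE; rewrite raddfB /= ?subrr //; ring. Qed.
(** The quotient of [num w 1 w] by [num w A w]: of modulus 1 when A fixes w and less than 1
    otherwise, so that high powers single out the stabilizer. *)
Let ratio A := b2 / num w A w.

(** Delta does not vanish at w. Hence on the stabilizer of w the factor J^k depends only on k mod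
    12. *)
Lemma stab_J12 A : mob A w = w -> J A w ^+ 12 = 1.
Proof.
move=> h; have := Delta_wform A w0; rewrite h => e1.
by apply: (mulIf (Delta_neq0 w0)); rewrite mul1r [RHS]e1.
Qed.

Let ratio_stab A : mob A w = w -> ratio A = (J A w)^-1.
Proof.
move=> h; have j0 := J_neq0 A w0.
have -> : ratio A = b2 / ((mob A w - pt (Re w) (- Im w)) * J A w).
  by rewrite /ratio /num /mob; congr (_ / _); field.
by rewrite h b2E invfM mulrA divff ?mul1r.
Qed.

Let ratio_lt A : mob A w != w -> nm (ratio A) < 1.
Proof.
move=> h; have j0 := J_neq0 A w0; have h1 := num_lower A w0 w0.
have nb : nm b2 = 2 * Im w.
  have -> : b2 = 'i%C * ofR (2 * Im w) by apply: complex_eqE; rewrite ?cReM ?cImM /=; ring.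
  by rewrite nmM nm_i mul1r nm_real ger0_norm // mulr_ge0 // ltW.
(* With t = A w this is |t - conj w|^2 = |t - w|^2 + 4 Im t Im w, multiplied by |J|^2. *)
have key : nm (num w A w) ^+ 2 = nm (mob A w - w) ^+ 2 * nm (J A w) ^+ 2 + (2 * Im w) ^+ 2.
  have -> : num w A w = (mob A w - pt (Re w) (- Im w)) * J A w by rewrite /num /mob; field.
  rewrite nmM exprMn; have iE := Im_mob A w0; set t := mob A w in iE *.
  have jn : nm (J A w) != 0 by rewrite nm_eq0.
  rewrite !sqr_nm !raddfB /= -sqr_nm opprK.
  have -> : (2 * Im w) ^+ 2 = 4 * Im t * Im w * nm (J A w) ^+ 2 by rewrite iE; field.
  by ring.
have n2 : nm b2 < nm (num w A w).
  rewrite -(@ltr_pXn2r _ 2) ?nnegrE ?nm_ge0 // key nb ltrDr mulr_gt0 // exprn_gt0 // nm_gt0 //.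
  by rewrite subr_eq0.
by rewrite nmM nmV ltr_pdivrMr ?mul1r //; apply: le_lt_trans n2; exact: nm_ge0.
Qed.

Let ratio_nm A : mob A w = w -> nm (ratio A) = 1.
Proof.
move=> h; have := congr1 (@nm R) (stab_J12 h); rewrite nmX nm1 ratio_stab // nmV => /eqP.
by rewrite pexprn_eq1 ?nm_ge0 //= => /eqP ->; rewrite invr1.
Qed.

(** The limit of the rescaled Poincare series, supported on the stabilizer of w; [s] is the order of
    that stabilizer, kept as a sum. *)
Let Sg k i j : C := csum (fun A => if mob A w == w then ratio A ^+ k * rho A^-1%g i j else 0).
Let s : C := csum (fun A => if mob A w == w then 1 else 0).

Let ratio_bound k : (6 <= k)%N -> exists2 K : R, 0 <= K & forall A, nm (ratio A ^+ k) <= K * bw A.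
Proof.
move=> k6; have [x x0 h] := num_bound w0 w0 (normr_ge0 (Re w)).
exists (nm b2 ^+ k * x ^+ k); first by rewrite mulr_ge0 ?exprn_ge0 ?nm_ge0 // ltW.
move=> A; rewrite /ratio exprMn nmM [nm (b2 ^+ k)]nmX -mulrA ler_wpM2l ?exprn_ge0 ?nm_ge0 //.
exact: (h A w _ _).2.
Qed.

Let s_hasSum : hasSum (fun A => if mob A w == w then 1 else 0) s.
Proof.
have [K K0 h] := ratio_bound (leqnn 6).
apply: csumP (bsum_bw K0) _ => A; case: eqP => [fx|_].
  by rewrite nm1; have := h A; rewrite nmX ratio_nm // expr1n.
by rewrite nm0; have := h A; apply: le_trans; exact: nm_ge0.
Qed.

Let s0 : s != 0.
Proof.
apply/eqP => s0; have := s_hasSum; rewrite s0 => hs.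
have [X hX] := hs (1 / 2) ltac:(by lra).
have := hX (undup (1%g :: X)) (undup_uniq _) ltac:(by move=> A hA; rewrite mem_undup in_cons hA orbT).
apply/negP; rewrite -ltNge subr0; apply: lt_le_trans (nm_Re _); apply: lt_le_trans (ler_norm _).
rewrite (bigD1_seq 1%g) ?undup_uniq ?mem_undup ?mem_head //= mob1 eqxx cReD /=.
suff : 0 <= Re (\sum_(i <- undup (1%g :: X) | i != 1%g) (if mob i w == w then 1 else 0) : C).
  by move=> ?; lra.
elim/big_ind: _ => [//|x y hx hy|A _]; first by rewrite cReD addr_ge0.
by case: ifP; rewrite ?ler01.
Qed.

Let Sg_term k i j A : (6 <= k)%N -> exists2 K : R, 0 <= K & forall A,
  nm (if mob A w == w then ratio A ^+ k * rho A^-1%g i j else 0) <= K * bw A.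
Proof.
move=> k6; have [K K0 h] := ratio_bound k6; exists (K * `|M|); first by rewrite mulr_ge0.
move=> B; have hB : nm (ratio B ^+ k * rho B^-1%g i j) <= K * `|M| * bw B.
  rewrite nmM mulrAC; apply: ler_pM; rewrite ?nm_ge0 //.
  by apply: le_trans (ler_norm M); exact: rho_bound.
by case: ifP => // _; rewrite nm0; apply: le_trans hB; exact: nm_ge0.
Qed.

Let Sg_hasSum k i j : (6 <= k)%N ->
  hasSum (fun A => if mob A w == w then ratio A ^+ k * rho A^-1%g i j else 0) (Sg k i j).
Proof.
by move=> k6; have [K K0 h] := Sg_term i j 1%g k6; apply: csumP (bsum_bw K0) h.
Qed.

Let Sg_limit k1 i j (d : R) : (6 <= k1)%N -> 0 < d -> exists N, forall p, (N <= p)%N ->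
  nm (b2 ^+ (k1 + 12 * p) * pc (k1 + 12 * p) w i j w - Sg k1 i j) <= d.
Proof.
move=> k6 d0; have [K K0 hK] := ratio_bound k6.
pose F A (p : nat) := ratio A ^+ (k1 + 12 * p) * rho A^-1%g i j.
pose l A := if mob A w == w then ratio A ^+ k1 * rho A^-1%g i j else 0.
have rle A : nm (ratio A) <= 1.
  by have [/ratio_nm ->|/ratio_lt/ltW] := eqVneq (mob A w) w.
have hb := bsum_bw (mulr_ge0 K0 (normr_ge0 M)).
have Fb A p : nm (F A p) <= K * `|M| * bw A.
  rewrite /F nmM mulrAC; apply: ler_pM; rewrite ?nm_ge0 //.
    apply: le_trans (hK A); rewrite exprD nmM ler_piMr ?nm_ge0 //.
    by rewrite nmX exprn_ile1 ?nm_ge0.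
  by apply: le_trans (ler_norm M); exact: rho_bound.
have lF A : mob A w = w -> forall p, F A p = l A.
  move=> fx p; rewrite /l fx eqxx /F exprD exprM; congr (_ * _).
  by rewrite ratio_stab // [_^-1 ^+ 12]exprVn stab_J12 // invr1 expr1n mulr1.
have lb A : nm (l A) <= K * `|M| * bw A.
  have [fx|nfx] := eqVneq (mob A w) w; first by rewrite -(lF A fx 0%N).
  by rewrite /l (negPf nfx) nm0; exact: hb.1 A.
have [|A d' d'0|Y hY] := @dominated_limit R _ nat (fun Y p => Y <= p%:R) F l _ _ hb _ (fun A p _ => Fb A p) lb _ d d0.
- by move=> Y Y' p YY; exact: le_trans.
- have [fx|nfx] := eqVneq (mob A w) w.
    by exists 0 => p _; rewrite lF // subrr nm0 ltW.
  have M1 : 0 < `|M| + 1 by rewrite ltr_wpDl.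
  have [N hN] := pow_small (nm_ge0 (ratio A)) (ratio_lt nfx) (divr_gt0 d'0 M1).
  exists N%:R => p; rewrite ler_nat => Np.
  rewrite /l (negPf nfx) subr0 /F nmM nmX.
  have -> : d' = d' / (`|M| + 1) * (`|M| + 1) by rewrite divfK // gt_eqF.
  apply: ler_pM; rewrite ?nm_ge0 ?exprn_ge0 ?nm_ge0 //.
    by apply: hN; lia.
  apply: le_trans (rho_bound _ _ _) _; apply: le_trans (ler_norm _) _; by rewrite lerDl.
have [N hN] : exists N : nat, Y <= N%:R.
  by exists (Num.truncn Y).+1; apply: ltW; exact: truncnS_gt.
exists N => p Np; have := hY p; rewrite /l -/(Sg k1 i j).
have -> : csum (F^~ p) = b2 ^+ (k1 + 12 * p) * pc (k1 + 12 * p) w i j w.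
  have k6' : (6 <= k1 + 12 * p)%N by lia.
  rewrite -(csumE (hasSumZ (b2 ^+ (k1 + 12 * p)) (pc_hasSum i j k6' w0 w0))).
  by congr csum; apply/funext => A; rewrite /pcterm /F /ratio exprMn mulrA.
by apply; apply: le_trans hN _; rewrite ler_nat.
Qed.

Definition Pm k t : 'M[C]_n := \matrix_(i, j) pc k w i j t.

(** The series itself is only bounded at the cusp; the factor Delta makes it cuspidal at the price
    of 12 in the weight. *)
Lemma Pm_form k (u : 'cV[C]_n) (F := fun t => Delta t *: (Pm k t *m u)) : (6 <= k)%N ->
  vform (12 + k%:Z) F /\ cuspv F.
Proof.
move=> k6.
have FE t i : F t i 0 = Delta t * \sum_j pc k w i j t * u j 0.
  by rewrite /F !mxE; congr (_ * _); apply: eq_bigr => j _; rewrite [Pm k t i j]mxE.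
split; first split.
- move=> i; apply: (@holoH_eq R (fun t => Delta t * \sum_j pc k w i j t * u j 0)).
    by move=> t t0; rewrite FE.
  apply: holoHM; first exact: Delta_holo.
  by apply: holoH_sum => j _; apply: holoHM; [exact: pc_holo | exact: holoH_cst].
- move=> A t t0; have jt := J_neq0 A t0.
  have PA : Pm k (mob A t) = J A t ^+ k *: (rho A *m Pm k t).
    apply/matrixP => i j; rewrite !mxE pc_mob //; congr (_ * _).
    by apply: eq_bigr => l _; rewrite mxE.
  have E : J A t ^ (12 + k%:Z) = J A t ^ 12 * J A t ^+ k by rewrite [LHS]expfzDr.
  rewrite /F PA Delta_wform // E.
  move: (J A t ^ 12) (J A t ^+ k) (Delta t) (Pm k t) => a b c X.
  by rewrite -scalemxAl -scalemxAr !scalerA mulmxA; congr (_ *: _); ring.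
- move=> i; apply: (@eq_vanish R (fun t => Delta t * \sum_j pc k w i j t * u j 0)).
    by move=> t t0; rewrite FE.
  apply: vanishM; first exact: Delta_vanish.
  elim: (index_enum _) => [|j r [K [Y hK]]].
    by exists 0, 0 => t _; rewrite big_nil nm0.
  have [K' [Y' hK']] := boundedM (@pc_bounded k w i j k6 w0) (@bounded_inf_cst R (u j 0)).
  exists (K' + K), (Num.max Y' Y) => t; rewrite gt_max => /andP[/hK' h1 /hK h2].
  by rewrite big_cons; apply: le_trans (nmD _ _) _; exact: lerD.
Qed.

Lemma vformZ k c F : vform k F -> vform k (fun t => c *: F t).
Proof.
move=> [h1 h2]; split=> [i|A z z0]; last by rewrite h2 // -scalemxAr !scalerA mulrC.
by apply: (@holoH_eq R (fun z => c * F z i 0)); [move=> z _; rewrite mxE | exact: holoHZ].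
Qed.

Lemma cuspvZ c F : cuspv F -> cuspv (fun t => c *: F t).
Proof.
move=> h i; apply: eq_vanish (vanishZ c (h i)) => z _; by rewrite mxE.
Qed.

Section Weight.
Variable k1 : nat.
Hypothesis k6 : (6 <= k1)%N.
Let Sm := \matrix_(i, j) Sg k1 i j.

(** [Sm] is s times the averaging projector onto the vectors on which the stabilizer acts through
    J^-k1. *)
Let Sm_fix r (X : 'M[C]_(n, r)) : (forall A, mob A w = w -> rho A *m X = (J A w ^+ k1)^-1 *: X) ->
  Sm *m X = s *: X.
Proof.
move=> hX; apply/matrixP => i j; rewrite [LHS]mxE [RHS]mxE.
have h1 := hasSum_sum (index_enum 'I_n) (f := fun l A => X l j * (if mob A w == w then ratio A ^+ k1 * rho A^-1%g i l else 0)) (fun l => hasSumZ (X l j) (Sg_hasSum i l k6)).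
have h2 := hasSumZ (X i j) s_hasSum.
rewrite [s * _]mulrC -(hasSum_unique _ h2 (s := \sum_l X l j * Sg k1 i l)).
  by apply: eq_bigr => l _; rewrite [Sm i l]mxE mulrC.
move: h1; congr hasSum; apply/funext => A; case: eqP => [fx|_]; last first.
  by rewrite mulr0 big1 // => l _; rewrite mulr0.
have j0 := J_neq0 A w0; rewrite mulr1.
have fx' : mob A^-1%g w = w by rewrite -{1}fx mobK.
have JV' : J A^-1%g w = (J A w)^-1 by rewrite -{1}fx JV.
have := congr1 (fun u : 'M_(n, r) => u i j) (hX _ fx').
rewrite [LHS]mxE [RHS]mxE JV' exprVn invrK => E.
rewrite -[RHS](mulKf (expf_neq0 k1 j0)) -E mulr_sumr; apply: eq_bigr => l _.
by rewrite ratio_stab // exprVn; ring.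
Qed.

Let SS B : mob B w = w -> rho B *m Sm = (J B w ^+ k1)^-1 *: Sm.
Proof.
move=> fx; have jb := J_neq0 B w0; apply/matrixP => i j; rewrite [LHS]mxE [RHS]mxE [Sm i j]mxE.
apply: (mulfI (expf_neq0 k1 jb)); rewrite mulVKf ?expf_neq0 //.
have h1 := hasSumZ (J B w ^+ k1) (hasSum_sum (index_enum 'I_n) (f := fun l A => rho B i l * (if mob A w == w then ratio A ^+ k1 * rho A^-1%g l j else 0)) (fun l => hasSumZ (rho B i l) (Sg_hasSum l j k6))).
have c1 : cancel (fun A => (A * B^-1)%g) (fun A => (A * B)%g) by move=> A; rewrite mulgKV.
have c2 : cancel (fun A => (A * B)%g) (fun A => (A * B^-1)%g) by move=> A; rewrite mulgK.
have h2 := hasSum_reindex c1 c2 (Sg_hasSum i j k6).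
rewrite -(hasSum_unique _ h2 (s := J B w ^+ k1 * \sum_l rho B i l * Sg k1 l j)).
  by congr (_ * _); apply: eq_bigr => l _; rewrite [Sm l j]mxE.
move: h1; congr hasSum; apply/funext => A.
have fx' : mob B^-1%g w = w by rewrite -{1}fx mobK.
have JV' : J B^-1%g w = (J B w)^-1 by rewrite -{1}fx JV.
have mE : mob (A * B^-1)%g w = mob A w by rewrite mobM // fx'.
rewrite mE; case: eqP => [fA|_]; last first.
  by rewrite big1 ?mulr0 // => l _; rewrite mulr0.
have ja := J_neq0 A w0.
rewrite !ratio_stab ?mE // JM // fx' JV' invgM invgK rhoM mxE.
by rewrite invfM invrK exprMn !mulr_sumr; apply: eq_bigr => l _; ring.
Qed.

Let Pm_fix p B : mob B w = w ->
  rho B *m Pm (k1 + 12 * p) w = (J B w ^+ k1)^-1 *: Pm (k1 + 12 * p) w.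
Proof.
move=> fx; have jb := J_neq0 B w0; apply/matrixP => i j; rewrite !mxE.
apply: (mulfI (expf_neq0 k1 jb)); rewrite mulVKf ?expf_neq0 //.
have k6' : (6 <= k1 + 12 * p)%N by lia.
have := pc_mob i j B k6' w0 w0; rewrite fx => ->; rewrite exprD exprM stab_J12 // expr1n mulr1.
by congr (_ * _); apply: eq_bigr => l _; rewrite mxE.
Qed.

(** For large p the rescaled series is close to [Sm], which may be singular; adding s - Sm gives a
    matrix close to the scalar s, hence invertible. *)
Let Pm_surj (v : 'cV[C]_n) : (forall A, mob A w = w -> rho A *m v = (J A w ^+ k1)^-1 *: v) ->
  exists p (u : 'cV[C]_n), Pm (k1 + 12 * p) w *m u = v.
Proof.
move=> hv; have ns : 0 < nm s by rewrite nm_gt0.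
have n1 : 0 < n%:R + 1 :> R by rewrite ltr_wpDl.
have [d d0 nd] : exists2 d : R, 0 < d & n%:R * d < nm s.
  exists (nm s / (n%:R + 1)); first by rewrite divr_gt0.
  by rewrite mulrA ltr_pdivrMr // mulrDr mulr1 [nm s * _]mulrC ltrDl.
have [p hp] : exists p : nat, forall i j, nm (b2 ^+ (k1 + 12 * p) * pc (k1 + 12 * p) w i j w - Sg k1 i j) <= d.
  have h (x : 'I_n * 'I_n) : exists N, forall p, (N <= p)%N ->
      nm (b2 ^+ (k1 + 12 * p) * pc (k1 + 12 * p) w x.1 x.2 w - Sg k1 x.1 x.2) <= d.
    exact: Sg_limit.
  have [f hf] := choice h; exists (\max_x f x)%N => i j.
  by apply: (hf (i, j)); exact: (leq_bigmax (i, j)).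
have hb : b2 ^+ (k1 + 12 * p) != 0 by rewrite expf_neq0.
exists p; have := Pm_fix p; have hpE i j : nm (b2 ^+ (k1 + 12 * p) * Pm (k1 + 12 * p) w i j - Sm i j) <= d.
  by rewrite [Pm _ _ i j]mxE [Sm i j]mxE.
move: (Pm (k1 + 12 * p) w) (b2 ^+ (k1 + 12 * p)) hb hpE => P b hb hpE PB.
have [N NE uN] : exists2 N : 'M_n, N = b *: P + (s%:M - Sm) & N \in unitmx.
  exists (b *: P + (s%:M - Sm)) => //.
  apply: (near_scalar_unit (s := s) (e := d)) => // i j.
  apply: le_trans (hpE i j); rewrite le_eqVlt; apply/orP; left; apply/eqP; congr nm.
  by rewrite [LHS]addrC !mxE -mulr_natl; ring.
pose u := invmx N *m v; have Nu : N *m u = v by rewrite mulKVmx.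
exists (b *: u); move: u Nu => u; rewrite NE mulmxDl -scalemxAl -scalemxAr => Nu.
(* In v = N u the part (s - Sm) u has the eigenproperty of v, so Sm multiplies it by s. But Sm also
   kills it, as Sm Sm = s Sm; so it is 0. *)
have Vy A : mob A w = w -> rho A *m ((s%:M - Sm) *m u) = (J A w ^+ k1)^-1 *: ((s%:M - Sm) *m u).
  move=> fx; have -> : (s%:M - Sm) *m u = v - b *: (P *m u) by rewrite -Nu addrAC subrr add0r.
  by rewrite mulmxBr hv // -scalemxAr mulmxA PB // -scalemxAl scalerBr !scalerA mulrC.
have : s *: ((s%:M - Sm) *m u) == 0.
  rewrite -(Sm_fix Vy) mulmxA mulmxBr mul_mx_scalar.
  by rewrite (Sm_fix SS) subrr mul0mx.
by rewrite scaler_eq0 (negPf s0) /= => /eqP E; rewrite -Nu E addr0.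
Qed.

Lemma Poincare_nat (v : 'cV[C]_n) : (forall A, mob A w = w -> rho A *m v = (J A w ^+ k1)^-1 *: v) ->
  exists N F, [/\ vform (k1%:Z + 12 * N) F, cuspv F & F w = v].
Proof.
move=> /Pm_surj[p [u hu]]; have D0 := Delta_neq0 w0.
have k6' : (6 <= k1 + 12 * p)%N by lia.
have [h1 h2] := Pm_form u k6'.
exists (1 + p%:Z), (fun t => (Delta w)^-1 *: (Delta t *: (Pm (k1 + 12 * p) t *m u))); split.
- have -> : k1%:Z + 12 * (1 + p%:Z) = 12 + (k1 + 12 * p)%N%:Z by lia.
  exact: vformZ h1.
- exact: cuspvZ h2.
- by rewrite hu scalerA mulVf // scale1r.
Qed.
End Weight.

Lemma Poincare_value (k0 : int) (v : 'cV[C]_n) :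
  (forall A, mob A w = w -> rho A *m v = J A w ^ (- k0) *: v) ->
  exists N F, [/\ vform (k0 + 12 * N) F, cuspv F & F w = v].
Proof.
(* Adding 12 (|k0| + 6) turns any integral weight into a natural number at least 6 and keeps the
   action of the stabilizer, by [stab_J12]. *)
move=> hv; pose m0 := (absz k0)%:Z + 6.
have [k1 k1E] : exists k1 : nat, k1%:Z = k0 + 12 * m0.
  by exists (absz (k0 + 12 * m0)); rewrite /m0; lia.
have k6 : (6 <= k1)%N by move: k1E; rewrite /m0; lia.
have [|N [F [h1 h2 h3]]] := Poincare_nat k6 (v := v).
  move=> A fx; have j0 := J_neq0 A w0; rewrite hv // exprnP k1E invr_expz opprD expfzDr //.
  by rewrite -mulrN -exprz_exp -[J A w ^ 12]/(J A w ^+ 12) stab_J12 // exp1rz mulr1.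
exists (m0 + N), F; split=> //.
by rewrite mulrDr addrA -k1E.
Qed.
End Limit.
End Poincare.

(** * Vector-valued cusp forms *)

Section Lattice.
Variable R : realType.
Local Notation C := R[i].
Local Notation Re := (@complex.Re R).
Local Notation Im := (@complex.Im R).
Local Notation ofR := (real_complex R).
Local Notation J := (@autf R).
Implicit Types (A B : SL2Z) (z w u t c : C).
(** The point 2i serves as a point with trivial stabilizer: 16 c^2 = 4 - t^2, t the trace, leaves
    only c = 0. *)
Lemma stab_2i A : mob A (pt 0 2 : C) = pt 0 2 -> A \in pm1.
Proof.
move=> fx; have w0 : 0 < Im (pt 0 2 : C) by rewrite /=.
have [_ h] := fixed_quadratic w0 fx; apply: (fixed_c0 w0 fx).
have h' : 16%:Z * (ec A * ec A) = 4%:Z - (ea A + ed A) * (ea A + ed A).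
  have c16 : (16%:Z)%:~R = 16 :> R by [].
  have c4 : (4%:Z)%:~R = 4 :> R by [].
  by apply: (@intr_inj R); rewrite intrM intrB !intrM !intrD c16 c4; move: h => /= h; lra.
have [h1|[h1|h1]] : ec A = 0 \/ (1 <= ec A \/ ec A <= -1) by lia.
- by [].
- by have := sqr_ge0 (ea A + ed A); rewrite !expr2 in h' *; nia.
- by have := sqr_ge0 (ea A + ed A); rewrite !expr2 in h' *; nia.
Qed.

Variables (n : nat) (rho : SL2Z -> 'M[C]_n).
Hypothesis rhoM : forall A B, rho (A * B)%g = rho A *m rho B.
Hypothesis rho1 : rho 1%g = 1%:M.
Variable M : R.
Hypothesis rho_bound : forall A i j, nm (rho A i j) <= M.
Variable e : nat.
Hypotheses (e0 : (0 < e)%N) (rho_e : rho (mT e%:Z) = 1%:M).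
Local Notation vform := (vform rho).

Lemma mulmx_holo r k F (X : 'M[C]_(r, n)) i : vform k F -> holoH (fun z => (X *m F z) i 0).
Proof.
move=> [h _]; apply: (@holoH_eq R (fun z => \sum_j X i j * F z j 0)); first by move=> z _; rewrite mxE.
by apply: holoH_sum => j _; apply: holoHZ; exact: h.
Qed.

Lemma vanish_sum (I : Type) (s : seq I) (f : I -> C -> C) : (forall j, vanish (f j)) ->
  vanish (fun z => \sum_(j <- s) f j z).
Proof.
move=> h; elim: s => [|j s ih].
  by move=> d d0; exists 0 => z _; rewrite big_nil nm0 ltW.
apply: eq_vanish (vanishD (h j) ih) => z _; by rewrite big_cons.
Qed.

Lemma mulmx_vanish r F (X : 'M[C]_(r, n)) i : cuspv F -> vanish (fun z => (X *m F z) i 0).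
Proof.
move=> h; apply: (@eq_vanish R (fun z => \sum_j X i j * F z j 0)); first by move=> z _; rewrite mxE.
by apply: vanish_sum => j; exact: vanishZ.
Qed.

Lemma vform_e k F z : vform k F -> 0 < Im z -> F (z + e%:R) = F z.
Proof.
move=> [_ h] z0; rewrite -[e%:R]/((e%:Z)%:~R) -mob_mT h // J_mT exp1rz scale1r.
by rewrite rho_e mul1mx.
Qed.

(** [siegel] is applied to the squared coordinates of rho(B) F for all B and all indices at once, a
    family that SL2(Z) permutes. *)
Lemma vform_nonpos k F : vform k F -> cuspv F -> k <= 0 -> forall z, 0 < Im z -> F z = 0.
Proof.
move=> hF cF k0; pose u (x : SL2Z * 'I_n) z := ((rho x.1 *m F z) x.2 0) ^+ 2.
have eR : 0 < e%:R :> R by rewrite ltr0n.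
have uh x : holoH (u x) by apply: holoHX; exact: mulmx_holo hF.
have up x z : 0 < Im z -> u x (z + e%:R) = u x z by move=> z0; rewrite /u (vform_e hF).
have uv x : vanish (u x).
  apply: vanishM; first exact: mulmx_vanish.
  have [Y hY] := mulmx_vanish (rho x.1) x.2 cF ltr01; by exists 1, Y.
have hM : exists K, forall x y, nm (u x (pt y (79 / 100))) <= K.
  have hl (l : 'I_n) : exists K, forall y, nm (F (pt y (79 / 100)) l 0) <= K.
    apply: (@width_bounded R e (fun z => F z l 0) e0 (hF.1 l)); last by lra.
    by move=> z z0; rewrite (vform_e hF).
  have [K hK] := choice hl; exists ((\sum_l `|M| * K l) ^+ 2) => x y.
  rewrite nmX; have le1 : nm ((rho x.1 *m F (pt y (79 / 100))) x.2 0) <= \sum_l `|M| * K l.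
    rewrite mxE; apply: le_trans (nm_sum _ _ _) _; apply: ler_sum => l _; rewrite nmM.
    have a1 : nm (rho x.1 x.2 l) <= `|M| by apply: le_trans (rho_bound _ _ _) (ler_norm _).
    exact: (ler_pM (nm_ge0 _) (nm_ge0 _) a1 (hK l y)).
  by rewrite lerXn2r ?nnegrE ?nm_ge0 //; apply: le_trans le1; exact: nm_ge0.
have S0 : forall x z, 0 < Im z -> u x z = 0.
  apply: (@siegel R _ u k 0 (2 * pi / e%:R)) => //.
  - move=> [B i] A z z0; exists ((B * A)%g, i); rewrite /u /= !nmX hF.2 //.
    by rewrite -scalemxAr mulmxA -rhoM mxE nm_weight.
  - move=> x K hK z hz; have h79 : 0 < 79 / 100 :> R by lra.
    exact: (@width_max0 R e (u x) e0 (uh x) (up x) (79 / 100) K h79 (uv x) hK z hz).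
  - move=> y hy; rewrite mul0r expR0; case: k k0 {hF} => [[|m]|m] // _.
    have h79 : 0 < 79 / 100 :> R by lra.
    rewrite NegzE -invr_expz invf_le1 ?exprn_gt0 ?divr_gt0 //; last by apply: lt_le_trans hy.
    by apply: exprn_ege1; rewrite ler_pdivlMr // mul1r.
  - by rewrite divr_gt0 // pi2_gt0.
move=> z z0; apply/colP => i; rewrite mxE.
have := S0 (1%g, i) z z0; rewrite /u /= rho1 mul1mx => /eqP.
by rewrite expf_eq0 => /eqP.
Qed.

Lemma vformD k F G : vform k F -> vform k G -> vform k (fun z => F z + G z).
Proof.
move=> [f1 f2] [g1 g2]; split=> [i|A z z0]; last by rewrite f2 // g2 // mulmxDr scalerDr.
apply: (@holoH_eq R (fun z => F z i 0 + G z i 0)); first by move=> z _; rewrite mxE.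
exact: holoHD.
Qed.
Lemma vform0 k : vform k (fun=> 0).
Proof.
split=> [i|A z z0]; last by rewrite mulmx0 scaler0.
by apply: (@holoH_eq R (fun=> 0)); [move=> z _; rewrite mxE | exact: holoH_cst].
Qed.
Lemma vform_sum k (I : Type) (s : seq I) (F : I -> C -> 'cV[C]_n) : (forall j, vform k (F j)) ->
  vform k (fun z => \sum_(j <- s) F j z).
Proof.
move=> h; elim: s => [|j s ih].
  by rewrite (_ : (fun z => _) = fun=> 0); [exact: vform0 | apply/funext => z; rewrite big_nil].
rewrite (_ : (fun z => _) = fun z => F j z + \sum_(l <- s) F l z); first exact: vformD.
by apply/funext => z; rewrite big_cons.
Qed.
Lemma vformM k l f F : wform l f -> holoH f -> vform k F -> vform (l + k) (fun z => f z *: F z).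
Proof.
move=> wf hf [f1 f2]; split=> [i|A z z0].
  apply: (@holoH_eq R (fun z => f z * F z i 0)); first by move=> z _; rewrite mxE.
  exact: holoHM.
rewrite (f2 A z z0) (wf A z z0) -scalemxAr !scalerA expfzDr ?J_neq0 //.
by rewrite [J A z ^ l * _ * _]mulrAC.
Qed.

Lemma cuspvD (F G : C -> 'cV[C]_n) : cuspv F -> cuspv G -> cuspv (fun z => F z + G z).
Proof. by move=> h1 h2 i; apply: eq_vanish (vanishD (h1 i) (h2 i)) => z _; rewrite mxE. Qed.
Lemma cuspv_sum (I : Type) (s : seq I) (F : I -> C -> 'cV[C]_n) : (forall j, cuspv (F j)) ->
  cuspv (fun z => \sum_(j <- s) F j z).
Proof.
move=> h i; apply: eq_vanish (vanish_sum s (fun j => h j i)) => z _; by rewrite summxE.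
Qed.
Lemma cuspvM f (F : C -> 'cV[C]_n) c : tends f c -> cuspv F -> cuspv (fun z => f z *: F z).
Proof.
move=> tf h i; apply: eq_vanish (vanishM (h i) (tends_bounded tf)) => z _.
by rewrite mxE mulrC.
Qed.

Hypothesis rho_pm1 : forall A, A \in pm1 -> rho A = 1%:M.

Lemma pm1_J A z : A \in pm1 -> J A z ^+ 2 = 1.
Proof.
rewrite inE => /orP[]/eqP h; rewrite /autf h !mxE /= ?mul0r ?add0r ?expr1n //.
by rewrite mulrN1z sqrrN expr1n.
Qed.

Lemma Poincare_generic w v : 0 < Im w -> (forall A, mob A w = w -> A \in pm1) ->
  exists (N : nat) F, [/\ vform (2 + 12 * N%:Z) F, cuspv F & F w = v].
Proof.
move=> w0 hw; have [v0|v0] := eqVneq v 0.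
  exists 0%N, (fun=> 0); split=> //; first exact: vform0.
  by move=> i d d0; exists 0 => z _; rewrite mxE nm0 ltW.
have [|N [F [h1 h2 h3]]] := Poincare_value rhoM rho_bound e0 rho_e w0 (k0 := 2%:Z) (v := v).
  move=> A /hw A1; rewrite rho_pm1 // mul1mx -invr_expz -exprnP pm1_J // invr1 scale1r //.
(* A negative N would mean a negative weight, hence F = 0. *)
case: N h1 => [N|N] h1; first by exists N, F.
by move: v0; rewrite -h3 (vform_nonpos h1 h2) ?eqxx //; lia.
Qed.

Variables (Q : 'M[C]_n) (lam : 'I_n -> R).
Hypothesis uQ : Q \in unitmx.
(** The eigenvalue 1 of rho(T) gets exponent 1 rather than 0. That lam <= 1 makes [hco] o(1/q) for
    cusp forms; that lam > 0 keeps F / Delta cuspidal in [leads0_div]. *)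
Hypothesis lam01 : forall i, 0 < lam i <= 1.
Hypothesis QT : Q *m rho matT = diag_mx (\row_i ee (ofR (lam i))) *m Q.

(* The i-th coordinate of F in the eigenbasis of T, divided by q^lam_i: it is
   periodic and bounded at the cusp. *)
Definition hco (F : C -> 'cV[C]_n) i z : C := (Q *m F z) i 0 * ee (- (ofR (lam i) * z)).
Definition leads F (c : 'cV[C]_n) := forall i, tends (hco F i) (c i 0).

Lemma hcoE F i z : (Q *m F z) i 0 = hco F i z * ee (ofR (lam i) * z).
Proof. by rewrite /hco eeN divfK ?ee_neq0. Qed.

Lemma hco_perH k F i : vform k F -> perH (hco F i).
Proof.
move=> [_ h] z z0; rewrite /hco -{1}mob_T h // J_T exp1rz scale1r mulmxA QT -mulmxA.
rewrite mul_diag_mx mulrDr mulr1 opprD eeD !eeN; set X := Q *m F z; rewrite mxE mxE.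
have := ee_neq0 (ofR (lam i)); have := ee_neq0 (ofR (lam i) * z); move: (ee _) (ee _) => a b a0 b0.
by field; rewrite a0 b0.
Qed.

Lemma hco_holo k F i : vform k F -> holoH (hco F i).
Proof.
move=> hF; apply: holoHM; first exact: mulmx_holo hF.
by move=> z z0; eexists; apply: cdiff_comp (cdiffN (cdiffZ _ (cdiff_id z))) (cdiff_ee _).
Qed.

Lemma nm_ee_lam (r : R) z : nm (ee (ofR r * z)) = expR (- (2 * pi * r * Im z)).
Proof. by rewrite nm_ee cImM /= mul0r addr0 mulrA. Qed.

Lemma hco_smallq k F i : vform k F -> cuspv F -> smallq (hco F i).
Proof.
move=> hF cF d d0; have [Y hY] := mulmx_vanish Q i cF d0.
exists (Num.max 0 Y) => z; rewrite gt_max => /andP[z0 /hY h]; apply: le_trans h.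
rewrite /hco -mulrA -eeD nmM ler_piMr ?nm_ge0 //.
have -> : - (ofR (lam i) * z) + z = ofR (1 - lam i) * z by rewrite rmorphB rmorph1; ring.
have /andP[l0 l1] := lam01 i.
rewrite nm_ee_lam -[X in _ <= X]expR0 ler_expR oppr_le0.
by rewrite !mulr_ge0 ?subr_ge0 // ltW // pi_gt0.
Qed.

Lemma leads_exists k F : vform k F -> cuspv F -> exists c : 'cV[C]_n, leads F c.
Proof.
move=> hF cF; have h i : exists c, tends (hco F i) c.
  have [c [K K0 hK]] := perH_limit (hco_perH i hF) (hco_holo i hF) (hco_smallq i hF cF).
  by exists c; exact: vanish_ee hK.
have [f hf] := choice h; exists (\col_i f i) => i; by rewrite mxE.
Qed.

Lemma tends_unique f (a b : C) : tends f a -> tends f b -> a = b.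
Proof.
move=> ha hb; apply/subr0_eq/(@nm_small0 R _ 2) => d d0.
have [Y hY] := ha d d0; have [Y' hY'] := hb d d0.
pose z : C := pt 0 (Num.max Y Y' + 1).
have l1 : Y < Im z by rewrite /=; apply: le_lt_trans (_ : Num.max Y Y' < _); rewrite ?le_max ?lexx ?ltrDl.
have l2 : Y' < Im z by rewrite /=; apply: le_lt_trans (_ : Num.max Y Y' < _); rewrite ?le_max ?lexx ?orbT ?ltrDl.
have := nm_tri (f z) a b; have := hY z l1; have := hY' z l2.
rewrite [nm (a - f z)]nm_subC; lra.
Qed.

Lemma leadsD F G (c d : 'cV[C]_n) : leads F c -> leads G d -> leads (fun z => F z + G z) (c + d).
Proof.
move=> h1 h2 i; rewrite mxE; apply: eq_tends (tendsD (h1 i) (h2 i)) => z _.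
by rewrite /hco mulmxDr [in RHS]mxE mulrDl.
Qed.
Lemma leadsM f F a (c : 'cV[C]_n) : tends f a -> leads F c -> leads (fun z => f z *: F z) (a *: c).
Proof.
move=> h1 h2 i; rewrite mxE; apply: eq_tends (tendsM h1 (h2 i)) => z _.
by rewrite /hco -scalemxAr [in RHS]mxE mulrA.
Qed.
Lemma leads_sum (I : Type) (s : seq I) (F : I -> C -> 'cV[C]_n) (c : I -> 'cV[C]_n) : (forall j, leads (F j) (c j)) ->
  leads (fun z => \sum_(j <- s) F j z) (\sum_(j <- s) c j).
Proof.
move=> h; elim: s => [|j s ih].
  rewrite big_nil => i; rewrite mxE; apply: eq_tends (@tends_cst R 0) => z _.
  by rewrite /hco big_nil mulmx0 mxE mul0r.
rewrite big_cons (_ : (fun z => _) = fun z => F j z + \sum_(l <- s) F l z); first exact: leadsD.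
by apply/funext => z; rewrite big_cons.
Qed.

(** Coordinates with zero leading coefficient are O(q^(1 + lam)); dividing by Delta, of order q,
    leaves O(q^lam), which still vanishes at the cusp. *)
Lemma leads0_div k F : vform k F -> cuspv F -> leads F 0 ->
  vform (k - 12) (fun z => (Delta z)^-1 *: F z) /\ cuspv (fun z => (Delta z)^-1 *: F z).
Proof.
move=> hF cF lF; split.
  rewrite addrC; apply: vformM hF; first exact: (wformV (@Delta_wform R)).
  by apply: holoHV; [exact: Delta_holo | exact: Delta_neq0].
have [d d0 hd] := Delta_bounded R.
have vQ i : vanish (fun z => (Q *m ((Delta z)^-1 *: F z)) i 0).
  have [c [K K0 hK]] := perH_limit (hco_perH i hF) (hco_holo i hF) (hco_smallq i hF cF).
  have c0 : c = 0 by apply: tends_unique (vanish_ee hK) _; have := lF i; rewrite mxE.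
  have hb : bounded_inf (fun z => hco F i z / ee z).
    exists K, 1 => z /hK; rewrite c0 subr0 nmM nmV => h.
    by rewrite ler_pdivrMr // nm_gt0 ee_neq0.
  have le : vanish (fun z => ee (ofR (lam i) * z)).
    move=> r r0; have /andP[l0 l1] := lam01 i; have [Y hY] := nm_ee_small r0.
    exists (Y / lam i) => z hz; apply: ltW.
    have -> : nm (ee (ofR (lam i) * z)) = nm (ee (pt 0 (lam i * Im z))).
      by rewrite nm_ee_lam nm_ee /=; congr expR; ring.
    by apply: hY => /=; rewrite mulrC -ltr_pdivrMr.
  apply: eq_vanish (vanishM le (boundedM hb (tends_bounded hd))) => z z0.
  rewrite -scalemxAr [RHS]mxE hcoE; have := Delta_neq0 z0; have := ee_neq0 z.
  by move: (ee z) (Delta z) => a b a0 b0; field; rewrite a0 b0.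
move=> i; apply: (@eq_vanish R (fun z => \sum_j invmx Q i j * (Q *m ((Delta z)^-1 *: F z)) j 0)).
  by move=> z _; rewrite -[RHS](congr1 (fun X : 'cV_n => X i 0) (mulKmx uQ ((Delta z)^-1 *: F z))) mxE.
by apply: vanish_sum => j; apply: vanishZ.
Qed.

Definition indep (X : 'I_n -> 'cV[C]_n) := forall y : 'I_n -> C, \sum_j y j *: X j = 0 -> forall j, y j = 0.

Lemma indep_unit (X : 'I_n -> 'cV[C]_n) : indep X -> (\matrix_(i, j) X j i 0) \in unitmx.
Proof.
move=> hX; rewrite -unitmx_tr unitmxE unitfE; apply/det0P => -[v v0 vX].
move/eqP: v0; apply; apply/rowP => j; rewrite mxE; apply: (hX (fun j => v 0 j)).
apply/colP => i; rewrite summxE [RHS]mxE.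
transitivity ((v *m (\matrix_(i, j) X j i 0)^T) 0 i); last by rewrite vX mxE.
by rewrite mxE; apply: eq_bigr => l _; rewrite !mxE.
Qed.

Lemma unit_indep (X : 'I_n -> 'cV[C]_n) : (\matrix_(i, j) X j i 0) \in unitmx -> indep X.
Proof.
move=> uX y hy j; have : (\matrix_(i, j) X j i 0) *m (\col_j y j) = 0.
  rewrite -hy; apply/colP => i; rewrite mxE summxE.
  by apply: eq_bigr => l _; rewrite !mxE mulrC.
move/(congr1 (mulmx (invmx (\matrix_(i, j) X j i 0)))); rewrite mulKmx // mulmx0.
by move/colP/(_ j); rewrite !mxE.
Qed.

Lemma indep_span (X : 'I_n -> 'cV[C]_n) v : indep X -> exists a : 'I_n -> C, v = \sum_j a j *: X j.
Proof.
move=> /indep_unit uX; pose a := invmx (\matrix_(i, j) X j i 0) *m v.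
exists (fun j => a j 0); rewrite -{1}(mulKVmx uX v) -/a; apply/colP => i.
by rewrite mxE summxE; apply: eq_bigr => l _; rewrite !mxE mulrC.
Qed.

Lemma indep_swap (X : 'I_n -> 'cV[C]_n) (a : 'I_n -> C) c j0 : indep X -> a j0 != 0 -> c != 0 ->
  indep (fun j => if j == j0 then c *: \sum_l a l *: X l else X j).
Proof.
move=> hX a0 c0 y hy.
have h := hX (fun j => (if j == j0 then 0 else y j) + y j0 * c * a j) _.
have {h}h : forall j, (if j == j0 then 0 else y j) + y j0 * c * a j = 0.
  apply: h; rewrite -[RHS]hy; under eq_bigr do rewrite scalerDl -[(_ * a _) *: _]scalerA.
  rewrite big_split /= -scaler_sumr [RHS](bigD1 j0) //= eqxx scalerA addrC; congr (_ + _).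
  rewrite (bigD1 j0) //= eqxx scale0r add0r; apply: eq_bigr => l /negPf lj.
  by rewrite lj.
have y0 : y j0 = 0.
  have := h j0; rewrite eqxx add0r => /eqP; rewrite !mulf_eq0 (negPf a0) (negPf c0) !orbF.
  by move/eqP.
by move=> j; have := h j; rewrite y0 !mul0r addr0; case: eqP => [->|].
Qed.
Definition tup (m : 'I_n -> nat) (X : 'I_n -> C -> 'cV[C]_n) :=
  forall j, vform (2 + 12 * (m j)%:Z) (X j) /\ cuspv (X j).
Definition good m X := tup m X /\ exists2 z, 0 < Im z & indep (fun j => X j z).

Lemma good_exists : exists m X, good m X.
Proof.
have w0 : 0 < Im (pt 0 2 : C) by rewrite /=.
have h (j : 'I_n) := Poincare_generic (delta_mx j 0) w0 stab_2i.
have [m /choice[X hX]] := choice h; exists m, X; split.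
  by move=> j; have [h1 h2 _] := hX j.
exists (pt 0 2) => // y; under eq_bigr => j _ do have [_ _ ->] := hX j.
move=> hy j; have := congr1 (fun Y : 'cV_n => Y j 0) hy; rewrite summxE mxE (bigD1 j) //= !mxE !eqxx mulr1.
rewrite big1 ?addr0 // => l lj; by rewrite !mxE eq_sym (negPf lj) mulr0.
Qed.

(** The matrix of the [hco] tends to the invertible matrix of leading coefficients, so it is
    invertible high enough; restoring the nonzero factors q^lam keeps independence. *)
Lemma leads_indep X (L : 'I_n -> 'cV[C]_n) : (forall j, leads (X j) (L j)) -> indep L ->
  exists2 z, 0 < Im z & indep (fun j => X j z).
Proof.
move=> hL /indep_unit uL; set Lm := \matrix_(i, j) L j i 0 in uL.
pose H z : 'M[C]_n := \matrix_(i, j) hco (X j) i z.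
have h1 i j : tends (fun z => (invmx Lm *m H z) i j) ((1%:M : 'M[C]_n) i j).
  rewrite -(mulVmx uL) mxE; apply: (@eq_vanish R (fun z => \sum_l invmx Lm i l * (H z l j - Lm l j))).
    by move=> z _; rewrite mxE -sumrB; apply: eq_bigr => l _; rewrite mulrBr.
  apply: vanish_sum => l; apply: vanishZ; apply: eq_vanish (hL j l) => z _.
  by rewrite !mxE.
have d0 : 0 < (n%:R + 1)^-1 :> R by rewrite invr_gt0 ltr_wpDl.
have [Y hY] := choice (fun x : 'I_n * 'I_n => h1 x.1 x.2 _ d0).
pose z : C := pt 0 (1 + \sum_x `|Y x|).
have s0 : 0 <= \sum_x `|Y x| by apply: sumr_ge0 => x _.
have z0 : 0 < Im z by rewrite /= ltr_wpDr.
exists z => //; have uH : H z \in unitmx.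
  have : invmx Lm *m H z \in unitmx.
    apply: (@near_scalar_unit R n 1 _ (n%:R + 1)^-1) => [i j|].
      have yz : Y (i, j) < Im z.
        apply: (le_lt_trans (ler_norm _)); apply: (@le_lt_trans _ _ (\sum_x `|Y x|)).
          by rewrite (bigD1 (i, j)) //= lerDl sumr_ge0.
        by rewrite /= ltrDr ltr01.
      by have := hY (i, j) z yz; rewrite [(1%:M : 'M_n) _ _]mxE mulr1.
    by rewrite nm1 ltr_pdivrMr ?ltr_wpDl // mul1r ltrDl.
  by rewrite unitmx_mul => /andP[].
move=> y hy; apply: (unit_indep (X := fun j => \col_i hco (X j) i z)).
  by rewrite (_ : \matrix_(i, j) _ = H z) //; apply/matrixP => i j; rewrite !mxE.
apply/colP => i; rewrite summxE [RHS]mxE.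
apply: (mulIf (ee_neq0 (ofR (lam i) * z))); rewrite mul0r mulr_suml.
transitivity ((Q *m \sum_j y j *: X j z) i 0); last by rewrite hy mulmx0 mxE.
rewrite mulmx_sumr summxE; apply: eq_bigr => j _.
have -> : (y j *: \col_i0 hco (X j) i0 z) i 0 = y j * hco (X j) i z by rewrite !mxE.
have -> : (Q *m (y j *: X j z)) i 0 = y j * (Q *m X j z) i 0 by rewrite -scalemxAr mxE.
by rewrite hcoE -mulrA.
Qed.

Lemma min_good : exists m X, good m X /\ forall m' X', good m' X' -> (\sum_j m j <= \sum_j m' j)%N.
Proof.
pose P N := `[< exists m X, good m X /\ (\sum_(j < n) m j)%N = N >].
have [m0 [X0 h0]] := good_exists.
have exP : exists N, P N by exists (\sum_j m0 j)%N; apply/asboolP; exists m0, X0.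
case: (ex_minnP exP) => N /asboolP[m [X [h hN]]] hmin.
exists m, X; split=> // m' X' h'; rewrite hN; apply: hmin; apply/asboolP; by exists m', X'.
Qed.

(* Multiplying by powers of E4, which tends to 1 at infinity, equalizes weights
   without changing leading coefficients. *)
Lemma combine m X (L : 'I_n -> 'cV[C]_n) (a : 'I_n -> C) (p : nat) (b := fun j z => a j * E4 z ^+ (3 * (p - m j))) :
  tup m X -> (forall j, leads (X j) (L j)) -> (forall j, a j != 0 -> (m j <= p)%N) ->
  let F z := \sum_j b j z *: X j z in
  [/\ vform (2 + 12 * p%:Z) F, cuspv F & leads F (\sum_j a j *: L j)].
Proof.
move=> hX hL ha F.
have E4h j : holoH (b j) by apply: holoHZ; apply: holoHX; exact: E4_holo.
have tb j : tends (b j) (a j).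
  by have := tendsZ (a j) (tendsX (3 * (p - m j)) (@E4_tends R)); rewrite expr1n mulr1.
split.
- apply: vform_sum => j; have [a0|a0] := eqVneq (a j) 0.
    rewrite (_ : (fun z => _) = fun=> 0); first exact: vform0.
    by apply/funext => z; rewrite /b a0 mul0r scale0r.
  have mp := ha j a0.
  have -> : 2 + 12 * p%:Z = 4 * (3 * (p - m j))%N%:Z + (2 + 12 * (m j)%:Z) by lia.
  apply: vformM (E4h j) (hX j).1; apply: wformZ; exact: (wformX _ (@E4_wform R)).
- by apply: cuspv_sum => j; apply: cuspvM (tb j) (hX j).2.
- by apply: leads_sum => j; exact: leadsM.
Qed.

(* Among the tuples of cusp forms of weights 2 + 12 m_j with determinant not
   identically zero, one with least total weight has independent leading
   coefficients: otherwise a combination of them would be divisible by Delta. *)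
Theorem lattice : exists m X (L : 'I_n -> 'cV[C]_n),
  [/\ tup m X, forall j, leads (X j) (L j), indep L,
     forall (p : nat) F, vform (2 + 12 * p%:Z) F -> cuspv F -> exists c : 'I_n -> C -> C,
       (forall j, holoH (c j)) /\ forall z, 0 < Im z -> F z = \sum_j c j z *: X j z &
     forall F, vform 2 F -> cuspv F -> exists a : 'I_n -> C,
       (forall j, a j != 0 -> m j = 0%N) /\ forall z, 0 < Im z -> F z = \sum_j a j *: X j z].
Proof.
have [m [X [[hX [z0 z00 iX]] hmin]]] := min_good.
have [L hL] := choice (fun j => leads_exists (hX j).1 (hX j).2).
have iL : indep L.
  move=> y hy j1; apply/eqP/negPn/negP => y1.
  (* A form of largest weight in the relation is replaced by F / Delta: all exponents of E4 in
     [combine] are then nonnegative, and the total weight drops by 12. *)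
  have [j0 y0 hj0] := @arg_maxnP _ j1 (fun j => y j != 0) m y1.
  have [h1 h2 h3] := combine hX hL hj0; rewrite hy in h3.
  set F := (fun z => _) in h1 h2 h3.
  have [g1 g2] := leads0_div h1 h2 h3.
  have D0 := Delta_neq0 z00.
  pose X' j z := if j == j0 then (Delta z)^-1 *: F z else X j z.
  have iX' : indep (fun j => X' j z0).
    have := indep_swap (a := fun j => y j * E4 z0 ^+ (3 * (m j0 - m j))) (c := (Delta z0)^-1) (j0 := j0) iX.
    apply; last by rewrite invr_eq0.
    by rewrite subnn muln0 expr0 mulr1.
  (* For m j0 = 0, F / Delta would have weight -10 and vanish, against independence at z0. *)
  have m0 : (0 < m j0)%N.
    rewrite lt0n; apply/eqP => m0; rewrite m0 in g1.
    have z1 : (Delta z0)^-1 *: F z0 = 0 by apply: (vform_nonpos g1 g2) => //; lia.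
    have : ((j0 == j0)%:R : C) = 0.
      apply: (iX' (fun j => (j == j0)%:R)).
      rewrite (bigD1 j0) //= eqxx scale1r big1 ?addr0 => [|j /negPf ->]; last by rewrite scale0r.
      by rewrite /X' eqxx z1.
    by rewrite eqxx => /eqP; rewrite oner_eq0.
  pose m' j := if j == j0 then (m j0).-1 else m j.
  suff gd : good m' X'.
    have := hmin m' X' gd; rewrite (bigD1 j0) //= [X in (_ <= X)%N](bigD1 j0) //= /m' eqxx.
    rewrite [X in (_ <= _ + X)%N](eq_bigr m) => [|j /negPf -> //].
    by rewrite leq_add2r; lia.
  split; last by exists z0.
  move=> j; rewrite /X' /m'; case: eqP => [_|_]; last exact: hX.
  by split=> //; have -> : 2 + 12 * (m j0).-1%:Z = 2 + 12 * (m j0)%:Z - 12 by lia.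
(* Minimality again: if the leading vector of F involved some L j with m j > p, F could replace X j
   and lower the total. *)
have swap p F a : vform (2 + 12 * p%:Z) F -> cuspv F -> leads F (\sum_j a j *: L j) ->
    forall j, a j != 0 -> (m j <= p)%N.
  move=> hF cF lF j0 a0; rewrite leqNgt; apply/negP => pm.
  pose X' j := if j == j0 then F else X j; pose m' j := if j == j0 then p else m j.
  suff gd : good m' X'.
    have := hmin m' X' gd; rewrite (bigD1 j0) //= [X in (_ <= X)%N](bigD1 j0) //= /m' eqxx.
    rewrite [X in (_ <= _ + X)%N](eq_bigr m) => [|j /negPf -> //].
    by rewrite leq_add2r leqNgt pm.
  split; first by move=> j; rewrite /X' /m'; case: eqP => // _; exact: hX.
  have iL' := indep_swap iL a0 (oner_neq0 C).
  by apply: leads_indep iL' => j; rewrite /X'; case: eqP => _; rewrite ?scale1r.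
(* Removing the combination of the X j with the same leading vector leaves Delta times a form of
   weight 12 less, the induction step for generation. *)
have step p F : vform (2 + 12 * p%:Z) F -> cuspv F -> exists a : 'I_n -> C,
    (forall j, a j != 0 -> (m j <= p)%N) /\ exists G, [/\ vform (2 + 12 * p%:Z - 12) G, cuspv G &
    forall z, 0 < Im z -> F z = \sum_j (a j * E4 z ^+ (3 * (p - m j))) *: X j z + Delta z *: G z].
  move=> hF cF; have [c lF] := leads_exists hF cF; have [a ca] := indep_span c iL.
  rewrite ca in lF; exists a; have ha := swap _ _ _ hF cF lF; split=> //.
  have [h1 h2 h3] := combine hX hL ha; set S := (fun z => \sum_j _) in h1 h2 h3.
  have h4 : vform (2 + 12 * p%:Z) (fun z => F z + -1 *: S z) by apply: vformD => //; exact: vformZ.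
  have h5 : cuspv (fun z => F z + -1 *: S z) by apply: cuspvD => //; exact: cuspvZ.
  have h6 : leads (fun z => F z + -1 *: S z) 0.
    have := leadsD lF (leadsM (@tends_cst R (-1)) h3); by rewrite scaleN1r subrr.
  have [g1 g2] := leads0_div h4 h5 h6; exists (fun z => (Delta z)^-1 *: (F z + -1 *: S z)).
  split=> // z z1; rewrite scalerA divff ?Delta_neq0 // scale1r scaleN1r addrCA /S subrr addr0 //.
exists m, X, L; split=> //.
- elim=> [|p ih] F hF cF; have [a [ha [G [g1 g2 FE]]]] := step _ F hF cF.
    exists (fun j z => a j * E4 z ^+ (3 * (0 - m j))); split=> [j|z z1].
      by apply: holoHZ; apply: holoHX; exact: E4_holo.
    by rewrite FE // (vform_nonpos g1 g2) // ?scaler0 ?addr0.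
  have [|c [hc GE]] := ih G _ g2.
    by move: g1; have -> : 2 + 12 * p.+1%:Z - 12 = 2 + 12 * p%:Z by lia.
  exists (fun j z => a j * E4 z ^+ (3 * (p.+1 - m j)) + Delta z * c j z); split=> [j|z z1].
    apply: holoHD; first by apply: holoHZ; apply: holoHX; exact: E4_holo.
    by apply: holoHM; [exact: Delta_holo | exact: hc].
  rewrite FE // GE // scaler_sumr -big_split /=; apply: eq_bigr => j _.
  by rewrite scalerA scalerDl.
- move=> F hF cF; have [a [ha [G [g1 g2 FE]]]] := step 0%N F hF cF.
  exists a; split=> [j /ha|z z1]; first by rewrite leqn0 => /eqP.
  rewrite FE // (vform_nonpos g1 g2) // ?scaler0 ?addr0 //.
  by apply: eq_bigr => j _; rewrite sub0n muln0 expr0 mulr1.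
Qed.
End Lattice.

(** * Zeros of E4 and E6, orders at fixed points *)

Section ScalarForms.
Variable R : realType.
Local Notation C := R[i].
Local Notation Re := (@complex.Re R).
Local Notation Im := (@complex.Im R).
Local Notation ofR := (real_complex R).
Local Notation J := (@autf R).
Implicit Types (A B : SL2Z) (z w u t c : C) (f g F E : C -> C).

Lemma bounded_tends f : perH f -> holoH f -> bounded_inf f -> exists c, tends f c.
Proof.
move=> fp hf [M [Y hM]]; have [c [K K0 hK]] := perH_limit fp hf (smallq_bounded hM).
by exists c; exact: vanish_ee hK.
Qed.

Lemma scalar_Poincare (k0 : int) w : 0 < Im w -> (forall A, mob A w = w -> J A w ^ k0 = 1) ->
  exists N f, [/\ wform (k0 + 12 * N) f, holoH f, vanish f & f w = 1].
Proof.
move=> w0 hw; pose rho A : 'M[C]_1 := 1%:M.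
have rhoM A B : rho (A * B)%g = rho A *m rho B by rewrite /rho mul1mx.
have rho_b A i j : nm (rho A i j) <= 1 by rewrite /rho !ord1 mxE nm1.
have [|N [F [[h1 h2] h3 h4]]] := Poincare_value rhoM rho_b (ltn0Sn 0) erefl w0 (k0 := k0) (v := 1%:M).
  by move=> A fx; rewrite /rho mul1mx -invr_expz hw // invr1 scale1r.
exists N, (fun z => F z 0 0); split=> //; last by rewrite h4 mxE.
by move=> A z z0; rewrite h2 // /rho mul1mx mxE.
Qed.

(** Divide by Delta, subtract the multiple of E E4^(3N) with the same limit at the cusp, and induct:
    in weight k0 < 12 only the zero form vanishes at the cusp. *)
Lemma wform_divisible E (k0 : nat) : wform k0%:Z E -> holoH E -> tends E 1 -> (k0 < 12)%N ->
  forall (N : nat) f, wform (k0%:Z + 12 * N%:Z) f -> holoH f -> vanish f ->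
  exists g, forall z, 0 < Im z -> f z = E z * g z.
Proof.
move=> wE hE tE k12; elim=> [|N ih] f wf hf vf.
  by exists (fun=> 0) => z z0; rewrite mulr0 (wform_vanish0 wf) //; lia.
pose f1 z := f z * (Delta z)^-1.
have w1 : wform (k0%:Z + 12 * N%:Z) f1.
  have -> : k0%:Z + 12 * N%:Z = k0%:Z + 12 * N.+1%:Z + - 12 by lia.
  exact: wformM wf (wformV (@Delta_wform R)).
have h1 : holoH f1 by apply: holoHM => //; apply: holoHV; [exact: Delta_holo | exact: Delta_neq0].
have [c tc] := bounded_tends (wform_perH w1) h1 (vanish_div_Delta (wform_perH wf) hf vf).
pose e z := E z * E4 z ^+ (3 * N).
have we : wform (k0%:Z + 12 * N%:Z) e.
  have -> : k0%:Z + 12 * N%:Z = k0%:Z + 4%:Z * (3 * N)%N%:Z by lia.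
  exact: wformM wE (wformX _ (@E4_wform R)).
have he : holoH e by apply: holoHM => //; apply: holoHX; exact: E4_holo.
have te : tends e 1.
  by have := tendsM tE (tendsX (3 * N) (@E4_tends R)); rewrite expr1n mulr1.
have [|||g hg] := ih (fun z => f1 z - c * e z).
- by apply: wformB => //; exact: wformZ.
- by apply: holoHB => //; exact: holoHZ.
- have := tendsB tc (tendsZ c te); rewrite mulr1 subrr.
  by apply: eq_vanish => z _; rewrite subr0.
exists (fun z => Delta z * (c * E4 z ^+ (3 * N) + g z)) => z z0.
have -> : f z = Delta z * (f1 z - c * e z + c * e z).
  by rewrite subrK /f1 mulrC divfK ?Delta_neq0.
by rewrite hg // /e; ring.
Qed.

(** In place of the valence formula: a scalar Poincare series of weight k0 mod 12 has value 1 at w,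
    and it is divisible by E. *)
Lemma wform_nonzero E (k0 : nat) w : wform k0%:Z E -> holoH E -> tends E 1 -> (k0 < 12)%N ->
  0 < Im w -> (forall A, mob A w = w -> J A w ^+ k0 = 1) -> E w != 0.
Proof.
move=> wE hE tE k12 w0 hw; have [N [f [h1 h2 h3 h4]]] := @scalar_Poincare k0%:Z w w0 hw.
have [N0|N0] := ltP N 0.
  have := wform_vanish0 h1 h2 h3 _ w0; rewrite h4 => /(_ _)/eqP; rewrite oner_eq0 => h.
  by have /h : k0%:Z + 12 * N < 12 by lia.
case: N h1 N0 => // N h1 _; have [g hg] := wform_divisible wE hE tE k12 h1 h2 h3.
by apply/eqP => Ew; have /eqP := hg w w0; rewrite h4 Ew mul0r oner_eq0.
Qed.

Lemma J_stab_i A : mob A ('i%C : C) = 'i%C -> J A ('i%C : C) ^+ 4 = 1.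
Proof.
move=> h; have i0 := @i_gt0 R; have [A1|SA] := stab_i h.
  by rewrite -[4%N]/(2 * 2)%N exprM pm1_J // expr1n.
have := pm1_J ('i%C : C) SA; rewrite JM // h J_S exprMn sqr_i mulN1r => /eqP; rewrite eqr_oppLR => /eqP e.
by rewrite -[4%N]/(2 * 2)%N exprM e sqrrN expr1n.
Qed.

Lemma J_stab_zeta A : mob A (zeta R) = zeta R -> J A (zeta R) ^+ 6 = 1.
Proof.
move=> h; have z0 := zeta_gt0 R; have h3 := zeta_X3 R.
have zn : zeta R != 0 by apply/eqP => e; rewrite e ltxx in z0.
have mR := mob_R_zeta R.
have RA : mob (matR * A)%g (zeta R) = zeta R by rewrite mobM // h mR.
rewrite -[6%N]/(2 * 3)%N exprM; case: (stab_zeta h) => [A1|A1|A1].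
- by rewrite pm1_J // expr1n.
- have := pm1_J (zeta R) A1; rewrite JM // h J_R_zeta exprMn zeta1X => /(congr1 (fun x => x ^+ 3)).
  by rewrite exprMn h3 mul1r expr1n.
- have := pm1_J (zeta R) A1; rewrite JM // RA JM // h J_R_zeta !exprMn zeta1X => /(congr1 (fun x => x ^+ 3)).
  by rewrite !exprMn h3 !mul1r expr1n.
Qed.

Lemma E4_i : E4 ('i%C : C) != 0.
Proof. by apply: (wform_nonzero (@E4_wform R) (@E4_holo R) (@E4_tends R)) => //; exact: J_stab_i. Qed.
Lemma E6_zeta : E6 (zeta R) != 0.
Proof. by apply: (wform_nonzero (@E6_wform R) (@E6_holo R) (@E6_tends R)) => //; [exact: zeta_gt0 | exact: J_stab_zeta]. Qed.

Lemma wform_orbit k f A w : wform k f -> 0 < Im w -> (f (mob A w) == 0) = (f w == 0).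
Proof.
move=> wf w0; rewrite wf // mulf_eq0; case: eqP => // /eqP.
by rewrite expfz_eq0 (negPf (J_neq0 A w0)) andbF.
Qed.

(** Off the orbits of i and zeta the stabilizer is {1, -1}, and at i one has J^4 = 1;
    [wform_nonzero] excludes zeros in both cases. *)
Lemma E4_zero w : 0 < Im w -> E4 w = 0 -> exists B, mob B w = zeta R.
Proof.
move=> w0 /eqP Ew; apply: contrapT => hB; move: Ew; apply/negP.
have [[A fx A1]|h] := pselect (exists2 A, mob A w = w & A \notin pm1).
  have [B [Bw|Bw]] := elliptic w0 fx A1; last by case: hB; exists B.
  by rewrite -(wform_orbit B (@E4_wform R) w0) Bw E4_i.
apply: (wform_nonzero (@E4_wform R) (@E4_holo R) (@E4_tends R)) => // A fx.
have A1 : A \in pm1 by apply: contrapT => A1; apply: h; exists A => //; apply/negP.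
by rewrite -[4%N]/(2 * 2)%N exprM pm1_J // expr1n.
Qed.

Lemma E6_zero w : 0 < Im w -> E6 w = 0 -> exists B, mob B w = 'i%C.
Proof.
move=> w0 /eqP Ew; apply: contrapT => hB; move: Ew; apply/negP.
have [[A fx A1]|h] := pselect (exists2 A, mob A w = w & A \notin pm1).
  have [B [Bw|Bw]] := elliptic w0 fx A1; first by case: hB; exists B.
  by rewrite -(wform_orbit B (@E6_wform R) w0) Bw E6_zeta.
apply: (wform_nonzero (@E6_wform R) (@E6_holo R) (@E6_tends R)) => // A fx.
have A1 : A \in pm1 by apply: contrapT => A1; apply: h; exists A => //; apply/negP.
by rewrite -[6%N]/(2 * 3)%N exprM pm1_J // expr1n.
Qed.

Lemma dv_orbit (k : nat) f B w : wform k%:Z f -> holoH f -> 0 < Im w -> f w = 0 ->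
  dv f (mob B w) != 0 -> dv f w != 0.
Proof.
move=> wf hf w0 fw; rewrite (dv_mob B wf hf w0) fw mulr0 addr0.
by apply: contra => /eqP ->; rewrite mulr0.
Qed.

Lemma E4_simple w : 0 < Im w -> E4 w = 0 -> dv (@E4 R) w != 0.
Proof.
move=> w0 Ew; have [B Bw] := E4_zero w0 Ew.
apply: (dv_orbit (B := B) (@E4_wform R) (@E4_holo R) w0 Ew); rewrite Bw.
exact/dv_E4_zeta/E6_zeta.
Qed.

Lemma E6_simple w : 0 < Im w -> E6 w = 0 -> dv (@E6 R) w != 0.
Proof.
move=> w0 Ew; have [B Bw] := E6_zero w0 Ew.
apply: (dv_orbit (B := B) (@E6_wform R) (@E6_holo R) w0 Ew); rewrite Bw.
exact/dv_E6_i/E4_i.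
Qed.

Lemma holo_ccont f w : holoH f -> 0 < Im w -> ccont f w.
Proof. by move=> hf w0; have [D hD] := hf w w0; exact: cdiff_cont hD. Qed.

Lemma eq_punctured f g w : holoH f -> holoH g -> 0 < Im w ->
  (forall z, 0 < Im z -> z != w -> f z = g z) -> f w = g w.
Proof.
move=> hf hg w0 h; apply/subr0_eq/(@nm_small0 R _ 2) => e e0.
have [d1 d10 h1] := holo_ccont hf w0 e0; have [d2 d20 h2] := holo_ccont hg w0 e0.
pose d := Num.min (Im w) (Num.min d1 d2) / 2.
have d0 : 0 < d by rewrite divr_gt0 // !lt_min w0 d10.
have dd : d < Num.min (Im w) (Num.min d1 d2) by rewrite /d; move: d0; rewrite /d; lra.
move: dd; rewrite !lt_min => /and3P[_ dd1 dd2].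
pose z : C := w + pt 0 d.
have nz : nm (z - w) = d.
  by rewrite /z addrC addKr /nm /= expr0n add0r sqrtr_sqr ger0_norm // ltW.
have z0 : 0 < Im z by rewrite /z cImD /= addr_gt0.
have zw : z != w by rewrite -subr_eq0 -nm_gt0 nz.
have a1 := h1 z ltac:(by rewrite nz); have a2 := h2 z ltac:(by rewrite nz).
rewrite h // in a1; have := nm_tri (g z) (f w) (g w); rewrite [nm (f w - g z)]nm_subC; lra.
Qed.

Lemma holoH_comp_mob f A : holoH f -> holoH (fun z => f (mob A z)).
Proof.
move=> hf z z0; have [D hD] := hf _ (mob_gt0 A z0).
by eexists; exact: cdiff_comp (cdiff_mob A z0) hD.
Qed.

Lemma holoH_Jexp A (k : int) : holoH (fun z => J A z ^ k).
Proof.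
have hJ : holoH (J A) by move=> z _; eexists; exact: cdiff_J.
case: k => k; first by apply: (@holoHX R).
apply: (@holoH_eq R (fun z => (J A z ^+ k.+1)^-1)); first by move=> z _; rewrite NegzE -invr_expz.
apply: holoHV; first exact: holoHX.
by move=> z z0; rewrite expf_neq0 // J_neq0.
Qed.

Lemma holoH_lin w : holoH (fun z => z - w).
Proof. by move=> z _; eexists; exact: cdiffB (cdiff_id z) (cdiff_cst w z). Qed.

(** The Taylor coefficient of order t at w is multiplied by J(g, w)^(k + 2t) chi, so it vanishes
    unless this is 1. The induction divides by z - w, with g z - w = (z - w) / (J(g, z) J(g, w)). *)
Lemma order_at w (g : SL2Z) (k : int) (chi : C) f (a : nat) : 0 < Im w -> mob g w = w -> holoH f ->
  (forall z, 0 < Im z -> f (mob g z) = J g z ^ k * chi * f z) ->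
  (forall t : nat, (t < a)%N -> J g w ^ (k + 2 * t%:Z) * chi != 1) ->
  exists h, [/\ holoH h, forall z, 0 < Im z -> f z = (z - w) ^+ a * h z &
    forall z, 0 < Im z -> h (mob g z) = J g z ^ (k + a%:Z) * (J g w ^+ a * chi) * h z].
Proof.
move=> w0 gw hf fg; elim: a => [|a ih] ha.
  exists f; split=> // z z0; first by rewrite expr0 mul1r.
  by rewrite expr0 mul1r addr0 fg.
have [|h [hh fh hg]] := ih; first by move=> t ta; apply: ha; exact: ltnW.
have jw := J_neq0 g w0.
have hw : h w = 0.
  have := hg w w0; rewrite gw mulrA exprnP -expfzDr // => /eqP.
  rewrite -subr_eq0 -{1}[h w]mul1r -mulrBl mulf_eq0 => /orP[|/eqP //].
  rewrite subr_eq0 eq_sym -addrA -mulr2n -[a%:Z *+ 2]mulr_natl => /negPn.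
  by rewrite (ha a (ltnSn a)).
have hs : holoH (slope h w) by exact: holoH_slope.
have hE z : 0 < Im z -> h z = (z - w) * slope h w z.
  by move=> z0; rewrite (slopeE _ (hh w w0)) hw add0r.
have rel z : 0 < Im z -> z != w ->
    slope h w (mob g z) = J g z ^ (k + a.+1%:Z) * (J g w ^+ a.+1 * chi) * slope h w z.
  move=> z0 zw; have jz := J_neq0 g z0; have zw0 : z - w != 0 by rewrite subr_eq0.
  have := hg z z0; rewrite !hE ?mob_gt0 // -{1}gw mobB //.
  have -> : J g z ^ (k + a.+1%:Z) = J g z ^ (k + a%:Z) * J g z.
    by rewrite intS [1 + _]addrC addrA [LHS]expfzDr // expr1z.
  rewrite exprSr => e.
  apply: (mulfI (_ : (z - w) / (J g z * J g w) != 0)).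
    by rewrite mulf_neq0 // invr_eq0 mulf_neq0.
  by rewrite e; field; rewrite jz jw.
exists (slope h w); split=> // z z0; first by rewrite fh // hE // exprSr mulrA.
have [->|zw] := eqVneq z w; last exact: rel.
apply: (@eq_punctured (fun z => slope h w (mob g z))
  (fun z => J g z ^ (k + a.+1%:Z) * (J g w ^+ a.+1 * chi) * slope h w z)) => //.
- exact: holoH_comp_mob.
- apply: holoHM => //; apply: holoHM; [exact: holoH_Jexp | exact: holoH_cst].
Qed.
End ScalarForms.

(** * Local form of Phi *)

Section Frame.
Variable R : realType.
Local Notation C := R[i].
Local Notation Im := (@complex.Im R).
Local Notation J := (@autf R).
Implicit Types (A B : SL2Z) (z w u t c : C).
Variables (n : nat) (rho : SL2Z -> 'M[C]_n).
Hypothesis rhoM : forall A B, rho (A * B)%g = rho A *m rho B.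
Hypothesis rho1 : rho 1%g = 1%:M.
Variable M : R.
Hypothesis rho_bound : forall A i j, nm (rho A i j) <= M.
Variable e : nat.
Hypotheses (e0 : (0 < e)%N) (rho_e : rho (mT e%:Z) = 1%:M).
Variables (m : 'I_n -> nat) (X : 'I_n -> C -> 'cV[C]_n).
Hypothesis tupX : tup rho m X.
Hypothesis genX : forall (p : nat) F, vform rho (2 + 12 * p%:Z) F -> cuspv F ->
  exists c : 'I_n -> C -> C,
    (forall j, holoH (c j)) /\ forall z, 0 < Im z -> F z = \sum_j c j z *: X j z.

Definition Phi z : 'M[C]_n := \matrix_(i, j) X j z i 0.

Lemma holoH_det (U : C -> 'M[C]_n) : (forall i j, holoH (fun z => U z i j)) -> holoH (fun z => \det (U z)).
Proof.
move=> hU; apply: holoH_sum => s _; apply: holoHM; first exact: holoH_cst.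
by apply: holoH_prod => i _; exact: hU.
Qed.

Lemma Phi_holo i j : holoH (fun z => Phi z i j).
Proof.
by apply: (@holoH_eq R (fun z => X j z i 0)); [move=> z _; rewrite mxE | exact: (tupX j).1.1].
Qed.

Lemma generated (G : 'I_n -> C -> 'cV[C]_n) (N : 'I_n -> nat) :
  (forall j, vform rho (2 + 12 * (N j)%:Z) (G j) /\ cuspv (G j)) ->
  exists2 c : C -> 'M[C]_n, (forall i j, holoH (fun z => c z i j)) &
    forall z, 0 < Im z -> \matrix_(i, j) G j z i 0 = Phi z *m c z.
Proof.
move=> hG; have [c hc] := choice (fun j => genX (hG j).1 (hG j).2).
exists (fun z => \matrix_(i, j) c j i z) => [i j|z z0].
  by apply: (@holoH_eq R (c j i)); [move=> z _; rewrite mxE | exact: (hc j).1].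
apply/matrixP => i j; rewrite !mxE (hc j).2 // summxE; apply: eq_bigr => l _.
by rewrite !mxE mulrC.
Qed.

(** Cusp forms with the unit vectors as values at w are combinations of the X j, so the columns of
    Phi w span. *)
Lemma Phi_generic w : (forall A, A \in pm1 -> rho A = 1%:M) -> 0 < Im w ->
  (forall A, mob A w = w -> A \in pm1) -> \det (Phi w) != 0.
Proof.
move=> rho_pm1 w0 hw.
have h (j : 'I_n) := Poincare_generic rhoM rho1 rho_bound e0 rho_e rho_pm1 (delta_mx j 0) w0 hw.
have [N /choice[G hG]] := choice h.
have [|c hc cE] := @generated G N; first by move=> j; have [] := hG j.
have := cE w w0; rewrite (_ : \matrix_(i, j) _ = 1%:M); last first.
  by apply/matrixP => i j; have [_ _ gw] := hG j; rewrite !mxE gw !mxE eqxx andbT.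
move/(congr1 determinant); rewrite det1 det_mulmx => /eqP; rewrite eq_sym => d1.
by apply/eqP => d0; move: d1; rewrite d0 mul0r eq_sym oner_eq0.
Qed.

(** [order_at] makes row l of P Phi divisible by (z - w)^(a l). That the determinant has no further
    zero at w is seen from forms E^(a j) G j, where G j is a Poincare series with the j-th
    eigenvector as value at w: they are combinations of the X j, and their determinant has order
    exactly the sum of the a l. *)
Lemma frame w (g : SL2Z) (E : C -> C) (kE r : nat) (P : 'M[C]_n) (a : 'I_n -> nat) :
  0 < Im w -> mob g w = w -> wform kE%:Z E -> holoH E -> tends E 1 ->
  E w = 0 -> dv E w != 0 ->
  (forall (b : nat) (v : 'cV[C]_n), rho g *m v = J g w ^ (kE%:Z * b%:Z - 2) *: v ->
     forall A, mob A w = w -> rho A *m v = J A w ^ (kE%:Z * b%:Z - 2) *: v) ->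
  P \in unitmx -> P *m rho g = diag_mx (\row_l J g w ^ (kE%:Z * (a l)%:Z - 2)) *m P ->
  (forall l, (a l < r)%N) -> J g w ^+ (kE + 2) = 1 ->
  (forall t : nat, (0 < t < r)%N -> J g w ^+ (kE * t) != 1) ->
  exists U : C -> 'M[C]_n, [/\ forall i j, holoH (fun z => U z i j),
    forall z, 0 < Im z -> P *m Phi z = diag_mx (\row_l (z - w) ^+ a l) *m U z & \det (U w) != 0].
Proof.
move=> w0 gw wE hE tE Ew dE hstab uP Pg ar jE mu.
have jw := J_neq0 g w0; have J12 := stab_J12 w0 gw.
pose chi l := J g w ^ (kE%:Z * (a l)%:Z - 2).
have [U hU] : exists U : 'I_n * 'I_n -> C -> C, forall x, holoH (U x) /\
    forall z, 0 < Im z -> (P *m Phi z) x.1 x.2 = (z - w) ^+ a x.1 * U x z.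
  suff hUx : forall x : 'I_n * 'I_n, exists h : C -> C, holoH h /\
      forall z, 0 < Im z -> (P *m Phi z) x.1 x.2 = (z - w) ^+ a x.1 * h z.
    by have [U hU] := choice hUx; exists U.
  move=> [l j] /=.
  have [[hX1 hX2] _] := tupX j.
  have fE z : (P *m Phi z) l j = (P *m X j z) l 0.
    by rewrite !mxE; apply: eq_bigr => i _; rewrite mxE.
  have hf : holoH (fun z => (P *m Phi z) l j).
    apply: (@holoH_eq R (fun z => (P *m X j z) l 0)); first by move=> z _; rewrite fE.
    exact: mulmx_holo (tupX j).1.
  have [||h [hh hf' _]] := order_at (k := 2 + 12 * (m j)%:Z) (chi := chi l) (a := a l) w0 gw hf.
  - move=> z z0; rewrite !fE hX2 // -scalemxAr mulmxA Pg -mulmxA mul_diag_mx.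
    by rewrite mxE [X in _ * X]mxE [X in _ * (X * _)]mxE mulrA.
  (* Modulo J^12 = 1 and J^(kE + 2) = 1 the exponent reduces to kE (a l - t), a case of [mu]. *)
  - move=> t ta; have -> : J g w ^ (2 + 12 * (m j)%:Z + 2 * t%:Z) * chi l = J g w ^+ (kE * (a l - t)).
      rewrite /chi -expfzDr //.
      have -> : 2 + 12 * (m j)%:Z + 2 * t%:Z + (kE%:Z * (a l)%:Z - 2) =
         12%:Z * (m j)%:Z + ((kE + 2)%N%:Z * t%:Z + (kE * (a l - t))%N%:Z).
        by rewrite PoszM -subzn ?(ltnW ta) // PoszD; ring.
      by rewrite expfzDr // expfzDr // -!exprz_exp -!exprnP J12 jE !expr1n !mul1r.
    by apply: mu; have := ar l; lia.
  by exists h.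
exists (fun z => \matrix_(l, j) U (l, j) z).
have hUm i j : holoH (fun z => (\matrix_(l, j) U (l, j) z) i j).
  by apply: (@holoH_eq R (U (i, j))); [move=> z _; rewrite mxE | exact: (hU (i, j)).1].
have PU z : 0 < Im z -> P *m Phi z = diag_mx (\row_l (z - w) ^+ a l) *m \matrix_(l, j) U (l, j) z.
  by move=> z0; apply/matrixP => l j; rewrite mul_diag_mx [RHS]mxE [X in _ = X * _]mxE (hU (l, j)).2 // mxE.
split=> //.
pose v j := invmx P *m delta_mx j (0 : 'I_1).
have Pv j : P *m v j = delta_mx j 0 by rewrite /v mulKVmx.
have v0 j : v j != 0.
  by apply/eqP => h; have := Pv j; rewrite h mulmx0 => /(congr1 (fun Y : 'cV_n => Y j 0))/eqP; rewrite !mxE !eqxx eq_sym oner_eq0.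
have rv j : rho g *m v j = J g w ^ (kE%:Z * (a j)%:Z - 2) *: v j.
  apply: (can_inj (mulKmx uP)); rewrite mulmxA Pg -mulmxA Pv -scalemxAr Pv mul_diag_mx.
  apply/matrixP => i l; rewrite !mxE; case: (i =P j) => [->|_] //; by rewrite !mulr0.
have hG j : exists (NG : nat * (C -> 'cV[C]_n)),
    [/\ vform rho (2 - kE%:Z * (a j)%:Z + 12 * NG.1%:Z) NG.2, cuspv NG.2 & NG.2 w = v j].
  have [|N [G [h1 h2 h3]]] := Poincare_value rhoM rho_bound e0 rho_e w0 (k0 := 2 - kE%:Z * (a j)%:Z) (v := v j).
    by move=> A Aw; rewrite opprB; exact: hstab (rv j) A Aw.
  case: N h1 => [N|N] h1; first by exists (N, G).
  move: (v0 j); rewrite -h3 (vform_nonpos rhoM rho1 rho_bound e0 rho_e h1 h2) ?eqxx //.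
  by rewrite NegzE; nia.
have [NG hNG] := choice hG.
pose Y j z := E z ^+ a j *: (NG j).2 z.
have hY j : vform rho (2 + 12 * (NG j).1%:Z) (Y j) /\ cuspv (Y j).
  have [h1 h2 _] := hNG j; split; last exact: cuspvM (tendsX (a j) tE) h2.
  have -> : 2 + 12 * (NG j).1%:Z = kE%:Z * (a j)%:Z + (2 - kE%:Z * (a j)%:Z + 12 * (NG j).1%:Z) by ring.
  exact: vformM (wformX (a j) wE) (holoHX (a j) hE) h1.
have [c hc cE] := generated hY.
pose Gm z : 'M[C]_n := \matrix_(i, j) (NG j).2 z i 0.
have hGm i j : holoH (fun z => Gm z i j).
  apply: (@holoH_eq R (fun z => (NG j).2 z i 0)); first by move=> z _; rewrite mxE.
  by have [[h _] _ _] := hNG j.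
have YE z : \matrix_(i, j) Y j z i 0 = Gm z *m diag_mx (\row_j E z ^+ a j).
  by apply/matrixP => i j; rewrite mul_mx_diag !mxE mulrC.
pose s := (\sum_j a j)%N.
have prodE (x : C) : \det (diag_mx (\row_j x ^+ a j) : 'M[C]_n) = x ^+ s.
  by rewrite det_diag -prodrXr; apply: eq_bigr => j _; rewrite mxE.
pose Um z : 'M[C]_n := \matrix_(l, j) U (l, j) z.
(* The identity of determinants, divided by (z - w)^s away from w. Continuity carries it to w, where
   the left side is nonzero. *)
have key z : 0 < Im z -> z != w -> \det P * \det (Gm z) * slope E w z ^+ s = \det (Um z) * \det (c z).
  move=> z0 zw; have zs : (z - w) ^+ s != 0 by rewrite expf_neq0 // subr_eq0.
  apply: (mulfI zs); have := congr1 determinant (congr1 (mulmx P) (cE z z0)).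
  rewrite YE [P *m (Phi z *m c z)]mulmxA PU // !det_mulmx !prodE (slopeE z (hE w w0)) Ew add0r exprMn => h.
  by rewrite -/(Um z) in h; rewrite [RHS]mulrA -h; ring.
have hslope : holoH (slope E w) by exact: holoH_slope.
have kw : \det P * \det (Gm w) * slope E w w ^+ s = \det (Um w) * \det (c w).
  apply: (@eq_punctured R (fun z => \det P * \det (Gm z) * slope E w z ^+ s) (fun z => \det (Um z) * \det (c z))) => //.
    apply: holoHM; last exact: holoHX.
    by apply: holoHZ; apply: holoH_det.
  by apply: holoHM; apply: holoH_det.
have Gw : Gm w = invmx P.
  apply/matrixP => i j; have [_ _ h3] := hNG j; rewrite mxE h3 /v mxE (bigD1 j) //= mxE !eqxx mulr1.
  by rewrite big1 ?addr0 // => l lj; rewrite mxE (negPf lj) mulr0.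
apply/eqP => d0; move/eqP: kw; rewrite -/(Um w) d0 mul0r Gw -det_mulmx mulmxV // det1 mul1r.
by rewrite expf_eq0 /slope eqxx (negPf dE) andbF.
Qed.
End Frame.

(** * Weight identity and duality *)

Section Division.
Variable R : realType.
Local Notation C := R[i].
Local Notation Re := (@complex.Re R).
Local Notation Im := (@complex.Im R).
Local Notation ofR := (real_complex R).
Local Notation J := (@autf R).
Implicit Types (A B : SL2Z) (z w u t c : C) (f g F E : C -> C).

Definition simple_zeros E := forall w, 0 < Im w -> E w = 0 -> dv E w != 0.

(** Local divisibility at every zero gives global divisibility, one factor E at a time. The frames
    provide it only up to a factor [u] nonzero at w. *)
Lemma divide_E E : holoH E -> simple_zeros E -> forall (s : nat) f, holoH f ->
  (forall w, 0 < Im w -> E w = 0 -> exists u h : C -> C,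
     [/\ holoH u, holoH h, u w != 0 & forall z, 0 < Im z -> f z * u z = (z - w) ^+ s * h z]) ->
  exists2 q, holoH q & forall z, 0 < Im z -> f z = E z ^+ s * q z.
Proof.
move=> hE sE; elim=> [|s ih] f hf hs.
  by exists f => // z z0; rewrite expr0 mul1r.
have [w w0 Ew|g hg fE] := holoH_quotient hf hE.
  split; last exact: sE.
  have [u [h [hu hh uw /(_ w w0)]]] := hs w w0 Ew.
  by rewrite subrr expr0n mul0r => /eqP; rewrite mulf_eq0 (negPf uw) orbF => /eqP.
have [w w0 Ew|q hq gE] := ih g hg; last first.
  by exists q => // z z0; rewrite fE // gE // exprS mulrA.
have [u [h [hu hh uw fu]]] := hs w w0 Ew.
have hS : holoH (slope E w) by exact: holoH_slope.
exists (fun z => u z * slope E w z), h; split=> //; first exact: holoHM.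
  by rewrite mulf_neq0 // /slope eqxx; exact: sE.
have key z : 0 < Im z -> z != w -> g z * (u z * slope E w z) = (z - w) ^+ s * h z.
  move=> z0 zw; have zw0 : z - w != 0 by rewrite subr_eq0.
  apply: (mulfI zw0); rewrite [RHS]mulrA -exprS -fu // fE // (slopeE z (hE w w0)) Ew add0r; ring.
move=> z z0; have [->|] := eqVneq z w; last exact: key.
apply: (@eq_punctured R (fun z => g z * (u z * slope E w z)) (fun z => (z - w) ^+ s * h z)) => //.
  by apply: holoHM => //; exact: holoHM.
by apply: holoHM => //; apply: holoHX; exact: holoH_lin.
Qed.

Lemma divide_value E (s : nat) f (q u h : C -> C) w : holoH E -> holoH q -> holoH u -> holoH h ->
  0 < Im w -> E w = 0 -> (forall z, 0 < Im z -> f z = E z ^+ s * q z) ->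
  (forall z, 0 < Im z -> f z * u z = (z - w) ^+ s * h z) -> h w != 0 -> q w != 0.
Proof.
move=> hE hq hu hh w0 Ew fE fu; apply: contra => /eqP qw; apply/eqP.
have hS : holoH (slope E w) by exact: holoH_slope.
rewrite -[RHS](_ : slope E w w ^+ s * q w * u w = 0); last by rewrite qw mulr0 mul0r.
apply/esym/(@eq_punctured R (fun z => slope E w z ^+ s * q z * u z) h) => //.
  by apply: holoHM => //; apply: holoHM => //; exact: holoHX.
move=> z z0 zw; have zs : (z - w) ^+ s != 0 by rewrite expf_neq0 // subr_eq0.
by apply: (mulfI zs); rewrite -fu // fE // (slopeE z (hE w w0)) Ew add0r exprMn; ring.
Qed.

(** At a zero of E, differentiating E f = 0 gives E' f = 0 with E' nonzero. *)
Lemma simple_cancel E f : holoH E -> simple_zeros E -> holoH f ->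
  (forall z, 0 < Im z -> E z * f z = 0) -> forall z, 0 < Im z -> f z = 0.
Proof.
move=> hE sE hf h z z0; have /eqP := h z z0; rewrite mulf_eq0 => /orP[/eqP Ez|/eqP //].
have d1 := cdiffM (dvP (hE z z0)) (dvP (hf z z0)).
have d2 : cdiff (fun w => E w * f w) z 0.
  by apply: (cdiff_near z0 _ (cdiff_cst 0 z)) => w hw; rewrite h // (@disc_H R z).
have := cdiff_unique d1 d2; rewrite Ez mul0r addr0 => /eqP.
by rewrite mulf_eq0 (negPf (sE z z0 Ez)) => /eqP.
Qed.

Lemma simple_cancelX E f (s : nat) : holoH E -> simple_zeros E -> holoH f ->
  (forall z, 0 < Im z -> E z ^+ s * f z = 0) -> forall z, 0 < Im z -> f z = 0.
Proof.
move=> hE sE hf; elim: s => [|s ih] h z z0; first by have := h z z0; rewrite expr0 mul1r.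
apply: (ih _ z z0) => w w0; apply: (simple_cancel hE sE (f := fun z => E z ^+ s * f z) _ _ w0).
  by apply: holoHM => //; exact: holoHX.
by move=> t t0; rewrite mulrA -exprS h.
Qed.

Lemma holoH_exprz f (k : int) : holoH f -> (forall z, 0 < Im z -> f z != 0) -> holoH (fun z => f z ^ k).
Proof.
move=> hf f0; case: k => k; first by apply: (@holoHX R).
apply: (@holoH_eq R (fun z => (f z ^+ k.+1)^-1)); first by move=> z _; rewrite NegzE -invr_expz.
by apply: holoHV; [exact: holoHX | move=> z z0; rewrite expf_neq0 // f0].
Qed.

Lemma tends_exprz f c (k : int) : c != 0 -> tends f c -> tends (fun z => f z ^ k) (c ^ k).
Proof.
move=> c0 tf; case: k => k; first exact: (tendsX k tf).
rewrite NegzE -invr_expz; have ck : c ^+ k.+1 != 0 by rewrite expf_neq0.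
have := tends_comp (F := fun x => x^-1) (tendsX k.+1 tf) (cdiff_cont (cdiff_inv ck)).
by apply: eq_tends => z _; rewrite -invr_expz.
Qed.

Lemma tends_det n (U : C -> 'M[C]_n) (V : 'M[C]_n) :
  (forall i j, tends (fun z => U z i j) (V i j)) -> tends (fun z => \det (U z)) (\det V).
Proof.
move=> h; have ts (I : Type) (r : seq I) (f : I -> C -> C) (c : I -> C) : (forall i, tends (f i) (c i)) ->
    tends (fun z => \sum_(i <- r) f i z) (\sum_(i <- r) c i).
  move=> hf; elim: r => [|i r ih].
    by rewrite big_nil; apply: eq_tends (@tends_cst R 0) => z _; rewrite big_nil.
  by rewrite big_cons; apply: eq_tends (tendsD (hf i) ih) => z _; rewrite big_cons.
have tp (I : Type) (r : seq I) (f : I -> C -> C) (c : I -> C) : (forall i, tends (f i) (c i)) ->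
    tends (fun z => \prod_(i <- r) f i z) (\prod_(i <- r) c i).
  move=> hf; elim: r => [|i r ih].
    by rewrite big_nil; apply: eq_tends (@tends_cst R 1) => z _; rewrite big_nil.
  by rewrite big_cons; apply: eq_tends (tendsM (hf i) ih) => z _; rewrite big_cons.
by apply: ts => s; apply: tendsZ; apply: tp => i; exact: h.
Qed.

Lemma tends_adj n (U : C -> 'M[C]_n) (V : 'M[C]_n) :
  (forall i j, tends (fun z => U z i j) (V i j)) -> forall i j, tends (fun z => (\adj (U z)) i j) ((\adj V) i j).
Proof.
move=> h i j; rewrite mxE /cofactor; apply: (@eq_tends R (fun z => (-1) ^+ (j + i) * \det (row' j (col' i (U z))))).
  by move=> z _; rewrite mxE.
by apply: tendsZ; apply: tends_det => k l; rewrite !mxE; apply: eq_tends (h _ _) => z _; rewrite !mxE.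
Qed.

Lemma holoH_adj n (U : C -> 'M[C]_n) : (forall i j, holoH (fun z => U z i j)) ->
  forall i j, holoH (fun z => (\adj (U z)) i j).
Proof.
move=> h i j; apply: (@holoH_eq R (fun z => (-1) ^+ (j + i) * \det (row' j (col' i (U z))))).
  by move=> z _; rewrite mxE.
apply: holoHZ; apply: holoH_det => k l; apply: holoH_eq (h (lift j k) (lift i l)) => z _; by rewrite !mxE.
Qed.

Lemma bounded_div f g c : bounded_inf f -> tends g c -> c != 0 ->
  (exists2 h, (forall z, 0 < Im z -> h z * g z = f z) & True) ->
  forall h, (forall z, 0 < Im z -> h z * g z = f z) -> bounded_inf h.
Proof.
move=> bf tg c0 _ h hE.
have tV := tends_comp (F := fun x => x^-1) tg (cdiff_cont (cdiff_inv c0)).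
have [K [Y hK]] := boundedM bf (tends_bounded tV).
have cn : 0 < nm c by rewrite nm_gt0.
have [Y' hY'] := tg (nm c / 2) ltac:(by rewrite divr_gt0).
exists K, (Num.max Y (Num.max Y' 0)) => z; rewrite !gt_max => /and3P[/hK h1 /hY' h2 z0].
have g0 : g z != 0.
  apply/eqP => g0; move: h2; rewrite g0 sub0r nmN; lra.
by move: h1; rewrite -hE // mulfK.
Qed.

Lemma tends_div f g c : tends f c -> tends g 1 -> forall h, (forall z, 0 < Im z -> h z * g z = f z) -> tends h c.
Proof.
move=> tf tg h hE.
have tV := tends_comp (F := fun x => x^-1) tg (cdiff_cont (cdiff_inv (oner_neq0 C))).
have := tendsM tf tV; rewrite invr1 mulr1 => t1 e e0.
have [Y hY] := t1 e e0; have [Y' hY'] := tg (1 / 2) ltac:(by lra).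
exists (Num.max Y (Num.max Y' 0)) => z; rewrite !gt_max => /and3P[/hY h1 /hY' h2 z0].
have g0 : g z != 0.
  by apply/eqP => g0; move: h2; rewrite g0 sub0r nmN nm1; lra.
by move: h1; rewrite -hE // mulfK.
Qed.
Lemma isolated_value (s : seq C) c : exists2 e : R, 0 < e & forall v, v \in s -> nm (v - c) < e -> v = c.
Proof.
elim: s => [|x s [e e0 he]]; first by exists 1.
have [xc|xc] := eqVneq x c.
  by exists e => // v; rewrite inE => /orP[/eqP -> //|]; exact: he.
exists (Num.min e (nm (x - c))) => [|v]; first by rewrite lt_min e0 nm_gt0 subr_eq0.
rewrite inE lt_min => /orP[/eqP ->|vs] /andP[h1 h2]; last exact: he.
by rewrite ltxx in h2.
Qed.

(** A continuous function with finitely many values is locally constant, so its derivative is 0. *)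
Lemma finite_valued_cst f (s : seq C) : holoH f -> (forall z, 0 < Im z -> f z \in s) ->
  forall z w, 0 < Im z -> 0 < Im w -> f z = f w.
Proof.
move=> hf fs; apply: cdiff_cst_H => z z0; have [e e0 he] := isolated_value s (f z).
have [D /cdiff_cont/(_ e e0)[d d0 hd]] := hf z z0.
apply: (@cdiff_near R (fun=> f z) f z 0 (Num.min d (Im z))); last exact: cdiff_cst.
  by rewrite lt_min d0.
move=> w; rewrite lt_min => /andP[wd wz]; apply/esym/he; last exact: hd.
by apply: fs; exact: disc_H wz.
Qed.

Lemma boundedD f g : bounded_inf f -> bounded_inf g -> bounded_inf (fun z => f z + g z).
Proof.
move=> [M [Y hM]] [N [X hN]]; exists (M + N), (Num.max Y X) => z; rewrite gt_max => /andP[/hM h1 /hN h2].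
by apply: le_trans (nmD _ _) _; exact: lerD.
Qed.

Lemma bounded_sum (I : Type) (s : seq I) (f : I -> C -> C) : (forall i, bounded_inf (f i)) ->
  bounded_inf (fun z => \sum_(i <- s) f i z).
Proof.
move=> h; elim: s => [|i s ih].
  by rewrite (_ : (fun z => _) = fun=> 0); [exact: bounded_inf_cst | apply/funext => z; rewrite big_nil].
rewrite (_ : (fun z => _) = fun z => f i z + \sum_(j <- s) f j z); first exact: boundedD.
by apply/funext => z; rewrite big_cons.
Qed.

Lemma bounded_prod (I : Type) (s : seq I) (f : I -> C -> C) : (forall i, bounded_inf (f i)) ->
  bounded_inf (fun z => \prod_(i <- s) f i z).
Proof.
move=> h; elim: s => [|i s ih].
  by rewrite (_ : (fun z => _) = fun=> 1); [exact: bounded_inf_cst | apply/funext => z; rewrite big_nil].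
rewrite (_ : (fun z => _) = fun z => f i z * \prod_(j <- s) f j z); first exact: boundedM.
by apply/funext => z; rewrite big_cons.
Qed.

Lemma bounded_eq f g : (forall z, 0 < Im z -> f z = g z) -> bounded_inf f -> bounded_inf g.
Proof.
move=> fg [M [Y hM]]; exists M, (Num.max Y 0) => z; rewrite gt_max => /andP[/hM h z0].
by rewrite -fg.
Qed.

(* For fixed x the product of x - (M F(z))_l over the finite image of the
   representation is invariant under SL2(Z), hence constant in z. *)
Lemma bounded_weight0 n (rho : SL2Z -> 'M[C]_n) (V : seq 'M[C]_n) (F : C -> 'cV[C]_n) :
  {morph rho : A B / (A * B)%g >-> A *m B} -> rho 1%g = 1%:M ->
  (forall A, rho A \in V) -> (forall M, M \in V -> exists A, M = rho A) ->
  vform rho 0 F -> (forall l, bounded_inf (fun z => F z l 0)) ->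
  forall z w, 0 < Im z -> 0 < Im w -> F z = F w.
Proof.
move=> rhoM rho1 inV Vin hF bF z w z0 w0; apply/matrixP => l k; rewrite ord1 {k}.
have MF M : bounded_inf (fun z => (M *m F z) l 0).
  apply: (@bounded_eq (fun z => \sum_j M l j * F z j 0)) => [t _|]; first by rewrite mxE.
  by apply: bounded_sum => j; apply: boundedM (bF j); exact: bounded_inf_cst.
pose V' := undup V; pose p x t := \prod_(M <- V') (x - (M *m F t) l 0).
have pinv x : mob_invariant (p x).
  move=> A t t0; rewrite /p hF.2 // expr0z scale1r.
  pose f (M : 'M[C]_n) := M *m rho A.
  have finj : injective f.
    move=> M1 M2 /(congr1 (mulmx^~ (rho A^-1%g))).
    by rewrite -!mulmxA -rhoM mulgV rho1 !mulmx1.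
  have fV : perm_eq (map f V') V'.
    apply: uniq_perm; rewrite ?undup_uniq ?map_inj_uniq ?undup_uniq // => M.
    apply/mapP/idP => [[M1 + ->]|].
      by rewrite !mem_undup => /Vin[B ->]; rewrite /f -rhoM inV.
    rewrite mem_undup => /Vin[B ->]; exists (rho (B * A^-1)%g); first by rewrite mem_undup inV.
    by rewrite /f -rhoM mulgVK.
  rewrite -[RHS](perm_big _ fV) big_map; apply: eq_bigr => M _.
  by rewrite /f mulmxA.
have pb x : bounded_inf (p x).
  apply: bounded_prod => M; apply: (@bounded_eq (fun t => x + (-1) * (M *m F t) l 0)).
    by move=> t _; rewrite mulN1r.
  by apply: boundedD; [exact: bounded_inf_cst | apply: boundedM => //; exact: bounded_inf_cst].
have ph x : holoH (p x).
  apply: holoH_prod => M _; apply: holoHB; first exact: holoH_cst.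
  exact: mulmx_holo hF.
apply: (finite_valued_cst (s := [seq (M *m F w) l 0 | M <- V']) (hF.1 l)) => // t t0.
have [Mb [Y hb]] := pb (F t l 0).
have [c hc] := weight0_const (pinv (F t l 0)) (ph _) (smallq_bounded hb).
have : p (F t l 0) w = 0.
  rewrite (hc w) // -(hc t) // /p (big_rem 1%:M) /=; first by rewrite mul1mx subrr mul0r.
  by rewrite mem_undup -rho1.
move/eqP; rewrite /p prodf_seq_eq0 => /hasP[M MV /=]; rewrite subr_eq0 => /eqP ->.
by apply/mapP; exists M.
Qed.
End Division.

(** * Determinant and inverse of Phi *)

Section Duality.
Variable R : realType.
Local Notation C := R[i].
Local Notation Re := (@complex.Re R).
Local Notation Im := (@complex.Im R).
Local Notation ofR := (real_complex R).
Local Notation J := (@autf R).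
Implicit Types (A B : SL2Z) (z w u t c : C).
Variables (n : nat) (rho : SL2Z -> 'M[C]_n).
Hypothesis rhoM : forall A B, rho (A * B)%g = rho A *m rho B.
Variables (m : 'I_n -> nat) (X : 'I_n -> C -> 'cV[C]_n) (L : 'I_n -> 'cV[C]_n).
Hypothesis tupX : tup rho m X.
Variables (Q : 'M[C]_n) (lam : 'I_n -> R).
Hypothesis uQ : Q \in unitmx.
Hypothesis lam01 : forall i, 0 < lam i <= 1.
Hypothesis leadX : forall j, leads Q lam (X j) (L j).
Hypothesis indL : indep L.
Variables (a6 a4 : 'I_n -> nat).
Hypothesis a6_le : forall l, (a6 l <= 1)%N.
Hypothesis a4_le : forall l, (a4 l <= 2)%N.
Local Notation Phi := (Phi X).
Definition has_frame (a : 'I_n -> nat) w := exists (P : 'M[C]_n) (U : C -> 'M[C]_n),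
  [/\ P \in unitmx, forall i j, holoH (fun z => U z i j),
    forall z, 0 < Im z -> P *m Phi z = diag_mx (\row_l (z - w) ^+ a l) *m U z & \det (U w) != 0].
Hypothesis frame6 : forall w, 0 < Im w -> E6 w = 0 -> has_frame a6 w.
Hypothesis frame4 : forall w, 0 < Im w -> E4 w = 0 -> has_frame a4 w.
Hypothesis generic : forall w, 0 < Im w -> E4 w != 0 -> E6 w != 0 -> \det (Phi w) != 0.
Local Notation s6 := (\sum_l a6 l)%N.
Local Notation s4 := (\sum_l a4 l)%N.

Lemma E46 w : 0 < Im w -> E4 w = 0 -> E6 w != 0.
Proof.
move=> w0 Ew; have [B Bw] := E4_zero w0 Ew.
by rewrite -(wform_orbit B (@E6_wform R) w0) Bw E6_zeta.
Qed.

Lemma hPhi i j : holoH (fun z => Phi z i j). Proof. exact: (Phi_holo tupX). Qed.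
Lemma hD : holoH (fun z => \det (Phi z)). Proof. by apply: holoH_det => i j; exact: hPhi. Qed.

Lemma det_pow (a : 'I_n -> nat) (x : C) : \det (diag_mx (\row_l x ^+ a l) : 'M[C]_n) = x ^+ (\sum_l a l)%N.
Proof. by rewrite det_diag -prodrXr; apply: eq_bigr => l _; rewrite mxE. Qed.

Lemma frame_det a w P U : (forall z, 0 < Im z -> P *m Phi z = diag_mx (\row_l (z - w) ^+ a l) *m U z) ->
  forall z, 0 < Im z -> \det (Phi z) * \det P = (z - w) ^+ (\sum_l a l)%N * \det (U z).
Proof. by move=> h z z0; rewrite mulrC -det_mulmx h // det_mulmx det_pow. Qed.

(* The cofactor identity adj(U) D' P Phi = (z-w)^k det U, with D D' = (z-w)^k. *)
Lemma frame_adj a (k : nat) w P U : (forall l, (a l <= k)%N) ->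
  (forall z, 0 < Im z -> P *m Phi z = diag_mx (\row_l (z - w) ^+ a l) *m U z) ->
  forall z i l, 0 < Im z -> (z - w) ^+ k * (\adj (Phi z)) i l * (\det P * \det (U z)) =
    (z - w) ^+ (\sum_l a l)%N * (\det (U z) * (\adj (U z) *m (diag_mx (\row_l (z - w) ^+ (k - a l)) *m P)) i l).
Proof.
move=> ak PU z i l z0.
pose D' : 'M[C]_n := diag_mx (\row_l (z - w) ^+ (k - a l)).
have DP : D' *m P *m Phi z = (z - w) ^+ k *: U z.
  rewrite -mulmxA PU // mulmxA mulmx_diag; apply/matrixP => j j'; rewrite mul_diag_mx [LHS]mxE [RHS]mxE.
  by rewrite !mxE -exprD subnK.
have h1 : \adj (U z) *m (D' *m P) *m Phi z = ((z - w) ^+ k * \det (U z))%:M.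
  by rewrite -mulmxA DP -scalemxAr mul_adj_mx scale_scalar_mx.
have h2 : \det (Phi z) *: (\adj (U z) *m (D' *m P)) = ((z - w) ^+ k * \det (U z)) *: \adj (Phi z).
  by rewrite -[RHS]mul_scalar_mx -h1 -[RHS]mulmxA mul_mx_adj mul_mx_scalar.
have h3 := congr1 (fun M : 'M[C]_n => M i l) h2; rewrite [LHS]mxE [RHS]mxE in h3.
have d := frame_det PU z0; rewrite -/D' [RHS]mulrA -d.
have alg (x y u p t b : C) : x * y = t * u * b -> t * b * (p * u) = x * p * y.
  by move=> h; transitivity (p * (x * y)); [rewrite h |]; ring.
exact: alg h3.
Qed.

Lemma E4s : simple_zeros (@E4 R). Proof. by move=> w; exact: E4_simple. Qed.
Lemma E6s : simple_zeros (@E6 R). Proof. by move=> w; exact: E6_simple. Qed.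

(** The frames give the order of det Phi at the elliptic points, and [generic] its nonvanishing
    elsewhere; so the cofactor q has no zero in the half-plane. *)
Lemma det_factor : exists q : C -> C, [/\ holoH q, forall z, 0 < Im z -> q z != 0 &
  forall z, 0 < Im z -> \det (Phi z) = E6 z ^+ s6 * (E4 z ^+ s4 * q z)].
Proof.
have [w w0 Ew|d1 hd1 D1] := divide_E (@E6_holo R) E6s hD (s := s6).
  have [P [U [uP hU PU dU]]] := frame6 w0 Ew.
  exists (fun=> \det P), (fun z => \det (U z)); split=> //; first exact: holoH_cst.
  - exact: holoH_det.
  - exact: frame_det PU.
have [w w0 Ew|q hq D2] := divide_E (@E4_holo R) E4s hd1 (s := s4).
  have [P [U [uP hU PU dU]]] := frame4 w0 Ew.
  exists (fun z => \det P * E6 z ^+ s6), (fun z => \det (U z)); split=> //.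
  - by apply: holoHZ; apply: holoHX; exact: E6_holo.
  - exact: holoH_det.
  - by rewrite mulf_neq0 ?expf_neq0 ?E46 // -unitfE -unitmxE.
  - by move=> z z0; rewrite -(frame_det PU z0) D1 //; ring.
exists q; split=> // [w w0|z z0]; last by rewrite D1 // D2.
have [E4w|E4w] := eqVneq (E4 w) 0.
  have [P [U [uP hU PU dU]]] := frame4 w0 E4w.
  apply: (divide_value (u := fun z => \det P * E6 z ^+ s6) (h := fun z => \det (U z)) (@E4_holo R) hq _ _ w0 E4w D2) => //.
  - by apply: holoHZ; apply: holoHX; exact: E6_holo.
  - exact: holoH_det.
  - by move=> z z0; rewrite -(frame_det PU z0) D1 //; ring.
have [E6w|E6w] := eqVneq (E6 w) 0.
  have [P [U [uP hU PU dU]]] := frame6 w0 E6w.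
  have : d1 w != 0.
    apply: (divide_value (u := fun=> \det P) (h := fun z => \det (U z)) (@E6_holo R) hd1 _ _ w0 E6w D1) => //.
    + exact: holoH_cst.
    + exact: holoH_det.
    + exact: frame_det PU.
  by rewrite D2 // mulf_eq0 negb_or => /andP[].
by have := generic w0 E4w E6w; rewrite D1 // D2 // !mulf_eq0 !negb_or => /and3P[].
Qed.

(** Identities may be checked after multiplication by det Phi, as in a field of meromorphic
    functions. *)
Lemma det_cancel f q : holoH f -> (forall z, 0 < Im z -> q z != 0) ->
  (forall z, 0 < Im z -> E6 z ^+ s6 * (E4 z ^+ s4 * q z) * f z = 0) -> forall z, 0 < Im z -> f z = 0.
Proof.
move=> hf q0 h; apply: (simple_cancelX (s := s4) (@E4_holo R) E4s hf).
apply: (simple_cancelX (s := s6) (@E6_holo R) E6s); first by apply: holoHM => //; apply: holoHX; exact: E4_holo.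
move=> z z0; apply: (mulIf (q0 z z0)); rewrite mul0r -[RHS](h z z0); ring.
Qed.

Lemma Phi_mob A z : 0 < Im z ->
  Phi (mob A z) = rho A *m Phi z *m diag_mx (\row_j J A z ^ (2 + 12 * (m j)%:Z)).
Proof.
move=> z0; apply/matrixP => i j; have [[_ h] _] := tupX j.
rewrite mul_mx_diag [LHS]mxE [RHS]mxE h // mxE [X in _ = _ * X]mxE mulrC; congr (_ * _).
by rewrite !mxE; apply: eq_bigr => l _; rewrite mxE.
Qed.

Definition Hm z : 'M[C]_n := \matrix_(i, j) hco Q lam (X j) i z.
Definition Lm : 'M[C]_n := \matrix_(i, j) L j i 0.

Lemma Hm_tends i j : tends (fun z => Hm z i j) (Lm i j).
Proof. by rewrite mxE; apply: eq_tends (leadX j i) => z _; rewrite mxE. Qed.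

Lemma Lm_det : \det Lm != 0.
Proof. by rewrite -unitfE -unitmxE; exact: indep_unit. Qed.

Lemma QPhi z : Q *m Phi z = diag_mx (\row_i ee (ofR (lam i) * z)) *m Hm z.
Proof.
apply/matrixP => i j; rewrite mul_diag_mx [RHS]mxE [X in _ = X * _]mxE [Hm z i j]mxE mulrC -hcoE.
by rewrite !mxE; apply: eq_bigr => l _; rewrite mxE.
Qed.

Variable Ng : nat.
Hypothesis Ng0 : (0 < Ng)%N.
Hypothesis det_rho : forall A, \det (rho A) ^+ Ng = 1.

Lemma weight_identity : (\sum_j (2 + 12 * (m j)%:R)) - 6 * s6%:R - 4 * s4%:R = 12 * \sum_i lam i.
Proof.
have [q [hq q0 Dq]] := det_factor.
(* W is the weight of det Phi, and K that of q after the factors E6 and E4 are removed. *)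
pose W := (\sum_j (2 + 12 * m j))%N; pose K : int := W%:Z - 6%:Z * s6%:Z - 4%:Z * s4%:Z.
have qA A z : 0 < Im z -> q (mob A z) = J A z ^ K * \det (rho A) * q z.
  move: z; suff : forall z, 0 < Im z -> q (mob A z) - J A z ^ K * \det (rho A) * q z = 0.
    by move=> h z z0; apply/subr0_eq/h.
  apply: (det_cancel (q := q)) => //.
    apply: holoHB; first exact: holoH_comp_mob.
    by apply: holoHM => //; apply: holoHM; [exact: holoH_Jexp | exact: holoH_cst].
  move=> z z0; have jz := J_neq0 A z0.
  have := congr1 determinant (Phi_mob A z0); rewrite !det_mulmx !Dq ?mob_gt0 //.
  have -> : \det (diag_mx (\row_j J A z ^ (2 + 12 * (m j)%:Z)) : 'M[C]_n) = J A z ^+ W.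
    rewrite det_diag -prodrXr; apply: eq_bigr => j _; rewrite mxE.
    by have -> : 2 + 12 * (m j)%:Z = (2 + 12 * m j)%N by lia.
  rewrite E6_wform // E4_wform // -!exprnP => h.
  have WK : J A z ^+ W = J A z ^ K * (J A z ^+ 6) ^+ s6 * (J A z ^+ 4) ^+ s4.
    rewrite -!exprM !exprnP -!expfzDr //; congr (_ ^ _); rewrite /K !PoszM; ring.
  have jn : (J A z ^+ 6) ^+ s6 * (J A z ^+ 4) ^+ s4 != 0 by rewrite mulf_neq0 ?expf_neq0.
  apply: (mulfI jn); rewrite mulr0.
  have -> : forall a b c d x y r k : C, a * b * (c * (d * x) * (r - k * y * x)) =
     (a * c) * (b * d * r) * x - y * (c * (d * x)) * (k * a * b) * x by move=> *; ring.
  rewrite -WK -!exprMn -h; ring.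
(* The power N kills the character det rho, and the power of Delta brings the weight K N to 0: r is
   invariant and without zeros. *)
pose N := (12 * Ng)%N.
pose r z := q z ^+ N * Delta z ^ (- (K * Ng%:Z)).
have r0 z : 0 < Im z -> r z != 0.
  by move=> z0; rewrite mulf_neq0 ?expf_neq0 ?q0 // expfz_neq0 // Delta_neq0.
have hr : holoH r.
  apply: holoHM; first exact: holoHX.
  by apply: holoH_exprz; [exact: Delta_holo | exact: Delta_neq0].
have ri : mob_invariant r.
  move=> A z z0; have jz := J_neq0 A z0.
  have e1 : (J A z ^ K) ^+ N * (J A z ^ 12) ^ (- (K * Ng%:Z)) = 1.
    rewrite exprnP !exprz_exp -expfzDr // (_ : K * N%:Z + 12 * - (K * Ng%:Z) = 0) ?expr0z //.
    by rewrite /N PoszM; ring.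
  have e2 : \det (rho A) ^+ N = 1 by rewrite /N mulnC exprM det_rho expr1n.
  have alg (a d x b y : C) (k : int) : a ^+ N * b ^ k = 1 -> d ^+ N = 1 ->
      (a * d * x) ^+ N * (b * y) ^ k = x ^+ N * y ^ k.
    by move=> h1 h2; rewrite !exprMn expfzMl h2 mulr1 mulrACA h1 mul1r.
  by rewrite /r (qA A z z0) (Delta_wform A z0); exact: alg.
have [dlt dlt0 tdlt] := Delta_tends R.
pose Lam := \sum_i lam i.
have tq : exists2 c, c != 0 & tends (fun z => q z * ee (- (ofR Lam * z))) c.
  have dQ : \det Q != 0 by rewrite -unitfE -unitmxE.
  exists ((\det Q)^-1 * \det Lm); first by rewrite mulf_neq0 ?Lm_det // invr_eq0.
  have tE : tends (fun z => E6 z ^+ s6 * E4 z ^+ s4) 1.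
    by have := tendsM (tendsX s6 (@E6_tends R)) (tendsX s4 (@E4_tends R)); rewrite !expr1n mulr1.
  have tl := tendsZ (\det Q)^-1 (tends_det Hm_tends).
  apply: (tends_div tl tE) => z z0.
  have := congr1 determinant (QPhi z); rewrite !det_mulmx Dq // det_diag.
  have -> : \prod_i (\row_i0 ee (ofR (lam i0) * z)) 0 i = ee (ofR Lam * z).
    rewrite /Lam rmorph_sum mulr_suml; under eq_bigr do rewrite mxE.
    by elim/big_rec2: _ => [|i x y _ ->]; rewrite ?ee0 ?eeD.
  rewrite eeN => h; have e0 := ee_neq0 (ofR Lam * z).
  apply: (mulfI dQ); rewrite mulVKf //; apply: (mulfI e0); rewrite -h; field.
  by rewrite e0.
have [c c0 tc] := tq.
(* The order of r at the cusp. If it were positive r would vanish identically, if negative 1 / r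
   would; nu = 0 is the claim times Ng. *)
pose nu : R := Lam * N%:R - (K * Ng%:Z)%:~R.
have tr : exists2 c', c' != 0 & tends (fun z => r z * ee (- (ofR nu * z))) c'.
  exists (c ^+ N * dlt ^ (- (K * Ng%:Z))); first by rewrite mulf_neq0 ?expf_neq0 ?expfz_neq0.
  apply: eq_tends (tendsM (tendsX N tc) (tends_exprz (- (K * Ng%:Z)) dlt0 tdlt)) => z z0.
  rewrite exprMn expfzMl mulrACA /r; congr (_ * _).
  have eez (k : int) : ee z ^ k = ee (k%:~R * z).
    case: k => k; first by rewrite -exprnP eeX mulr_natl.
    by rewrite NegzE -invr_expz -exprnP eeX rmorphN mulNr eeN mulr_natl.
  rewrite exprz_inv opprK eez eeX -eeD; congr ee.
  have oN : ofR (N%:R : R) = N%:R := rmorph_nat _ _.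
  have oK : ofR ((K * Ng%:Z)%:~R : R) = (K * Ng%:Z)%:~R := rmorph_int _ _.
  have onu : ofR nu = ofR Lam * N%:R - (K * Ng%:Z)%:~R by rewrite -oN -oK -rmorphM -rmorphB.
  by rewrite onu -mulr_natl; ring.
have vnu (x : R) : 0 < x -> vanish (fun z : C => ee (ofR x * z)).
  move=> x0 e e0; have [Y hY] := nm_ee_small e0.
  exists (Y / x) => z hz; apply: ltW.
  have -> : nm (ee (ofR x * z)) = nm (ee (pt 0 (x * Im z))).
    by rewrite nm_ee_lam nm_ee /=; congr expR; ring.
  by apply: hY => /=; rewrite mulrC -ltr_pdivrMr.
have nu0 : nu = 0.
  have [c' c'0 tr'] := tr; have [nu1|nu1|//] := ltgtP nu 0.
    pose rV z := (r z)^-1.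
    have : rV 'i%C = 0; last by move/eqP; rewrite invr_eq0 (negPf (r0 _ _)) // i_gt0.
    apply: (@weight0_zero R rV) (@i_gt0 R); first by move=> A z z0; rewrite /rV ri.
      exact: holoHV.
    have tV := tends_comp (F := fun x => x^-1) tr' (cdiff_cont (cdiff_inv c'0)).
    apply: eq_vanish (vanishM (vnu (- nu) ltac:(by rewrite oppr_gt0)) (tends_bounded tV)) => z z0.
    by rewrite invfM mulrCA rmorphN mulNr mulfV ?mulr1 // ee_neq0.
  have : r 'i%C = 0; last by move/eqP; rewrite (negPf (r0 _ _)) // i_gt0.
  apply: (@weight0_zero R r) (@i_gt0 R) => //.
  apply: eq_vanish (vanishM (vnu nu nu1) (tends_bounded tr')) => z z0.
  by rewrite mulrCA eeN mulfV ?mulr1 // ee_neq0.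
have KE : (K%:~R : R) = \sum_j (2 + 12 * (m j)%:R) - 6 * s6%:R - 4 * s4%:R.
  have -> : \sum_j (2 + 12 * (m j)%:R) = W%:R :> R.
    by rewrite /W natr_sum; apply: eq_bigr => j _; rewrite natrD natrM.
  by rewrite /K !rmorphB !rmorphM.
rewrite -KE; have NgR : (Ng%:R : R) != 0 by rewrite pnatr_eq0 -lt0n.
move: nu0; rewrite /nu /N natrM rmorphM /= -pmulrn -/Lam => h.
have {}h : Lam * (12 * Ng%:R) = K%:~R * Ng%:R by apply: subr0_eq.
by apply: (mulIf NgR); rewrite -h -/Lam; ring.
Qed.
(** Phi^-1 has poles of order at most 1 at the zeros of E6 and 2 at those of E4, because a6 <= 1 and
    a4 <= 2; the factor E4^2 E6 clears them. *)
Lemma adj_factor i l : exists2 y : C -> C, holoH y & forall z, 0 < Im z ->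
  E4 z ^+ 2 * E6 z * (\adj (Phi z)) i l = E6 z ^+ s6 * (E4 z ^+ s4 * y z).
Proof.
have hA : holoH (fun z => (\adj (Phi z)) i l) by apply: holoH_adj => *; exact: hPhi.
have hfr (a : 'I_n -> nat) (k : nat) w (P : 'M[C]_n) (U : C -> 'M[C]_n) : (forall i j, holoH (fun z => U z i j)) ->
    holoH (fun z => \det (U z) * (\adj (U z) *m (diag_mx (\row_l (z - w) ^+ (k - a l)) *m P)) i l).
  move=> hU; apply: holoHM; first exact: holoH_det.
  apply: (@holoH_eq R (fun z => \sum_j (\adj (U z)) i j * ((z - w) ^+ (k - a j) * P j l))).
    by move=> z _; rewrite mxE; apply: eq_bigr => j _; rewrite mul_diag_mx !mxE.
  apply: holoH_sum => j _; apply: holoHM; first exact: holoH_adj.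
  by apply: holoHM; [apply: holoHX; exact: holoH_lin | exact: holoH_cst].
have sE (E : C -> C) w z : holoH E -> 0 < Im w -> E w = 0 -> E z = (z - w) * slope E w z.
  by move=> hE w0 Ew; rewrite (slopeE z (hE w w0)) Ew add0r.
have hf1 : holoH (fun z => E6 z * (\adj (Phi z)) i l) by apply: holoHM => //; exact: E6_holo.
have [w w0 Ew|y1 hy1 Y1] := divide_E (@E6_holo R) E6s hf1 (s := s6).
- have [P [U [uP hU PU dU]]] := frame6 w0 Ew.
  exists (fun z => \det P * \det (U z)), (fun z => slope (@E6 R) w z * (\det (U z) *
    (\adj (U z) *m (diag_mx (\row_l (z - w) ^+ (1 - a6 l)) *m P)) i l)); split.
  + by apply: holoHZ; apply: holoH_det.
  + by apply: holoHM; [apply: holoH_slope => //; exact: E6_holo | exact: hfr].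
  + by rewrite mulf_neq0 // -unitfE -unitmxE.
  + move=> z z0; rewrite (sE _ w z (@E6_holo R)) // [RHS]mulrCA -(frame_adj a6_le PU) // expr1; ring.
have hf2 : holoH (fun z => E4 z ^+ 2 * y1 z) by apply: holoHM => //; apply: holoHX; exact: E4_holo.
have [w w0 Ew|y hy Y] := divide_E (@E4_holo R) E4s hf2 (s := s4).
- have [P [U [uP hU PU dU]]] := frame4 w0 Ew.
  exists (fun z => E6 z ^+ s6 * (\det P * \det (U z))), (fun z => slope (@E4 R) w z ^+ 2 * E6 z * (\det (U z) *
    (\adj (U z) *m (diag_mx (\row_l (z - w) ^+ (2 - a4 l)) *m P)) i l)); split.
  + apply: holoHM; first by apply: holoHX; exact: E6_holo.
    by apply: holoHZ; apply: holoH_det.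
  + apply: holoHM; last exact: hfr.
    apply: holoHM; last exact: E6_holo.
    by apply: holoHX; apply: holoH_slope => //; exact: E4_holo.
  + by rewrite !mulf_neq0 ?expf_neq0 ?E46 // -unitfE -unitmxE.
  + move=> z z0; rewrite mulrA -[_ * E6 z ^+ s6]mulrA [y1 z * _]mulrC -Y1 //.
    by rewrite (sE _ w z (@E4_holo R)) // exprMn [RHS]mulrCA -(frame_adj a4_le PU) //; ring.
by exists y => // z z0; rewrite -Y // -mulrA Y1 //; ring.
Qed.

Local Notation e z := (E4 z ^+ 2 * E6 z * Delta z).

Lemma dual_basis : exists Psi : C -> 'M[C]_n, (forall i j, holoH (fun z => Psi z i j)) /\
  forall z, 0 < Im z -> Psi z *m Phi z = (e z)%:M.
Proof.
have [q [hq q0 Dq]] := det_factor.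
have hy (x : 'I_n * 'I_n) : exists y : C -> C, holoH y /\ forall z, 0 < Im z ->
    E4 z ^+ 2 * E6 z * (\adj (Phi z)) x.1 x.2 = E6 z ^+ s6 * (E4 z ^+ s4 * y z).
  by have [y h1 h2] := adj_factor x.1 x.2; exists y.
have [Y hY] := choice hy.
pose Psi z : 'M[C]_n := \matrix_(i, l) (Delta z * Y (i, l) z / q z).
have hP i j : holoH (fun z => Psi z i j).
  apply: (@holoH_eq R (fun z => Delta z * Y (i, j) z / q z)); first by move=> z _; rewrite mxE.
  apply: holoHM; last exact: holoHV.
  by apply: holoHM; [exact: Delta_holo | exact: (hY _).1].
exists Psi; split=> // z z0; apply/matrixP => i k; apply/subr0_eq; move: z z0.
apply: (det_cancel (q := q)) => //.
  apply: holoHB.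
    apply: (@holoH_eq R (fun z => \sum_j Psi z i j * Phi z j k)); first by move=> z _; rewrite mxE.
    by apply: holoH_sum => j _; apply: holoHM => //; exact: hPhi.
  apply: (@holoH_eq R (fun z => (e z) * (i == k)%:R)); first by move=> z _; rewrite mxE mulr_natr.
  apply: holoHM; last exact: holoH_cst.
  apply: holoHM; last exact: Delta_holo.
  by apply: holoHM; [apply: holoHX; exact: E4_holo | exact: E6_holo].
move=> z z0; rewrite mulrBr; apply/eqP; rewrite subr_eq0; apply/eqP.
have qz := q0 z z0; rewrite mxE mulr_sumr.
transitivity (\sum_l Delta z * (E4 z ^+ 2 * E6 z * (\adj (Phi z)) i l * Phi z l k)).
  apply: eq_bigr => l _; rewrite (hY (i, l)).2 // [Psi z i l]mxE; field; exact: qz.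
transitivity (Delta z * (E4 z ^+ 2 * E6 z * \sum_l (\adj (Phi z)) i l * Phi z l k)).
  by rewrite !mulr_sumr; apply: eq_bigr => l _; ring.
have := congr1 (fun M : 'M[C]_n => M i k) (mul_adj_mx (Phi z)).
rewrite mxE => ->; rewrite -Dq // !mxE; case: (i == k) => /=; rewrite ?mulr1n ?mulr0n; ring.
Qed.

Hypothesis rho1 : rho 1%g = 1%:M.
Variable V : seq 'M[C]_n.
Hypothesis inV : forall A, rho A \in V.
Hypothesis Vin : forall M, M \in V -> exists A, M = rho A.
Hypothesis noinv : forall v : 'rV[C]_n, (forall A, v *m rho A = v) -> v = 0.

Lemma rhoV A : rho A *m rho A^-1%g = 1%:M.
Proof. by rewrite -rhoM mulgV rho1. Qed.

Lemma e_mob A z : 0 < Im z -> e (mob A z) = J A z ^ 26 * e z.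
Proof.
move=> z0; have := wformM (wformM (wformX 2 (@E4_wform R)) (@E6_wform R)) (@Delta_wform R) A z0.
by have -> : 4%:Z * 2%:Z + 6%:Z + 12 = 26 by [].
Qed.

Lemma e_2i : e (pt 0 2) != 0 :> C.
Proof.
have w0 : 0 < Im (pt 0 2 : C) by rewrite /=.
have stab (B : SL2Z) (x : C) : 0 < Im x -> mob B (pt 0 2) = x -> forall g : SL2Z, mob g x = x -> g \in pm1.
  move=> x0 Bw g gx; have h : mob (B^-1 * (g * B))%g (pt 0 2 : C) = pt 0 2.
    by rewrite !mobM ?mob_gt0 // Bw gx -Bw mobK.
  by have := pm1_conj B^-1%g (stab_2i h); rewrite conjgE invgK !mulgA mulgV mul1g mulgK.
have h4 : E4 (pt 0 2) != 0 :> C.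
  apply/eqP => Ew; have [B Bw] := E4_zero w0 Ew; have := stab B _ (@zeta_gt0 R) Bw matR (@mob_R_zeta R).
  by case/pm1_valE => b /(congr1 (fun M : 'M[int]_2 => M 1 0)); rewrite /= mulmx2E !mxE /=; case: b.
have h6 : E6 (pt 0 2) != 0 :> C.
  apply/eqP => Ew; have [B Bw] := E6_zero w0 Ew; have := stab B _ (@i_gt0 R) Bw matS (@mob_S_i R).
  by case/pm1_valE => b /(congr1 (fun M : 'M[int]_2 => M 1 0)); rewrite /= !mxE /=; case: b.
by apply: mulf_neq0; [apply: mulf_neq0 => //; exact: expf_neq0 | exact: Delta_neq0].
Qed.

Lemma weight_le1 i : (m i <= 1)%N.
Proof.
rewrite leqNgt; apply/negP => mi.
have [Psi [hPsi PsiPhi]] := dual_basis.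
have [q [hq q0 Dq]] := det_factor.
(* Checked after multiplication by Phi, where E4^2 E6 Delta of weight 26 appears; 26 - (2 + 12 m j)
   = 24 - 12 m j. *)
have PsiA A z : 0 < Im z -> Psi (mob A z) *m rho A =
    diag_mx (\row_j J A z ^ (24 - 12 * (m j)%:Z)) *m Psi z.
  move=> z0; apply/matrixP => k l; apply/subr0_eq; move: z z0.
  pose M z := Psi (mob A z) *m rho A - diag_mx (\row_j J A z ^ (24 - 12 * (m j)%:Z)) *m Psi z.
  have hM k' l' : holoH (fun z => M z k' l').
    apply: (@holoH_eq R (fun z => \sum_j Psi (mob A z) k' j * rho A j l' - J A z ^ (24 - 12 * (m k')%:Z) * Psi z k' l')).
      by move=> z _; rewrite /M mul_diag_mx !mxE.
    apply: holoHB; last by apply: holoHM => //; exact: holoH_Jexp.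
    apply: holoH_sum => j _; apply: (@holoHM R (fun z => Psi (mob A z) k' j)); last exact: holoH_cst.
    exact: (@holoH_comp_mob R (fun z => Psi z k' j) A).
  suff h z : 0 < Im z -> \det (Phi z) *: M z = 0.
    apply: (@det_cancel _ q) => [||z z0] //.
      by apply: holoH_eq (hM k l) => z _; rewrite /M !mxE.
    rewrite -Dq //; have := congr1 (fun X : 'M[C]_n => X k l) (h z z0).
    by rewrite /M !mxE.
  move=> z0; have jz := J_neq0 A z0.
  have MP : M z *m Phi z = 0.
    rewrite /M mulmxBl -!mulmxA PsiPhi //.
    have := Phi_mob A z0; set dJ := diag_mx _ => h.
    have udJ : dJ *m diag_mx (\row_j J A z ^ (- (2 + 12 * (m j)%:Z))) = 1%:M.
      rewrite mulmx_diag; apply/matrixP => a b; rewrite !mxE; case: (a == b) => //=.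
      by rewrite !mulr1n -expfzDr // subrr expr0z.
    rewrite -[rho A *m Phi z]mulmx1 -udJ [rho A *m Phi z *m _]mulmxA -h.
    rewrite [Psi (mob A z) *m _]mulmxA PsiPhi ?mob_gt0 //.
    rewrite e_mob // mul_scalar_mx mul_mx_scalar; apply/matrixP => a b; rewrite !mxE.
    case: (a == b); rewrite ?mulr0n ?mulr0 ?subr0 // !mulr1n mulrAC -expfzDr //.
    by apply/eqP; rewrite subr_eq0 mulrC; apply/eqP; congr (_ * J A z ^ _); ring.
  by rewrite -mul_mx_scalar -mul_mx_adj mulmxA MP mul0mx.
(* For m i >= 2 this power of Delta brings row i, of weight 24 - 12 m i, to weight 0. *)
pose F z : 'cV[C]_n := Delta z ^+ (m i - 2) *: (row i (Psi z))^T.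
pose rho' A := (rho A^-1%g)^T.
have rho'M : {morph rho' : A B / (A * B)%g >-> A *m B}.
  by move=> A B; rewrite /rho' invMg rhoM trmx_mul.
have rho'1 : rho' 1%g = 1%:M by rewrite /rho' invg1 rho1 trmx1.
have FE z l : F z l 0 = Delta z ^+ (m i - 2) * Psi z i l by rewrite !mxE.
have hF : vform rho' 0 F.
  split=> [l|A z z0].
    apply: (@holoH_eq R (fun z => Delta z ^+ (m i - 2) * Psi z i l)); first by move=> z _; rewrite FE.
    by apply: holoHM => //; apply: holoHX; exact: Delta_holo.
  have jz := J_neq0 A z0.
  have h : row i (Psi (mob A z)) = J A z ^ (24 - 12 * (m i)%:Z) *: (row i (Psi z) *m rho A^-1%g).
    have -> : Psi (mob A z) = diag_mx (\row_j J A z ^ (24 - 12 * (m j)%:Z)) *m Psi z *m rho A^-1%g.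
      by rewrite -PsiA // -mulmxA rhoV mulmx1.
    rewrite !row_mul scalemxAl; congr (_ *m _); apply/matrixP => a b.
    by rewrite -row_mul mul_diag_mx !mxE.
  rewrite /F Delta_wform // h expr0z scale1r -scalemxAr /rho' -trmx_mul linearZ /= scalerA; congr (_ *: _).
  rewrite exprMn (exprnP (J A z ^ 12)) exprz_exp mulrAC -expfzDr //.
  have -> : 12 * (m i - 2)%N%:Z + (24 - 12 * (m i)%:Z) = 0 by rewrite -subzn //; ring.
  by rewrite expr0z mul1r.
(* Boundedness at the cusp: inverting the factors q^lam of Q Phi is compensated by the q of Delta,
   as 1 - lam >= 0. *)
pose Y z := Psi z *m invmx Q.
have YE z : 0 < Im z -> Y z *m diag_mx (\row_j ee (ofR (lam j) * z)) *m Hm z = (e z)%:M.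
  by move=> z0; rewrite -mulmxA -QPhi /Y -mulmxA mulKmx // PsiPhi.
have Yl a l z : 0 < Im z -> Y z a l * \det (Hm z) =
    (E4 z ^+ 2 * E6 z * (Delta z / ee z)) * ee (ofR (1 - lam l) * z) * (\adj (Hm z)) a l.
  move=> z0; have := congr1 (fun M => (M *m \adj (Hm z)) a l) (YE z z0) => /=.
  rewrite -(mulmxA _ (Hm z)) mul_mx_adj mul_mx_scalar mul_scalar_mx mul_mx_diag => h0.
  have {h0} h : \det (Hm z) * (Y z a l * ee (ofR (lam l) * z)) = e z * (\adj (Hm z)) a l.
    by move: h0; rewrite [LHS]mxE [RHS]mxE [X in _ * X]mxE [X in _ * (_ * X)]mxE.
  have e1 := ee_neq0 (ofR (lam l) * z); have e2 := ee_neq0 z.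
  have -> : ee (ofR (1 - lam l) * z) = ee z / ee (ofR (lam l) * z).
    by rewrite -eeN -eeD rmorphB rmorph1; congr ee; ring.
  apply: (mulfI e1); transitivity (\det (Hm z) * (Y z a l * ee (ofR (lam l) * z))); first by ring.
  rewrite h; field.
  by rewrite e1 e2.
have bad : forall a l, bounded_inf (fun z => (\adj (Hm z)) a l).
  by move=> a l; apply: tends_bounded (tends_adj Hm_tends a l).
have blam l : bounded_inf (fun z : C => ee (ofR (1 - lam l) * z)).
  exists 1, 0 => z z0; rewrite nm_ee_lam -[X in _ <= X]expR0 ler_expR oppr_le0.
  by rewrite !mulr_ge0 ?(ltW z0) ?pi_ge0 // subr_ge0; have /andP[] := lam01 l.
have [dlt _ td] := Delta_tends R.
have bE : bounded_inf (fun z : C => E4 z ^+ 2 * E6 z * (Delta z / ee z)).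
  apply: boundedM (tends_bounded td).
  exact: tends_bounded (tendsM (tendsX 2 (@E4_tends R)) (@E6_tends R)).
have bY a l : bounded_inf (fun z => Y z a l).
  have bb := boundedM (boundedM bE (blam l)) (bad a l).
  apply: (bounded_div (f := fun z => Y z a l * \det (Hm z)) _ (tends_det Hm_tends) Lm_det _) => //.
    by apply: bounded_eq bb => z z0; rewrite Yl.
  by exists (fun z => Y z a l).
have bPsi l : bounded_inf (fun z => Psi z i l).
  apply: (@bounded_eq R (fun z => \sum_j Y z i j * Q j l)).
    move=> z z0; have -> : Psi z = Y z *m Q by rewrite /Y mulmxKV.
    by rewrite [RHS]mxE.
  by apply: bounded_sum => j; apply: boundedM (bY i j) (bounded_inf_cst _).
have bF l : bounded_inf (fun z => F z l 0).
  apply: (@bounded_eq R (fun z => Delta z ^+ (m i - 2) * Psi z i l)) => [z _|]; first by rewrite FE.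
  apply: boundedM (bPsi l); have [M [Z hb]] := boundedM (tends_bounded td) (@ee_bounded R 1).
  have : bounded_inf (fun z : C => Delta z).
    by exists M, Z => z /hb; rewrite expr1 divfK // ee_neq0.
  elim: (m i - 2)%N => [|p ih] bD; first exact: (bounded_inf_cst 1).
  by apply: bounded_eq (boundedM bD (ih bD)) => z _; rewrite exprS.
have Fc := @bounded_weight0 R n rho' [seq M^T | M <- V] F rho'M rho'1 _ _ hF bF.
have w0 : 0 < Im (pt 0 2 : C) by rewrite /=.
(* A constant form of weight 0 for the dual representation is an invariant row vector. *)
have F0 : F (pt 0 2) = 0.
  apply: trmx_inj; rewrite trmx0; apply: noinv => A; apply: trmx_inj; rewrite trmx_mul trmxK.
  have := hF.2 A^-1%g _ w0; rewrite expr0z scale1r /rho' invgK => <-.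
  apply: Fc; rewrite ?mob_gt0 //.
  - by move=> B; apply: map_f.
  - by move=> M /mapP[M' /Vin[B ->] ->]; exists B^-1%g; rewrite /rho' invgK.
have : (Psi (pt 0 2) *m Phi (pt 0 2)) i i = 0.
  rewrite mxE big1 // => l _; have := congr1 (fun c : 'cV[C]_n => c l 0) F0; rewrite FE [RHS]mxE.
  by move/eqP; rewrite mulf_eq0 expf_eq0 (negPf (Delta_neq0 w0)) andbF => /eqP ->; rewrite mul0r.
by rewrite PsiPhi // mxE eqxx mulr1n => /eqP; rewrite (negPf e_2i).
Qed.
End Duality.

(** * Dimension of the space of vector-valued cusp forms *)

Section Counting.
Variable R : realType.
Local Notation C := R[i].
Local Notation Im := (@complex.Im R).
Local Notation ofR := (real_complex R).
Local Notation J := (@autf R).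
Implicit Types (A B : SL2Z) (z w u t c : C).
Variables (n : nat) (rho : SL2Z -> 'M[C]_n).
Hypothesis rhoM : {morph rho : A B / (A * B)%g >-> A *m B}.
Hypothesis rho1 : rho 1%g = 1%:M.
Hypothesis rho_pm1 : forall A, A \in pm1 -> rho A = 1%:M.
Variable V : seq 'M[C]_n.
Hypothesis inV : forall A, rho A \in V.
Hypothesis Vin : forall M, M \in V -> exists A, M = rho A.
Variable e : nat.
Hypotheses (e0 : (0 < e)%N) (rho_e : rho (mT e%:Z) = 1%:M).
Variables (Q : 'M[C]_n) (lam : 'I_n -> R).
Hypothesis uQ : Q \in unitmx.
Hypothesis lam01 : forall i, 0 < lam i <= 1.
Hypothesis QT : Q *m rho matT = diag_mx (\row_i ee (ofR (lam i))) *m Q.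

Definition cusp2 (F : C -> 'cV[C]_n) := vform rho 2 F /\ cuspv F.
Definition cusp2_basis d (F : 'I_d -> C -> 'cV[C]_n) := [/\ forall j, cusp2 (F j),
  forall G, cusp2 G -> exists c : 'I_d -> C, forall z, 0 < Im z -> G z = \sum_j c j *: F j z &
  forall c : 'I_d -> C, (forall z, 0 < Im z -> \sum_j c j *: F j z = 0) -> forall j, c j = 0].

Lemma entries_bounded : exists M : R, forall A i j, nm (rho A i j) <= M.
Proof.
exists (\sum_(X <- V) \sum_i \sum_j nm (X i j)) => A i j.
rewrite (big_rem (rho A)) //= (bigD1 i) //= (bigD1 j) //= -!addrA lerDl.
by rewrite !addr_ge0 ?sumr_ge0 // => *; rewrite ?sumr_ge0 // => *; rewrite ?sumr_ge0 // => *; exact: nm_ge0.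
Qed.

Lemma cusp2_basis_of (m : 'I_n -> nat) (X : 'I_n -> C -> 'cV[C]_n) (L : 'I_n -> 'cV[C]_n) :
  tup rho m X -> (forall j, leads Q lam (X j) (L j)) -> indep L ->
  (forall F, vform rho 2 F -> cuspv F -> exists a : 'I_n -> C,
       (forall j, a j != 0 -> m j = 0%N) /\ forall z, 0 < Im z -> F z = \sum_j a j *: X j z) ->
  exists F : 'I_#|[pred j | m j == 0%N]| -> C -> 'cV[C]_n, cusp2_basis F.
Proof.
move=> tX lX iL gX; exists (fun j => X (enum_val j)).
have sumE (a : 'I_n -> C) z : (forall j, a j != 0 -> m j = 0%N) ->
    \sum_j a j *: X j z = \sum_(j < #|[pred j | m j == 0%N]|) a (enum_val j) *: X (enum_val j) z.
  move=> ha; rewrite -(big_enum_val (A := [pred j | m j == 0%N]) (fun j => a j *: X j z)) /= [RHS]big_mkcond /=.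
  by apply: eq_bigr => j _; rewrite inE; case: eqP => // /eqP mj; have [->|/ha /eqP] := eqVneq (a j) 0; rewrite ?scale0r // (negPf mj).
split=> [j|G [vG cG]|c hc j].
- have /eqP mj : m (enum_val j) == 0%N by have := enum_valP j; rewrite inE.
  by have [h1 h2] := tX (enum_val j); split=> //; move: h1; rewrite mj mulr0 addr0.
- have [a [ha aE]] := gX G vG cG; exists (fun j => a (enum_val j)) => z z0.
  by rewrite aE // sumE.
pose a i : C := \sum_(k | enum_val k == i) c k.
have aE k : a (enum_val k) = c k.
  by rewrite /a (big_pred1 k) // => l; rewrite /= (inj_eq enum_val_inj).
have a0 i : a i != 0 -> m i = 0%N.
  rewrite /a => ai; apply/eqP/contraT => mi; move: ai; rewrite big_pred0 ?eqxx // => k.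
  by apply/negP => /eqP ki; have := enum_valP k; rewrite ki inE (negPf mi).
rewrite -aE; apply: iL; apply/colP => i; rewrite [RHS]mxE.
have lS := leads_sum (index_enum _) (fun l => leadsM (tends_cst (a l)) (lX l)).
apply: tends_unique (lS i) _; apply: eq_tends (@tends_cst R 0) => z z0.
rewrite /hco sumE //; under eq_bigr => k _ do rewrite aE.
by rewrite hc // mulmx0 mxE mul0r.
Qed.

Section Stabilizer.
Variables (w : C) (w0 : 0 < Im w) (g : SL2Z) (b : int) (v : 'cV[C]_n).
Hypothesis gv : rho g *m v = J g w ^ (2 * b) *: v.

Lemma stab_pm1 A : A \in pm1 -> rho A *m v = J A w ^ (2 * b) *: v.
Proof. by move=> A1; rewrite rho_pm1 // mul1mx -exprz_exp -exprnP pm1_J // exp1rz scale1r. Qed.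

Lemma stab_cancel A : mob A w = w -> rho (g * A)%g *m v = J (g * A)%g w ^ (2 * b) *: v ->
  rho A *m v = J A w ^ (2 * b) *: v.
Proof.
move=> Aw; rewrite rhoM (JM g A w0) Aw expfzMl; move: gv (J A w ^ (2 * b)).
move: (J g w ^ (2 * b)) => x gx y; rewrite mulrC -scalerA -gx -mulmxA => h; have := congr1 (mulmx (rho g^-1%g)) h; rewrite -scalemxAr !mulmxA -rhoM mulVg rho1 mul1mx.
by rewrite mul1mx.
Qed.
End Stabilizer.

Lemma stab_conj B w z : 0 < Im w -> mob B w = z -> forall A, mob A w = w -> mob (B * A * B^-1)%g z = z.
Proof. by move=> w0 <- A Aw; rewrite !mobM ?mob_gt0 // mobK // Aw. Qed.

Lemma conj_pm1 B A : (B * A * B^-1)%g \in pm1 -> A \in pm1.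
Proof. by move/(pm1_conj B); rewrite conjgE !mulgA mulVg mul1g mulgKV. Qed.

Lemma J_conj B g w z : 0 < Im w -> mob B w = z -> mob g z = z -> J (B^-1 * g * B)%g w = J g z.
Proof.
move=> w0 Bw gz; rewrite !JM ?mob_gt0 // Bw gz mulrAC -Bw.
have : J (B^-1 * B)%g w = 1 by rewrite mulVg J1.
by rewrite JM // Bw => ->; rewrite mul1r.
Qed.

(* The eigenvalue of S is -1 or 1 according to a6 = 0, 1 (J = i at i), that of R is
   zeta^2, zeta or 1 according to a4 = 0, 1, 2 (J = zeta + 1 at zeta). *)
Variables (P6 P4 : 'M[C]_n) (a6 a4 : 'I_n -> nat).
Hypotheses (uP6 : P6 \in unitmx) (uP4 : P4 \in unitmx).
Hypothesis a6_le : forall l, (a6 l <= 1)%N.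
Hypothesis a4_le : forall l, (a4 l <= 2)%N.
Hypothesis P6S : P6 *m rho matS = diag_mx (\row_l ('i%C : C) ^ (6 * (a6 l)%:Z - 2)) *m P6.
Hypothesis P4R : P4 *m rho matR = diag_mx (\row_l (zeta R + 1) ^ (4 * (a4 l)%:Z - 2)) *m P4.

Lemma conj_diag (P D : 'M[C]_n) B g : P *m rho g = D *m P ->
  P *m rho B *m rho (B^-1 * g * B)%g = D *m (P *m rho B).
Proof.
move=> h; rewrite -mulmxA -rhoM !mulgA mulgV mul1g rhoM !mulmxA h; by [].
Qed.

Lemma rho_unit B : rho B \in unitmx.
Proof. by apply: (mulmx1_unit (B := rho B^-1%g) _).1; rewrite -rhoM mulgV rho1. Qed.

Section Frames.
Variables (m : 'I_n -> nat) (X : 'I_n -> C -> 'cV[C]_n).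
Hypothesis tupX : tup rho m X.
Hypothesis genX : forall (p : nat) F, vform rho (2 + 12 * p%:Z) F -> cuspv F ->
  exists c : 'I_n -> C -> C,
    (forall j, holoH (c j)) /\ forall z, 0 < Im z -> F z = \sum_j c j z *: X j z.

(** w lies in the orbit of i, so a conjugate of S fixes it, with the same factor J = i and the
    eigenbasis P6 rho(B). The exponents 6 b - 2 are even, so -1 acts trivially. *)
Lemma frame_E6 w : 0 < Im w -> E6 w = 0 -> has_frame X a6 w.
Proof.
move=> w0 Ew; have [B Bw] := E6_zero w0 Ew; have [M hM] := entries_bounded.
have i0 := @i_gt0 R; have mS := mob_S_i R.
pose g := (B^-1 * matS * B)%g.
have gw : mob g w = w by rewrite /g !mobM ?mob_gt0 // Bw mS -Bw mobK.
have Jg : J g w = 'i%C by rewrite /g (J_conj w0 Bw mS) J_S.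
have i4 : ('i%C : C) ^+ 4 = 1 by rewrite -[4%N]/(2 * 2)%N exprM sqr_i sqrrN expr1n.
exists (P6 *m rho B).
have [||||||U [hU PU dU]] := frame rhoM rho1 hM e0 rho_e tupX genX (P := P6 *m rho B) (a := a6) (r := 2) w0 gw
  (@E6_wform R) (@E6_holo R) (@E6_tends R) Ew (E6_simple w0 Ew).
- move=> b v; have -> : 6%:Z * b%:Z - 2 = 2 * (3 * b%:Z - 1) by ring.
  move=> gv A Aw; have [A1|A1] := stab_i (stab_conj w0 Bw Aw).
    by apply: stab_pm1; exact: conj_pm1 A1.
  apply: (stab_cancel w0 gv); [exact: Aw |]; apply: stab_pm1; apply: (@conj_pm1 B).
  by rewrite /g !mulgA mulgV mul1g -!mulgA in A1 *.
- by rewrite unitmx_mul uP6 rho_unit.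
- by rewrite Jg; exact: conj_diag P6S.
- by move=> l; rewrite ltnS.
- by rewrite Jg -[(6 + 2)%N]/(4 * 2)%N exprM i4 expr1n.
- move=> t ht; have -> : t = 1%N by lia.
  rewrite Jg muln1 -[6%N]/(4 + 2)%N exprD i4 mul1r sqr_i; apply/eqP => /eqP.
  by rewrite -subr_eq0 -opprD oppr_eq0 -[1 + 1]/(2%:R) pnatr_eq0.
by exists U; split=> //; rewrite unitmx_mul uP6 rho_unit.
Qed.

Lemma frame_E4 w : 0 < Im w -> E4 w = 0 -> has_frame X a4 w.
Proof.
move=> w0 Ew; have [B Bw] := E4_zero w0 Ew; have [M hM] := entries_bounded.
have z0 := zeta_gt0 R; have mR := mob_R_zeta R.
pose g := (B^-1 * matR * B)%g.
have gw : mob g w = w by rewrite /g mobM // Bw mobM // mR -Bw mobK.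
have Jg : J g w = zeta R + 1 by rewrite /g (J_conj w0 Bw mR) J_R_zeta.
have x2 := zeta1X R; have z3 := zeta_X3 R; have zz := zeta2 R.
have zn : zeta R != 1.
  apply/eqP => z1; have : (3%:R : C) = 0 by rewrite -zz z1; ring.
  by move/eqP; rewrite pnatr_eq0.
exists (P4 *m rho B).
have [||||||U [hU PU dU]] := frame rhoM rho1 hM e0 rho_e tupX genX (P := P4 *m rho B) (a := a4) (r := 3) w0 gw
  (@E4_wform R) (@E4_holo R) (@E4_tends R) Ew (E4_simple w0 Ew).
- move=> b v; have -> : 4%:Z * b%:Z - 2 = 2 * (2 * b%:Z - 1) by ring.
  move=> gv A Aw.
  have conjE D : (matR * (B * D * B^-1))%g = (B * (g * D) * B^-1)%g.
    by rewrite /g !mulgA mulgV mul1g.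
  have gA : mob (g * A)%g w = w by rewrite mobM // Aw gw.
  have [A1|A1|A1] := stab_zeta (stab_conj w0 Bw Aw).
  + by apply: stab_pm1; exact: conj_pm1 A1.
  + by rewrite conjE in A1; apply: (stab_cancel w0 gv); [exact: Aw |]; apply: stab_pm1; exact: conj_pm1 A1.
  + rewrite !conjE in A1; apply: (stab_cancel w0 gv); [exact: Aw |]; apply: (stab_cancel w0 gv); [exact: gA |].
    by apply: stab_pm1; exact: conj_pm1 A1.
- by rewrite unitmx_mul uP4 rho_unit.
- by rewrite Jg; exact: conj_diag P4R.
- by move=> l; rewrite ltnS.
- by rewrite Jg -[(4 + 2)%N]/(2 * 3)%N exprM x2 z3.
- move=> t ht; rewrite Jg -[4%N]/(2 * 2)%N -mulnA exprM x2.
  have [->|->] : t = 1%N \/ t = 2%N by lia.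
    apply/eqP => h; move/eqP: zn; apply; rewrite -[LHS]mul1r -{1}h muln1 -exprSr z3 //.
  by rewrite -[(2 * 2)%N]/(3 + 1)%N exprD z3 mul1r expr1.
by exists U; split=> //; rewrite unitmx_mul uP4 rho_unit.
Qed.

Lemma generic_E w : 0 < Im w -> E4 w != 0 -> E6 w != 0 -> \det (Phi X w) != 0.
Proof.
move=> w0 h4 h6; have [M hM] := entries_bounded.
apply: (Phi_generic rhoM rho1 hM e0 rho_e genX rho_pm1 w0) => A Aw.
apply/negPn/negP => A1; have [B [Bw|Bw]] := elliptic w0 Aw A1.
  have := E6_i R; rewrite -Bw => /eqP.
  by rewrite (wform_orbit B (@E6_wform R) w0) (negPf h6).
have := E4_zeta R; rewrite -Bw => /eqP.
by rewrite (wform_orbit B (@E4_wform R) w0) (negPf h4).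
Qed.
End Frames.

Hypothesis noinv : forall v : 'rV[C]_n, (forall A, v *m rho A = v) -> v = 0.

(* The exponents m_j of a basis are 0 or 1, so the weight identity counts the
   zeros among them, that is, the dimension of the space of cusp forms. *)
Theorem cusp2_dimension : exists d (F : 'I_d -> C -> 'cV[C]_n), cusp2_basis F /\
  12 * d%:R = 14 * n%:R - 6 * (\sum_l a6 l)%N%:R - 4 * (\sum_l a4 l)%N%:R - 12 * \sum_i lam i :> R.
Proof.
have [M hM] := entries_bounded.
have [m [X [L [tX lX iL gX bX]]]] := lattice rhoM rho1 hM e0 rho_e rho_pm1 uQ lam01 QT.
have [F hF] := cusp2_basis_of tX lX iL bX.
exists #|[pred j | m j == 0%N]|, F; split=> //.
have Ng0 : (0 < (size V)`!)%N by rewrite fact_gt0.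
have det_rho A : \det (rho A) ^+ (size V)`! = 1.
  (* Pigeonhole: two of the powers A^0, ..., A^|V| have the same image, so the determinant has order
     at most |V|, hence dividing the factorial. *)
  pose s := [seq rho (A ^+ k)%g | k <- iota 0 (size V).+1].
  have : ~~ uniq s.
    apply/negP => us; have := uniq_leq_size us (s2 := V).
    rewrite size_map size_iota ltnn => h; suff : false by [].
    by apply: h => x /mapP[k _ ->]; exact: inV.
  move/(uniqPn 0) => [i [j [ij]]]; rewrite size_map size_iota => js.
  rewrite !(nth_map 0%N) ?size_iota ?(ltn_trans ij) // !nth_iota ?(ltn_trans ij) // !add0n => rij.
  have r1 : \det (rho A) ^+ (j - i) = 1.
    have dX k : \det (rho (A ^+ k)%g) = \det (rho A) ^+ k.
      by elim: k => [|k ih]; rewrite ?expg0 ?rho1 ?det1 // expgS rhoM det_mulmx ih exprS.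
    have di : \det (rho A) ^+ i != 0 by rewrite expf_neq0 // -unitfE -unitmxE; exact: rho_unit.
    by apply: (mulIf di); rewrite mul1r -exprD subnK ?(ltnW ij) // -!dX rij.
  have /dvdnP[q ->] : (j - i %| (size V)`!)%N by apply: dvdn_fact; rewrite subn_gt0 ij /=; lia.
  by rewrite mulnC exprM r1 expr1n.
have f6 := frame_E6 tX gX; have f4 := frame_E4 tX gX; have fg := generic_E gX.
have wi := weight_identity tX uQ lX iL f6 f4 fg Ng0 det_rho.
have m1 := weight_le1 rhoM tX uQ lam01 lX iL a6_le a4_le f6 f4 fg rho1 inV Vin noinv.
(* As m j is 0 or 1, each weight is 14 minus 12 when m j = 0. *)
have : \sum_j (2 + 12 * (m j)%:R) = 14 * n%:R - 12 * #|[pred j | m j == 0%N]|%:R :> R.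
  rewrite -sum1_card natr_sum [X in _ - 12 * X]big_mkcond /= mulr_sumr.
  have -> : 14 * n%:R = \sum_(j < n) 14 :> R by rewrite sumr_const card_ord mulr_natr.
  rewrite -sumrB; apply: eq_bigr => j _; rewrite inE.
  by case: (m j) (m1 j) => [|[|//]] _ /=; ring.
by move: wi => /[swap] ->; lra.
Qed.
End Counting.

(** * Multiplicities of representations *)

Section Multiplicity.
Variables (F : closedFieldType) (gT : finGroupType) (G : {group gT}) (n N : nat).
Variables (rho : mx_representation F G n) (sigma : mx_representation F G N).
Hypothesis irr : mx_irreducible rho.

Definition intertwines (Y : 'M[F]_(n, N)) := forall x, x \in G -> rho x *m Y = Y *m sigma x.

(* By Burnside's theorem the relation propagates from the rho x to all matrices A. *)
Lemma Burnside_independent d (X : 'I_d -> 'M[F]_(n, N)) (v : 'I_d -> 'rV[F]_n) :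
  (forall k, intertwines (X k)) -> (forall c : 'I_d -> F, \sum_k c k *: X k = 0 -> forall k, c k = 0) ->
  \sum_k v k *m X k = 0 -> forall k, v k = 0.
Proof.
move=> hX indX v0; have /andP[_ full] := group_closure_closed_field irr.
have vA (A : 'M[F]_n) : \sum_k v k *m A *m X k = 0.
  have /submxP[D AD] : (mxvec A <= enveloping_algebra_mx rho)%MS by exact: submx_full.
  have -> : A = \sum_i D 0 i *: rho (enum_val i).
    rewrite -[A]mxvecK AD mulmx_sum_row linear_sum; apply: eq_bigr => i _.
    by rewrite linearZ /= rowK mxvecK.
  transitivity (\sum_i D 0 i *: ((\sum_k v k *m X k) *m sigma (enum_val i))).
    under eq_bigr => k _ do rewrite mulmx_sumr mulmx_suml.
    rewrite exchange_big; apply: eq_bigr => i _; rewrite mulmx_suml scaler_sumr.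
    apply: eq_bigr => k _; rewrite -scalemxAr -scalemxAl; congr (_ *: _).
    by rewrite -!mulmxA hX //; exact: enum_valP.
  by rewrite v0 big1 // => i _; rewrite mul0mx scaler0.
move=> k; apply/rowP => i; rewrite mxE; apply: (indX (fun k => v k 0 i)).
apply/row_matrixP => j; rewrite row0 linear_sum -[RHS](vA (delta_mx i j)); apply: eq_bigr => l _.
rewrite linearZ /= rowE scalemxAl; congr (_ *m _).
apply/rowP => t; rewrite !mxE (bigD1 i) //= big1 ?addr0 => [|s /negPf si]; rewrite !mxE ?eqxx //=.
by rewrite si mulr0.
Qed.

Lemma intertwines_simple (Y : 'M[F]_(n, N)) : intertwines Y -> row_free Y ->
  exists modY : mxmodule sigma <<Y>>%MS, mx_rsim rho (submod_repr modY).
Proof.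
move=> hY fY; have modY : mxmodule sigma <<Y>>%MS.
  apply/mxmoduleP => x Gx; rewrite genmxE (eqmxMr _ (genmxE Y)) -hY //; exact: submxMl.
exists modY; have YY : (Y <= <<Y>>)%MS by rewrite genmxE.
exists (in_submod <<Y>>%MS Y) => [||x Gx].
- by rewrite genmxE; apply/esym/eqP.
- by rewrite /row_free mxrank_in_submod.
- by rewrite -in_submodJ // -hY // in_submodE mulmxA -in_submodE.
Qed.

(** The d intertwiners have independent images, each a copy of rho, and every copy of rho in sigma
    lies in their sum; so the isotypic component has rank d n. *)
Theorem irr_multE d (X : 'I_d -> 'M[F]_(n, N)) :
  (forall k, intertwines (X k)) ->
  (forall Y, intertwines Y -> exists c : 'I_d -> F, Y = \sum_k c k *: X k) ->
  (forall c : 'I_d -> F, \sum_k c k *: X k = 0 -> forall k, c k = 0) ->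
  irr_mult rho sigma = d.
Proof.
move=> hX spanX indX; have ind := Burnside_independent hX indX.
have n0 : (0 < n)%N by case/mx_irrP: irr.
have fX k : row_free (X k).
  apply: inj_row_free => v vX; have := ind (fun l => if l == k then v else 0) _ k; rewrite eqxx; apply.
  by rewrite (bigD1 k) //= eqxx vX big1 ?addr0 // => l /negPf ->; rewrite mul0mx.
have rankS : \rank (\sum_k <<X k>>)%MS = (d * n)%N.
  have <- : \rank (\mxcol_k X k) = (d * n)%N.
    have -> : (d * n)%N = (\sum_(k < d) n)%N by rewrite sum_nat_const card_ord.
    apply/eqP/inj_row_free => v; rewrite -[v]submxrowK mul_mxrow_mxcol => h.
    have -> : \mxrow_j submxrow v j = \mxrow_(j < d) (0 : 'M[F]_(1, n)).
      by apply: eq_mxrow => k; exact: ind (fun k => submxrow v k) h k.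
    by apply/matrixP => a b; rewrite !mxE.
  by rewrite eqmx_col.
rewrite /irr_mult; case: pickP => [W /asboolP rW|noW].
  have [B0 rk _ _] := rW; have simW := socle_simple W.
  have WE : (W :=: \sum_k <<X k>>)%MS.
    apply/eqmxP/andP; split; last first.
      apply/sumsmx_subP => k _; have [modY rY] := intertwines_simple (hX k) (fX k).
      apply: (mx_iso_component simW); apply/(mx_rsim_iso (socle_module W) modY).
      exact: mx_rsim_trans (mx_rsim_sym rW) rY.
    have [I [V isoV WV]] := component_mx_def simW; rewrite /socle_val WV; apply/sumsmx_subP => i _.
    have modV := mx_iso_module (isoV i) (socle_module W).
    have [B rB fB hB] := mx_rsim_trans rW ((mx_rsim_iso (socle_module W) modV).2 (isoV i)).
    have hY : intertwines (val_submod B).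
      move=> x Gx; have e : B *m submod_mx modV x = rho x *m B := esym (hB x Gx).
      by rewrite -(val_submodJ modV) // e /val_submod /= mulmxA.
    have VY : (V i <= val_submod B)%MS.
      have := mxrank_leqif_sup (val_submodP B); rewrite /val_submod /= mxrankMfree ?row_base_free //.
      by rewrite (eqP fB) => -[_ <-]; exact/eqP.
    have [c YE] := spanX _ hY; apply: submx_trans VY _; rewrite YE.
    by apply: summx_sub => k _; apply: scalemx_sub; apply: (sumsmx_sup k) => //; rewrite genmxE.
  by rewrite /socle_mult WE rankS -rk mulnK.
(* When no component of type rho is found, d must be 0: the image of a first intertwiner would
   generate one. *)
case: d X hX spanX indX {ind rankS} fX => // d X hX _ _ fX.
have [modY rY] := intertwines_simple (hX ord0) (fX ord0).
have simY : mxsimple sigma <<X ord0>>%MS by apply/(submod_mx_irr modY)/(mx_rsim_irr rY irr).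
pose W := PackSocle (component_socle (DecSocleType sigma) simY).
have := noW W; move/asboolP => []; apply: mx_rsim_trans rY _; apply/mx_rsim_iso.
apply/component_mx_isoP => //; first exact: socle_simple.
by rewrite -(PackSocleK (component_socle (DecSocleType sigma) simY)).
Qed.
End Multiplicity.

(** * Matrices of finite order *)

Section FiniteOrder.
Variable R : realType.
Local Notation C := R[i].
Local Notation ofR := (real_complex R).

Lemma ee_prim (e : nat) : (0 < e)%N -> e.-primitive_root (ee (ofR (e%:R^-1)) : C).
Proof.
move=> e0; have eR : (e%:R : R) != 0 by rewrite pnatr_eq0 -lt0n.
have eeE k : ee (ofR (e%:R^-1)) ^+ k = ee (ofR (k%:R / e%:R)) :> C.
  by rewrite eeX; congr ee; rewrite mulrC -rmorphMn /= mulr_natr.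
apply/andP; split=> //; apply/forallP => /= k; rewrite unity_rootE eeE; apply/eqP.
have [kE|ke] := eqVneq k.+1 e; first by rewrite kE divff // rmorph1 ee1 eqxx.
apply/negbTE/eqP => /ee_eq1 h; have ke' : (k.+1 < e)%N by rewrite ltn_neqAle ke /=.
have : ofR (k.+1%:R / e%:R) = 0.
  by apply: h; rewrite /= ger0_norm ?divr_ge0 // ltr_pdivrMr ?ltr0n // mul1r ltr_nat.
by move/eqP; rewrite fmorph_eq0 mulf_eq0 invr_eq0 (negPf eR) orbF pnatr_eq0.
Qed.

(** The minimal polynomial divides X^e - 1, which has distinct roots. The powers of A are given as a
    sequence [f] because square matrices form a ring only in size n.+1. *)
Lemma finite_order_diag n (A : 'M[C]_n) (f : nat -> 'M[C]_n) (e : nat) : (0 < e)%N ->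
  f 0%N = 1%:M -> (forall k, f k.+1 = A *m f k) -> f e = 1%:M ->
  exists (P : 'M[C]_n) (d : 'I_n -> C),
    [/\ P \in unitmx, P *m A = diag_mx (\row_i d i) *m P & forall i, d i ^+ e = 1].
Proof.
move=> e0 f0 fS fe; case: n A f f0 fS fe => [|n] A f f0 fS fe.
  exists 1%:M, (fun=> 1); split=> [||[] //]; first exact: unitmx1.
  by apply/matrixP => -[].
have fX k : f k = A ^+ k by elim: k => [|k ih]; rewrite ?f0 // fS ih exprS.
have dA : diagonalizable A.
  apply/diagonalizableP; exists [seq ee (ofR (e%:R^-1)) ^+ i | i <- index_iota 0 e].
    rewrite map_inj_in_uniq ?iota_uniq // => i j; rewrite !mem_index_iota => /andP[_ ie] /andP[_ je] /eqP.
    by rewrite (eq_prim_root_expr (ee_prim e0)) !modn_small // => /eqP.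
  rewrite big_map factor_Xn_sub_1 ?ee_prim //; apply: mxminpoly_min.
  by rewrite rmorphB rmorphXn /= horner_mx_X rmorph1 -fX fe subrr.
have [P uP /diagonalizable_forPex[D /(simmxP uP) PD]] := dA.
exists P, (fun i => D 0 i); split=> //.
  by rewrite PD; congr (diag_mx _ *m _); apply/rowP => i; rewrite mxE.
have PX k : P *m A ^+ k = diag_mx (\row_i D 0 i ^+ k) *m P.
  elim: k => [|k ih].
    have -> : diag_mx (\row_i D 0 i ^+ 0) = 1%:M by apply/matrixP => i j; rewrite !mxE.
    by rewrite mulmx1 mul1mx.
  rewrite exprS mulmxA PD -mulmxA ih mulmxA mulmx_diag; congr (diag_mx _ *m _).
  by apply/rowP => i; rewrite !mxE exprS.
move=> i; have := PX e; rewrite -fX fe mulmx1 => /(congr1 (mulmx^~ (invmx P))).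
by rewrite mulmxV // mulmxK // => /(congr1 (fun M : 'M[C]_n.+1 => M i i)); rewrite !mxE eqxx.
Qed.

Lemma trace_diag n (P A : 'M[C]_n) (d : 'I_n -> C) : P \in unitmx ->
  P *m A = diag_mx (\row_i d i) *m P -> \tr A = \sum_i d i.
Proof.
move=> uP PA; have -> : A = invmx P *m (diag_mx (\row_i d i) *m P) by rewrite -PA mulKmx.
by rewrite mxtrace_mulC mulmxK // mxtrace_diag; apply: eq_bigr => i _; rewrite mxE.
Qed.

Lemma rank_eigenspace_diag n (P A : 'M[C]_n) (d : 'I_n -> C) c : P \in unitmx ->
  P *m A = diag_mx (\row_i d i) *m P -> \rank (eigenspace A c) = #|[pred i | d i == c]|.
Proof.
move=> uP PA; pose S := (\sum_(i | d i == c) <<delta_mx 0 i : 'rV[C]_n>>)%MS.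
have -> : (eigenspace A c :=: S *m P)%MS.
  apply/eqmxP/andP; split.
    apply/rV_subP => v /eigenspaceP vA; have -> : v = v *m invmx P *m P by rewrite mulmxKV.
    set w := v *m invmx P; apply: submxMr.
    have wd : w *m diag_mx (\row_i d i) = c *: w.
      have wP : w *m P = v by rewrite mulmxKV.
      rewrite -[LHS](mulmxK uP) -(mulmxA w) -PA mulmxA wP vA.
      by rewrite -scalemxAl.
    move: wd; clearbody w => wd.
    rewrite [w]row_sum_delta; apply: summx_sub => i _; have [di|di] := eqVneq (d i) c.
      by apply: scalemx_sub; apply: (sumsmx_sup i); rewrite ?di ?genmxE.
    have := congr1 (fun u : 'rV[C]_n => u 0 i) wd; rewrite mul_mx_diag !mxE => /eqP.
    rewrite mulrC -subr_eq0 -mulrBl mulf_eq0 subr_eq0 (negPf di) /= => /eqP e.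
    by rewrite e scale0r sub0mx.
  rewrite sumsmxMr; apply/sumsmx_subP => i /eqP di; rewrite (eqmxMr _ (genmxE _)).
  apply/eigenspaceP; rewrite -mulmxA PA mulmxA -di scalemxAl; congr (_ *m _).
  apply/rowP => j; rewrite mul_mx_diag !mxE /=.
  by have [->|_] := eqVneq j i; rewrite /= ?mulr1 ?mul1r ?mulr0 ?mul0r.
rewrite mxrankMfree ?row_free_unit // /S.
have dS : mxdirect (\sum_(i | d i == c) <<delta_mx 0 i : 'rV[C]_n>>) by apply: mxdirect_delta.
rewrite (mxdirectP dS) /= (eq_bigr (fun=> 1%N)) ?sum1_card // => i _.
by rewrite genmxE mxrank_delta.
Qed.
End FiniteOrder.

(** * Cusp forms for Gamma *)

Section Translation.
Variable R : realType.
Local Notation C := R[i].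
Local Notation Im := (@complex.Im R).
Local Notation ofR := (real_complex R).
Local Notation J := (@autf R).
Implicit Types (A B : SL2Z) (f : UHP R -> C) (F : C -> C).

Lemma extend_Sub f z (z0 : 0 < Im z) : extend f z = f (Sub z z0).
Proof. by rewrite -[X in extend f X](SubK (UHP R) z0) extendE. Qed.

Lemma holoH_extend f : holomorphic f <-> holoH (extend f).
Proof.
split=> [hf z z0|hf z]; last exact/derivable_cdiff/hf/(valP z).
exact/derivable_cdiff/(hf (Sub z z0)).
Qed.

Lemma vanish_extend f : vanishes_at_infty f <-> vanish (extend f).
Proof.
split=> hf eps eps0.
  have [M hM] := hf eps eps0; exists (Num.max M 0) => z; rewrite gt_max => /andP[zM z0].
  by have := hM (Sub z z0) zM; rewrite -extend_Sub nmE ltcR => /ltW.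
have [Y hY] := hf (eps / 2) ltac:(by rewrite divr_gt0); exists Y => z /hY; rewrite extendE => h.
by rewrite nmE ltcR; apply: le_lt_trans h _; rewrite ltr_pdivrMr // ltr_pMr // ltr1n.
Qed.

Lemma extend_restrict F z : 0 < Im z -> extend (fun w : UHP R => F (val w)) z = F z.
Proof. by move=> z0; rewrite extend_Sub SubK. Qed.

Variables (Gamma : normalSubgroup PSL2Z) (fi : finite_index Gamma).
Local Notation G := (fin_gquot fi).
Local Notation S2 := (@S2 R Gamma).
Variables (n : nat) (rho : mx_representation C [set: G] n).

Definition lift_repr A : 'M[C]_n := rho (toG fi A).

Lemma lift_reprM : {morph lift_repr : A B / (A * B)%g >-> A *m B}.
Proof. by move=> A B; rewrite /lift_repr toGM repr_mxM ?inE. Qed.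

Lemma toG1 : toG fi 1%g = 1%g.
Proof. by apply: (mulgI (toG fi 1%g)); rewrite -toGM !mulg1. Qed.

Lemma lift_repr1 : lift_repr 1%g = 1%:M.
Proof. by rewrite /lift_repr toG1 repr_mx1. Qed.

Lemma toG_Gamma A : toPSL A \in Gamma -> toG fi A = 1%g.
Proof.
move=> hA; rewrite -toG1; apply/gquotP; rewrite /coset_rel.
have -> : toPSL 1%g = 1%g by apply: (mulgI (toPSL 1%g)); rewrite -[in LHS]to_gquotM !mulg1.
by rewrite mulg1 nsubV.
Qed.

Lemma toPSL_pm1 A : A \in pm1 -> toPSL A = 1%g.
Proof. by move=> hA; apply/gquotP; rewrite /coset_rel mulg1; exact: nsubV (NormalSubgroup pm1_closed pm1_conj) A hA. Qed.

Lemma toG_pm1 A : A \in pm1 -> toG fi A = 1%g.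
Proof. by move=> /toPSL_pm1 h; apply: toG_Gamma; rewrite h; exact: nsub1. Qed.

Lemma toG_X A k : toG fi (A ^+ k)%g = (toG fi A ^+ k)%g.
Proof. by elim: k => [|k ih]; rewrite ?expg0 ?toG1 // !expgS toGM ih. Qed.

Lemma mT_X k : mT k%:Z = (matT ^+ k)%g.
Proof.
elim: k => [|k ih]; first by apply/val_inj/mx2_entries; rewrite !mxE.
rewrite expgS -ih; apply/val_inj/mx2_entries; rewrite SL2Z_valM mulmx2E !mxE /=; lia.
Qed.

Lemma lift_repr_image A : lift_repr A \in [seq rho g | g : G].
Proof. by apply: map_f; rewrite mem_enum. Qed.

Lemma image_lift_repr M : M \in [seq rho g | g : G] -> exists A, M = lift_repr A.
Proof. by case/mapP => g _ ->; exists (liftG g); rewrite /lift_repr liftGK. Qed.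

Lemma lift_repr_T : lift_repr (mT #[toG fi matT]%g%:Z) = 1%:M.
Proof. by rewrite mT_X /lift_repr toG_X expg_order repr_mx1. Qed.

Lemma lift_repr_pm1 A : A \in pm1 -> lift_repr A = 1%:M.
Proof. by move=> h; rewrite /lift_repr toG_pm1 // repr_mx1. Qed.

Lemma cusp2_S2 X : cusp2 lift_repr X ->
  (forall i, S2 (fun z => X (val z) i 0)) /\
  forall A i, slash (fun z => X (val z) i 0) A = fun z => \sum_j lift_repr A i j * X (val z) j 0.
Proof.
move=> [[hX tX] cX].
have sX A i : slash (fun z => X (val z) i 0) A = fun z => \sum_j lift_repr A i j * X (val z) j 0.
  apply/funext => z; rewrite /slash [val (mobius A z)]/=.
  have := tX A (val z) (valP z); rewrite /mob => ->.
  by rewrite mxE -exprnP mulrAC mulfV ?expf_neq0 ?autf_neq0 // mul1r mxE.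
split=> // i; split=> [|A hA|A].
- apply/holoH_extend; apply: holoH_eq (hX i) => z z0; exact/esym/(extend_restrict (fun z => X z i 0)).
- rewrite sX; apply/funext => z; rewrite (bigD1 i) //= big1 ?addr0 => [|j ji].
    by rewrite /lift_repr toG_Gamma // repr_mx1 mxE eqxx mul1r.
  by rewrite /lift_repr toG_Gamma // repr_mx1 mxE eq_sym (negPf ji) mul0r.
- apply/vanish_extend; rewrite sX; apply: eq_vanish (mulmx_vanish (lift_repr A) i cX) => z z0.
  by rewrite (extend_restrict (fun z => \sum_j lift_repr A i j * X z j 0)) // mxE.
Qed.

Lemma S2_cusp2 (f : 'I_n -> UHP R -> C) : (forall i, S2 (f i)) ->
  (forall A i, slash (f i) A = fun z => \sum_j lift_repr A i j * f j z) ->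
  cusp2 lift_repr (fun z => \col_i extend (f i) z).
Proof.
move=> Sf sf; split; first split=> [i|A z z0].
- by apply: holoH_eq (_ : holoH (extend (f i))) => [z _|]; [rewrite mxE | apply/holoH_extend; have [] := Sf i].
- apply/colP => i; rewrite !mxE.
  have := congr1 (fun h : UHP R -> C => h (Sub z z0)) (sf A i); rewrite /slash => /= h.
  have -> : extend (f i) (mob A z) = f i (mobius A (Sub z z0)) by rewrite -extendE.
  have jz := J_neq0 A z0; move/(congr1 ( *%R (J A z ^+ 2))): h; rewrite mulrC mulfVK ?expf_neq0 // => ->.
  by congr (_ * _); apply: eq_bigr => j _; rewrite mxE extend_Sub.
move=> i; have [_ _ /(_ 1%g)] := Sf i; rewrite slash1 => /vanish_extend h.
by apply: eq_vanish h => z _; rewrite mxE.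
Qed.

Lemma pm1_SS : (matS * matS)%g \in pm1.
Proof. by rewrite inE; apply/orP; right; apply/eqP; apply: mx2_entries; rewrite SL2Z_valM mulmx2E !mxE. Qed.

Lemma pm1_RRR : (matR * (matR * matR))%g \in pm1.
Proof.
rewrite inE; apply/orP; right; apply/eqP; apply: mx2_entries.
- by rewrite !SL2Z_valM !mulmx2E !mxE.
- by rewrite !SL2Z_valM !mulmx2E !mxE.
- by rewrite !SL2Z_valM !mulmx2E !mxE.
- by rewrite !SL2Z_valM !mulmx2E !mxE.
Qed.

Lemma T_diag : exists (Q : 'M[C]_n) (k : 'I_n -> nat), [/\ Q \in unitmx,
  forall i, (0 < k i <= #[toG fi matT]%g)%N &
  Q *m lift_repr matT = diag_mx (\row_i ee (ofR ((k i)%:R / #[toG fi matT]%g%:R))) *m Q].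
Proof.
set e := #[_]%g; have e0 : (0 < e)%N by exact: order_gt0.
have [|k||Q [d [uQ QT dE]]] := @finite_order_diag R n (lift_repr matT) (fun k => lift_repr (matT ^+ k)%g) e e0.
- by rewrite expg0 lift_repr1.
- by rewrite expgS lift_reprM.
- by rewrite -mT_X lift_repr_T.
have hk i : exists k : nat, (0 < k <= e)%N /\ d i = ee (ofR (k%:R / e%:R)).
  have [j ->] := prim_rootP (ee_prim R e0) (dE i).
  have eeE (k : nat) : ee (ofR (e%:R^-1)) ^+ k = ee (ofR (k%:R / e%:R)) :> C.
    by rewrite eeX; congr ee; rewrite mulrC -rmorphMn /= mulr_natr.
  (* Exponents are wanted in 1, ..., e, so the eigenvalue 1 gets e instead of 0. *)
  have [j0|j0] := eqVneq (j : nat) 0%N.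
    exists e; rewrite e0 leqnn j0 expr0 divff ?rmorph1 ?ee1 // pnatr_eq0 -lt0n //.
  by exists j; rewrite eeE lt0n j0 ltnW.
have [k hk'] := choice hk; exists Q, k; split=> // [i|]; first by have [] := hk' i.
by rewrite QT; congr (diag_mx _ *m _); apply/rowP => i; rewrite !mxE; have [] := hk' i.
Qed.

(** S^2 = -1 acts trivially, so the eigenvalues are 1 and -1, and the trace counts the l with a l =
    1. *)
Lemma S_diag : exists (P : 'M[C]_n) (a : 'I_n -> nat), [/\ P \in unitmx, forall l, (a l <= 1)%N,
  P *m lift_repr matS = diag_mx (\row_l ('i%C : C) ^ (6 * (a l)%:Z - 2)) *m P &
  \tr (lift_repr matS) = 2 * (\sum_l a l)%N%:R - n%:R].
Proof.
have [|k||P [d [uP PS dE]]] := @finite_order_diag R n (lift_repr matS) (fun k => lift_repr (matS ^+ k)%g) 2 isT.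
- by rewrite expg0 lift_repr1.
- by rewrite expgS lift_reprM.
- by rewrite expgS expg1 lift_repr_pm1 ?pm1_SS.
pose a i : nat := d i == 1.
have da i : d i = (2 * (a i)%:R - 1).
  rewrite /a; have /eqP := dE i; rewrite sqrf_eq1 => /orP[]/eqP ->; rewrite ?eqxx /=; first by ring.
  have -> : (-1 == 1 :> C) = false.
    by rewrite eq_sym -subr_eq0 opprK; apply/negbTE; rewrite -[1 + 1]/(2%:R) pnatr_eq0.
  by rewrite /=; ring.
exists P, a; split; [exact: uP | by move=> l; rewrite /a; case: eqP | |].
  rewrite PS; congr (diag_mx _ *m _); apply/rowP => i; rewrite !mxE da.
  have i2 : ('i%C : C) ^+ 2 = -1 := sqr_i R.
  rewrite /a; case: eqP => _ /=.
    have -> : 6%:Z * 1%N%:Z - 2 = (2 * 2)%N by [].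
    by rewrite -exprnP exprM i2 sqrrN expr1n; ring.
  have -> : 6%:Z * 0%N%:Z - 2 = - 2%:Z by [].
  by rewrite -invr_expz -exprnP i2 invrN invr1; ring.
rewrite (trace_diag uP PS) (eq_bigr _ (fun i _ => da i)) sumrB -mulr_sumr natr_sum sumr_const card_ord.
by [].
Qed.

(** The two terms of the formula depend only on the eigenvalues of R: an eigenvalue 1, zeta or
    zeta^2, with a = 2, 1 or 0, contributes (1 - a) / 3. *)
Lemma R_diag (z3 := zeta R) : exists (P : 'M[C]_n) (a : 'I_n -> nat), [/\ P \in unitmx, forall l, (a l <= 2)%N,
  P *m lift_repr matR = diag_mx (\row_l (z3 + 1) ^ (4 * (a l)%:Z - 2)) *m P &
  z3 ^+ 2 * \tr (lift_repr matR^-1%g) / (3 * (1 - z3 ^+ 2)) + z3 * \tr (lift_repr matR) / (3 * (1 - z3)) =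
   (n%:R - (\sum_l a l)%N%:R) / 3].
Proof.
have x2 := zeta1X R; have zz3 := zeta_X3 R; have zz := zeta2 R; rewrite -/z3 in x2 zz3 zz.
have zn : z3 != 1.
  apply/eqP => z1; have : (3%:R : C) = 0 by rewrite -zz z1; ring.
  by move/eqP; rewrite pnatr_eq0.
have z30 : z3 != 0.
  by apply/eqP => z0; move: zz3; rewrite z0 expr0n /= => /eqP; rewrite eq_sym oner_eq0.
have [|k||P [d [uP PR dE]]] := @finite_order_diag R n (lift_repr matR) (fun k => lift_repr (matR ^+ k)%g) 3 isT.
- by rewrite expg0 lift_repr1.
- by rewrite expgS lift_reprM.
- by rewrite !expgS expg0 mulg1 lift_repr_pm1 ?pm1_RRR.
have PV : P *m lift_repr matR^-1%g = diag_mx (\row_i d i ^+ 2) *m P.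
  have -> : lift_repr matR^-1%g = lift_repr matR *m lift_repr matR.
    by rewrite -lift_reprM -[LHS]mulmx1 -(lift_repr_pm1 pm1_RRR) -lift_reprM mulKg.
  rewrite mulmxA PR -mulmxA PR mulmxA mulmx_diag; congr (diag_mx _ *m _).
  by apply/rowP => i; rewrite !mxE expr2.
pose a i : nat := if d i == 1 then 2 else if d i == z3 then 1 else 0.
have da i : [\/ d i = 1 /\ a i = 2, d i = z3 /\ a i = 1%N | d i = z3 ^+ 2 /\ a i = 0%N].
  rewrite /a; case: eqP => [|/eqP n1]; first by constructor 1.
  case: eqP => [|/eqP nz]; first by constructor 2.
  constructor 3; split=> //; apply/eqP; rewrite -subr_eq0.
  have : (d i - 1) * (d i - z3) * (d i - z3 ^+ 2) = 0.
    transitivity (d i ^+ 3 - z3 ^+ 3 - (z3 ^+ 2 + z3 + 1) * (d i ^+ 2 - d i * z3)).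
      by ring.
    by rewrite dE zz3 zz subrr mul0r subr0.
  by move/eqP; rewrite !mulf_eq0 !subr_eq0 (negPf n1) (negPf nz) orFb orFb.
exists P, a; split; first exact: uP.
- by move=> l; case: (da l) => -[_ ->].
- rewrite PR; congr (diag_mx _ *m _); apply/rowP => i; rewrite !mxE.
  case: (da i) => -[-> ->].
  + have -> : 4%:Z * 2%N%:Z - 2 = (2 * 3)%N by [].
    by rewrite -exprnP exprM x2 zz3.
  + have -> : 4%:Z * 1%N%:Z - 2 = 2%N by [].
    by rewrite -exprnP x2.
  + have -> : 4%:Z * 0%N%:Z - 2 = - 2%:Z by [].
    by rewrite -invr_expz -exprnP x2; apply: (mulIf z30); rewrite -exprSr zz3 mulVf.
rewrite (trace_diag uP PR) (trace_diag uP PV) !mulr_sumr !mulr_suml -big_split /=.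
have -> : (n%:R - (\sum_l a l)%N%:R) / 3 = \sum_i (1 - (a i)%:R) / 3 :> C.
  by rewrite -mulr_suml sumrB sumr_const card_ord natr_sum.
have n2 : 1 - z3 ^+ 2 != 0.
  rewrite -[1 - _]opprB oppr_eq0 -(mul1r 1) mul1r subr_sqr_1 mulf_eq0 subr_eq0 (negPf zn) /=.
  by apply: contraNneq z30 => h; rewrite -x2 h expr0n.
have n1 : 1 - z3 != 0 by rewrite subr_eq0 eq_sym.

have n12 : (1 - z3) * (1 - z3 ^+ 2) = 3.
  by apply/eqP; rewrite -subr_eq0; apply/eqP; transitivity ((z3 ^+ 2 + z3 + 1) * (z3 - 2)); [ring | rewrite zz mul0r].
have iv : (3 * (1 - z3 ^+ 2))^-1 = (1 - z3) / 9.
  by apply: (mulIf n2); rewrite mulrAC n12; field; rewrite n2.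
have iu : (3 * (1 - z3))^-1 = (1 - z3 ^+ 2) / 9.
  by apply: (mulfI n1); rewrite mulrA n12; field; rewrite n1.
rewrite iv iu; apply: eq_bigr => i _; apply/eqP; rewrite -subr_eq0; apply/eqP; case: (da i) => -[-> ->].
- by transitivity ((z3 ^+ 2 + z3 + 1) * (- 2 * z3 + 3) / 9); [field | rewrite zz !mul0r].
- by transitivity ((z3 ^+ 2 + z3 + 1) * (- z3 ^+ 2 * (z3 - 1)) / 9); [field | rewrite zz !mul0r].
- transitivity ((z3 ^+ 2 + z3 + 1) * (- z3 ^+ 5 + 2 * z3 ^+ 4 - 2 * z3 ^+ 3 + 3 * z3 - 3) / 9); first by field.
  by rewrite zz !mul0r.
Qed.
End Translation.

(** * The space of cusp forms as a representation of G *)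

Section CuspForms.
Variable R : realType.
Local Notation C := R[i].
Local Notation Im := (@complex.Im R).
Local Notation ofR := (real_complex R).
Local Notation J := (@autf R).
Variables (Gamma : normalSubgroup PSL2Z) (fi : finite_index Gamma).
Local Notation G := (fin_gquot fi).
Local Notation S2 := (@S2 R Gamma).

Lemma cusp2_lincomb n (rho : SL2Z -> 'M[C]_n) d (F : 'I_d -> C -> 'cV[C]_n) (c : 'I_d -> C) :
  (forall k, cusp2 rho (F k)) -> cusp2 rho (fun z => \sum_k c k *: F k z).
Proof.
move=> hF; split; first by apply: vform_sum => k; apply: vformZ; exact: (hF k).1.
by apply: cuspv_sum => k; apply: cuspvZ; exact: (hF k).2.
Qed.

Section Basis.
Variables (n : nat) (rho : mx_representation C [set: G] n).
Local Notation e := #[toG fi matT]%g.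

Lemma lam_bounds (k : 'I_n -> nat) : (forall i, (0 < k i <= e)%N) -> forall i, 0 < ((k i)%:R / e%:R : R) <= 1.
Proof.
move=> hk i; have e0 : 0 < e%:R :> R by rewrite ltr0n order_gt0.
by have /andP[h1 h2] := hk i; rewrite divr_gt0 ?ltr0n //= ler_pdivrMr // mul1r ler_nat.
Qed.

(** Irreducibility is not assumed, so that [basisS2_basis] can apply this to the regular
    representation. *)
Lemma cusp2_finite : exists d (F : 'I_d -> C -> 'cV[C]_n), cusp2_basis (lift_repr rho) F.
Proof.
have [Q [k [uQ hk QT]]] := T_diag rho; have lam01 := lam_bounds hk.
have [M hM] := entries_bounded (lift_repr_image rho).
have [m [X [L [tX lX iL gX bX]]]] := lattice (lift_reprM rho) (lift_repr1 rho) hM (order_gt0 _)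
  (lift_repr_T rho) (@lift_repr_pm1 _ _ _ _ rho) uQ lam01 QT.
have [F hF] := cusp2_basis_of tX lX iL bX.
by exists #|[pred j | m j == 0%N]|, F.
Qed.
End Basis.

(* The component at 1 identifies the forms for the regular representation with S2. *)
Lemma basisS2_basis : is_basis S2 (@basisS2 R Gamma).
Proof.
suff ex : exists mb : {m : nat & 'I_m -> UHP R -> C}, is_basis S2 (projT2 mb).
  rewrite /basisS2 /dimS2 /Defs.basis_of.
  by case: pselect => [h|ne]; [exact: svalP (cid h) | case: (ne ex)].
pose rg := regular_repr C [set: G]; pose ix := @gring_index G [set: G].
have [d [F [cF gF iF]]] := cusp2_finite rg.
pose b k : UHP R -> C := fun z => F k (val z) (ix 1%g) 0.
have rgE x i j : rg x i j = (j == ix (enum_val i * x)%g)%:R by rewrite !mxE.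
have lE (c : 'rV[C]_d) : lincomb b c = fun z => (\sum_k c 0 k *: F k (val z)) (ix 1%g) 0.
  by apply/funext => z; rewrite summxE /lincomb; apply: eq_bigr => k _; rewrite mxE.
exists (existT _ d b); split=> [c|f Sf] /=.
  by rewrite lE; exact: (cusp2_S2 (cusp2_lincomb (fun k => c 0 k) cF)).1.
pose fs (i : 'I_#|[set: G]|) := slash f (liftG (enum_val i : G)).
have sf A i : slash (fs i) A = fun z => \sum_j lift_repr rg A i j * fs j z.
  rewrite slashM; apply/funext => z; rewrite (bigD1 (ix (enum_val i * toG fi A)%g)) //= big1 ?addr0.
    rewrite /lift_repr rgE eqxx mul1r /fs gring_indexK ?inE //.
    by rewrite (S2_slash_eq (fi := fi) (B := liftG (enum_val i * toG fi A)%g) Sf) // toGM !liftGK.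
  by move=> j ji; rewrite /lift_repr rgE (negPf ji) mul0r.
have [c cE] := gF _ (S2_cusp2 (fun i => S2_slash _ Sf) sf).
exists (\row_k c k); split.
  apply/funext => z; rewrite lE; have := congr1 (fun v : 'cV[C]_#|[set: G]| => v (ix 1%g) 0) (cE (val z) (valP z)).
  rewrite mxE extendE /fs gring_indexK ?inE // => h.
  have f1 : slash f (liftG (1%g : G)) = f by rewrite (S2_slash_eq (fi := fi) (B := 1%g) Sf) ?slash1 // liftGK toG1.
  rewrite -[in LHS]f1 h; congr (fun_of_matrix _ _ _); apply: eq_bigr => k _; by rewrite mxE.
move=> v' fE; apply/rowP => k; rewrite mxE; apply/subr0_eq; move: k.
(* Uniqueness: the component of D at 1 is zero, and every other component is a slash translate of
   it; so D = 0 and independence of the F k applies. *)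
pose D z := \sum_k (c k - v' 0 k) *: F k z.
have cD : cusp2 (lift_repr rg) D by apply: cusp2_lincomb.
have [_ sD] := cusp2_S2 cD; apply: iF => z z0; apply/colP => j; rewrite [RHS]mxE.
have D1 : (fun w : UHP R => D (val w) (ix 1%g) 0) = fun=> 0.
  apply/funext => w; rewrite /D; under eq_bigr do rewrite scalerBl.
  rewrite sumrB mxE [X in _ + X]mxE -(cE _ (valP w)) mxE extendE.
  rewrite /fs gring_indexK ?inE // (S2_slash_eq (fi := fi) (B := 1%g) Sf) ?slash1 ?liftGK ?toG1 //.
  by rewrite [in X in X - _]fE lE subrr.
have := congr1 (fun h : UHP R -> C => h (Sub z z0)) (sD (liftG (enum_val j)) (ix 1%g)).
rewrite D1 /slash mul0r (bigD1 j) //= big1 ?addr0 => [|l lj]; last first.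
  by rewrite /lift_repr rgE liftGK gring_indexK ?inE // mul1g /ix gring_valK (negPf lj) mul0r.
by rewrite /lift_repr rgE liftGK gring_indexK ?inE // mul1g /ix gring_valK eqxx mul1r => <-.
Qed.

(** A vector-valued form for rho is the same as an intertwiner from rho to S2: row i of [X k] holds
    the coordinates of the i-th component of F k, and the transformation law is the intertwining
    relation. *)
Lemma irr_mult_canonical n (rho : mx_representation C [set: G] n) d (F : 'I_d -> C -> 'cV[C]_n) :
  mx_irreducible rho -> cusp2_basis (lift_repr rho) F -> irr_mult rho (canonical_repr R fi) = d.
Proof.
move=> irr [cF gF iF]; have bb := basisS2_basis.
pose f k i : UHP R -> C := fun z => F k (val z) i 0.
have Sf k i : S2 (f k i) := (cusp2_S2 (cF k)).1 i.
pose X k : 'M[C]_(n, dimS2 R Gamma) := \matrix_i coords (@basisS2 R Gamma) (f k i).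
have XE k i : lincomb (@basisS2 R Gamma) (row i (X k)) = f k i by rewrite rowK (coordsP bb (Sf k i)).
have linD (m : nat) (B : 'I_m -> 'rV[C]_(dimS2 R Gamma)) (c : 'I_m -> C) :
    lincomb (@basisS2 R Gamma) (\sum_j c j *: B j) = fun z => \sum_j c j * lincomb (@basisS2 R Gamma) (B j) z.
  apply/funext => z; rewrite /lincomb; under [RHS]eq_bigr do rewrite mulr_sumr.
  rewrite exchange_big; apply: eq_bigr => i _; rewrite summxE mulr_suml.
  by apply: eq_bigr => j _; rewrite mxE mulrA.
apply: (@irr_multE _ _ _ _ _ _ _ irr d X).
- move=> k x _; apply/row_matrixP => i; apply: (lincomb_inj bb).
  rewrite !row_mul mulmx_sum_row linD canonical_mxE // XE.
  rewrite (cusp2_S2 (cF k)).2; apply/funext => z; apply: eq_bigr => j _.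
  by rewrite XE /lift_repr liftGK mxE.
- move=> Y hY; pose h i := lincomb (@basisS2 R Gamma) (row i Y).
  have Sh i : S2 (h i) by exact: bb.1.
  have sh A i : slash (h i) A = fun z => \sum_j lift_repr rho A i j * h j z.
    rewrite (S2_slash_eq (fi := fi) (B := liftG (toG fi A)) (Sh i)) ?liftGK //.
    rewrite /h -canonical_mxE // -row_mul -[canonical_mx _ _]/(canonical_repr R fi (toG fi A)) -hY ?inE //.
    by rewrite row_mul mulmx_sum_row linD; apply/funext => z; apply: eq_bigr => j _; rewrite mxE.
  have [c cE] := gF _ (S2_cusp2 Sh sh); exists c.
  apply/row_matrixP => i; apply: (lincomb_inj bb); rewrite linear_sum /=.
  under eq_bigr do rewrite linearZ /=.
  rewrite linD; apply/funext => z; have := congr1 (fun v : 'cV[C]_n => v i 0) (cE (val z) (valP z)).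
  by rewrite mxE extendE summxE /h => ->; apply: eq_bigr => k _; rewrite XE mxE.
- move=> c c0; apply: iF => z z0; apply/colP => i; rewrite summxE [RHS]mxE.
  have := congr1 (fun Y => lincomb (@basisS2 R Gamma) (row i Y) (Sub z z0)) c0.
  rewrite linear_sum /=; under eq_bigr do rewrite linearZ /=.
  rewrite linD row0 /lincomb [RHS]big1 => [h|j _]; last by rewrite mxE mul0r.
  by rewrite -[RHS]h; apply: eq_bigr => k _; rewrite -/(lincomb _ _ _) XE mxE.
Qed.

(** A nonzero invariant row spans a submodule, which is everything; then every g acts as the
    identity. *)
Lemma irreducible_noinv n (rho : mx_representation C [set: G] n) : mx_irreducible rho ->
  ~ (forall g, rho g = 1%:M) -> forall v : 'rV[C]_n, (forall A, v *m lift_repr rho A = v) -> v = 0.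
Proof.
move=> /mx_irrP[n0 irr] nt v hv; apply/eqP; apply: contra_notT nt => v0 g.
have gv x : v *m rho x = v by have := hv (liftG x); rewrite /lift_repr liftGK.
have full : row_full <<v>>%MS.
  apply: irr; last by rewrite -submx0 genmxE submx0.
  by apply/mxmoduleP => x _; rewrite genmxE (eqmxMr _ (genmxE v)) gv.
apply/row_matrixP => i; rewrite rowE [in RHS]rowE mulmx1.
have : (delta_mx (0 : 'I_1) i <= <<v>>)%MS by exact: submx_full.
by rewrite genmxE => /submxP[D ->]; rewrite -mulmxA gv.
Qed.

(** Both are cube roots of 1, other than 1, with positive imaginary part. *)
Lemma cis_zeta : cis (2 * pi / 3 : R) = zeta R.
Proof.
have e3 := ee_prim R (isT : (0 < 3)%N); set x := ee _ in e3.
have xE : x = cis (2 * pi / 3) by rewrite /x ee_real.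
have x3 := prim_expr_order e3; have xn : x != 1.
  by have := eq_prim_root_expr e3 1 0; rewrite expr1 expr0 => ->.
have xx : (x - zeta R) * (x - zeta R ^+ 2) = 0.
  apply: (mulfI (_ : x - 1 != 0)); first by rewrite subr_eq0.
  have zz := zeta2 R; have zz3 := zeta_X3 R.
  rewrite mulr0; transitivity (x ^+ 3 - zeta R ^+ 3 - (zeta R ^+ 2 + zeta R + 1) * (x ^+ 2 - x * zeta R)); first by ring.
  by rewrite x3 zz3 zz subrr mul0r subr0.
rewrite -xE; apply/subr0_eq; move/eqP: xx; rewrite mulf_eq0 => /orP[/eqP //|/eqP/subr0_eq x2].
have : 0 < Im x.
  rewrite xE /=; apply: sin_gt0_pi; have p0 := pi_gt0 R; lra.
have -> : x = - (zeta R + 1) by rewrite x2; apply: subr0_eq; rewrite -[RHS](zeta2 R); ring.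
by have := zeta_gt0 R; move: (zeta R) => z z0; rewrite raddfN raddfD /= addr0 oppr_gt0 ltNge ltW.
Qed.
End CuspForms.

Theorem theorem4p1 (R : realType)
    (Gamma : normalSubgroup PSL2Z) (fi : finite_index Gamma)
    (n : nat) (rho : mx_representation R[i] [set: fin_gquot fi] n) :
  mx_irreducible rho ->
  ~ (forall g, rho g = 1%:M) ->
  let S := toG fi matS in
  let T := toG fi matT in
  let r := toG fi matR in
  let e := #[T]%g in
  let N (k : nat) : nat :=
    \rank (eigenspace (rho T) (cis (2 * pi * k%:R / e%:R : R))) in
  let zeta3 : R[i] := cis (2 * pi / 3 : R) in
  (irr_mult rho (canonical_repr R fi))%:R =
    - (5 / 12) * n%:R
    + \sum_(1 <= k < e) (N k)%:R * (1 - k%:R / e%:R)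
    - \tr (rho S) / 4
    + zeta3 ^+ 2 * \tr (rho r^-1%g) / (3 * (1 - zeta3 ^+ 2))
    + zeta3 * \tr (rho r) / (3 * (1 - zeta3)).
Proof.
move=> irr nt S T r e N zeta3.
have [Q [k [uQ hk QT]]] := T_diag rho; have lam01 := @lam_bounds R Gamma fi n k hk; rewrite -/e in hk QT lam01.
have [P6 [a6 [uP6 a6l P6S tr6]]] := S_diag rho.
have [P4 [a4 [uP4 a4l P4R tr4]]] := R_diag rho.
have noinv := irreducible_noinv irr nt.
have e0 : (0 < e)%N by exact: order_gt0.
have [d [F [bF dE]]] := cusp2_dimension (lift_reprM rho) (lift_repr1 rho) (@lift_repr_pm1 _ _ _ _ rho)
  (lift_repr_image rho) (@image_lift_repr _ _ _ _ rho) e0 (lift_repr_T rho) uQ lam01 QT uP6 uP4 a6l a4l P6S P4R noinv.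
rewrite (irr_mult_canonical irr bF).
have rV : rho r^-1%g = lift_repr rho matR^-1%g.
  by rewrite /lift_repr; congr (rho _); apply: (mulgI r); rewrite mulgV -toGM mulgV toG1.
rewrite /zeta3 cis_zeta rV -addrA tr4 -[rho S]/(lift_repr rho matS) tr6.
(* An eigenvalue with exponent k_i contributes 1 - k_i / e; the eigenvalue 1, with k_i = e,
   contributes 0, which matches a sum starting at k = 1. *)
have NE : \sum_(1 <= j < e) (N j)%:R * (1 - j%:R / e%:R) = n%:R - real_complex R (\sum_i (k i)%:R / e%:R).
  pose x : R[i] := ee (real_complex R e%:R^-1).
  have xX (j : nat) : ee (real_complex R (j%:R / e%:R)) = x ^+ j.
    by rewrite /x eeX; congr ee; rewrite mulrC -rmorphMn /= mulr_natr.
  have NjE j : (1 <= j < e)%N -> (N j)%:R = \sum_i (k i == j)%:R :> R[i].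
    move=> /andP[j1 je]; have cE : cis (2 * pi * j%:R / e%:R : R) = x ^+ j by rewrite -xX ee_real mulrA.
    rewrite /N cE (rank_eigenspace_diag (x ^+ j) uQ QT) -sum1_card natr_sum big_mkcond /=.
    apply: eq_bigr => i _; rewrite inE xX (eq_prim_root_expr (ee_prim R e0)) (modn_small je).
    have /andP[k1] := hk i; rewrite leq_eqVlt => /orP[/eqP ->|ke]; last by rewrite modn_small //; case: (_ == _).
    by rewrite modnn eq_sym (gtn_eqF j1) eq_sym (ltn_eqF je).
  have -> : n%:R - real_complex R (\sum_i (k i)%:R / e%:R) = \sum_i (1 - (k i)%:R / e%:R) :> R[i].
    rewrite sumrB sumr_const card_ord rmorph_sum; congr (_ - _); apply: eq_bigr => i _.
    by rewrite rmorphM fmorphV !rmorph_nat.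
  rewrite big_nat_cond (eq_bigr (fun j => \sum_i (k i == j)%:R * (1 - j%:R / e%:R))); last first.
    by move=> j /andP[hj _]; rewrite NjE // mulr_suml.
  rewrite -big_nat_cond exchange_big; apply: eq_bigr => i _ /=.
  have /andP[k1] := hk i; rewrite leq_eqVlt => /orP[/eqP ke|ke].
    rewrite ke divff ?pnatr_eq0 -?lt0n // subrr big_nat big1 // => j /andP[_ je].
    by rewrite (gtn_eqF je) mul0r.
  rewrite (big_rem (k i)) /= ?mem_index_iota ?k1 // eqxx mul1r big1_seq ?addr0 // => j /andP[_].
  rewrite mem_rem_uniq ?iota_uniq // inE => /andP[/negPf jk _].
  by rewrite eq_sym jk mul0r.
(* d = 7n/6 - s6/2 - s4/3 - sum lam, where s6 = (Tr S + n)/2, s4/3 is n/3 minus the R terms, and sum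
   lam is n minus the T sum; 7/6 - 1/4 - 1/3 - 1 = -5/12. *)
rewrite NE; have := congr1 (real_complex R) dE; rewrite !(rmorphB, rmorphM) !rmorph_nat => h.
have -> : d%:R = 12 * d%:R / 12 :> R[i] by field.
by rewrite h; field.
Qed.
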